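(* Let $E$ be a finite set, $\kappa\in(0,1)$, and let $\{Q_u:u\in[0,1]\}$ be a family of irreducible aperiodic transition matrices on $E$ such that for all $(x,y)\in E^2$ the map $u\mapsto Q_u(x,y)$ is $\kappa$-Hölder continuous. Assume that, as $n\to\infty$, the bandwidth $b=b_n\in(0,1)$ satisfies $b\to0$ and $nb^{1+\epsilon}\to\infty$ for a given $\epsilon>0$. 1. For $(x,y)\in E^2$, $$\sup_{u\in[0,1]}|\mathbb{E}\hat\pi_u(x)-\pi_u(x)|=O(b^\kappa),\qquad \sup_{u\in[0,1]}\left|\frac{\mathbb{E}\hat\pi_{u,2}(x,y)}{\mathbb{E}\hat\pi_u(x)}-Q_u(x,y)\right|=O(b^\kappa),$$ and $$\sup_{u\in[0,1]}|\hat\pi_u(x)-\mathbb{E}\hat\pi_u(x)|=O_{\mathbb{P}}\left(\frac{\sqrt{\log n}}{\sqrt{nb}}\right),\qquad \sup_{u\in[0,1]}\left|\hat Q_u(x,y)-\frac{\mathbb{E}\hat\pi_{u,2}(x,y)}{\mathbb{E}\hat\pi_u(x)}\right|=O_{\mathbb{P}}\left(\frac{\sqrt{\log n}}{\sqrt{nb}}\right).$$ 2. For $u\in[0,1]$, the vector $\left(\sqrt{nb}\,[\hat\pi_u(x)-\mathbb{E}\hat\pi_u(x)]\right)_{x\in E}$ is asymptotically Gaussian with mean $0$ and covariance $\Sigma^{(1)}_u:E\times E\to\mathbb{R}$ defined by $$\Sigma^{(1)}_u=\int K^2(z)\,dz\cdot\left[\Gamma_u(0)+\sum_{j\ge1}\left(\Gamma_u(j)+\Gamma_u(j)'\right)\right],\qquad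 \Gamma_u(j)_{x,y}=\pi_u(x)Q_u^j(x,y)-\pi_u(x)\pi_u(y),$$ where $'$ denotes transposition. 3. For $u\in[0,1]$, the vector $\sqrt{nb}\left(\hat Q_u(x,y)-\frac{\mathbb{E}\hat\pi_{u,2}(x,y)}{\mathbb{E}\hat\pi_u(x)}\right)_{(x,y)\in E^2}$ is asymptotically Gaussian with mean $0$ and covariance $\Sigma^{(2)}_u:E^2\times E^2\to\mathbb{R}$ defined by $$\Sigma^{(2)}_u\left((x,y),(x',y')\right)=\int K^2(z)\,dz\cdot\frac{1}{\pi_u(x)}Q_u(x,y)\left[\mathbf 1_{y=y'}-Q_u(x',y')\right]\mathbf 1_{x=x'}.$$
   Context: By convention $Q_u=Q_0$ for $u<0$. For each integer $n\ge1$, $(X_{n,k})_{k\in\mathbb{Z},k\le n}$ is an $E$-valued non-homogeneous Markov chain with $\mathbb{P}(X_{n,k}=y\mid X_{n,k-1}=x)=Q_{k/n}(x,y)$ for $k\le n$. $\pi_u$ is the invariant probability of $Q_u$. $K:\mathbb{R}\to\mathbb{R}_+$ is a Lipschitz function supported on $[-1,1]$ with $\int K(z)\,dz=1$. For $u\in[0,1]$ and $1\le i\le n-1$ the kernel weights are $$e_i(u)=\frac{\frac1{nb}K\left(\frac{u-i/n}{b}\right)}{\frac1{nb}\sum_{j=1}^{n-1}K\left(\frac{u-j/n}{b}\right)}.$$ The estimators are $\hat\pi_u(x)=\sum_{i=1}^{n-1}e_i(u)\mathbf 1_{X_{n,i}=x}$, $\hat\pi_{u,2}(x,y)=\sum_{i=1}^{n-1}e_i(u)\mathbf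 1_{X_{n,i}=x,\,X_{n,i+1}=y}$, and $\hat Q_u(x,y)=\hat\pi_{u,2}(x,y)/\hat\pi_u(x)$. ''Asymptotically Gaussian'' means convergence in distribution to the stated centered Gaussian vector as $n\to\infty$.
   Formalization: Parts 2 and 3 are stated for u in the open interval (0,1), since the printed covariances fail at u=0 and u=1 (e.g. i.i.d. uniform, K symmetric); part 1 assumes that for n large the denominator of e_i(u) is non-zero for all u in [0,1]. *)

(* Defs.v *)
(* Mathematical Components with MathComp-Analysis. *)
From HB Require Import structures.
From mathcomp Require Import all_boot all_order all_algebra.
From mathcomp Require Import all_classical all_reals all_analysis.

Set Implicit Arguments.
Unset Strict Implicit.
Unset Printing Implicit Defensive.

Import Order.TTheory GRing.Theory Num.Theory.
Import numFieldNormedType.Exports.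

Local Open Scope classical_set_scope.
Local Open Scope ring_scope.

Section transition_matrices.
Context {R : realType} {E : finType}.
Implicit Types (M : E -> E -> R) (p : E -> R).

Definition transition_matrix M :=
  (forall x y, 0 <= M x y) /\ (forall x, \sum_y M x y = 1).

Fixpoint tpow M (j : nat) (x y : E) : R :=
  if j is j'.+1 then \sum_z M x z * tpow M j' z y else (x == y)%:R.

Definition irreducible M := forall x y, exists j, 0 < tpow M j x y.

(* The greatest common divisor of the return times to x is 1. *)
Definition aperiodic M := forall x (d : nat),
  (forall j, (0 < j)%N -> 0 < tpow M j x x -> (d %| j)%N) -> d = 1%N.

Definition invariant_probability M p :=
  [/\ forall x, 0 <= p x, \sum_x p x = 1
    & forall y, \sum_x p x * M x y = p y].

End transition_matrices.

Definition holder01 {R : realType} (kappa : R) (f : R -> R) :=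
  exists C : R, forall u v, u \in `[0, 1] -> v \in `[0, 1] ->
    `|f u - f v| <= C * `|u - v| `^ kappa.

(* Row n of the triangular array, a process indexed by the integers k <= n
   (the values Y k for k > n play no role).  The Markov property
     P(Y_k = y | Y_{k-1} = s_0, Y_{k-2} = s_1, ..., Y_{k-1-m} = s_m)
       = Q_{k/n}(s_0, y)
   is stated in product form, so that it says nothing when the conditioning
   event is null. *)
Definition row_markov_chain {R : realType} {E : finType}
    {d : measure_display} {T : measurableType d} (P : probability T R)
    (Q : R -> E -> E -> R) (n : nat) (Y : int -> T -> E) :=
  (forall k : int, k <= n%:Z -> forall x, measurable [set w | Y k w = x]) /\
  (forall k : int, k <= n%:Z -> forall (m : nat) (s : nat -> E) (y : E),
    let past := [set w | forall j, (j <= m)%N -> Y (k - 1 - j%:Z) w = s j] in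
    P ([set w | Y k w = y] `&` past)
      = (P past * (Q (k%:~R / n%:R) (s 0%N) y)%:E)%E).

Section estimators.
Context {R : realType} {E : finType} {T : Type}.
Variables (K : R -> R) (b : R) (n : nat).

Definition kernel_term (u : R) (i : nat) : R :=
  (n%:R * b)^-1 * K ((u - i%:R / n%:R) / b).

Definition kernel_mass (u : R) : R := \sum_(1 <= j < n) kernel_term u j.

(* e_i(u) *)
Definition kernel_weight (u : R) (i : nat) : R :=
  kernel_term u i / kernel_mass u.

Variable Y : int -> T -> E.

Definition pi_hat (u : R) (x : E) (w : T) : R :=
  \sum_(1 <= i < n) kernel_weight u i * (Y i%:Z w == x)%:R.

Definition pi2_hat (u : R) (x y : E) (w : T) : R :=
  \sum_(1 <= i < n) kernel_weight u i *
    ((Y i%:Z w == x) && (Y i.+1%:Z w == y))%:R.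

Definition Q_hat (u : R) (x y : E) (w : T) : R :=
  pi2_hat u x y w / pi_hat u x w.

End estimators.

Section expectations.
Context {R : realType} {E : finType} {d : measure_display}
  {T : measurableType d}.
Variables (P : probability T R) (K : R -> R) (b : R) (n : nat).
Variable Y : int -> T -> E.

Definition mean_pi_hat (u : R) (x : E) : R :=
  fine 'E_P[pi_hat K b n Y u x].

Definition mean_pi2_hat (u : R) (x y : E) : R :=
  fine 'E_P[pi2_hat K b n Y u x y].

Definition mean_ratio (u : R) (x y : E) : R :=
  mean_pi2_hat u x y / mean_pi_hat u x.

End expectations.

Section limiting_covariances.
Context {R : realType} {E : finType}.
Variables (K : R -> R) (M : E -> E -> R) (p : E -> R).

Definition kernel_sq : R := \int[lebesgue_measure]_z (K z ^+ 2).

Definition Gamma (j : nat) (x y : E) : R :=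
  p x * tpow M j x y - p x * p y.

Definition Sigma1 (x y : E) : R :=
  kernel_sq *
  (Gamma 0 x y + \big[+%R/0]_(1 <= j <oo) (Gamma j x y + Gamma j y x)).

Definition Sigma2 (a c : E * E) : R :=
  kernel_sq * ((p a.1)^-1 * M a.1 a.2 *
    ((a.2 == c.2)%:R - M c.1 c.2) * (a.1 == c.1)%:R).

End limiting_covariances.

(* The supremum is taken in the extended reals, hence is +oo on functions that
   are unbounded on [0, 1]. *)
Definition sup01 {R : realType} (f : R -> R) : \bar R :=
  ereal_sup [set `|f u|%:E | u in `[0, 1]].

Definition is_bigO {R : realType} (a : nat -> \bar R) (r : nat -> R) :=
  exists C : R, \forall n \near \oo, (`|a n| <= (C * r n)%:E)%E.

Definition is_bigO_prob {R : realType} {d : measure_display}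
    {T : measurableType d} (P : probability T R)
    (Z : nat -> T -> \bar R) (r : nat -> R) :=
  forall eta : R, 0 < eta -> exists2 C : R, 0 < C &
    \forall n \near \oo,
      (P [set w | (C * r n)%:E < `|Z n w| ] <= eta%:E)%E.

(* normal_prob m 0 is not the Dirac mass at m, whence the case s = 0. *)
Definition gaussian_law {R : realType} (m s : R) (A : set R) : \bar R :=
  if s == 0 then \d_m A else normal_prob m s A.

(* Possibly degenerate: every linear combination of the components has a
   (possibly degenerate) Gaussian law. *)
Definition gaussian_vector {R : realType} {d : measure_display}
    {T : measurableType d} (P : probability T R) {I : finType}
    (G : I -> {RV P >-> R}) :=
  forall t : I -> R, exists m s : R, forall A : set R, measurable A ->
    P [set w | A (\sum_i t i * G i w)] = gaussian_law m s A.

(* Convergence in distribution of random vectors of R^I, by bounded continuous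
   test functions for the product topology. *)
Definition cvg_in_distribution {R : realType} {I : finType}
    {d : measure_display} {T : measurableType d} (P : probability T R)
    (Z : nat -> T -> I -> R)
    {d' : measure_display} {T' : measurableType d'} (P' : probability T' R)
    (G : T' -> I -> R) :=
  forall f : {ptws I -> R} -> R, continuous f ->
    (exists B : R, forall v, `|f v| <= B) ->
    'E_P[fun w => f (Z n w)]%E @[n --> \oo] --> 'E_P'[fun w => f (G w)]%E.

Definition asymptotically_gaussian {R : realType} {I : finType}
    {d : measure_display} {T : measurableType d} (P : probability T R)
    (Z : nat -> T -> I -> R) (S : I -> I -> R) :=
  exists (d' : measure_display) (T' : measurableType d')
         (P' : probability T' R) (G : I -> {RV P' >-> R}),
    [/\ gaussian_vector G,
        forall i, 'E_P'[G i]%E = 0%:E,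
        forall i j, covariance P' (G i) (G j) = (S i j)%:E
      & cvg_in_distribution P Z P' (fun w i => G i w)].

(* Main.v *)
(** Irreducibility and aperiodicity make a power of each [Q u] positive; by
    compactness of [0, 1] and continuity of [Q], the products of [m]
    consecutive transitions of the array satisfy a Doeblin condition with one
    [m] and one constant, so that the rows forget their past geometrically fast,
    uniformly in [n]. The law of the row [n] at time [i] is then within
    [O(n^-kappa)] of [pi (i/n)], which gives the bias.

    A sum of bounded functions of consecutive states differs from a martingale
    with bounded increments by a bounded corrector, hence is sub-Gaussian; a
    union bound over a grid of mesh [n^-3], on which the weights are Lipschitz,
    gives the uniform deviations.

    For the central limit theorems, the solution of the Poisson equation for
    [Q u], with [u] fixed, turns the estimators, up to negligible terms, into
    martingale sums, whose characteristic functions converge because Riemann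
    sums of [K^2] do. Characteristic functions are handled through the real
    quantities [E cos (t.x + al)]: continuous functions on a cube are uniform
    limits of trigonometric polynomials, obtained by averaging over coin tosses
    of bias [(1 + sin)/2] as in Bernstein's proof. *)

Require Import Defs.
From HB Require Import structures.
From mathcomp Require Import all_boot all_order all_algebra.
From mathcomp Require Import all_classical all_reals all_analysis.
From mathcomp Require Import measurable_realfun.
From mathcomp Require Import ring lra zify.

Set Implicit Arguments.
Unset Strict Implicit.
Unset Printing Implicit Defensive.

Import Order.TTheory GRing.Theory Num.Theory.
Import numFieldNormedType.Exports.

Local Open Scope classical_set_scope.
Local Open Scope ring_scope.

(** * Uniform mixing *)

Section stochastic_products.
Context {R : realType} {E : finType}.
Implicit Types (M B : E -> E -> R) (v : E -> R) (A : nat -> E -> E -> R).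

(** Two features of the setting shape the argument. The estimators of row [n] see the times 0 to [n]
    only, so everything is transferred to a finite mass function on paths [{ffun 'I_n.+1 -> E}]:
    expectations become finite sums, and conditioning becomes testing against functions of the past.
    The negative times serve once, to show that each row is at time 0 exactly distributed as [pi 0].
    Secondly, the bias, of order [b^kappa], may exceed [1 / sqrt(nb)]. Centering at exact
    expectations is therefore kept at every approximation, and the errors left by freezing [Q] at
    [u] are shown negligible through their variance, not through their size. One contraction
    estimate, for the l1 norm of signed vectors of mass 0, yields the exponential inequality, the
    variance bounds, the continuity of [pi], the bias and the Poisson equation. The condition on
    [n b^(1+eps)] acts through two consequences: [nb] tends to infinity, and [log n] is negligible
    before [nb]. *)

Definition l1norm v : R := \sum_x `|v x|.

Definition rowmul v M : E -> R := fun y => \sum_x v x * M x y.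

Definition avg M (h : E -> R) : E -> R := fun x => \sum_y M x y * h y.

(* A k is the transition from time k - 1 to time k, and chainmx A k j the
   transition from time k to time k + j. *)
Fixpoint chainmx A (k j : nat) (x y : E) : R :=
  if j is j'.+1 then \sum_z A k.+1 x z * chainmx A k.+1 j' z y
  else (x == y)%:R.

Lemma tpowE M k j : tpow M j = chainmx (fun=> M) k j.
Proof.
elim: j k => [//|j IH] k /=.
by apply/funext => x; apply/funext => y; rewrite (IH k.+1).
Qed.

Lemma sum_delta (f : E -> R) (x : E) : \sum_z (x == z)%:R * f z = f x.
Proof.
rewrite (bigD1 x)//= eqxx mul1r big1 ?addr0// => z.
by rewrite eq_sym => /negPf ->; rewrite mul0r.
Qed.

Lemma sum_deltar (f : E -> R) (x : E) : \sum_z f z * (z == x)%:R = f x.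
Proof. by rewrite -[RHS]sum_delta; apply: eq_bigr => z _; rewrite mulrC eq_sym. Qed.

Lemma chainmxD A k i j x y :
  chainmx A k (i + j) x y = \sum_z chainmx A k i x z * chainmx A (k + i) j z y.
Proof.
elim: i k x => [|i IH] k x /=; first by rewrite add0n addn0 sum_delta.
under eq_bigr do rewrite IH mulr_sumr.
rewrite exchange_big/=; apply: eq_bigr => z _.
rewrite mulr_suml; apply: eq_bigr => w _.
by rewrite mulrA addSnnS.
Qed.

Section stochastic.
Variable A : nat -> E -> E -> R.
Hypothesis trA : forall k, transition_matrix (A k).

Lemma chainmx_ge0 k j x y : 0 <= chainmx A k j x y.
Proof.
elim: j k x => [|j IH] k x /=; first by rewrite ler0n.
by apply: sumr_ge0 => z _; rewrite mulr_ge0// (trA _).1.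
Qed.

Lemma chainmx_sum1 k j x : \sum_y chainmx A k j x y = 1.
Proof.
elim: j k x => [|j IH] k x /=.
  by rewrite -[RHS](sum_delta (fun=> 1) x); apply: eq_bigr => y _; rewrite mulr1.
rewrite exchange_big/= -[RHS]((trA k.+1).2 x); apply: eq_bigr => z _.
by rewrite -mulr_sumr IH mulr1.
Qed.

Lemma chainmx_transition k j : transition_matrix (chainmx A k j).
Proof. by split=> [x y|x]; [exact: chainmx_ge0|exact: chainmx_sum1]. Qed.

End stochastic.

Lemma transition_le1 M x y : transition_matrix M -> M x y <= 1.
Proof.
move=> [M0 M1]; rewrite -(M1 x) (bigD1 y)//= lerDl.
by apply: sumr_ge0 => z _; exact: M0.
Qed.

Lemma l1norm_ge0 v : 0 <= l1norm v.
Proof. by apply: sumr_ge0 => x _; rewrite normr_ge0. Qed.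

Lemma ler_l1norm v x : `|v x| <= l1norm v.
Proof. by rewrite /l1norm (bigD1 x)//= lerDl sumr_ge0. Qed.

Lemma l1norm_rowmul M v : transition_matrix M ->
  l1norm (rowmul v M) <= l1norm v.
Proof.
move=> [M0 M1]; rewrite /l1norm /rowmul.
apply: (@le_trans _ _ (\sum_y \sum_x `|v x| * M x y)).
  apply: ler_sum => y _; apply: (le_trans (ler_norm_sum _ _ _)).
  by apply: ler_sum => x _; rewrite normrM (ger0_norm (M0 _ _)).
rewrite exchange_big/=; apply: ler_sum => x _.
by rewrite -mulr_sumr M1 mulr1.
Qed.

(** A vector of mass 0 does not see constants: [B] may be replaced with [B - delta], still
    nonnegative, whose rows sum to [1 - #|E| delta <= 1 - delta]. The last inequality needs a state,
    whence the separate case of an empty [E]. *)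
Lemma l1norm_rowmul_doeblin B (delta : R) v : transition_matrix B ->
  0 <= delta -> (forall x y, delta <= B x y) -> \sum_x v x = 0 ->
  l1norm (rowmul v B) <= (1 - delta) * l1norm v.
Proof.
move=> [B0 B1] d0 dB v0.
have [/eqP E0|E0] := boolP (#|E| == 0%N).
  have h (f : E -> R) : \sum_x f x = 0.
    by apply: big1 => x; have := fintype0 x E0.
  by rewrite /l1norm !h mulr0.
have E1 : 1 <= #|E|%:R :> R by rewrite ler1n lt0n.
rewrite /l1norm /rowmul.
apply: (@le_trans _ _ (\sum_y \sum_x `|v x| * (B x y - delta))).
  apply: ler_sum => y _.
  have -> : \sum_x v x * B x y = \sum_x v x * (B x y - delta).
    under [RHS]eq_bigr do rewrite mulrBr.
    by rewrite sumrB -mulr_suml v0 mul0r subr0.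
  apply: (le_trans (ler_norm_sum _ _ _)).
  by apply: ler_sum => x _; rewrite normrM (ger0_norm (x := B x y - _)) ?subr_ge0.
rewrite exchange_big/= mulr_sumr; apply: ler_sum => x _.
rewrite -mulr_sumr sumrB B1 sumr_const -mulr_natl mulrC ler_wpM2r//.
by rewrite lerB// ler_peMl.
Qed.

Lemma rowmul_sum M v : transition_matrix M -> \sum_y rowmul v M y = \sum_x v x.
Proof.
move=> [_ M1]; rewrite exchange_big/=; apply: eq_bigr => x _.
by rewrite -mulr_sumr M1 mulr1.
Qed.

Lemma rowmul_chainmxD A k i j v :
  rowmul v (chainmx A k (i + j)) =
  rowmul (rowmul v (chainmx A k i)) (chainmx A (k + i) j).
Proof.
apply/funext => y; rewrite /rowmul; under eq_bigr do rewrite chainmxD mulr_sumr.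
rewrite exchange_big/=; apply: eq_bigr => z _; rewrite mulr_suml.
by apply: eq_bigr => x _; rewrite mulrA.
Qed.

Lemma bernoulli_ineq (x : R) m : 0 <= x <= 1 -> 1 - m%:R * x <= (1 - x) ^+ m.
Proof.
move=> /andP[x0 x1]; elim: m => [|m IH]; first by rewrite mul0r subr0 expr0.
rewrite exprS -[m.+1]add1n natrD.
apply: (@le_trans _ _ ((1 - x) * (1 - m%:R * x))); last first.
  by rewrite ler_wpM2l// subr_ge0.
have : 0 <= m%:R * x * x by rewrite !mulr_ge0.
by nra.
Qed.

(** By Bernoulli's inequality the [m]-th power of this rate is at least [1 - delta], so a
    contraction by [1 - delta] per block of [m] steps is geometric in single steps, without [m]-th
    roots. The factor 2 keeps the rate positive when [m = delta = 1]. *)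
Definition mix_rate (m : nat) (delta : R) : R := 1 - delta / (m%:R * 2).
Definition mix_cst (m : nat) (delta : R) : R := (mix_rate m delta ^+ m)^-1.

Lemma mix_rate_bounds m delta : (0 < m)%N -> 0 < delta <= 1 ->
  0 < mix_rate m delta < 1.
Proof.
move=> m0 /andP[d0 d1].
have m1 : 1 <= m%:R :> R by rewrite ler1n.
have q0 : 0 < delta / (m%:R * 2) by rewrite divr_gt0// mulr_gt0// ltr0n.
rewrite /mix_rate; apply/andP; split; last by rewrite gtrBl.
rewrite subr_gt0 ltr_pdivrMr; last by rewrite mulr_gt0// ltr0n.
by rewrite mul1r; lra.
Qed.

Lemma mix_cst_ge1 m delta : (0 < m)%N -> 0 < delta <= 1 ->
  1 <= mix_cst m delta.
Proof.
move=> m0 hd; have /andP[r0 r1] := mix_rate_bounds m0 hd.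
by rewrite /mix_cst invf_ge1 ?exprn_gt0// exprn_ile1// ltW.
Qed.

(** Blocks of [m] steps are peeled off by strong induction on [j]; a last incomplete block does not
    increase the norm, and [mix_cst] pays for it. *)
Lemma l1norm_chainmx A m delta k j v :
  (forall k, transition_matrix (A k)) -> (0 < m)%N -> 0 < delta <= 1 ->
  (forall k x y, delta <= chainmx A k m x y) -> \sum_x v x = 0 ->
  l1norm (rowmul v (chainmx A k j)) <=
    mix_cst m delta * mix_rate m delta ^+ j * l1norm v.
Proof.
move=> trA m0 hd hA; have /andP[r0 r1] := mix_rate_bounds m0 hd.
elim/ltn_ind: j k v => j IH k v v0.
have [jm|mj] := ltnP j m.
  apply: le_trans (l1norm_rowmul v (chainmx_transition trA k j)) _.
  rewrite ler_peMl ?l1norm_ge0// mulrC ler_pdivlMr ?exprn_gt0// mul1r.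
  by apply: ler_wiXn2l; [exact: ltW|exact: ltW|exact: ltnW].
rewrite -{1}(subnKC mj) rowmul_chainmxD.
apply: le_trans (IH _ _ _ _ _) _.
- by rewrite ltn_subrL m0 (leq_trans m0 mj).
- by rewrite rowmul_sum//; exact: chainmx_transition.
case/andP: hd => d0 d1.
have := l1norm_rowmul_doeblin (chainmx_transition trA k m) (ltW d0) (hA k) v0.
have h : 1 - delta <= mix_rate m delta ^+ m.
  apply: le_trans (bernoulli_ineq _ _); last first.
    have q0 : 0 < delta / (m%:R * 2) by rewrite divr_gt0// mulr_gt0// ltr0n.
    by move: r0; rewrite /mix_rate (ltW q0)/= subr_gt0 => /ltW.
  have -> : m%:R * (delta / (m%:R * 2)) = delta / 2.
    by field; rewrite pnatr_eq0 -lt0n.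
  by lra.
move=> /le_trans/(_ (ler_wpM2r (l1norm_ge0 _) h)) h2.
have c1 : 0 <= mix_cst m delta * mix_rate m delta ^+ (j - m).
  by rewrite mulr_ge0 ?invr_ge0 ?exprn_ge0// ltW.
apply: le_trans (ler_wpM2l c1 h2) _.
by rewrite mulrA -(mulrA _ (_ ^+ _) (_ ^+ m)) -exprD subnK.
Qed.

End stochastic_products.

Lemma minn_sub n k i m : (k < i)%N -> (i <= k + m)%N ->
  (minn k n <= minn i n)%N /\ (minn i n - minn k n <= m)%N.
Proof. by lia. Qed.

Lemma near_all_finType (T : Type) (F : set_system T) {FF : Filter F}
    (I : finType) (P : I -> T -> Prop) :
  (forall i, \forall t \near F, P i t) -> \forall t \near F, forall i, P i t.
Proof.
move=> h; suff : \forall t \near F, forall i, i \in enum I -> P i t.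
  by apply: filterS => t ht i; apply: ht; rewrite mem_enum.
elim: (enum I) => [|i s IH]; first exact: nearW.
near=> t; move=> j; rewrite inE => /predU1P[->|js].
  by near: t; exact: h.
by move: j js; near: t.
Unshelve. all: by end_near. Qed.

(** Let [d] be the least positive difference of two elements of [J]. The remainder modulo [d] of an
    element of [J] is again such a difference, hence 0; so [d] divides [J] and equals 1. With [a]
    and [a + 1] in [J], every [n >= a^2] equals [(n/a - n%a) a + (n%a) (a+1)]. *)
Lemma numerical_semigroup (J : pred nat) : J 0%N ->
  (forall i j, J i -> J j -> J (i + j)%N) ->
  (forall d, (forall j, (0 < j)%N -> J j -> (d %| j)%N) -> d = 1%N) ->
  exists N, forall n, (N <= n)%N -> J n.
Proof.
move=> J0 JD Jd.
have JM k j : J j -> J (k * j)%N.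
  by move=> Jj; elim: k => // k IH; rewrite mulSn; exact: JD.
pose D d := (0 < d)%N && `[< exists2 a, J a & J (a + d)%N >].
(* Without a positive difference, [J] has no positive element (compare with 0), and the divisibility
   condition holds vacuously for 2. *)
have exD : exists d, D d.
  apply: contrapT => nD; have : 2 = 1%N by apply: Jd => j j0 Jj; exfalso;
    apply: nD; exists j; rewrite /D j0/=; apply/asboolP; exists 0%N.
  by [].
case: (ex_minnP exD) => d /andP[d0 /asboolP[a Ja Jad]] dmin.
have d1 : d = 1%N.
  apply: Jd => j j0 Jj; rewrite /dvdn; apply/negPn/negP => rj.
  have : D (j %% d)%N.
    rewrite /D lt0n rj/=; apply/asboolP; exists (j %/ d * (a + d))%N.
      exact: JM.
    have -> : (j %/ d * (a + d) + j %% d = j + j %/ d * a)%N.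
      by rewrite mulnDr -addnA -divn_eq addnC.
    by apply: JD => //; exact: JM.
  by move/dmin; rewrite leqNgt ltn_mod d0.
move: Ja Jad; rewrite {}d1 addn1 => Ja Ja1.
have [a0|a0] := posnP a.
  by exists 0%N => n _; rewrite -(muln1 n); apply: JM; rewrite a0 in Ja1.
exists (a * a)%N => n an; rewrite (divn_eq n a).
have r := ltn_pmod n a0.
have qa : (a <= n %/ a)%N by rewrite leq_divRL.
have -> : (n %/ a * a + n %% a = (n %/ a - n %% a) * a + n %% a * a.+1)%N.
  by rewrite mulnS (addnC (n %% a)%N) addnA -mulnDl subnK// ltnW// (leq_trans r).
by apply: JD; exact: JM.
Qed.

Section primitive.
Context {R : realType} {E : finType}.
Implicit Types (M : E -> E -> R).

Lemma tpow_gt0D M i j x y z : transition_matrix M ->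
  0 < tpow M i x y -> 0 < tpow M j y z -> 0 < tpow M (i + j) x z.
Proof.
move=> trM; rewrite !(tpowE _ 0%N) chainmxD => xy yz.
rewrite (bigD1 y)//= ltr_wpDr//; last first.
  by rewrite mulr_gt0// -(tpowE _ i) (tpowE _ 0%N).
by apply: sumr_ge0 => w _; rewrite mulr_ge0//; exact: chainmx_ge0.
Qed.

(** All large integers are return times to [x], so a path from [x] to [y] can be preceded by a loop
    of the missing length. Sums of the thresholds and of the path lengths stand in for maxima. *)
Lemma irreducible_aperiodic_primitive M :
  transition_matrix M -> irreducible M -> aperiodic M ->
  exists m, forall j, (m <= j)%N -> forall x y, 0 < tpow M j x y.
Proof.
move=> trM irrM aperM.
have /fin_all_exists[N hN] x :
    exists N, forall n, (N <= n)%N -> 0 < tpow M n x x.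
  apply: numerical_semigroup; first by rewrite /= eqxx.
    by move=> i j; exact: tpow_gt0D.
  by move=> d; exact: aperM.
have /fin_all_exists[p hp] (a : E * E) : exists j, 0 < tpow M j a.1 a.2.
  exact: irrM.
exists (\sum_x N x + \sum_a p a)%N => j hj x y.
have pj : (p (x, y) <= j)%N.
  by apply: leq_trans hj; rewrite (bigD1 (x, y))//= addnCA leq_addr.
rewrite -(subnK pj); apply: tpow_gt0D (hp (x, y)) => //; apply: hN.
rewrite -(leq_add2r (p (x, y))) subnK//; apply: leq_trans hj.
by rewrite (bigD1 x)//= (bigD1 (x, y) (F := p))//= leq_add// leq_addr.
Qed.

(** The factors are exchanged one at a time; each exchange costs [eta], the other factors being
    stochastic. *)
Lemma chainmx_tpow_dist (A : nat -> E -> E -> R) M k j eta :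
  (forall k, transition_matrix (A k)) -> transition_matrix M ->
  (forall i x, (k < i <= k + j)%N -> \sum_y `|A i x y - M x y| <= eta) ->
  forall x y, `|chainmx A k j x y - tpow M j x y| <= j%:R * eta.
Proof.
move=> trA trM; elim: j k => [|j IH] k hA x y.
  by rewrite /= subrr normr0 mul0r.
rewrite /=.
have -> : \sum_z A k.+1 x z * chainmx A k.+1 j z y -
    \sum_z M x z * tpow M j z y =
    \sum_z (A k.+1 x z - M x z) * chainmx A k.+1 j z y +
    \sum_z M x z * (chainmx A k.+1 j z y - tpow M j z y).
  by rewrite -sumrB -big_split/=; apply: eq_bigr => z _; ring.
rewrite -[j.+1]add1n natrD mulrDl mul1r.
apply: le_trans (ler_normD _ _) (lerD _ _).
  apply: le_trans (ler_norm_sum _ _ _) _.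
  apply: le_trans (hA k.+1 x _); last by rewrite ltnSn addnS ltnS leq_addr.
  apply: ler_sum => z _; rewrite normrM ler_piMr//.
  rewrite ger0_norm ?chainmx_ge0//.
  exact: (transition_le1 _ _ (chainmx_transition trA _ _)).
apply: le_trans (ler_norm_sum _ _ _) _.
have -> : j%:R * eta = \sum_z M x z * (j%:R * eta).
  by rewrite -mulr_suml trM.2 mul1r.
apply: ler_sum => z _; rewrite normrM (ger0_norm (trM.1 _ _)).
apply: ler_wpM2l; first exact: trM.1.
apply: IH => i w /andP[ki ij]; apply: hA.
by rewrite (ltn_trans _ ki)//= addnS -addSn.
Qed.

End primitive.

Section uniform_mixing.
Context {R : realType} {E : finType}.
Variables (kappa : R) (Q : R -> E -> E -> R).
Hypothesis kappa01 : 0 < kappa < 1.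
Hypothesis Q_transition : forall u, u \in `[0, 1] -> transition_matrix (Q u).
Hypothesis Q_irreducible : forall u, u \in `[0, 1] -> irreducible (Q u).
Hypothesis Q_aperiodic : forall u, u \in `[0, 1] -> aperiodic (Q u).
Hypothesis Q_holder : forall x y, holder01 kappa (fun u => Q u x y).

Lemma holder_uniform : exists2 C : R, 0 < C & forall u v,
  u \in `[0, 1] -> v \in `[0, 1] ->
  forall x, \sum_y `|Q u x y - Q v x y| <= C * `|u - v| `^ kappa.
Proof.
have /fin_all_exists[C hC] (a : E * E) : exists C : R, forall u v,
    u \in `[0, 1] -> v \in `[0, 1] ->
    `|Q u a.1 a.2 - Q v a.1 a.2| <= C * `|u - v| `^ kappa.
  exact: Q_holder.
exists (1 + \sum_x \sum_y `|C (x, y)|).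
  by rewrite ltr_pwDl// !sumr_ge0// => x _; rewrite sumr_ge0.
move=> u v hu hv x.
apply: (@le_trans _ _ (\sum_y `|C (x, y)| * `|u - v| `^ kappa)).
  apply: ler_sum => y _; apply: le_trans (hC (x, y) u v hu hv) _.
  by rewrite ler_wpM2r ?powR_ge0// ler_norm.
rewrite -mulr_suml ler_wpM2r ?powR_ge0// [in leRHS](bigD1 x)//= addrCA lerDl.
by rewrite addr_ge0// sumr_ge0// => y _; rewrite sumr_ge0.
Qed.

(** Extends [Q] to the whole line by constants, so that continuity and neighborhoods are those of
    [R] and not of the subspace [0, 1]. *)
Let clamp (u : R) := Num.max 0 (Num.min u 1).

Let clamp01 u : clamp u \in `[0, 1].
Proof. by rewrite in_itv/= /clamp le_max lexx/= ge_max ler01/= ge_min lexx orbT. Qed.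

Let clamp_id u : u \in `[0, 1] -> clamp u = u.
Proof.
by rewrite in_itv/= => /andP[u0 u1]; rewrite /clamp (min_idPl u1) (max_idPr u0).
Qed.

Lemma clamp_lip u v : `|clamp u - clamp v| <= `|u - v|.
Proof.
wlog uv : u v / u <= v.
  by move=> h; case: (leP u v) => [/h//|/ltW/h]; rewrite distrC (distrC v).
have m (x : R) : x <= Num.max 0 x by rewrite le_max lexx orbT.
have m0 (x : R) : 0 <= Num.max 0 x by rewrite le_max lexx.
rewrite distrC (distrC u) !ger0_norm ?subr_ge0//; last first.
  have uv1 : Num.min u 1 <= Num.min v 1 by rewrite le_min !ge_min uv lexx orbT.
  by rewrite /clamp ge_max m0/= (le_trans uv1).
rewrite lerBlDr [leLHS]/clamp ge_max; apply/andP; split.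
  by apply: addr_ge0 (m0 _); rewrite subr_ge0.
rewrite ge_min.
case: (leP u 1) => u1; apply/orP; [left|right]; rewrite /clamp.
  by rewrite (min_idPl u1); have := m u; lra.
by rewrite (min_idPr (ltW u1)); have := m 1; lra.
Qed.

Lemma powR_small (C e : R) : 0 < C -> 0 < e ->
  exists2 eta : R, 0 < eta & forall t, 0 <= t -> t < eta -> C * t `^ kappa < e.
Proof.
case/andP: kappa01 => k0 _ C0 e0; exists ((e / C) `^ kappa^-1).
  by rewrite powR_gt0// divr_gt0.
move=> t t0 te; rewrite mulrC -ltr_pdivlMr//.
have := gt0_ltr_powR k0 _ _ te.
rewrite -powRrM mulVf ?gt_eqF// powRr1; last by rewrite divr_ge0 ?ltW.
by apply; rewrite nnegrE ?powR_ge0.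
Qed.

Lemma continuous_tpow_clamp j x y : continuous (fun u => tpow (Q (clamp u)) j x y).
Proof.
have [C C0 hC] := holder_uniform.
have cQ z w : continuous (fun u => Q (clamp u) z w).
  move=> u; apply/cvgrPdist_lt => e e0.
  have [eta eta0 heta] := powR_small C0 e0.
  near=> v.
  have := hC _ _ (clamp01 u) (clamp01 v) z.
  rewrite (bigD1 w)//= => h.
  apply: (@le_lt_trans _ _ (C * `|clamp u - clamp v| `^ kappa)).
    by apply: le_trans h; rewrite lerDl sumr_ge0.
  apply: heta => //; apply: le_lt_trans (clamp_lip _ _) _.
  by near: v; exact: cvgr_dist_lt.
elim: j x y => [|j IH] x y u /=; first exact: cvg_cst.
apply: cvg_big => [|z _]; first exact: add_continuous.
by apply: cvgM; [exact: cQ|exact: IH].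
Unshelve. all: by end_near. Qed.

(** Compactness is used twice, in its near-covering form: for a common exponent, then for a common
    lower bound among the numbers [1 / (i+1)]. The first pass asks for positivity at all exponents
    [j >= m], a condition monotone in [m]: once the [p]-th power is positive, so are all later ones,
    since each row of the remaining factor has a positive entry. *)
Lemma uniform_primitive : exists m (delta : R), [/\ (0 < m)%N, 0 < delta <= 1 &
  forall u, u \in `[0, 1] -> forall x y, delta <= tpow (Q u) m x y].
Proof.
have cpt := @segment_compact R 0 1.
have /compact_near_coveringP ncov := cpt.
have [m0 hm0] : exists m, forall u, u \in `[0, 1] ->
    forall j, (m <= j)%N -> forall x y, 0 < tpow (Q u) j x y.
  have : \forall m \near \oo, `[0, 1]%classic `<=`
      (fun u => forall j, (m <= j)%N -> forall x y, 0 < tpow (Q (clamp u)) j x y).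
    apply: ncov => u hu.
    have [p hp] := irreducible_aperiodic_primitive (Q_transition hu)
      (Q_irreducible hu) (Q_aperiodic hu).
    exists ([set v | forall x y, 0 < tpow (Q (clamp v)) p x y], [set m | (p <= m)%N]).
      split => /=; last by exists p.
      have h : \forall v \near u, forall a : E * E,
          0 < tpow (Q (clamp v)) p a.1 a.2.
        apply: (@near_all_finType _ (nbhs u) (nbhs_filter u) (E * E)%type) => a.
        apply: (cvgr_gt _ (@continuous_tpow_clamp p a.1 a.2 u)).
        by rewrite clamp_id//; exact: hp.
      by apply: filterS h => v hv x y; exact: (hv (x, y)).
    move=> [v m]/= [hv pm] j mj x y.
    have pj := leq_trans pm mj.
    rewrite -(subnK pj) (tpowE _ 0%N) chainmxD.
    have trv := Q_transition (clamp01 v).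
    have [z z0] : exists z, 0 < tpow (Q (clamp v)) (j - p) x z.
      apply: contrapT => nz; have := chainmx_sum1 (fun=> trv) 0 (j - p) x.
      rewrite big1 => [/eqP|z _]; first by rewrite eq_sym oner_eq0.
      apply/eqP; apply: contrapT => /negP z0; apply: nz; exists z.
      by rewrite (tpowE _ 0%N) lt_neqAle eq_sym z0 chainmx_ge0.
    rewrite (bigD1 z)//= ltr_wpDr//.
      by apply: sumr_ge0 => w _; rewrite mulr_ge0//; exact: chainmx_ge0.
    by rewrite -!tpowE mulr_gt0.
  case=> m _ hm; exists m => u hu; rewrite -(clamp_id hu).
  by apply: (hm m) => //=; rewrite clamp_id.
pose m := maxn m0 1.
have mm0 : (m0 <= m)%N by rewrite leq_maxl.
have m1 : (0 < m)%N by rewrite leq_maxr.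
have : \forall i \near \oo, `[0, 1]%classic `<=`
    (fun u => forall x y, i.+1%:R^-1 < tpow (Q (clamp u)) m x y).
  apply: ncov => u hu.
  have /fin_all_exists2[e e0 he] (a : E * E) : exists2 e : R, 0 < e &
      e < tpow (Q (clamp u)) m a.1 a.2.
    exists (tpow (Q (clamp u)) m a.1 a.2 / 2).
      by rewrite divr_gt0// clamp_id//; exact: hm0.
    have h : 0 < tpow (Q (clamp u)) m a.1 a.2 by rewrite clamp_id//; exact: hm0.
    by rewrite ltr_pdivrMr// ltr_pMr// ltr1n.
  exists ([set v | forall x y, e (x, y) < tpow (Q (clamp v)) m x y],
      [set i | forall a, i.+1%:R^-1 < e a]).
    split => /=.
      have h : \forall v \near u, forall a : E * E,
          e a < tpow (Q (clamp v)) m a.1 a.2.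
        apply: (@near_all_finType _ (nbhs u) (nbhs_filter u) (E * E)%type) => a.
        by apply: (cvgr_gt _ (@continuous_tpow_clamp m a.1 a.2 u)); exact: he.
      by apply: filterS h => v hv x y; exact: (hv (x, y)).
    apply: (@near_all_finType _ \oo _ (E * E)%type) => a.
    exact: near_infty_natSinv_lt (PosNum (e0 a)).
  by move=> [v i]/= [h1 h2] x y; apply: lt_trans (h2 (x, y)) _.
case=> i _ hi; exists m, i.+1%:R^-1; split=> //.
  by rewrite invr_gt0 ltr0n/= invf_le1 ?ler1n// ltr0n.
move=> u hu x y; rewrite ltW// -(clamp_id hu).
by apply: (hi i) => //=; rewrite clamp_id.
Qed.

(** The minimum keeps the parameter in [0, 1] at every time [k], so that uniform bounds on products
    need no restriction on [k]; the rows follow these transitions for [k <= n]. *)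
Definition triangular_transition (n k : nat) : E -> E -> R :=
  Q ((minn k n)%:R / n%:R).

Lemma min_div_itv01 n k : (minn k n)%:R / n%:R \in `[0 : R, 1].
Proof.
rewrite in_itv/= divr_ge0 ?ler0n//=.
have [->|n0] := posnP n; first by rewrite invr0 mulr0.
by rewrite ler_pdivrMr ?ltr0n// mul1r ler_nat geq_minr.
Qed.

Lemma triangular_transitionP n k : transition_matrix (triangular_transition n k).
Proof. exact/Q_transition/min_div_itv01. Qed.

(** Along [m] consecutive steps the parameter moves by at most [m / n], so the product is within
    [m C (m/n)^kappa] of the [m]-th power of one [Q u]; half of the [delta] of [uniform_primitive]
    pays for this. *)
Lemma uniform_mixing : exists m (delta : R), [/\ (0 < m)%N, 0 < delta <= 1,
  forall u, u \in `[0, 1] -> forall x y, delta <= tpow (Q u) m x y &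
  \forall n \near \oo,
    forall k x y, delta <= chainmx (triangular_transition n) k m x y].
Proof.
have [m [delta [m0 /andP[d0 d1] hd]]] := uniform_primitive.
have [C C0 hC] := holder_uniform.
exists m, (delta / 2); split=> //.
- by rewrite divr_gt0//= ler_pdivrMr//; lra.
- by move=> u hu x y; apply: le_trans (hd u hu x y); rewrite ler_pdivrMr//; lra.
have C2 : 0 < m%:R * C by rewrite mulr_gt0// ltr0n.
have d2 : 0 < delta / 2 by rewrite divr_gt0.
have [eta eta0 heta] := powR_small C2 d2.
have m0' : 0 < m%:R :> R by rewrite ltr0n.
near=> n => k x y.
have n0 : (0 < n)%N by near: n; exists 1%N.
have mn : m%:R / n%:R < eta.
  rewrite ltr_pdivrMr ?ltr0n// mulrC -ltr_pdivrMr//.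
  by near: n; exact: nbhs_infty_gtr.
set u := (minn k n)%:R / n%:R : R.
have hu : u \in `[0, 1] by exact: min_div_itv01.
have := @chainmx_tpow_dist _ _ (triangular_transition n) (Q u) k m
  (C * (m%:R / n%:R) `^ kappa) (@triangular_transitionP n) (Q_transition hu).
move=> /(_ _ x y)-/(_ _)/wrap[].
  move=> i z /andP[ki ikm]; apply: le_trans (hC _ _ (min_div_itv01 n i) hu z) _.
  apply: ler_wpM2l; first exact: ltW.
  apply: ge0_ler_powR; rewrite ?nnegrE ?divr_ge0//.
    by case/andP: kappa01 => /ltW.
  rewrite -mulrBl normrM (ger0_norm (x := n%:R^-1)) ?invr_ge0 ?ler0n//.
  rewrite ler_wpM2r ?invr_ge0 ?ler0n//.
  have [ab abm] := minn_sub n ki ikm.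
  by rewrite -natrB// normr_nat ler_nat.
rewrite ler_norml mulrA => /andP[+ _].
have := heta _ (divr_ge0 (ler0n _ m) (ler0n _ n)) mn.
have := hd _ hu x y.
move: (chainmx _ _ _ _ _) (tpow _ _ _ _) (_ * C * _) => a b c; lra.
Unshelve. all: by end_near. Qed.

End uniform_mixing.

Section expR_inequalities.
Context {R : realType}.
Implicit Types x : R.

(** For [x <= 1/2] both sides are compared with [1 + x + 2 x^2] through [1 / (1 - x)]; for larger
    [x], already [x <= 2 x^2]. The bare [x] on the right vanishes in expectation for a centered
    variable. *)
Lemma expR_le_id_sqr x : expR x <= x + expR (2 * x ^+ 2).
Proof.
have [x2|x2] := leP x 2^-1; last first.
  apply: le_trans (_ : expR (2 * x ^+ 2) <= _); last by rewrite lerDr; lra.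
  rewrite ler_expR; nra.
apply: (@le_trans _ _ (x + (1 + 2 * x ^+ 2))); last by rewrite lerD2l expR_ge1Dx.
have h1 : 0 < 1 - x by lra.
have : expR x <= (1 - x)^-1.
  rewrite -[expR x]invrK -expRN lef_pV2 ?posrE ?expR_gt0//.
  by apply: le_trans (expR_ge1Dx _); rewrite lexx.
move=> /le_trans; apply; rewrite -div1r ler_pdivrMr//; nra.
Qed.

(** Serves to read second moments off exponential moments at two opposite points, and later to
    dominate quadratic errors under a normal law. *)
Lemma sqr_le_cosh x : x ^+ 2 / 4 <= expR x + expR (- x) - 2.
Proof.
wlog x0 : x / 0 <= x.
  move=> h; case: (leP 0 x) => [/h//|x0].
  have := h (- x); rewrite sqrrN opprK addrC (addrC (expR x)) addrC; apply.
  by rewrite oppr_ge0 ltW.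
have h1 : (1 + x / 2) ^+ 2 <= expR x.
  rewrite (splitr x) expRD -expr2 -splitr lerXn2r ?expR_ge1Dx// ?nnegrE ?expR_ge0//.
  by rewrite addr_ge0// divr_ge0.
have := expR_ge1Dx (- x); move: h1; rewrite expr2; lra.
Qed.

End expR_inequalities.

(** * Exponential inequality for additive functionals *)

Section finite_expectation.
Context {R : realType} {Omega : finType}.
Variable pr : Omega -> R.
Implicit Types Z : Omega -> R.

Definition Ex Z : R := \sum_w pr w * Z w.

Hypothesis pr_ge0 : forall w, 0 <= pr w.
Hypothesis pr_sum1 : \sum_w pr w = 1.

Lemma eq_Ex Z Z' : Z =1 Z' -> Ex Z = Ex Z'.
Proof. by move=> h; apply: eq_bigr => w _; rewrite h. Qed.

Lemma ExD Z Z' : Ex (fun w => Z w + Z' w) = Ex Z + Ex Z'.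
Proof. by rewrite -big_split; apply: eq_bigr => w _; rewrite mulrDr. Qed.

Lemma ExN Z : Ex (fun w => - Z w) = - Ex Z.
Proof. by rewrite -sumrN; apply: eq_bigr => w _; rewrite mulrN. Qed.

Lemma ExB Z Z' : Ex (fun w => Z w - Z' w) = Ex Z - Ex Z'.
Proof. by rewrite ExD ExN. Qed.

Lemma ExZ c Z : Ex (fun w => c * Z w) = c * Ex Z.
Proof. by rewrite mulr_sumr; apply: eq_bigr => w _; rewrite mulrCA. Qed.

Lemma Ex1M Z : Ex (fun w => 1 * Z w) = Ex Z.
Proof. by rewrite ExZ mul1r. Qed.

Lemma ExMr c Z : Ex (fun w => Z w * c) = Ex Z * c.
Proof. by rewrite mulr_suml; apply: eq_bigr => w _; rewrite mulrA. Qed.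

Lemma Ex_sum (I : Type) (s : seq I) (Z : I -> Omega -> R) :
  Ex (fun w => \sum_(i <- s) Z i w) = \sum_(i <- s) Ex (Z i).
Proof.
by rewrite exchange_big/=; apply: eq_bigr => w _; rewrite mulr_sumr.
Qed.

Lemma Ex_cst c : Ex (fun=> c) = c.
Proof. by rewrite /Ex -mulr_suml pr_sum1 mul1r. Qed.

Lemma ler_Ex Z Z' : (forall w, Z w <= Z' w) -> Ex Z <= Ex Z'.
Proof. by move=> h; apply: ler_sum => w _; rewrite ler_wpM2l. Qed.

Lemma Ex_ge0 Z : (forall w, 0 <= Z w) -> 0 <= Ex Z.
Proof. by move=> h; apply: sumr_ge0 => w _; rewrite mulr_ge0. Qed.

Lemma ler_norm_Ex Z : `|Ex Z| <= Ex (fun w => `|Z w|).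
Proof.
apply: le_trans (ler_norm_sum _ _ _) _; apply: ler_sum => w _.
by rewrite normrM ger0_norm.
Qed.

(** The linear term of [expR_le_id_sqr] has expectation 0 after centering, which leaves the factor
    [expR (2 c^2)]; the constant is cruder than Hoeffding's. *)
Lemma Ex_hoeffding Z c : (forall w, `|Z w - Ex Z| <= c) ->
  Ex (fun w => expR (Z w)) <= expR (Ex Z + 2 * c ^+ 2).
Proof.
move=> hc; rewrite expRD.
have -> : Ex (fun w => expR (Z w)) = expR (Ex Z) * Ex (fun w => expR (Z w - Ex Z)).
  by rewrite -ExZ; apply: eq_Ex => w; rewrite -expRD addrC subrK.
rewrite ler_wpM2l ?expR_ge0//.
apply: (@le_trans _ _ (Ex (fun w => (Z w - Ex Z) + expR (2 * c ^+ 2)))).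
  apply: ler_Ex => w; apply: le_trans (expR_le_id_sqr _) _.
  rewrite lerD2l ler_expR ler_wpM2l// -(real_normK (num_real (Z w - _))).
  by rewrite lerXn2r ?nnegrE ?(le_trans _ (hc w)).
by rewrite ExD ExB !Ex_cst subrr add0r.
Qed.

End finite_expectation.

Section finite_chain.
Context {R : realType} {E Omega : finType}.
Variables (pr : Omega -> R) (Y : nat -> Omega -> E).
Variables (A : nat -> E -> E -> R) (n : nat).
Local Notation Ex := (Ex pr).

(** Measurability with respect to the past up to [k], expressed as invariance along paths that agree
    up to [k], without sigma-algebras. *)
Definition adapted (V : Type) (k : nat) (Z : Omega -> V) :=
  forall w w', (forall j, (j <= k)%N -> Y j w = Y j w') -> Z w = Z w'.

(** The conditional law of the next state, tested against all functions of the past; no conditioning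
    event has to be non-null. *)
Definition markov_property := forall k, (k < n)%N ->
  forall Z : Omega -> R, adapted k Z -> forall y,
  Ex (fun w => Z w * (Y k.+1 w == y)%:R) = Ex (fun w => Z w * A k.+1 (Y k w) y).

Hypothesis pr_ge0 : forall w, 0 <= pr w.
Hypothesis pr_sum1 : \sum_w pr w = 1.
Hypothesis trA : forall k, transition_matrix (A k).
Hypothesis markov : markov_property.

Lemma adapted_step (V : Type) k (Z : Omega -> V) : adapted k Z -> adapted k.+1 Z.
Proof. by move=> h w w' hw; apply: h => j jk; apply: hw; exact: leqW. Qed.

Lemma adapted_Y k : adapted k (Y k).
Proof. by move=> w w'; apply. Qed.

Lemma adapted1 (V W : Type) k (Z : Omega -> V) (f : V -> W) :
  adapted k Z -> adapted k (fun w => f (Z w)).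
Proof. by move=> h w w' /h ->. Qed.

Lemma adapted2 (V V' W : Type) k (Z : Omega -> V) (Z' : Omega -> V')
    (f : V -> V' -> W) :
  adapted k Z -> adapted k Z' -> adapted k (fun w => f (Z w) (Z' w)).
Proof. by move=> h h' w w' hw; rewrite (h _ _ hw) (h' _ _ hw). Qed.

Lemma sum_indic (x : E) (f : E -> R) : f x = \sum_y f y * (x == y)%:R.
Proof. by rewrite -[LHS]sum_delta; apply: eq_bigr => y _; rewrite mulrC. Qed.

Lemma markov_step k (Z : Omega -> R) (g : E -> E -> R) : (k < n)%N ->
  adapted k Z ->
  Ex (fun w => Z w * g (Y k w) (Y k.+1 w)) =
  Ex (fun w => Z w * avg (A k.+1) (g (Y k w)) (Y k w)).
Proof.
move=> kn aZ.
under eq_Ex do rewrite (sum_indic (Y k.+1 _)) mulr_sumr.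
rewrite Ex_sum; under [RHS]eq_Ex do rewrite mulr_sumr.
rewrite Ex_sum; apply: eq_bigr => y _.
under eq_Ex do rewrite mulrA.
rewrite markov//; first by apply: eq_Ex => w; rewrite -mulrA (mulrC (g _ _)).
by apply: adapted2 => //; apply: (adapted1 (fun x => g x y)); exact: adapted_Y.
Qed.

Definition law k : E -> R := fun x => Ex (fun w => (Y k w == x)%:R).

Lemma Ex_law k (f : E -> R) : Ex (fun w => f (Y k w)) = \sum_x law k x * f x.
Proof.
under eq_Ex do rewrite (sum_indic (Y k _)).
rewrite Ex_sum; apply: eq_bigr => x _.
by under eq_Ex do rewrite mulrC; rewrite ExMr.
Qed.

Lemma law_ge0 k x : 0 <= law k x.
Proof. by apply: Ex_ge0 => // w; rewrite ler0n. Qed.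

Lemma law_sum1 k : \sum_x law k x = 1.
Proof.
rewrite -[RHS](Ex_cst pr_sum1 1) (Ex_law k (fun=> 1)).
by apply: eq_bigr => x _; rewrite mulr1.
Qed.

Lemma lawS k : (k < n)%N -> law k.+1 = rowmul (law k) (A k.+1).
Proof.
move=> kn; apply/funext => y; rewrite /law.
transitivity (Ex (fun w => 1 * (Y k.+1 w == y)%:R)).
  by apply: eq_Ex => w; rewrite mul1r.
rewrite markov//; under eq_Ex do rewrite mul1r.
by rewrite (Ex_law k (fun x => A k.+1 x y)).
Qed.

Section additive_functionals.
Variables (f : nat -> E -> E -> R) (phi : nat -> R).
Hypothesis f_bound : forall k x y, `|f k x y| <= phi k.

(* The expected sum of the next j terms of the functional, for the chain
   started from x at time k: subtracting it turns an additive functional into a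
   sum of martingale increments. *)
Fixpoint corrector (j k : nat) (x : E) : R :=
  if j is j'.+1 then avg (A k.+1) (fun y => f k x y + corrector j' k.+1 y) x
  else 0.

Definition functional (j k : nat) (w : Omega) : R :=
  \sum_(i < j) f (k + i) (Y (k + i) w) (Y (k + i).+1 w).

Lemma functionalS j k w : functional j.+1 k w =
  f k (Y k w) (Y k.+1 w) + functional j k.+1 w.
Proof.
rewrite /functional big_ord_recl addn0; congr (_ + _).
by apply: eq_bigr => i _; rewrite /= /bump/= add1n addSnnS.
Qed.

Lemma Ex_functional j k (Z : Omega -> R) : (k + j <= n)%N -> adapted k Z ->
  Ex (fun w => Z w * functional j k w) =
  Ex (fun w => Z w * corrector j k (Y k w)).
Proof.
elim: j k Z => [|j IH] k Z kj aZ.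
  by apply: eq_Ex => w; rewrite /functional big_ord0.
have kn : (k < n)%N by apply: leq_trans kj; rewrite addnS ltnS leq_addr.
under eq_Ex do rewrite functionalS mulrDr.
rewrite ExD IH ?addSnnS//; last exact: adapted_step.
rewrite -ExD; under eq_Ex do rewrite -mulrDr.
by rewrite (markov_step (fun x y => f k x y + corrector j k.+1 y)).
Qed.

Variables (c0 r : R).
Hypothesis c0_ge1 : 1 <= c0.
Hypothesis r01 : 0 < r < 1.
Hypothesis contraction : forall k j (v : E -> R), \sum_x v x = 0 ->
  l1norm (rowmul v (chainmx A k j)) <= c0 * r ^+ j * l1norm v.

Let fbar k : E -> R := fun x => avg (A k.+1) (f k x) x.

Lemma avg_bound M (h : E -> R) x c : transition_matrix M ->
  (forall y, `|h y| <= c) -> `|avg M h x| <= c.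
Proof.
move=> [M0 M1] hc; apply: le_trans (ler_norm_sum _ _ _) _.
rewrite -[leRHS]mul1r -(M1 x) mulr_suml; apply: ler_sum => y _.
by rewrite normrM ger0_norm// ler_wpM2l.
Qed.

(** Unfolds the recursion into contributions of single future times, to which the contraction
    applies. *)
Lemma correctorE j k x :
  corrector j k x = \sum_(i < j) avg (chainmx A k i) (fbar (k + i)) x.
Proof.
elim: j k x => [|j IH] k x; first by rewrite big_ord0.
rewrite big_ord_recl/= /avg/= sum_delta addn0.
under eq_bigr do rewrite mulrDr.
rewrite big_split/=; congr (_ + _).
under eq_bigr do rewrite IH mulr_sumr.
rewrite exchange_big/=; apply: eq_bigr => i _.
under eq_bigr do rewrite mulr_sumr.
rewrite exchange_big/=; apply: eq_bigr => z _.
rewrite mulr_suml; apply: eq_bigr => y _.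
by rewrite mulrA /bump/= add1n addSnnS.
Qed.

Let G (j k : nat) : R := \sum_(i < j) r ^+ i * phi (k + i).

Let phi_ge0 k : 0 <= phi k.
Proof.
have [x|E0] := pickP (fun x : E => true).
  by move=> _; exact: le_trans (f_bound k x x).
exfalso; have := law_sum1 0; rewrite big_pred0// => /eqP.
by rewrite eq_sym oner_eq0.
Qed.

Let G0 k : G 0 k = 0. Proof. exact: big_ord0. Qed.

Let GS j k : G j.+1 k = phi k + r * G j k.+1.
Proof.
rewrite /G big_ord_recl expr0 mul1r addn0 mulr_sumr; congr (_ + _).
by apply: eq_bigr => i _; rewrite /= /bump/= add1n exprS mulrA addSnnS.
Qed.

(** The corrector itself grows with [j], but only its oscillation matters: the difference of two
    Dirac masses has mass 0 and norm at most 2, so the influence of the starting point on the term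
    [i] steps ahead decays as [r^i]. [G] is the resulting discounted sum of the bounds [phi]. *)
Lemma corrector_osc j k x x' :
  `|corrector j k x - corrector j k x'| <= 2 * c0 * G j k.
Proof.
rewrite !correctorE -sumrB /G mulr_sumr.
apply: le_trans (ler_norm_sum _ _ _) _; apply: ler_sum => i _.
pose v z : R := (x == z)%:R - (x' == z)%:R.
have v0 : \sum_z v z = 0.
  rewrite sumrB; have h (t : E) : \sum_z (t == z)%:R = 1 :> R.
    by rewrite -[RHS](sum_delta (fun=> 1) t); apply: eq_bigr => z _; rewrite mulr1.
  by rewrite !h subrr.
have v2 : l1norm v <= 2.
  have h (t : E) : \sum_z `|(t == z)%:R| = 1 :> R.
    rewrite -[RHS](sum_delta (fun=> 1) t); apply: eq_bigr => z _.
    by rewrite mulr1 normr_nat.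
  have -> : 2 = \sum_z (`|(x == z)%:R| + `|(x' == z)%:R|) :> R.
    by rewrite big_split/= !h.
  by apply: ler_sum => z _; exact: ler_normB.
have -> : avg (chainmx A k i) (fbar (k + i)) x -
    avg (chainmx A k i) (fbar (k + i)) x' =
    \sum_y rowmul v (chainmx A k i) y * fbar (k + i) y.
  rewrite /avg -sumrB; apply: eq_bigr => y _; rewrite -mulrBl; congr (_ * _).
  rewrite /rowmul; under eq_bigr do rewrite mulrBl.
  by rewrite sumrB !(sum_delta (fun z => chainmx A k i z y)).
apply: le_trans (ler_norm_sum _ _ _) _.
apply: (@le_trans _ _ (l1norm (rowmul v (chainmx A k i)) * phi (k + i))).
  rewrite mulr_suml; apply: ler_sum => y _; rewrite normrM ler_wpM2l//.
  exact: avg_bound.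
rewrite mulrA; apply: ler_wpM2r => //.
apply: le_trans (contraction _ _ v0) _.
have := ler_wpM2l (_ : 0 <= c0 * r ^+ i) v2.
rewrite (mulrC 2) -!mulrA (mulrC 2); apply; rewrite mulr_ge0//.
  by rewrite (le_trans ler01).
by rewrite exprn_ge0// ltW//; case/andP: r01.
Qed.

(** Accumulates the exponents [2 c^2] of [Ex_hoeffding] with [c = 2 c0 (phi + G)], a bound on the
    martingale increments. *)
Let V (j k : nat) : R :=
  \sum_(i < j) 8 * c0 ^+ 2 * (phi (k + i) + G (j - i.+1) (k + i).+1) ^+ 2.

Let V0 k : V 0 k = 0. Proof. exact: big_ord0. Qed.

Let VS j k : V j.+1 k = 8 * c0 ^+ 2 * (phi k + G j k.+1) ^+ 2 + V j k.+1.
Proof.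
rewrite /V big_ord_recl addn0 subSS subn0; congr (_ + _).
by apply: eq_bigr => i _; rewrite /= /bump/= add1n addSnnS subSS.
Qed.

(** The conditional mean of the next term plus the next corrector is the current corrector, so each
    step costs one application of [Ex_hoeffding] under [A k.+1 (Y k w)]. The weight [Z] makes the
    induction possible by absorbing the exponentials of the past. *)
Lemma mgf_corrector j k (Z : Omega -> R) : (k + j <= n)%N -> adapted k Z ->
  (forall w, 0 <= Z w) ->
  Ex (fun w => Z w * expR (functional j k w)) <=
  Ex (fun w => Z w * expR (corrector j k (Y k w))) * expR (V j k).
Proof.
elim: j k Z => [|j IH] k Z kj aZ Z0.
  rewrite V0 expR0 mulr1.
  by under eq_Ex do rewrite /functional big_ord0 expR0.
have kn : (k < n)%N by apply: leq_trans kj; rewrite addnS ltnS leq_addr.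
under eq_Ex do rewrite functionalS expRD mulrA.
apply: le_trans (IH _ _ _ _ _) _; first by rewrite addSnnS.
- apply: adapted2; first exact: adapted_step.
  apply: adapted1; apply: adapted2; last exact: adapted_Y.
  by apply: adapted_step; exact: adapted_Y.
- by move=> w; rewrite mulr_ge0// expR_ge0.
under eq_Ex do rewrite -mulrA -expRD.
rewrite (markov_step (fun x y => expR (f k x y + corrector j k.+1 y)))//.
rewrite VS expRD mulrA ler_wpM2r ?expR_ge0// -ExMr.
apply: ler_Ex => // w; rewrite -mulrA ler_wpM2l// -expRD.
rewrite /= [leRHS](_ : _ = expR (avg (A k.+1) (fun y => f k (Y k w) y +
    corrector j k.+1 y) (Y k w) + 2 * (2 * c0 * (phi k + G j k.+1)) ^+ 2)).
  2: by congr (expR (_ + _)); ring.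
apply: (Ex_hoeffding (pr := A k.+1 (Y k w))).
- exact: (trA k.+1).1.
- exact: (trA k.+1).2.
move=> y; have := @avg_bound (A k.+1) (fun z => (f k (Y k w) y + corrector j k.+1 y) -
  (f k (Y k w) z + corrector j k.+1 z)) (Y k w) (2 * c0 * (phi k + G j k.+1)) (trA _).
rewrite /avg; under eq_bigr do rewrite mulrBr.
rewrite sumrB -mulr_suml (trA _).2 mul1r; apply => z.
have -> : f k (Y k w) y + corrector j k.+1 y - (f k (Y k w) z + corrector j k.+1 z)
  = (f k (Y k w) y - f k (Y k w) z) + (corrector j k.+1 y - corrector j k.+1 z).
  by ring.
apply: le_trans (ler_normD _ _) _; rewrite mulrDr lerD//; last exact: corrector_osc.
apply: le_trans (ler_normB _ _) _.
apply: le_trans (lerD (f_bound _ _ _) (f_bound _ _ _)) _.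
have := ler_wpM2r (phi_ge0 k) c0_ge1; rewrite mul1r -mulrA.
by lra.
Qed.

Definition mgf_cst : R := 16 * c0 ^+ 2 * (1 + (1 - r) ^- 2).

(** The added multiple of [G^2] is the potential that closes the induction:
    [G j.+1 k = phi k + r G j k.+1] is a convex combination of [phi k / (1 - r)] and [G j k.+1],
    with weights [1 - r] and [r], so its square is at most that of the squares. The two terms of
    [mgf_cst] pay for [(phi + G)^2 <= 2 (phi^2 + G^2)] and for this convexity. *)
Lemma V_bound j k :
  V j k + 16 * c0 ^+ 2 / (1 - r) * G j k ^+ 2 <= mgf_cst * \sum_(i < j) phi (k + i) ^+ 2.
Proof.
case/andP: r01 => r0 r1; have q0 : 0 < 1 - r by rewrite subr_gt0.
elim: j k => [|j IH] k.
  by rewrite V0 G0 big_ord0 expr0n/= !mulr0 addr0.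
rewrite VS big_ord_recl addn0 mulrDr.
have -> : \sum_(i < j) phi (k + bump 0 i) ^+ 2 = \sum_(i < j) phi (k.+1 + i) ^+ 2.
  by apply: eq_bigr => i _; rewrite /= /bump/= add1n addSnnS.
have {}IH := IH k.+1.
rewrite addrAC; apply: le_trans (_ : 16 * c0 ^+ 2 * (phi k ^+ 2 + G j k.+1 ^+ 2) +
  16 * c0 ^+ 2 / (1 - r) * (phi k ^+ 2 / (1 - r) + r * G j k.+1 ^+ 2) + V j k.+1 <= _).
  rewrite lerD2r; apply: lerD.
    have -> : 16 * c0 ^+ 2 * (phi k ^+ 2 + G j k.+1 ^+ 2) =
      8 * c0 ^+ 2 * (2 * (phi k ^+ 2 + G j k.+1 ^+ 2)) by ring.
    apply: ler_wpM2l; first by rewrite mulr_ge0// sqr_ge0.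
    by have := sqr_ge0 (phi k - G j k.+1); rewrite sqrrB sqrrD; lra.
  apply: ler_wpM2l; first by apply: divr_ge0 (ltW q0); rewrite mulr_ge0// sqr_ge0.
  rewrite GS; have e : phi k = (1 - r) * (phi k / (1 - r)).
    by rewrite mulrC divfK// gt_eqF.
  set p := phi k / (1 - r) in e *.
  have -> : phi k ^+ 2 / (1 - r) = (1 - r) * p ^+ 2.
    by rewrite /p; field; rewrite gt_eqF.
  rewrite {1}e; have := mulr_ge0 (mulr_ge0 (ltW r0) (ltW q0)) (sqr_ge0 (p - G j k.+1)).
  by set g := G _ _; nra.
have -> : mgf_cst * phi k ^+ 2 =
    16 * c0 ^+ 2 * phi k ^+ 2 + 16 * c0 ^+ 2 / (1 - r) * (phi k ^+ 2 / (1 - r)).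
  by rewrite /mgf_cst; field; rewrite gt_eqF.
have : 16 * c0 ^+ 2 / (1 - r) * G j k.+1 ^+ 2 = 16 * c0 ^+ 2 * G j k.+1 ^+ 2 +
  16 * c0 ^+ 2 / (1 - r) * (r * G j k.+1 ^+ 2).
  by field; rewrite gt_eqF.
move: IH; rewrite !mulrDr; lra.
Qed.

(** Two sources of randomness add up: the martingale increments, measured by [V], and the corrector
    at the random initial state, whose oscillation costs at most [8 c0^2 G^2]. The potential in
    [V_bound] covers the second one. *)
Lemma mgf_functional :
  Ex (fun w => expR (functional n 0 w - Ex (functional n 0))) <=
  expR (mgf_cst * \sum_(i < n) phi i ^+ 2).
Proof.
case/andP: r01 => r0 r1; have q0 : 0 < 1 - r by rewrite subr_gt0.
have a1 : adapted 0 (fun=> 1 : R) by [].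
have e1 : Ex (functional n 0) = Ex (fun w => corrector n 0 (Y 0 w)).
  have := @Ex_functional n 0 _ (leqnn n) a1.
  by rewrite !Ex1M.
have := @mgf_corrector n 0 _ (leqnn n) a1 (fun=> ler01).
rewrite !Ex1M => h; under eq_Ex do rewrite expRD.
rewrite ExMr; apply: le_trans (ler_wpM2r (expR_ge0 _) h) _.
apply: (@le_trans _ _ (expR (Ex (functional n 0) + 2 * (2 * c0 * G n 0) ^+ 2) *
  expR (V n 0) * expR (- Ex (functional n 0)))).
  rewrite ler_wpM2r ?expR_ge0// ler_wpM2r ?expR_ge0// e1.
  apply: Ex_hoeffding => // w.
  rewrite [X in _ - X](Ex_law 0 (corrector n 0)).
  have := @avg_bound (fun _ => law 0) (fun z => corrector n 0 (Y 0 w) - corrector n 0 z)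
    (Y 0 w) (2 * c0 * G n 0).
  rewrite /avg; under eq_bigr do rewrite mulrBr.
  rewrite sumrB -mulr_suml law_sum1 mul1r; apply.
    by split=> [_ y|_]; [exact: law_ge0|exact: law_sum1].
  by move=> z; exact: corrector_osc.
rewrite -!expRD ler_expR.
have : V n 0 + 16 * c0 ^+ 2 / (1 - r) * G n 0 ^+ 2 <=
  mgf_cst * \sum_(i < n) phi i ^+ 2 by exact: (V_bound n 0).
have : 2 * (2 * c0 * G n 0) ^+ 2 <= 16 * c0 ^+ 2 / (1 - r) * G n 0 ^+ 2.
  have -> : 2 * (2 * c0 * G n 0) ^+ 2 = 8 * c0 ^+ 2 * G n 0 ^+ 2 by ring.
  rewrite ler_wpM2r ?sqr_ge0// ler_pdivlMr//.
  by have := sqr_ge0 c0; nra.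
lra.
Qed.

End additive_functionals.

End finite_chain.

(** * Taylor bounds for sine and cosine *)

Section trigonometric_inequalities.
Context {R : realType}.
Implicit Types x : R.

Lemma mvt_bound (f f' : R -> R) (c x : R) : f 0 = 0 ->
  (forall t, is_derive t (1 : R) f (f' t)) ->
  (forall t, `|t| <= `|x| -> `|f' t| <= c) -> `|f x| <= c * `|x|.
Proof.
move=> f0 df hc.
have cf a b : {within `[a, b], continuous f}.
  by apply: derivable_within_continuous => t _; have := df t; case.
have [x0|x0|->] := ltgtP x 0; last by rewrite f0 !normr0 mulr0.
- have [t] := MVT x0 (fun t _ => df t) (cf _ _).
  rewrite in_itv/= => /andP[xt t0]; rewrite f0 sub0r => e.
  rewrite -normrN e normrM sub0r normrN ler_wpM2r//; apply: hc.
  by rewrite !ltr0_norm// lerN2 ltW.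
- have [t] := MVT x0 (fun t _ => df t) (cf _ _).
  rewrite in_itv/= => /andP[t0 tx]; rewrite f0 !subr0 => ->.
  rewrite normrM ler_wpM2r//; apply: hc.
  by rewrite !gtr0_norm// ltW.
Qed.

Lemma norm_sin_le x : `|sin x| <= `|x|.
Proof.
rewrite -[leRHS]mul1r; apply: (@mvt_bound sin cos) => [|t _]; [exact: sin0|exact: cos_max].
Qed.

Lemma cos_sub1_le x : `|cos x - 1| <= x ^+ 2 / 2.
Proof.
have := cos_mulr2n (x / 2); rewrite mulr2n -splitr => ->.
rewrite cos2sin2; have := norm_sin_le (x / 2).
rewrite -ler_sqr ?nnegrE// !real_normK ?num_real// => h.
rewrite ler0_norm; last by have := sqr_ge0 (sin (x / 2)); lra.
by move: h; rewrite exprMn expr2 [_ ^-1 ^+ 2]expr2; nra.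
Qed.

Lemma sin_sub_le x : `|sin x - x| <= `|x| ^+ 3.
Proof.
rewrite exprS mulrC real_normK ?num_real//.
apply: (@mvt_bound (fun x => sin x - x) (fun x => cos x - 1)).
  by rewrite sin0 subr0.
move=> t tx; apply: le_trans (cos_sub1_le _) _.
have : t ^+ 2 <= x ^+ 2 by rewrite -[t ^+ 2]real_normK ?num_real// -[x ^+ 2]real_normK ?num_real// lerXn2r ?nnegrE.
by have := sqr_ge0 x; lra.
Qed.

Lemma cos_taylor2_le x : `|cos x - 1 + x ^+ 2 / 2| <= x ^+ 4.
Proof.
have := cos_mulr2n (x / 2); rewrite mulr2n -splitr => ->.
rewrite cos2sin2; set s := sin _.
have -> : (1 - s ^+ 2) *+ 2 - 1 - 1 + x ^+ 2 / 2 =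
    - 2 * ((s - x / 2) * (s + x / 2)) by field.
have h1 := sin_sub_le (x / 2); have h2 := norm_sin_le (x / 2).
have h3 : `|s + x / 2| <= 2 * `|x / 2|.
  by apply: le_trans (ler_normD _ _) _; rewrite -/s in h2; lra.
rewrite !normrM normrN.
apply: le_trans (_ : `|2| * (`|x / 2| ^+ 3 * (2 * `|x / 2|)) <= _).
  by rewrite ler_wpM2l// ler_pM.
have -> : x ^+ 4 = `|x| ^+ 4 by rewrite -normrX ger0_norm// exprn_even_ge0.
rewrite normrM (ger0_norm (x := 2^-1))// (ger0_norm (x := 2))//.
have := exprn_ge0 4 (normr_ge0 x); move: `|x| => y y4.
have -> : 2 * ((y / 2) ^+ 3 * (2 * (y / 2))) = y ^+ 4 / 4 by field.
lra.
Qed.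

End trigonometric_inequalities.

Section deviations.
Context {R : realType} {E Omega : finType}.
Variables (pr : Omega -> R) (Y : nat -> Omega -> E).
Variables (A : nat -> E -> E -> R) (n : nat).
Local Notation Ex := (Ex pr).
Hypothesis pr_ge0 : forall w, 0 <= pr w.
Hypothesis pr_sum1 : \sum_w pr w = 1.
Hypothesis trA : forall k, transition_matrix (A k).
Hypothesis markov : markov_property pr Y A n.
Variables (c0 r : R).
Hypothesis c0_ge1 : 1 <= c0.
Hypothesis r01 : 0 < r < 1.
Hypothesis contraction : forall k j (v : E -> R), \sum_x v x = 0 ->
  l1norm (rowmul v (chainmx A k j)) <= c0 * r ^+ j * l1norm v.
Variables (f : nat -> E -> E -> R) (phi : nat -> R) (Phi : R).
Hypothesis f_bound : forall k x y, `|f k x y| <= phi k.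
Hypothesis Phi_ge : \sum_(i < n) phi i ^+ 2 <= Phi.

Local Notation S := (functional Y f n 0).
Local Notation C := (mgf_cst c0 r).

Lemma mgf_cst_gt0 : 0 < C.
Proof.
case/andP: r01 => r0 r1; rewrite /mgf_cst mulr_gt0//.
  by rewrite mulr_gt0// exprn_gt0// (lt_le_trans ltr01).
by rewrite ltr_pwDl// invr_ge0 sqr_ge0.
Qed.

Lemma mgf_functionalZ (l : R) :
  Ex (fun w => expR (l * (S w - Ex S))) <= expR (C * (l ^+ 2 * Phi)).
Proof.
have fl k x y : `|l * f k x y| <= `|l| * phi k.
  by rewrite normrM ler_wpM2l.
have Sl w : functional Y (fun k x y => l * f k x y) n 0 w = l * S w.
  by rewrite /functional mulr_sumr.
have := mgf_functional pr_ge0 pr_sum1 trA markov fl c0_ge1 r01 contraction.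
rewrite (eq_Ex pr Sl) ExZ => h.
under eq_Ex do rewrite mulrBr -Sl.
apply: le_trans h _; rewrite ler_expR ler_wpM2l ?(ltW mgf_cst_gt0)//.
under eq_bigr do rewrite exprMn real_normK ?num_real//.
by rewrite -mulr_sumr ler_wpM2l ?sqr_ge0.
Qed.

(** Chernoff's bound applied to both signs; [l] stays free and is optimized by the user, up to
    constants. *)
Lemma tail_functional (l t : R) : 0 <= l ->
  Ex (fun w => (t < `|S w - Ex S|)%R%:R) <=
  2 * expR (- (l * t) + C * (l ^+ 2 * Phi)).
Proof.
move=> l0; pose X w := S w - Ex S.
apply: (@le_trans _ _ (Ex (fun w => expR (- (l * t)) *
    (expR (l * X w) + expR (- l * X w))))).
  apply: ler_Ex => // w; case: ltP => [tX|_]; last first.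
    by rewrite mulr_ge0 ?addr_ge0 ?expR_ge0.
  rewrite mulrDr -!expRD.
  have [X0|X0] := leP 0 (X w).
    apply: ler_wpDr; first exact: expR_ge0.
    rewrite -[leLHS]expR0 ler_expR addrC subr_ge0 ler_wpM2l//.
    by move: tX; rewrite -/(X w) ger0_norm// => /ltW.
  apply: ler_wpDl; first exact: expR_ge0.
  rewrite -[leLHS]expR0 ler_expR addrC subr_ge0 mulNr -mulrN ler_wpM2l//.
  by move: tX; rewrite -/(X w) ltr0_norm// => /ltW.
rewrite ExZ ExD expRD mulrCA ler_wpM2l ?expR_ge0//.
have := mgf_functionalZ (- l); rewrite sqrrN => h2.
by have h1 := mgf_functionalZ l; rewrite -/X in h1 h2; lra.
Qed.

(** The variance is read off the exponential moments at [l] and [- l] through [sqr_le_cosh], with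
    [l] such that the exponent is 1. No covariance has to be estimated. *)
Lemma variance_functional : 0 < Phi ->
  Ex (fun w => (S w - Ex S) ^+ 2) <= 8 * expR 1 * C * Phi.
Proof.
move=> Phi0; have C0 := mgf_cst_gt0.
have CP : 0 < C * Phi by rewrite mulr_gt0.
pose l := Num.sqrt (C * Phi)^-1.
have l2 : l ^+ 2 = (C * Phi)^-1 by rewrite sqr_sqrtr// invr_ge0 ltW.
have e1 : C * (l ^+ 2 * Phi) = 1 by rewrite l2 mulrCA mulVf// gt_eqF.
have h : Ex (fun w => (l * (S w - Ex S)) ^+ 2 / 4) <=
    Ex (fun w => expR (l * (S w - Ex S)) + expR (- l * (S w - Ex S)) - 2).
  by apply: ler_Ex => // w; rewrite mulNr; exact: sqr_le_cosh.
rewrite ExB ExD Ex_cst// ExMr in h.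
have h1 := mgf_functionalZ l; have h2 := mgf_functionalZ (- l).
rewrite sqrrN e1 in h2; rewrite e1 in h1.
have e2 : Ex (fun w => (l * (S w - Ex S)) ^+ 2) =
    (C * Phi)^-1 * Ex (fun w => (S w - Ex S) ^+ 2).
  by rewrite -ExZ; apply: eq_Ex => w; rewrite exprMn l2.
rewrite e2 in h.
have : (C * Phi)^-1 * Ex (fun w => (S w - Ex S) ^+ 2) <= 8 * expR 1 by lra.
by rewrite mulrC ler_pdivrMr// mulrA.
Qed.

End deviations.

Lemma cos_lipschitz {R : realType} (x y : R) : `|cos x - cos y| <= `|x - y|.
Proof.
have h (m h : R) : `|cos (m + h) - cos (m - h)| <= `|2 * h|.
  rewrite cosD cosB (_ : _ - _ = - 2 * (sin m * sin h)); last by ring.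
  rewrite !normrM normrN ler_wpM2l// -[leRHS]mul1r.
  by apply: ler_pM => //; [exact: sin_max|exact: norm_sin_le].
have := h ((x + y) / 2) ((x - y) / 2).
have -> : (x + y) / 2 + (x - y) / 2 = x by field.
have -> : (x + y) / 2 - (x - y) / 2 = y by field.
by have -> : 2 * ((x - y) / 2) = x - y by field.
Qed.

Section average.
Context {R : realType} {E : finType}.
Implicit Types (N : E -> E -> R) (h : E -> R) (x : E) (c : R).

Lemma avg_dist N N' (h : E -> R) x c : (forall y, `|h y| <= c) ->
  `|avg N h x - avg N' h x| <= c * \sum_y `|N x y - N' x y|.
Proof.
move=> hc; rewrite /avg -sumrB mulr_sumr; apply: le_trans (ler_norm_sum _ _ _) _.
by apply: ler_sum => y _; rewrite -mulrBl normrM mulrC ler_wpM2r.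
Qed.

Lemma avgB N (h h' : E -> R) x :
  avg N (fun y => h y - h' y) x = avg N h x - avg N h' x.
Proof. by rewrite /avg -sumrB; apply: eq_bigr => y _; rewrite mulrBr. Qed.

Lemma avgZ N c (h : E -> R) x : avg N (fun y => c * h y) x = c * avg N h x.
Proof. by rewrite /avg mulr_sumr; apply: eq_bigr => y _; rewrite mulrCA. Qed.

Lemma avg_cst N c x : transition_matrix N -> avg N (fun=> c) x = c.
Proof. by move=> [_ N1]; rewrite /avg -mulr_suml N1 mul1r. Qed.

End average.

(** * Martingale central limit theorem *)

Section martingale_clt.
Context {R : realType} {E Omega : finType}.
Variables (pr : Omega -> R) (Y : nat -> Omega -> E).
Variables (A : nat -> E -> E -> R) (n : nat).
Local Notation Ex := (Ex pr).
Hypothesis pr_ge0 : forall w, 0 <= pr w.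
Hypothesis pr_sum1 : \sum_w pr w = 1.
Hypothesis trA : forall k, transition_matrix (A k).
Hypothesis markov : markov_property pr Y A n.
Variables (M : E -> E -> R) (g : E -> E -> R) (a : nat -> R) (wf : E -> R).
Variables (B W Vb eps eta al : R).
Hypothesis trM : transition_matrix M.

Definition increment (N : E -> E -> R) x y : R := g x y - avg N (g x) x.

Definition cond_var (N : E -> E -> R) x : R :=
  avg N (fun y => increment N x y ^+ 2) x.

Definition martingale k w : R :=
  \sum_(i < k) a i * increment (A i.+1) (Y i w) (Y i.+1 w).

Hypothesis g_bound : forall x y, `|g x y| <= B.
Hypothesis wf_bound : forall x, `|wf x| <= W.
Hypothesis Vb_ge0 : 0 <= Vb.
Hypothesis poisson : forall x, wf x - avg M wf x = cond_var M x - Vb.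
Hypothesis eps01 : 0 <= eps <= 1.
Hypothesis a_bound : forall k, `|a k| <= eps.
Hypothesis eta_ge0 : 0 <= eta.
Hypothesis A_close : forall k, a k != 0 ->
  forall x, \sum_y `|A k.+1 x y - M x y| <= eta.

Lemma increment_bound N x y : transition_matrix N -> `|increment N x y| <= 2 * B.
Proof.
move=> trN; apply: le_trans (ler_normB _ _) _.
by have := avg_bound x trN (g_bound x); have := g_bound x y; lra.
Qed.

Lemma avg_increment N x : transition_matrix N -> avg N (increment N x) x = 0.
Proof. by move=> trN; rewrite /increment avgB avg_cst// subrr. Qed.

Lemma B_ge0 (x y : E) : 0 <= B. Proof. exact: le_trans (g_bound x y). Qed.

Lemma W_ge0 (x : E) : 0 <= W. Proof. exact: le_trans (wf_bound x). Qed.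

Lemma cond_var_dist k x : a k != 0 ->
  `|cond_var (A k.+1) x - cond_var M x| <= 8 * B ^+ 2 * eta.
Proof.
move=> ak; have B0 := B_ge0 x x; have cl := A_close ak x.
have hA y : `|increment (A k.+1) x y ^+ 2| <= 4 * B ^+ 2.
  rewrite normrX; have := increment_bound x y (trA k.+1).
  have := normr_ge0 (increment (A k.+1) x y); nra.
have h1 := avg_dist (A k.+1) M x hA.
have h2 : `|avg M (fun y => increment (A k.+1) x y ^+ 2 - increment M x y ^+ 2) x|
    <= 4 * B ^+ 2 * eta.
  apply: avg_bound => // y; rewrite subr_sqr normrM.
  have -> : increment (A k.+1) x y - increment M x y =
      avg M (g x) x - avg (A k.+1) (g x) x by rewrite /increment; ring.
  have := avg_dist M (A k.+1) x (g_bound x).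
  under eq_bigr do rewrite distrC.
  have := ler_normD (increment (A k.+1) x y) (increment M x y).
  have := increment_bound x y (trA k.+1); have := increment_bound x y trM.
  have : B * \sum_y `|A k.+1 x y - M x y| <= B * eta by rewrite ler_wpM2l.
  have -> : 4 * B ^+ 2 * eta = (B * eta) * (4 * B) by ring.
  by move=> i1 i2 i3 i4 i5; apply: ler_pM => //; lra.
rewrite avgB in h2.
have -> : cond_var (A k.+1) x - cond_var M x =
    (avg (A k.+1) (fun y => increment (A k.+1) x y ^+ 2) x -
     avg M (fun y => increment (A k.+1) x y ^+ 2) x) +
    (avg M (fun y => increment (A k.+1) x y ^+ 2) x -
     avg M (fun y => increment M x y ^+ 2) x) by rewrite /cond_var; ring.
apply: le_trans (ler_normD _ _) _.
have : 4 * B ^+ 2 * (\sum_y `|A k.+1 x y - M x y|) <= 4 * B ^+ 2 * eta.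
  by rewrite ler_wpM2l// mulr_ge0// sqr_ge0.
lra.
Qed.

Let q k := 2^-1 * Vb * a k ^+ 2.
Let e k := expR (2^-1 * Vb * \sum_(i < k) a i ^+ 2).

Let eS k : e k = e k.+1 * expR (- q k).
Proof. by rewrite /e -expRD big_ord_recr/= mulrDr addrK. Qed.

Lemma expRN_taylor (t : R) : 0 <= t -> `|expR (- t) - 1 + t| <= t ^+ 2.
Proof.
move=> t0; have h := expR_ge1Dx (- t); rewrite ger0_norm; last by lra.
have : expR (- t) <= (1 + t)^-1.
  by rewrite expRN lef_pV2 ?posrE ?expR_gt0 ?expR_ge1Dx//; lra.
have : (1 + t)^-1 <= 1 - t + t ^+ 2.
  by rewrite -div1r ler_pdivrMr; [have := exprn_ge0 3 t0; rewrite !exprS expr0; lra|lra].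
lra.
Qed.

Let a2_ge0 k : 0 <= a k ^+ 2. Proof. exact: sqr_ge0. Qed.

Let ha k : 0 <= 2^-1 * a k ^+ 2. Proof. exact: mulr_ge0. Qed.

Let a3_le k : `|a k| ^+ 3 <= eps * a k ^+ 2.
Proof. by rewrite exprS real_normK ?num_real// ler_wpM2r. Qed.

Let a4_le k : a k ^+ 4 <= eps * a k ^+ 2.
Proof.
case/andP: eps01 => e0 e1.
rewrite (_ : a k ^+ 4 = `|a k| * `|a k| ^+ 3); last first.
  by rewrite -exprS -normrX ger0_norm// exprn_even_ge0.
apply: le_trans (a3_le k); rewrite ler_piMl ?exprn_ge0//.
exact: le_trans (a_bound k) e1.
Qed.

(** To second order the cosine averages to [1 - a^2/2 cond_var] and the exponential is
    [1 - a^2/2 Vb]; by the Poisson equation the difference is [- a^2/2 (wf - M wf)], which the third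
    term cancels. *)
Lemma avg_cos_increment k x :
  `|avg (A k.+1) (fun y => cos (a k * increment (A k.+1) x y)) x - expR (- q k)
    + 2^-1 * a k ^+ 2 * (wf x - avg (A k.+1) wf x)| <=
  a k ^+ 2 * ((16 * B ^+ 4 + Vb ^+ 2 / 4) * eps + (4 * B ^+ 2 + W / 2) * eta).
Proof.
have B0 := B_ge0 x x; have W0 := W_ge0 x.
have [ak|ak] := eqVneq (a k) 0.
  rewrite /q ak expr0n/= !mulr0 !mul0r oppr0 expR0 addr0.
  under eq_fun do rewrite mul0r cos0.
  by rewrite avg_cst// subrr normr0.
set Ac := avg _ _ x.
have r1 : `|Ac - 1 + 2^-1 * a k ^+ 2 * cond_var (A k.+1) x| <= 16 * B ^+ 4 * (eps * a k ^+ 2).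
  have -> : Ac - 1 + 2^-1 * a k ^+ 2 * cond_var (A k.+1) x =
      avg (A k.+1) (fun y => cos (a k * increment (A k.+1) x y) - 1 -
       - (2^-1 * a k ^+ 2) * increment (A k.+1) x y ^+ 2) x.
    by rewrite !avgB avg_cst// avgZ mulNr opprK.
  apply: avg_bound => // y; rewrite mulNr opprK.
  have -> : 2^-1 * a k ^+ 2 * increment (A k.+1) x y ^+ 2 =
    (a k * increment (A k.+1) x y) ^+ 2 / 2 by rewrite exprMn; ring.
  apply: le_trans (cos_taylor2_le _) _; rewrite exprMn mulrC.
  have -> : 16 * B ^+ 4 = (2 * B) ^+ 4 by ring.
  apply: ler_pM (a4_le k); rewrite ?exprn_even_ge0//.
  rewrite -[leLHS]ger0_norm ?exprn_even_ge0// normrX lerXn2r ?nnegrE ?mulr_ge0//.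
  exact: increment_bound.
have q0 : 0 <= q k by apply: mulr_ge0 => //; exact: mulr_ge0.
have r2 : `|expR (- q k) - 1 + q k| <= Vb ^+ 2 / 4 * (eps * a k ^+ 2).
  apply: le_trans (expRN_taylor q0) _.
  have -> : q k ^+ 2 = Vb ^+ 2 / 4 * a k ^+ 4 by rewrite /q; field.
  by rewrite ler_wpM2l ?a4_le// divr_ge0// sqr_ge0.
have r3 := cond_var_dist x ak.
have r4 : `|avg (A k.+1) wf x - avg M wf x| <= W * eta.
  apply: le_trans (avg_dist _ _ _ wf_bound) _.
  by rewrite ler_wpM2l// A_close.
have -> : Ac - expR (- q k) + 2^-1 * a k ^+ 2 * (wf x - avg (A k.+1) wf x) =
  (Ac - 1 + 2^-1 * a k ^+ 2 * cond_var (A k.+1) x) - (expR (- q k) - 1 + q k)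
  - 2^-1 * a k ^+ 2 * ((cond_var (A k.+1) x - cond_var M x) +
     (avg (A k.+1) wf x - avg M wf x)).
  have -> : wf x = avg M wf x + cond_var M x - Vb by have := poisson x; lra.
  by rewrite /q; field.
apply: le_trans (ler_normB _ _) _.
have h5 := ler_normB (Ac - 1 + 2^-1 * a k ^+ 2 * cond_var (A k.+1) x) (expR (- q k) - 1 + q k).
have h6 : `|2^-1 * a k ^+ 2 * ((cond_var (A k.+1) x - cond_var M x) +
     (avg (A k.+1) wf x - avg M wf x))| <= 2^-1 * a k ^+ 2 * (8 * B ^+ 2 * eta + W * eta).
  rewrite normrM [X in X * _]ger0_norm//.
  by apply: ler_wpM2l => //; exact: le_trans (ler_normD _ _) (lerD r3 r4).
have -> : a k ^+ 2 * ((16 * B ^+ 4 + Vb ^+ 2 / 4) * eps + (4 * B ^+ 2 + W / 2) * eta) =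
  16 * B ^+ 4 * (eps * a k ^+ 2) + Vb ^+ 2 / 4 * (eps * a k ^+ 2) +
  2^-1 * a k ^+ 2 * (8 * B ^+ 2 * eta + W * eta) by field.
by apply: lerD h6; apply: le_trans h5 (lerD r1 r2).
Qed.

(** The increments are centered exactly under [A k.+1], so the linear term vanishes and a cubic
    error remains. *)
Lemma avg_sin_increment k x :
  `|avg (A k.+1) (fun y => sin (a k * increment (A k.+1) x y)) x| <=
  8 * B ^+ 3 * (eps * a k ^+ 2).
Proof.
have B0 := B_ge0 x x.
have -> : avg (A k.+1) (fun y => sin (a k * increment (A k.+1) x y)) x =
    avg (A k.+1) (fun y => sin (a k * increment (A k.+1) x y) -
      a k * increment (A k.+1) x y) x.
  by rewrite avgB avgZ avg_increment// mulr0 subr0.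
apply: avg_bound => // y; apply: le_trans (sin_sub_le _) _.
rewrite normrM exprMn mulrC; have -> : 8 * B ^+ 3 = (2 * B) ^+ 3 by ring.
apply: ler_pM (a3_le k); rewrite ?exprn_ge0//.
by rewrite lerXn2r ?nnegrE ?mulr_ge0//; exact: increment_bound.
Qed.

(** The factor [e k] compensates the decay of the cosine, but with the constant [Vb] in place of the
    random conditional variances. The correction by [wf], a solution of the Poisson equation for the
    conditional variance, trades one for the other, so that the expectation of [Phi k] is almost
    constant in [k]. *)
Let Phi k w := e k * (cos (martingale k w + al) *
  (1 - 2^-1 * a k ^+ 2 * wf (Y k w))).

Definition clt_cst : R :=
  16 * B ^+ 4 + 8 * B ^+ 3 + Vb ^+ 2 / 4 + W * B + W * Vb / 4.
Definition clt_cst' : R := 4 * B ^+ 2 + W / 2.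

Lemma adapted_martingale k : adapted Y k (martingale k).
Proof.
move=> w w' h; apply: eq_bigr => i _.
by rewrite !h// ?ltn_ord// ltnW.
Qed.

Lemma ler_norm_Ex_bound (Z : Omega -> R) c : (forall w, `|Z w| <= c) -> `|Ex Z| <= c.
Proof.
move=> h; apply: le_trans (ler_norm_Ex pr_ge0 _) _.
by rewrite -[leRHS](Ex_cst pr_sum1); exact: ler_Ex.
Qed.

Lemma clt_step (x0 : E) k : (k < n)%N -> `|Ex (Phi k.+1) - Ex (Phi k)| <=
  e k.+1 * (a k ^+ 2 * (clt_cst * eps + clt_cst' * eta) +
            W * eps * `|a k.+1 - a k|).
Proof.
move=> kn; have B0 := B_ge0 x0 x0; have W0 := W_ge0 x0.
case/andP: (eps01) => e0 e1.
pose c w := cos (martingale k w + al).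
pose s w := sin (martingale k w + al).
pose c' w := cos (martingale k.+1 w + al).
have aM : adapted Y k (martingale k) := @adapted_martingale k.
have ac : adapted Y k c by exact: (adapted1 (fun x => cos (x + al)) aM).
have as' : adapted Y k s by exact: (adapted1 (fun x => sin (x + al)) aM).
pose d w := a k * increment (A k.+1) (Y k w) (Y k.+1 w).
have MS w : martingale k.+1 w + al = (martingale k w + al) + d w.
  by rewrite /martingale big_ord_recr/= addrAC.
pose Ac x := avg (A k.+1) (fun y => cos (a k * increment (A k.+1) x y)) x.
pose As x := avg (A k.+1) (fun y => sin (a k * increment (A k.+1) x y)) x.
pose Aw x := avg (A k.+1) wf x.
have E1 : Ex c' = Ex (fun w => c w * Ac (Y k w)) - Ex (fun w => s w * As (Y k w)).
  rewrite -(markov_step markov (fun x y => cos (a k * increment (A k.+1) x y)) kn ac).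
  rewrite -(markov_step markov (fun x y => sin (a k * increment (A k.+1) x y)) kn as').
  by rewrite -ExB; apply: eq_Ex => w; rewrite /c' MS cosD.
have E2 : Ex (fun w => c w * wf (Y k.+1 w)) = Ex (fun w => c w * Aw (Y k w)).
  exact: (markov_step markov (fun _ y => wf y) kn ac).
have P1 : Ex (Phi k.+1) = e k.+1 * (Ex c' -
    2^-1 * a k.+1 ^+ 2 * Ex (fun w => c' w * wf (Y k.+1 w))).
  rewrite -ExZ -ExB -ExZ; apply: eq_Ex => w; rewrite /Phi /c'; ring.
have P0 : Ex (Phi k) = e k * (Ex c - 2^-1 * a k ^+ 2 * Ex (fun w => c w * wf (Y k w))).
  rewrite -ExZ -ExB -ExZ; apply: eq_Ex => w; rewrite /Phi /c; ring.
(* [T1] is the corrected cosine term and [T2] the sine term of the addition formula; [T3] is due to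
   the change of [a^2] and of the cosine in the correction between [k] and [k + 1]; with [T4], the
   correction at time [k] is freed of its factor [expR (- q k)]. *)
pose T1 := Ex (fun w => c w * (Ac (Y k w) - expR (- q k) +
  2^-1 * a k ^+ 2 * (wf (Y k w) - Aw (Y k w)))).
pose T2 := Ex (fun w => s w * As (Y k w)).
pose T3 := Ex (fun w => (a k.+1 ^+ 2 * c' w - a k ^+ 2 * c w) * wf (Y k.+1 w)).
pose T4 := Ex (fun w => c w * wf (Y k w)).
have F1 : T1 = Ex (fun w => c w * Ac (Y k w)) - expR (- q k) * Ex c +
  2^-1 * a k ^+ 2 * (T4 - Ex (fun w => c w * Aw (Y k w))).
  rewrite /T4 -ExB -!ExZ -ExB -ExD; apply: eq_Ex => w; ring.
have F3 : T3 = a k.+1 ^+ 2 * Ex (fun w => c' w * wf (Y k.+1 w)) -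
   a k ^+ 2 * Ex (fun w => c w * wf (Y k.+1 w)).
  rewrite -!ExZ -ExB; apply: eq_Ex => w; ring.
have -> : Ex (Phi k.+1) - Ex (Phi k) = e k.+1 *
   (T1 - T2 - 2^-1 * T3 - 2^-1 * a k ^+ 2 * (1 - expR (- q k)) * T4).
  by rewrite P1 P0 (eS k) E1 F1 F3 -E2 /T2 /T4; field.
rewrite normrM [X in X * _]ger0_norm ?expR_ge0// ler_wpM2l ?expR_ge0//.
have c1 w : `|c w| <= 1 by exact: cos_max.
have b1 : `|T1| <= a k ^+ 2 * ((16 * B ^+ 4 + Vb ^+ 2 / 4) * eps + (4 * B ^+ 2 + W / 2) * eta).
  apply: ler_norm_Ex_bound => w; rewrite normrM.
  by rewrite -[leRHS]mul1r; apply: ler_pM => //; exact: avg_cos_increment.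
have b2 : `|T2| <= 8 * B ^+ 3 * (eps * a k ^+ 2).
  apply: ler_norm_Ex_bound => w; rewrite normrM.
  rewrite -[leRHS]mul1r; apply: ler_pM => //; first exact: sin_max.
  exact: avg_sin_increment.
have b3 : `|T3| <= (2 * eps * `|a k.+1 - a k| + 2 * B * (eps * a k ^+ 2)) * W.
  apply: ler_norm_Ex_bound => w; rewrite normrM; apply: ler_pM => //.
  have -> : a k.+1 ^+ 2 * c' w - a k ^+ 2 * c w =
    (a k.+1 ^+ 2 - a k ^+ 2) * c' w + a k ^+ 2 * (c' w - c w) by ring.
  apply: le_trans (ler_normD _ _) (lerD _ _).
    rewrite normrM -[leRHS]mulr1; apply: ler_pM => //; last exact: cos_max.
    rewrite subr_sqr normrM mulrC; apply: ler_wpM2r => //.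
    by apply: le_trans (ler_normD _ _) _; have := a_bound k; have := a_bound k.+1; lra.
  rewrite normrM ger0_norm// mulrC.
  apply: le_trans (_ : (`|a k| * (2 * B)) * a k ^+ 2 <= _).
    apply: ler_wpM2r => //; apply: le_trans (cos_lipschitz _ _) _.
    rewrite MS addrAC subrr add0r normrM ler_wpM2l//; exact: increment_bound.
  rewrite mulrAC mulrC ler_wpM2l ?mulr_ge0//.
  exact: ler_wpM2r.
have q0 : 0 <= q k by apply: mulr_ge0 => //; exact: mulr_ge0.
have b4 : `|2^-1 * a k ^+ 2 * (1 - expR (- q k)) * T4| <= W * Vb / 4 * (eps * a k ^+ 2).
  have t4 : `|T4| <= W.
    apply: ler_norm_Ex_bound => w; rewrite normrM -[leRHS]mul1r.
    by apply: ler_pM.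
  have ex0 : expR (- q k) <= 1 by rewrite -expR0 ler_expR oppr_le0.
  have hq : 0 <= 2^-1 * a k ^+ 2 * (1 - expR (- q k)).
    by apply: mulr_ge0; rewrite ?subr_ge0.
  rewrite normrM [X in X * _]ger0_norm//.
  apply: le_trans (_ : 2^-1 * a k ^+ 2 * q k * W <= _).
    apply: ler_pM => //; apply: ler_wpM2l => //.
    by have := expR_ge1Dx (- q k); lra.
  have -> : 2^-1 * a k ^+ 2 * q k * W = W * Vb / 4 * a k ^+ 4 by rewrite /q; field.
  by rewrite ler_wpM2l ?a4_le// divr_ge0// mulr_ge0.
have := ler_normB (T1 - T2 - 2^-1 * T3) (2^-1 * a k ^+ 2 * (1 - expR (- q k)) * T4).
have := ler_normB (T1 - T2) (2^-1 * T3); have := ler_normB T1 T2.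
have -> : `|2^-1 * T3| = 2^-1 * `|T3| by rewrite normrM ger0_norm.
rewrite /clt_cst /clt_cst'; move: b1 b2 b3 b4.
move: `|T1| `|T2| `|T3| `|T1 - T2| `|T1 - T2 - _| `|_ * T4| `|a k.+1 - a k| => *; lra.
Qed.

(** Telescopes [clt_step]; at both ends, removing the correction [wf] from [Phi] costs a multiple of
    [W a^2 <= W eps]. The term with [tau] is why the weights must have small total variation. *)
Lemma clt_bound (x0 : E) s tau : \sum_(i < n) a i ^+ 2 <= s ->
  \sum_(i < n) `|a i.+1 - a i| <= tau ->
  `|expR (2^-1 * Vb * \sum_(i < n) a i ^+ 2) *
     Ex (fun w => cos (martingale n w + al)) - cos al| <=
  expR (2^-1 * Vb * s) *
   (s * (clt_cst * eps + clt_cst' * eta) + W * eps * tau + W * eps).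
Proof.
move=> hs htau; have B0 := B_ge0 x0 x0; have W0 := W_ge0 x0.
case/andP: (eps01) => e0 e1.
have en k : (k <= n)%N -> e k <= expR (2^-1 * Vb * s).
  move=> kn; rewrite ler_expR ler_wpM2l ?mulr_ge0//; apply: le_trans hs.
  rewrite -!(big_mkord xpredT (fun i => a i ^+ 2)) [leRHS](big_cat_nat (leq0n k) kn)/=.
  by rewrite lerDl sumr_ge0.
have c0 : 0 <= clt_cst * eps + clt_cst' * eta.
  rewrite addr_ge0 ?mulr_ge0// /clt_cst /clt_cst';
  rewrite !addr_ge0 ?mulr_ge0 ?divr_ge0 ?mulr_ge0 ?exprn_ge0//.
have tel : Ex (Phi n) - Ex (Phi 0) = \sum_(k < n) (Ex (Phi k.+1) - Ex (Phi k)).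
  by rewrite -(big_mkord xpredT (fun k => Ex (Phi k.+1) - Ex (Phi k))) telescope_sumr.
have b1 : `|Ex (Phi n) - Ex (Phi 0)| <= expR (2^-1 * Vb * s) *
   (s * (clt_cst * eps + clt_cst' * eta) + W * eps * tau).
  rewrite tel; apply: le_trans (ler_norm_sum _ _ _) _.
  apply: le_trans (_ : \sum_(k < n) expR (2^-1 * Vb * s) * (a k ^+ 2 * (clt_cst * eps + clt_cst' * eta) +
            W * eps * `|a k.+1 - a k|) <= _).
    apply: ler_sum => k _; apply: le_trans (clt_step x0 (ltn_ord k)) _.
    apply: ler_wpM2r; last exact: en.
    by apply: addr_ge0; [exact: mulr_ge0|rewrite !mulr_ge0].
  rewrite -mulr_sumr ler_wpM2l ?expR_ge0// big_split/= -mulr_suml -mulr_sumr.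
  by apply: lerD; [exact: ler_wpM2r|apply: ler_wpM2l; rewrite ?mulr_ge0].
have b2 k : (k <= n)%N ->
    `|e k * Ex (fun w => cos (martingale k w + al)) - Ex (Phi k)| <=
    expR (2^-1 * Vb * s) * (2^-1 * W * eps).
  move=> kn; rewrite -ExZ -ExB; apply: ler_norm_Ex_bound => w.
  have -> : e k * cos (martingale k w + al) - Phi k w =
    e k * (cos (martingale k w + al) * (2^-1 * a k ^+ 2 * wf (Y k w))).
    by rewrite /Phi; ring.
  rewrite normrM ger0_norm ?expR_ge0//; apply: ler_pM; rewrite ?expR_ge0 ?en//.
  rewrite normrM -[leRHS]mul1r; apply: ler_pM => //; first exact: cos_max.
  rewrite normrM mulrAC; apply: ler_pM => //.
  rewrite normrM !ger0_norm// ler_wpM2l//.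
  rewrite -real_normK ?num_real// expr2; apply: le_trans (_ : eps * 1 <= _).
    by apply: ler_pM => //; exact: le_trans (a_bound _) e1.
  by rewrite mulr1.
have b3 : e 0 * Ex (fun w => cos (martingale 0 w + al)) = cos al.
  rewrite /e big_ord0 mulr0 expR0 mul1r.
  under eq_Ex do rewrite /martingale big_ord0 add0r.
  by rewrite Ex_cst.
have := b2 n (leqnn n); have := b2 0 (leq0n n).
rewrite b3 -/(e n).
set X := e n * _; set P := Ex (Phi n) in b1 *; set P0 := Ex (Phi 0) in b1 *.
move=> h0 hn.
have -> : X - cos al = (X - P) + (P - P0) - (cos al - P0) by ring.
apply: le_trans (ler_normB _ _) _; have := ler_normD (X - P) (P - P0).
move: b1 h0 hn; move: (expR _) (s * _) => x y.
move: `|_| `|_| `|_| `|_| => *; nra.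
Qed.

End martingale_clt.

(** * Trigonometric approximation *)

Section product_topology_reals.
Context {R : realType} {I : finType}.
Implicit Types (z v : I -> R) (f : {ptws I -> R} -> R).

(** Sup-norm balls. Comparing them with the product topology of [{ptws I -> R}] turns continuity
    into its epsilon-delta form. *)
Definition boxes z : set_system (I -> R) :=
  filter_from [set delta : R | 0 < delta]
    (fun delta => [set v | forall i, `|z i - v i| < delta]).

Lemma boxes_filter z : Filter (boxes z).
Proof.
apply: filter_from_filter; first by exists 1 => /=.
move=> a b /= a0 b0; exists (Num.min a b) => /=; first by rewrite lt_min a0.
by move=> v hv; split => i; have := hv i; rewrite lt_min => /andP[].
Qed.

Lemma boxes_cvg z : boxes z --> (z : {ptws I -> R}).
Proof.
have FF := boxes_filter z.
apply/cvg_sup => i; apply/cvg_image.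
  rewrite -subTset => x _; exists (fun j => if j == i then x else 0) => //.
  by rewrite eqxx.
move=> U; rewrite /nbhs/= => -[e /= e0 eU].
exists [set v : I -> R | U (v i)].
  by exists e => // v hv; apply: eU; exact: hv.
apply/seteqP; split => [_ [v Uv <-]//|x Ux].
exists (fun j => if j == i then x else 0) => /=; by rewrite eqxx.
Qed.

Lemma ptws_continuous_box f z e : continuous f -> 0 < e ->
  exists2 delta : R, 0 < delta &
    forall v, (forall i, `|z i - v i| < delta) -> `|f z - f v| < e.
Proof.
move=> cf e0; have FF := boxes_filter z.
have hU : nbhs (f z) [set y | `|f z - y| < e] by exists e.
have [delta d0 hd] : boxes z (f @^-1` [set y | `|f z - y| < e]).
  by apply: boxes_cvg; exact: cf.
by exists delta.
Qed.

Lemma ptws_nbhs_box z (delta : R) : 0 < delta ->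
  nbhs (z : {ptws I -> R}) [set v | forall i, `|z i - v i| < delta].
Proof.
move=> d0; pose P (i : I) (v : {ptws I -> R}) := `|z i - v i| < delta.
apply: (@near_all_finType _ _ (nbhs_filter (z : {ptws I -> R})) I P) => i.
have hU : nbhs (z i) [set y | `|z i - y| < delta] by exists delta.
exact: (@proj_continuous I (fun=> R) i z _ hU).
Qed.

(** Heine's argument on the cube, compact by Tychonoff's theorem. Near-covering controls full
    neighborhoods, which is why the second point may leave the cube. *)
Lemma ptws_unif_continuous f (L e : R) : continuous f -> 0 < e ->
  exists2 rho : R, 0 < rho & forall z v, (forall i, `|z i| <= L) ->
    (forall i, `|z i - v i| < rho) -> `|f z - f v| < e.
Proof.
move=> cf e0.
have cpt : compact [set z : {ptws I -> R} | forall i, `[- L, L]%classic (z i)].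
  exact: (@tychonoff I (fun=> R) (fun=> `[- L, L]%classic)
    (fun=> @segment_compact R (- L) L)).
have /compact_near_coveringP/(_ nat \oo (fun n z =>
    forall v, (forall i, `|z i - v i| < n.+1%:R^-1) -> `|f z - f v| < e)) := cpt.
case.
  move=> z _; have e2 : 0 < e / 2 by rewrite divr_gt0.
  have [delta d0 hd] := ptws_continuous_box z cf e2.
  have d2 : 0 < delta / 2 by rewrite divr_gt0.
  exists ([set v | forall i, `|z i - v i| < delta / 2],
          [set n | n.+1%:R^-1 < delta / 2]).
    split => /=; first exact: ptws_nbhs_box.
    exact: near_infty_natSinv_lt (PosNum d2).
  move=> [z' n]/= [h1 h2] v hv; rewrite (splitr e).
  have a1 : `|f z - f z'| < e / 2.
    by apply: hd => i; apply: lt_trans (h1 i) _; lra.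
  have a2 : `|f z - f v| < e / 2.
    apply: hd => i; rewrite (splitr delta).
    exact: le_lt_trans (ler_distD (z' i) _ _) (ltrD (h1 i) (lt_trans (hv i) h2)).
  by rewrite distrC in a1; exact: le_lt_trans (ler_distD (f z) _ _) (ltrD a1 a2).
move=> n _ hn; exists n.+1%:R^-1; first by rewrite invr_gt0 ltr0n.
move=> z v hz; apply: (hn n) => //= i.
by rewrite in_itv/= -ler_norml.
Qed.

End product_topology_reals.

Section trigonometric_polynomials.
Context {R : realType} {I : finType}.
Implicit Types (g h : (I -> R) -> R) (t z : I -> R).

(** The phase [al] makes sines available, so that the class is closed under products. Means of the
    generators carry the same information as the characteristic function. *)
Inductive trigpoly : ((I -> R) -> R) -> Prop :=
| trigpoly_cos t al : trigpoly (fun z => cos (\sum_i t i * z i + al))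
| trigpoly_lin c g h : trigpoly g -> trigpoly h ->
    trigpoly (fun z => c * g z + h z).

Lemma eq_trigpoly g h : g =1 h -> trigpoly g -> trigpoly h.
Proof. by move=> /funext ->. Qed.

Lemma trigpoly_cst c : trigpoly (fun=> c).
Proof.
have h1 : trigpoly (fun=> 1).
  apply: eq_trigpoly (trigpoly_cos (fun=> 0) 0) => z.
  by rewrite big1 ?addr0 ?cos0// => i _; rewrite mul0r.
have h0 : trigpoly (fun=> 0).
  by apply: eq_trigpoly (trigpoly_lin (-1) h1 h1) => z; rewrite mulr1 addNr.
by apply: eq_trigpoly (trigpoly_lin c h1 h0) => z; rewrite mulr1 addr0.
Qed.

Lemma trigpolyD g h : trigpoly g -> trigpoly h -> trigpoly (fun z => g z + h z).
Proof.
by move=> hg hh; apply: eq_trigpoly (trigpoly_lin 1 hg hh) => z; rewrite mul1r.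
Qed.

Lemma trigpolyZ c g : trigpoly g -> trigpoly (fun z => c * g z).
Proof.
move=> hg; apply: eq_trigpoly (trigpoly_lin c hg (trigpoly_cst 0)) => z.
by rewrite addr0.
Qed.

Lemma trigpolyM g h : trigpoly g -> trigpoly h -> trigpoly (fun z => g z * h z).
Proof.
move=> hg; elim: hg h => {g} [t al|c g g' _ IH _ IH'] h hh; last first.
  apply: eq_trigpoly (trigpoly_lin c (IH _ hh) (IH' _ hh)) => z.
  by rewrite mulrDl mulrA.
elim: hh => {h} [s be|c h h' _ IH _ IH']; last first.
  by apply: eq_trigpoly (trigpoly_lin c IH IH') => z; rewrite mulrDr mulrCA.
apply: eq_trigpoly (trigpolyZ 2^-1 (trigpolyD
  (trigpoly_cos (fun i => t i + s i) (al + be))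
  (trigpoly_cos (fun i => t i - s i) (al - be)))) => z.
have -> : \sum_i (t i + s i) * z i + (al + be) =
    (\sum_i t i * z i + al) + (\sum_i s i * z i + be).
  by rewrite addrACA -big_split/=; congr (_ + _); apply: eq_bigr => i _; ring.
have -> : \sum_i (t i - s i) * z i + (al - be) =
    (\sum_i t i * z i + al) - (\sum_i s i * z i + be).
  rewrite opprD addrACA -sumrB; congr (_ + _); apply: eq_bigr => i _; ring.
by rewrite cosD cosB; field.
Qed.

(* The expected value of F at the vector of counts s after tossing successively
   the coins of the list l, where coin i succeeds with probability p i; started
   from 0 these are Bernstein polynomials in p. *)
Fixpoint coin_avg (p : I -> R) (l : seq I) (F : (I -> nat) -> R)
    (s : I -> nat) : R :=
  if l is i :: l' then
    p i * coin_avg p l' F (fun j => ((i == j) + s j)%N) +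
    (1 - p i) * coin_avg p l' F s
  else F s.

Lemma trigpoly_coin_avg (p : (I -> R) -> I -> R) l F s :
  (forall i, trigpoly (fun z => p z i)) ->
  trigpoly (fun z => coin_avg (p z) l F s).
Proof.
move=> hp; elim: l s => [|i l IH] s /=; first exact: trigpoly_cst.
apply: trigpolyD; apply: trigpolyM => //.
by apply: trigpolyD; [exact: trigpoly_cst|];
  apply: eq_trigpoly (trigpolyZ (-1) (hp i)) => z; rewrite mulN1r.
Qed.

Lemma coin_avgD p l F G s : coin_avg p l (fun s => F s + G s) s =
  coin_avg p l F s + coin_avg p l G s.
Proof. by elim: l s => [//|i l IH] s /=; rewrite !IH; ring. Qed.

Lemma coin_avgZ p l c F s :
  coin_avg p l (fun s => c * F s) s = c * coin_avg p l F s.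
Proof. by elim: l s => [//|i l IH] s /=; rewrite !IH; ring. Qed.

Lemma coin_avg_cst p l c s : coin_avg p l (fun=> c) s = c.
Proof. by elim: l s => [//|i l IH] s /=; rewrite !IH; ring. Qed.

Lemma coin_avg_sum p l (F : I -> (I -> nat) -> R) s :
  coin_avg p l (fun s => \sum_i F i s) s = \sum_i coin_avg p l (F i) s.
Proof.
elim: l s => [//|i l IH] s /=; rewrite !IH !mulr_sumr -big_split/=.
by apply: eq_bigr.
Qed.

Lemma ler_coin_avg p l F G s : (forall i, 0 <= p i <= 1) ->
  (forall s, F s <= G s) -> coin_avg p l F s <= coin_avg p l G s.
Proof.
move=> hp FG; elim: l s => [//|i l IH] s /=; have /andP[p0 p1] := hp i.
by apply: lerD; apply: ler_wpM2l => //; rewrite subr_ge0.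
Qed.

Lemma ler_norm_coin_avg p l F G s : (forall i, 0 <= p i <= 1) ->
  (forall s, `|F s| <= G s) -> `|coin_avg p l F s| <= coin_avg p l G s.
Proof.
move=> hp FG; rewrite ler_norml -mulN1r -coin_avgZ.
by apply/andP; split; apply: ler_coin_avg => // s'; have := FG s';
  rewrite ler_norml ?mulN1r => /andP[].
Qed.

Lemma coin_avg_var p l i c s :
  coin_avg p l (fun s => ((s i)%:R - c) ^+ 2) s =
  (count_mem i l)%:R * (p i * (1 - p i)) +
  ((s i)%:R + (count_mem i l)%:R * p i - c) ^+ 2.
Proof.
elim: l s => [|j l IH] s /=; first by rewrite !mul0r addr0 add0r.
rewrite !IH; have [->|ji] := eqVneq j i; rewrite !natrD/=; ring.
Qed.

(** Bernstein's argument: either all frequencies are within [eta] of [p] and the error is at most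
    [eps], or one deviation is so large that [2 B] is below the quadratic term, whose average is a
    sum of binomial variances (Chebyshev). *)
Lemma coin_avg_bernstein (phi : (I -> R) -> R) (B eps eta : R) (N : nat) p :
  (0 < N)%N -> (forall i, 0 <= p i <= 1) -> 0 < eta -> 0 <= eps ->
  (forall q, `|phi q| <= B) ->
  (forall q, (forall i, `|p i - q i| < eta) -> `|phi p - phi q| <= eps) ->
  `|phi p - coin_avg p (flatten [seq nseq N i | i <- enum I])
      (fun s => phi (fun i => (s i)%:R / N%:R)) (fun=> 0%N)| <=
  eps + 2 * B * #|I|%:R / (N%:R * eta ^+ 2).
Proof.
move=> N0 hp eta0 eps0 hB heps; set l := flatten _.
have B0 : 0 <= B by exact: le_trans (hB p).
have NR : 0 < N%:R :> R by rewrite ltr0n.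
have e2 : 0 < eta ^+ 2 by rewrite exprn_gt0.
have lc i : count_mem i l = N.
  rewrite count_flatten -map_comp sumnE big_map (bigD1_seq i) ?mem_enum ?enum_uniq//=.
  rewrite count_nseq/= eqxx mul1n big1 ?addn0// => j ji.
  by rewrite count_nseq/= (negPf ji) mul0n.
rewrite -{1}(coin_avg_cst p l (phi p) (fun=> 0%N)).
rewrite -mulN1r -coin_avgZ -coin_avgD.
pose G (s : I -> nat) := eps + (2 * B / (N%:R * eta) ^+ 2) *
  \sum_i ((s i)%:R - N%:R * p i) ^+ 2.
apply: le_trans (_ : coin_avg p l G (fun=> 0%N) <= _).
  apply: ler_norm_coin_avg => // s; rewrite mulN1r.
  have c0 : 0 <= 2 * B / (N%:R * eta) ^+ 2.
    by apply: divr_ge0; [exact: mulr_ge0|exact: sqr_ge0].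
  have S0 : 0 <= \sum_i ((s i)%:R - N%:R * p i) ^+ 2.
    by apply: sumr_ge0 => i _; exact: sqr_ge0.
  have [|] := boolP [forall i, `|p i - (s i)%:R / N%:R| < eta].
    move=> /forallP h; apply: le_trans (heps _ h) _.
    by rewrite lerDl mulr_ge0.
  rewrite negb_forall => /existsP[i]; rewrite -leNgt => hi.
  apply: le_trans (_ : 2 * B <= _).
    by apply: le_trans (ler_normB _ _) _; have := hB p; have := hB (fun i => (s i)%:R / N%:R); lra.
  apply: ler_wpDl => //; rewrite mulrAC ler_pdivlMr ?exprn_gt0 ?mulr_gt0//.
  rewrite ler_wpM2l ?mulr_ge0// (bigD1 i)//=; apply: ler_wpDr.
    by apply: sumr_ge0 => j _; exact: sqr_ge0.
  have -> : (s i)%:R - N%:R * p i = - (N%:R * (p i - (s i)%:R / N%:R)).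
    by field; rewrite gt_eqF.
  rewrite sqrrN !exprMn ler_wpM2l ?sqr_ge0// -[leRHS]real_normK ?num_real//.
  by rewrite lerXn2r ?nnegrE// ltW.
rewrite coin_avgD coin_avg_cst coin_avgZ coin_avg_sum lerD2l.
apply: le_trans (_ : 2 * B / (N%:R * eta) ^+ 2 * \sum_(i : I) N%:R <= _).
  apply: ler_wpM2l.
    by apply: divr_ge0; [exact: mulr_ge0|exact: sqr_ge0].
  apply: ler_sum => i _; rewrite coin_avg_var lc add0r subrr expr0n/= addr0.
  have /andP[p0 p1] := hp i.
  by rewrite ler_piMr ?ler0n//; nra.
rewrite sumr_const le_eqVlt; apply/orP; left; apply/eqP.
by rewrite -[N%:R *+ _]mulr_natr; field; rewrite !gt_eqF.
Qed.

End trigonometric_polynomials.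

Section trigonometric_approximation.
Context {R : realType}.

(** By the mean value theorem, the cosine being at least [cos 1] on the interval; it makes the
    inverse of the sine Lipschitz there. *)
Lemma sin_expanding (x y : R) : `|x| <= 2^-1 -> `|y| <= 2^-1 ->
  cos 1 * `|x - y| <= `|sin x - sin y|.
Proof.
wlog xy : x y / x < y => [h hx hy|].
  have [xy|xy|->] := ltgtP x y; first exact: h.
    by rewrite distrC (distrC (sin x)); exact: h.
  by rewrite !subrr normr0 mulr0.
rewrite !ler_norml => /andP[x1 _] /andP[_ y1].
have cf : {within `[x, y], continuous (@sin R)}.
  by apply: continuous_subspaceT => t; exact: continuous_sin.
have [t] := MVT xy (fun t _ => is_derive_sin t) cf.
rewrite in_itv/= => /andP[xt ty] e.
rewrite distrC (distrC (sin x)) e normrM ler_wpM2r//.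
have tn : `|t| <= 1 by rewrite ler_norml; lra.
have pi2 : 2 <= pi :> R by exact: pi_ge2.
apply: le_trans (ler_norm _); rewrite -(cos_norm t).
by rewrite leNgt ltr_cos ?in_itv/= -?leNgt ?normr_ge0//=; lra.
Qed.

Let c : R := sin 2^-1.

Lemma sin_half_bounds : 0 < c < 1.
Proof.
have pi2 : 2 <= pi :> R by exact: pi_ge2.
apply/andP; split; first by apply: sin_gt0_pi; lra.
rewrite -[ltRHS]sin_pihalf ltr_sin ?in_itv/=; lra.
Qed.

(** Inverse of the sine on [-1/2, 1/2], extended by constants. The clamping keeps away from -1 and
    1, where [asin] is not Lipschitz, and accepts any frequency of successes. *)
Definition clamped_asin (s : R) : R := asin (Num.max (- c) (Num.min s c)).

Let clampc (s : R) : - c <= Num.max (- c) (Num.min s c) <= c.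
Proof.
have /andP[c0 _] := sin_half_bounds.
by rewrite le_max lexx/= ge_max ge_min lexx orbT andbT; lra.
Qed.

Let clampc1 (s : R) : -1 <= Num.max (- c) (Num.min s c) <= 1.
Proof. by have := clampc s; have := sin_half_bounds; lra. Qed.

Lemma clamped_asin_bound s : `|clamped_asin s| <= 2^-1.
Proof.
have pi2 : 2 <= pi :> R by exact: pi_ge2.
have s1 := clampc1 s; have h := asinK (_ : _ \in `[-1, 1]).
have e : sin (clamped_asin s) = Num.max (- c) (Num.min s c) by apply: h.
have l : - (pi / 2) <= clamped_asin s by exact: asin_geNpi2.
have u : clamped_asin s <= pi / 2 by exact: asin_lepi2.
rewrite ler_norml; apply/andP; split; rewrite leNgt; apply/negP => k.
  have : sin (clamped_asin s) < sin (- 2^-1) by rewrite ltr_sin ?in_itv/=; lra.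
  by rewrite e sinN -/c; have := clampc s; lra.
have : sin 2^-1 < sin (clamped_asin s) by rewrite ltr_sin ?in_itv/=; lra.
by rewrite e -/c; have := clampc s; lra.
Qed.

Lemma clamped_asinK x : `|x| <= 2^-1 -> clamped_asin (sin x) = x.
Proof.
have pi2 : 2 <= pi :> R by exact: pi_ge2.
rewrite ler_norml => /andP[x0 x1].
have h : - c <= sin x <= c.
  rewrite /c -sinN; apply/andP; split; rewrite leNgt ltr_sin ?in_itv/=; lra.
case/andP: h => h1 h2; rewrite /clamped_asin (min_idPl h2) (max_idPr h1).
by rewrite sinK// in_itv/=; lra.
Qed.

Lemma clamped_asin_lipschitz s s' :
  cos 1 * `|clamped_asin s - clamped_asin s'| <= `|s - s'|.
Proof.
apply: le_trans (sin_expanding (clamped_asin_bound s) (clamped_asin_bound s')) _.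
rewrite !asinK ?in_itv//=; have /andP[c0 _] := sin_half_bounds.
case: (leP s c) => sc; case: (leP s' c) => sc'.
- case: (leP (- c) s) => ?; case: (leP (- c) s') => ?; rewrite ?subrr ?normr0//;
  rewrite ler_norml; have := ler_norm (s - s'); have := ler_norm (s' - s);
  rewrite (distrC s'); lra.
- rewrite [X in _ - X]max_r; last by lra.
  case: (leP (- c) s) => ?; 
  rewrite ler_norml; have := ler_norm (s - s'); have := ler_norm (s' - s);
  rewrite (distrC s'); lra.
- rewrite [X in X - _]max_r; last by lra.
  case: (leP (- c) s') => ?; 
  rewrite ler_norml; have := ler_norm (s - s'); have := ler_norm (s' - s);
  rewrite (distrC s'); lra.
- by rewrite subrr normr0.
Qed.

(** Dividing by [2 L] brings the cube into the range where the sine is inverted by [clamped_asin],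
    so [f] is a function [phi] of the biases [p z]. The approximant averages values of [f] and thus
    obeys the bound [B] on the whole space, also far from the cube where it no longer approximates;
    later truncations rely on this. *)
Lemma trigpoly_approx {I : finType} (f : {ptws I -> R} -> R) (B L e : R) :
  continuous f -> (forall z, `|f z| <= B) -> 0 < L -> 0 < e ->
  exists p : (I -> R) -> R, [/\ trigpoly p, (forall z, `|p z| <= B) &
    forall z, (forall i, `|z i| <= L) -> `|f z - p z| <= e].
Proof.
move=> cf hB L0 e0; have e2 : 0 < e / 2 by rewrite divr_gt0.
have [rho rho0 hrho] := ptws_unif_continuous L cf e2.
have cos0 := @cos1_gt0 R.
have L2 : 0 < 2 * L by rewrite mulr_gt0.
pose node (q : I -> R) : I -> R := fun i => 2 * L * clamped_asin (2 * q i - 1).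
pose phi (q : I -> R) := f (node q).
pose p (z : I -> R) i := (1 + sin (z i / (2 * L))) / 2.
(* [node] is Lipschitz with constant [4 L / cos 1]. *)
pose eta := rho * cos 1 / (4 * L).
have eta0 : 0 < eta by rewrite !(mulr_gt0, invr_gt0).
have B0 : 0 <= B by exact: le_trans (hB (fun=> 0)).
have [N N0 hN] : exists2 N, (0 < N)%N &
    2 * B * #|I|%:R / (N%:R * eta ^+ 2) <= e / 2.
  pose x := 2 * B * #|I|%:R / eta ^+ 2 / (e / 2).
  exists (Num.truncn x).+1 => //.
  have := truncnS_gt x; rewrite /x ltr_pdivrMr// => /ltW h.
  rewrite invfM mulrA mulrAC ler_pdivrMr ?ltr0n//.
  by rewrite (mulrC (e / 2)).
have p01 z i : 0 <= p z i <= 1.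
  have := sin_le1 (z i / (2 * L)); have := sin_geN1 (z i / (2 * L)).
  by rewrite /p; lra.
exists (fun z => coin_avg (p z) (flatten [seq nseq N i | i <- enum I])
      (fun s => phi (fun i => (s i)%:R / N%:R)) (fun=> 0%N)); split.
- apply: trigpoly_coin_avg => i.
  have h := trigpoly_cos (fun j => (j == i)%:R / (2 * L)) (- (pi / 2)).
  apply: eq_trigpoly (trigpolyZ 2^-1 (trigpolyD (trigpoly_cst 1) h)) => z.
  rewrite cosBpihalf /p mulrC; congr ((1 + sin _) / 2).
  rewrite (bigD1 i)//= eqxx mul1r mulrC big1 ?addr0// => j /negPf ->.
  by rewrite !mul0r.
- move=> z; rewrite -[leRHS](coin_avg_cst (p z) (flatten [seq nseq N i | i <- enum I])
    B (fun=> 0%N)).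
  by apply: ler_norm_coin_avg => // s; exact: hB.
move=> z hz.
have nodep : node (p z) = z.
  apply/funext => i; rewrite /node /p.
  have -> : 2 * ((1 + sin (z i / (2 * L))) / 2) - 1 = sin (z i / (2 * L)) by field.
  rewrite clamped_asinK; first by field; rewrite !gt_eqF.
  rewrite normrM normfV (gtr0_norm L2) ler_pdivrMr//.
  by have := hz i; lra.
have -> : f z = phi (p z) by rewrite /phi nodep.
rewrite (splitr e); apply: le_trans (_ : e / 2 + 2 * B * #|I|%:R / (N%:R * eta ^+ 2) <= _); last by rewrite lerD2l.
apply: coin_avg_bernstein => //; [exact: ltW|by move=> q; exact: hB|].
move=> q hq; rewrite ltW//; apply: hrho; first by rewrite nodep.
move=> i; rewrite /node -mulrBr normrM (gtr0_norm L2).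
have h1 := clamped_asin_lipschitz (2 * p z i - 1) (2 * q i - 1).
have h2 : `|2 * p z i - 1 - (2 * q i - 1)| < 2 * eta.
  have -> : 2 * p z i - 1 - (2 * q i - 1) = 2 * (p z i - q i) by ring.
  by rewrite normrM gtr0_norm// ltr_pM2l.
have h3 := le_lt_trans h1 h2.
rewrite -(ltr_pM2l cos0) mulrCA.
apply: lt_le_trans (_ : 2 * L * (2 * eta) <= _); first by rewrite ltr_pM2l.
by rewrite le_eqVlt; apply/orP; left; apply/eqP; rewrite /eta; field; rewrite gt_eqF.
Qed.

End trigonometric_approximation.

(** * Gaussian vectors *)

Section real_mean.
Context {d : measure_display} {T : measurableType d} {R : realType}.
Variable P : probability T R.
Implicit Types h : T -> R.

Definition mean h : R := \int[P]_w h w.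

Definition bounded_measurable h :=
  measurable_fun setT h /\ exists B, forall w, `|h w| <= B.

Lemma bounded_measurable_integrable h :
  bounded_measurable h -> P.-integrable setT (EFin \o h).
Proof.
move=> [mh [B hB]]; apply: measurable_bounded_integrable => //.
  exact: le_lt_trans (probability_le1 P measurableT) (ltry 1).
exists B; split; first exact: num_real.
by move=> M BM w _; apply: le_trans (hB w) (ltW BM).
Qed.

Lemma expectation_mean h : P.-integrable setT (EFin \o h) ->
  ('E_P[h] = (mean h)%:E)%E.
Proof.
by move=> ih; rewrite unlock /mean /Rintegral fineK// integrable_fin_num.
Qed.

Lemma bounded_measurableD h h' : bounded_measurable h -> bounded_measurable h' ->
  bounded_measurable (fun w => h w + h' w).
Proof.
move=> [mh [B hB]] [mh' [B' hB']]; split; first exact: measurable_funD.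
by exists (B + B') => w; apply: le_trans (ler_normD _ _) (lerD _ _).
Qed.

Lemma bounded_measurableM h h' : bounded_measurable h -> bounded_measurable h' ->
  bounded_measurable (fun w => h w * h' w).
Proof.
move=> [mh [B hB]] [mh' [B' hB']]; split; first exact: measurable_funM.
by exists (B * B') => w; rewrite normrM; exact: ler_pM.
Qed.

Lemma bounded_measurable_cst c : bounded_measurable (fun=> c).
Proof. by split=> //; exists `|c|. Qed.

Lemma bounded_measurable_cos h : measurable_fun setT h ->
  bounded_measurable (fun w => cos (h w)).
Proof.
move=> mh; split; last by exists 1 => w; exact: cos_max.
apply: (measurableT_comp (f := cos)) mh.
by apply: continuous_measurable_fun; exact: continuous_cos.
Qed.

Lemma meanD h h' : P.-integrable setT (EFin \o h) ->
  P.-integrable setT (EFin \o h') -> mean (fun w => h w + h' w) = mean h + mean h'.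
Proof. by move=> *; rewrite /mean RintegralD. Qed.

Lemma meanB h h' : P.-integrable setT (EFin \o h) ->
  P.-integrable setT (EFin \o h') -> mean (fun w => h w - h' w) = mean h - mean h'.
Proof. by move=> *; rewrite /mean RintegralB. Qed.

Lemma meanZ c h : P.-integrable setT (EFin \o h) ->
  mean (fun w => c * h w) = c * mean h.
Proof. by move=> *; rewrite /mean RintegralZl. Qed.

Lemma mean_cst c : mean (fun=> c) = c.
Proof. by rewrite /mean Rintegral_cst//= probability_setT mulr1. Qed.

Lemma ler_mean h h' : P.-integrable setT (EFin \o h) ->
  P.-integrable setT (EFin \o h') -> (forall w, h w <= h' w) -> mean h <= mean h'.
Proof. by move=> *; apply: le_Rintegral. Qed.

Lemma ler_norm_mean h : P.-integrable setT (EFin \o h) ->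
  `|mean h| <= mean (fun w => `|h w|).
Proof. by move=> ih; apply: le_normr_Rintegral. Qed.

Lemma mean_bounded h B : P.-integrable setT (EFin \o h) ->
  (forall w, `|h w| <= B) -> `|mean h| <= B.
Proof.
move=> ih hB; apply: le_trans (ler_norm_mean ih) _; rewrite -[leRHS]mean_cst.
apply: ler_mean => //; first exact: (@integrable_norm _ _ _ P setT h).
exact/bounded_measurable_integrable/bounded_measurable_cst.
Qed.

Lemma mean_indic (A : set T) : measurable A -> mean (\1_A) = fine (P A).
Proof. by move=> mA; rewrite /mean /Rintegral integral_indic// setIT. Qed.

Section random_vectors.
Context {I : finType}.
Variable G : T -> I -> R.
Hypothesis mG : forall i, measurable_fun setT (fun w => G w i).

Lemma measurable_linear (t : I -> R) al :
  measurable_fun setT (fun w => \sum_i t i * G w i + al).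
Proof.
apply: measurable_funD => //; apply: measurable_sum => i.
by apply: measurable_funM.
Qed.

Lemma trigpoly_bounded_measurable p : trigpoly p ->
  bounded_measurable (fun w => p (G w)).
Proof.
elim=> [t al|c g h _ IH1 _ IH2].
  exact/bounded_measurable_cos/measurable_linear.
apply: bounded_measurableD => //; apply: bounded_measurableM => //.
exact: bounded_measurable_cst.
Qed.

(** [f (G w)] is the pointwise limit of trigonometric polynomials in [G w], taken on growing cubes;
    no measurable structure on [I -> R] is involved. *)
Lemma continuous_bounded_measurable (f : {ptws I -> R} -> R) B :
  continuous f -> (forall z, `|f z| <= B) ->
  bounded_measurable (fun w => f (G w)).
Proof.
move=> cf hB; split; last by exists B.
have h (n : nat) : exists p, trigpoly p /\
    forall z, (forall i, `|z i| <= n.+1%:R) -> `|f z - p z| <= n.+1%:R^-1.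
  have n0 : 0 < n.+1%:R^-1 :> R by rewrite invr_gt0 ltr0n.
  by have [p [tp _ hp]] := trigpoly_approx cf hB (ltr0Sn R n) n0; exists p.
have [p hp] := choice h.
apply: (@measurable_fun_cvg _ _ _ _ (fun n w => p n (G w))).
  by move=> n; apply: (trigpoly_bounded_measurable (hp n).1).1.
move=> w _; apply/cvgrPdist_le => e e0; near=> n.
apply: le_trans ((hp n).2 _ _) _.
  move=> i; apply: le_trans (_ : \sum_j `|G w j| <= _).
    by rewrite (bigD1 i)//= lerDl sumr_ge0.
  apply: le_trans (_ : n%:R <= _); last by rewrite ler_nat.
  by near: n; exact: nbhs_infty_ger.
by rewrite ltW//; near: n; exact: near_infty_natSinv_lt (PosNum e0).
Unshelve. all: by end_near. Qed.

End random_vectors.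

Lemma measurable_tail (X : T -> R) (r : R) : measurable_fun setT X ->
  measurable [set w | r < `|X w|].
Proof.
move=> mX; have mN : measurable_fun setT (fun w => `|X w|).
  exact: measurableT_comp.
have := mN measurableT `]r, +oo[%classic (measurable_itv _).
rewrite setTI; congr (measurable _); apply/seteqP.
by split=> w /=; rewrite in_itv/= andbT.
Qed.

Lemma mean_approx (X : T -> R) (h g : R -> R) (B L e : R) :
  measurable_fun setT X ->
  bounded_measurable (fun w => h (X w)) -> bounded_measurable (fun w => g (X w)) ->
  (forall x, `|h x| <= B) -> (forall x, `|g x| <= B) -> 0 <= e ->
  (forall x, `|x| <= L -> `|h x - g x| <= e) ->
  `|mean (fun w => h (X w)) - mean (fun w => g (X w))| <=
  e + 2 * B * fine (P [set w | L < `|X w|]).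
Proof.
move=> mX bh bg hB gB e0 hg.
have mt := measurable_tail L mX.
have ih := bounded_measurable_integrable bh.
have ig := bounded_measurable_integrable bg.
have b1 : bounded_measurable (\1_[set w | L < `|X w|]).
  split; first exact: measurable_indic.
  by exists 1 => w; rewrite indicE normr_nat lern1; case: (_ \in _).
have i1 := bounded_measurable_integrable b1.
have b2 := bounded_measurableM (bounded_measurable_cst (2 * B)) b1.
have i2 := bounded_measurable_integrable b2.
have b3 := bounded_measurable_cst e.
have bhg := bounded_measurableD bh (bounded_measurableM (bounded_measurable_cst (-1)) bg).
rewrite -meanB// -mean_indic// -meanZ// -{1}(mean_cst e) -meanD//; last first.
  exact: bounded_measurable_integrable b3.
have ihg : P.-integrable setT (EFin \o (fun w => h (X w) - g (X w))).
  apply: eq_integrable (bounded_measurable_integrable bhg) => // w _ /=.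
  by rewrite mulN1r.
apply: le_trans (ler_norm_mean ihg) _; apply: ler_mean.
- exact: (@integrable_norm _ _ _ P setT _ ihg).
- exact: bounded_measurable_integrable (bounded_measurableD b3 b2).
move=> w; rewrite indicE; have [Lw|Lw] := boolP (w \in [set w | L < `|X w|]).
  rewrite mulr1; apply: ler_wpDl => //; apply: le_trans (ler_normB _ _) _.
  by have := hB (X w); have := gB (X w); lra.
rewrite mulr0 addr0; apply: hg; rewrite leNgt; apply: contra Lw => Lw.
by rewrite inE.
Qed.

Lemma tail_cvg0 (X : T -> R) : measurable_fun setT X ->
  fine (P [set w | n%:R < `|X w|]) @[n --> \oo] --> (0 : R).
Proof.
move=> mX; pose F (n : nat) := [set w | n%:R < `|X w|].
have mF n : measurable (F n) by exact: measurable_tail.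
have capF : \bigcap_n F n = set0.
  apply/seteqP; split => // w hw.
  have := hw (Num.truncn `|X w|).+1 I; rewrite /F/= => /lt_trans-/(_ _ (truncnS_gt _)).
  by rewrite ltxx.
rewrite -[X in _ --> X]/(fine 0%:E); apply: fine_cvg.
rewrite (_ : (fine 0%:E)%:E = P set0); last by rewrite measure0.
rewrite -capF; apply: nonincreasing_cvg_mu => //.
- exact: le_lt_trans (probability_le1 P (mF _)) (ltry 1).
- by rewrite capF.
- move=> m n mn; apply/subsetPset => w; apply: le_lt_trans.
  by rewrite ler_nat.
Qed.

End real_mean.

(** * Characteristic functions determine laws on the line *)

Section char_fun_uniqueness.
Context {d1 d2 : measure_display} {T1 : measurableType d1}
  {T2 : measurableType d2} {R : realType}.
Variables (P1 : probability T1 R) (P2 : probability T2 R).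
Variables (X1 : T1 -> R) (X2 : T2 -> R).
Hypothesis mX1 : measurable_fun setT X1.
Hypothesis mX2 : measurable_fun setT X2.
Hypothesis char_eq : forall t al,
  mean P1 (fun w => cos (t * X1 w + al)) = mean P2 (fun w => cos (t * X2 w + al)).

Let vec (x : R) : unit -> R := fun=> x.

Let trigpoly_mean_eq p : trigpoly p ->
  mean P1 (fun w => p (vec (X1 w))) = mean P2 (fun w => p (vec (X2 w))).
Proof.
have b1 q : trigpoly q -> bounded_measurable (fun w => q (vec (X1 w))).
  by move=> tq; apply: (trigpoly_bounded_measurable (G := fun w => vec (X1 w))).
have b2 q : trigpoly q -> bounded_measurable (fun w => q (vec (X2 w))).
  by move=> tq; apply: (trigpoly_bounded_measurable (G := fun w => vec (X2 w))).
elim=> [t al|c g h tg IHg th IHh].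
  have e x : \sum_i t i * vec x i = t tt * x.
    by rewrite (bigD1 tt)//= big1 ?addr0// => -[].
  under eq_fun do rewrite e; under [in RHS]eq_fun do rewrite e.
  exact: char_eq.
have i1 := fun q tq => bounded_measurable_integrable P1 (b1 q tq).
have i2 := fun q tq => bounded_measurable_integrable P2 (b2 q tq).
rewrite (meanD (i1 _ (trigpolyZ c tg)) (i1 _ th)) (meanZ c (i1 _ tg)).
rewrite (meanD (i2 _ (trigpolyZ c tg)) (i2 _ th)) (meanZ c (i2 _ tg)).
by rewrite IHg IHh.
Qed.

(** On [[-n, n]] the function is replaced with a trigonometric polynomial under the same global
    bound; outside, the tails of both variables are small. The [+ 1] in [2 * B + 1] avoids a
    division by 0. *)
Lemma continuous_mean_eq (f : R -> R) B : continuous f -> (forall x, `|f x| <= B) ->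
  mean P1 (f \o X1) = mean P2 (f \o X2).
Proof.
move=> cf hB; have B0 : 0 <= B by exact: le_trans (hB 0).
pose F (z : {ptws unit -> R}) := f (z tt).
have cF : continuous F.
  move=> z; apply: (@continuous_comp _ _ _ (fun z : {ptws unit -> R} => z tt) f).
    exact: (@proj_continuous unit (fun=> R) tt z).
  exact: cf.
have hF z : `|F z| <= B by exact: hB.
have bm1 q : trigpoly q -> bounded_measurable (fun w => q (vec (X1 w))).
  by move=> tq; apply: (trigpoly_bounded_measurable (G := fun w => vec (X1 w))).
have bm2 q : trigpoly q -> bounded_measurable (fun w => q (vec (X2 w))).
  by move=> tq; apply: (trigpoly_bounded_measurable (G := fun w => vec (X2 w))).
have bf1 : bounded_measurable (fun w => f (X1 w)).
  by split; [exact: measurableT_comp (continuous_measurable_fun cf) mX1|exists B].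
have bf2 : bounded_measurable (fun w => f (X2 w)).
  by split; [exact: measurableT_comp (continuous_measurable_fun cf) mX2|exists B].
suff h e : 0 < e -> `|mean P1 (f \o X1) - mean P2 (f \o X2)| <= e.
  apply/eqP; rewrite -subr_eq0 -normr_le0; apply/ler_addgt0Pr => e e0.
  by rewrite add0r; exact: h.
move=> e0; have e4 : 0 < e / 4 / (2 * B + 1) by rewrite divr_gt0 ?divr_gt0//; lra.
have /cvgrPdist_le/(_ _ e4) tail1 := tail_cvg0 P1 mX1.
have /cvgrPdist_le/(_ _ e4) tail2 := tail_cvg0 P2 mX2.
near \oo => n.
have n0 : 0 < n%:R :> R by rewrite ltr0n; near: n; exists 1%N.
have e40 : 0 < e / 4 by rewrite divr_gt0.
have [p [tp pB hp]] := trigpoly_approx cF hF n0 e40.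
have b (t : R) : 0 <= t -> t <= e / 4 / (2 * B + 1) -> 2 * B * t <= e / 4.
  by move=> t0; rewrite ler_pdivlMr; lra.
have t1 : 2 * B * fine (P1 [set w | n%:R < `|X1 w|]) <= e / 4.
  apply: b; first exact: fine_ge0.
  apply: le_trans (ler_norm _) _; rewrite -normrN -sub0r.
  by near: n.
have t2 : 2 * B * fine (P2 [set w | n%:R < `|X2 w|]) <= e / 4.
  apply: b; first exact: fine_ge0.
  apply: le_trans (ler_norm _) _; rewrite -normrN -sub0r.
  by near: n.
have hp' x : `|x| <= n%:R -> `|f x - p (vec x)| <= e / 4.
  by move=> xn; apply: (hp (vec x)).
have m1 := mean_approx P1 mX1 bf1 (bm1 p tp) hB (fun x => pB (vec x)) (ltW e40) hp'.
have m2 := mean_approx P2 mX2 bf2 (bm2 p tp) hB (fun x => pB (vec x)) (ltW e40) hp'.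
rewrite (trigpoly_mean_eq tp) in m1.
rewrite distrC in m2.
apply: le_trans (ler_distD (mean P2 (fun w => p (vec (X2 w)))) _ _) _.
apply: le_trans (lerD m1 m2) _; lra.
Unshelve. all: by end_near. Qed.

(** A continuous function between the indicators of []a + 1/k, +oo[] and []a, +oo[], for positive
    [k]. *)
Let ramp (a : R) (k : nat) (x : R) : R := Num.max 0 (Num.min (k%:R * (x - a)) 1).

Let ramp_continuous a k : continuous (ramp a k).
Proof.
move=> x; have c : (k%:R * (y - a)) @[y --> x] --> k%:R * (x - a).
  by apply: cvgM; [exact: cvg_cst|apply: cvgB; [exact: cvg_id|exact: cvg_cst]].
apply/cvgrPdist_lt => e e0; have /cvgrPdist_lt/(_ _ e0) := c.
by apply: filterS => y; apply: le_lt_trans; exact: clamp_lip.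
Qed.

Let ramp_bound a k x : `|ramp a k x| <= 1.
Proof.
rewrite ger0_norm; first by rewrite ge_max ler01/= ge_min lexx orbT.
by rewrite le_max lexx.
Qed.

(** The ramps squeeze the mass of []a + 1/k, +oo[] under [P1] below that of []a, +oo[] under [P2],
    and [k] goes to infinity. One inequality is enough, the hypotheses being symmetric. *)
Lemma char_fun_law_eq_gt a :
  (P1 (X1 @^-1` `]a, +oo[) <= P2 (X2 @^-1` `]a, +oo[))%E.
Proof.
pose F (k : nat) := X1 @^-1` `]a + k.+1%:R^-1, +oo[.
have mI (x : R) : measurable (`]x, +oo[%classic : set R) by exact: measurable_itv.
have m1 x : measurable (X1 @^-1` `]x, +oo[).
  by rewrite -[X in measurable X]setTI; exact: mX1.
have m2 x : measurable (X2 @^-1` `]x, +oo[).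
  by rewrite -[X in measurable X]setTI; exact: mX2.
have cupF : \bigcup_k F k = X1 @^-1` `]a, +oo[.
  apply/seteqP; split=> [w [k _]|w]; rewrite /F/= !in_itv/= !andbT.
    by apply: lt_trans; rewrite ltrDl invr_gt0 ltr0n.
  move=> aX; have [k hk] := ltr_add_invr aX; exists k => //=.
  by rewrite in_itv/= andbT.
have cv : P1 (F k) @[k --> \oo] --> P1 (X1 @^-1` `]a, +oo[).
  rewrite -cupF; apply: nondecreasing_cvg_mu => //; first by move=> k; exact: m1.
    by rewrite cupF.
  move=> k l kl; apply/subsetPset => w; rewrite /F/= !in_itv/= !andbT.
  by apply: le_lt_trans; rewrite lerD2l lef_pV2 ?posrE ?ltr0n// ler_nat.
apply: (cvge_le _ cv) => //; near=> k.
have pr : measurable_fun setT (ramp a k.+1).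
  by apply: continuous_measurable_fun; exact: ramp_continuous.
have b1 : bounded_measurable (ramp a k.+1 \o X1).
  by split; [exact: measurableT_comp|exists 1 => w; exact: ramp_bound].
have b2 : bounded_measurable (ramp a k.+1 \o X2).
  by split; [exact: measurableT_comp|exists 1 => w; exact: ramp_bound].
have bi d (T : measurableType d) (P : probability T R) (S : set T) :
    measurable S -> bounded_measurable (\1_S : T -> R).
  move=> mS; split; first exact: measurable_indic.
  by exists 1 => w; rewrite indicE normr_nat lern1; case: (_ \in _).
have i1 := bounded_measurable_integrable P1 b1.
have i2 := bounded_measurable_integrable P2 b2.
have l1 : fine (P1 (F k)) <= mean P1 (ramp a k.+1 \o X1).
  rewrite -mean_indic//; last exact: m1.
  apply: ler_mean => //; first exact/bounded_measurable_integrable/bi/m1.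
  move=> w; rewrite indicE; case: (boolP (_ \in _)) => [|_]; last first.
    by rewrite /ramp/= le_max lexx.
  rewrite inE /F/= in_itv/= andbT => h.
  rewrite le_max le_min lexx andbT; apply/orP; right.
  by rewrite mulrC -ler_pdivrMr ?ltr0n// div1r lerBrDl ltW.
have l2 : mean P2 (ramp a k.+1 \o X2) <= fine (P2 (X2 @^-1` `]a, +oo[)).
  rewrite -mean_indic//.
  apply: ler_mean => //; first exact/bounded_measurable_integrable/bi/m2.
  move=> w; rewrite indicE; case: (boolP (_ \in _)) => [_|].
    by rewrite /ramp/= ge_max ler01 ge_min lexx orbT.
  rewrite notin_setE /= in_itv/= andbT => /negP; rewrite -leNgt => h.
  rewrite /ramp ge_max lexx/= ge_min; apply/orP; left.
  by rewrite mulr_ge0_le0// subr_le0.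
rewrite -[leLHS]fineK; last by rewrite fin_num_measure//; exact: m1.
rewrite -[leRHS]fineK; last by rewrite fin_num_measure//; exact: m2.
rewrite lee_fin; apply: le_trans l1 _; apply: le_trans l2.
by rewrite (continuous_mean_eq (@ramp_continuous a k.+1) (@ramp_bound a k.+1)).
Unshelve. all: by end_near. Qed.

End char_fun_uniqueness.

(** The half-lines []x, +oo[] are stable under intersection and generate the Borel sets; on them
    equality is two instances of [char_fun_law_eq_gt]. *)
Lemma char_fun_law_eq {d1 d2 : measure_display} {T1 : measurableType d1}
  {T2 : measurableType d2} {R : realType}
  (P1 : probability T1 R) (P2 : probability T2 R)
  (X1 : {mfun T1 >-> R}) (X2 : {mfun T2 >-> R}) :
  (forall t al, mean P1 (fun w => cos (t * X1 w + al)) =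
                mean P2 (fun w => cos (t * X2 w + al))) ->
  forall A, measurable A -> P1 (X1 @^-1` A) = P2 (X2 @^-1` A).
Proof.
move=> h A mA.
have mX1 : measurable_fun setT X1 by [].
have mX2 : measurable_fun setT X2 by [].
have h' t al := esym (h t al).
apply: (@measure_unique _ R _ (@RGenOInfty.G R) (fun k => `]- k%:R, +oo[%classic)
  _ _ _ _ (distribution P1 X1) (distribution P2 X2)) => //.
- exact: RGenOInfty.measurableE.
- move=> _ _ [x ->] [y ->]; exists (Num.max x y); apply/seteqP.
  by split=> z /=; rewrite !in_itv/= !andbT gt_max => /andP.
- by move=> k; exists (- k%:R).
- apply/seteqP; split=> // x _; exists (Num.truncn `|x|).+1 => //=.
  rewrite in_itv/= andbT ltrNl; apply: le_lt_trans (truncnS_gt _).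
  by rewrite -normrN ler_norm.
- move=> _ [x ->]; apply/eqP; rewrite eq_le; apply/andP; split.
    exact: (char_fun_law_eq_gt mX1 mX2 h x).
  exact: (char_fun_law_eq_gt mX2 mX1 h' x).
- by move=> k; apply: le_lt_trans (probability_le1 _ _) (ltry 1).
Qed.

(** * The characteristic function of a normal law *)

Section normal_density_integrals.
Context {R : realType}.
Local Notation mu := (@lebesgue_measure R).
Implicit Types (m s a x : R) (f : R -> \bar R).

Lemma ge0_integral_normal m s f : measurable_fun setT f -> (forall x, 0 <= f x)%E ->
  (\int[normal_prob m s]_x f x = \int[mu]_x (f x * (normal_pdf m s x)%:E))%E.
Proof.
move=> mf f0.
have dom := normal_prob_dominates m s.
rewrite -(Radon_Nikodym_SigmaFinite.change_of_variables dom f0 measurableT mf).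
have ii := Radon_Nikodym_SigmaFinite.f_integrable dom.
have mp : measurable_fun setT (fun x => (normal_pdf m s x)%:E).
  by apply/measurable_EFinP; exact: measurable_normal_pdf.
apply: ae_eq_integral => //.
- by apply: emeasurable_funM => //; exact: measurable_int ii.
- exact: emeasurable_funM.
apply: ae_eqe_mul2l; apply: integral_ae_eq => // A _ mA.
exact/esym/(Radon_Nikodym_SigmaFinite.f_integral dom).
Qed.

Lemma lebesgue_integral_shift a f : measurable_fun setT f -> (forall x, 0 <= f x)%E ->
  (\int[mu]_x f (x + a)%R = \int[mu]_x f x)%E.
Proof.
move=> mf f0; pose phi (x : R) : measurableTypeR R := x + a.
have mphi : measurable_fun setT phi by exact: measurable_funD.
rewrite [LHS](_ : _ = \int[mu]_(x in phi @^-1` setT) (f \o phi) x)%E//.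
rewrite -ge0_integral_pushforward//=.
apply: eq_measure_integral => //= A mA _.
apply/esym/lebesgue_measure_unique => //= _ [[c d]] _ <-.
rewrite /pushforward (_ : phi @^-1` `]c, d] = `]c - a, d - a]%classic).
  rewrite !lebesgue_measure_itv/= !lte_fin ltrD2r; case: ifP => // _.
  by rewrite -!EFinD; congr (_%:E); ring.
by apply/seteqP; split=> x; rewrite /= !in_itv/= /phi ltrBlDr lerBrDr.
Qed.

Lemma normal_pdf_tilt s a x : s != 0 ->
  normal_pdf 0 s x * expR (a * x) =
  expR (a ^+ 2 * s ^+ 2 / 2) * normal_pdf 0 s (x - a * s ^+ 2).
Proof.
move=> s0; rewrite !normal_pdfE// /normal_fun.
rewrite mulrCA -!mulrA -!expRD; congr (_ * expR _).
by field.
Qed.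

(** The Cameron-Martin formula in dimension 1, by completing the square and translating Lebesgue
    measure. It replaces integration by parts in the computation of the characteristic function. *)
Lemma normal_tilt s a (g : R -> R) : s != 0 ->
  measurable_fun setT g -> (forall x, 0 <= g x) ->
  (\int[normal_prob 0 s]_x (g x * expR (a * x))%:E =
   (expR (a ^+ 2 * s ^+ 2 / 2))%:E *
   \int[normal_prob 0 s]_x (g (x + a * s ^+ 2)%R)%:E)%E.
Proof.
move=> s0 mg g0; pose q := a * s ^+ 2.
have mq : measurable_fun (setT : set R) (fun x : R => x + q) by exact: measurable_funD.
have mgq : measurable_fun setT (fun x => g (x + q)).
  exact: measurableT_comp mg mq.
have mN q' : measurable_fun (setT : set R) (fun x : R => x - q') by exact: measurable_funD.
have mp q' : measurable_fun setT (fun x => normal_pdf 0 s (x - q')).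
  by apply: measurableT_comp (mN q'); exact: measurable_normal_pdf.
have me : measurable_fun setT (fun x => expR (a * x)).
  by apply: measurableT_comp => //; exact: measurable_funM.
have mpe (h : R -> R) : measurable_fun setT h -> measurable_fun setT (EFin \o h).
  by move=> mh; apply/measurable_EFinP.
have mp0 : measurable_fun setT (normal_pdf 0 s) by exact: measurable_normal_pdf.
rewrite [in LHS]ge0_integral_normal//=; last 2 first.
- by apply: mpe; exact: measurable_funM.
- by move=> x; rewrite lee_fin mulr_ge0// expR_ge0.
rewrite ge0_integral_normal//=; last 2 first.
- exact: mpe.
- by move=> x; rewrite lee_fin.
rewrite -(@lebesgue_integral_shift (- q)
  (fun x => (g (x + q))%:E * (normal_pdf 0 s x)%:E)%E); last 2 first.
- by apply: emeasurable_funM; apply: mpe.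
- by move=> x; rewrite mule_ge0// lee_fin// normal_pdf_ge0.
rewrite -ge0_integralZl//=; last 2 first.
- apply: emeasurable_funM; apply: mpe; last exact: mp.
  by rewrite (_ : (fun x => _) = g)//; apply/funext => x; rewrite subrK.
- by move=> x _; rewrite mule_ge0// lee_fin// normal_pdf_ge0.
apply: eq_integral => x _; rewrite -!EFinM; congr (_%:E).
by rewrite subrK [RHS]mulrCA -normal_pdf_tilt//; ring.
Qed.

End normal_density_integrals.

Lemma is_derive_quadratic {R : realType} (f : R -> R) (x l K h0 : R) : 0 < h0 ->
  (forall h, `|h| <= h0 -> `|f (x + h) - f x - h * l| <= K * h ^+ 2) ->
  is_derive x (1 : R) f l.
Proof.
move=> h00 hf.
have cv : h^-1 *: (f (h *: 1 + x) - f x) @[h --> (0 : R)^'] --> l.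
  apply/cvgrPdist_le => e e0.
  have K1 : 0 < `|K| + 1 by rewrite ltr_wpDl.
  have eK : 0 < e / (`|K| + 1) by rewrite divr_gt0.
  near=> h.
  have hn0 : h != 0 by near: h; exact: nbhs_dnbhs_neq.
  have hh0 : `|h| <= h0 by near: h; exact: dnbhs0_le.
  have hhe : `|h| <= e / (`|K| + 1) by near: h; exact: dnbhs0_le.
  have -> : h *: 1 = h :> R by rewrite /GRing.scale/= mulr1.
  have -> : l - h^-1 *: (f (h + x) - f x) = - (h^-1 * (f (x + h) - f x - h * l)).
    by rewrite /GRing.scale/= (addrC h x); field.
  rewrite normrN normrM normfV ler_pdivrMl ?normr_gt0//.
  apply: le_trans (hf h hh0) _; rewrite -[h ^+ 2]real_normK ?num_real// expr2 mulrCA.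
  rewrite ler_wpM2l//; move: hhe; rewrite ler_pdivlMr// => hhe.
  apply: le_trans hhe; rewrite mulrC ler_wpM2l//.
  by apply: le_trans (ler_norm _) _; rewrite lerDl.
apply: DeriveDef; first exact: cvgP cv.
exact: cvg_lim cv.
Unshelve. all: by end_near. Qed.

Section exponential_tilting.
Context {R : realType}.
Variable s : R.
Hypothesis s0 : s != 0.
Local Notation N := (normal_prob 0 s).

Lemma bounded_measurable_shift (g : R -> R) (a : R) :
  bounded_measurable g -> bounded_measurable (fun x : R => g (x + a)).
Proof.
move=> [mg [B hB]]; split; last by exists B.
by apply: measurableT_comp mg _; exact: measurable_funD.
Qed.

Let mexp (a : R) : measurable_fun setT (fun x : R => expR (a * x)).
Proof. by apply: measurableT_comp => //; exact: measurable_funM. Qed.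

Lemma normal_expR_integral (a : R) :
  (\int[N]_x (expR (a * x))%:E = (expR (a ^+ 2 * s ^+ 2 / 2))%:E)%E.
Proof.
have := @normal_tilt R s a (fun=> 1) s0 _ (fun=> ler01).
move=> /(_ (measurable_cst _)); under eq_integral do rewrite mul1r.
by move=> ->; rewrite integral_cst//= probability_setT !mule1.
Qed.

Lemma normal_expR_integrable (a : R) : N.-integrable setT (EFin \o (fun x => expR (a * x))).
Proof.
apply/integrableP; split; first by apply/measurable_EFinP; exact: mexp.
under eq_integral => x _ do rewrite /= (ger0_norm (expR_ge0 _)).
by rewrite normal_expR_integral ltry.
Qed.

Lemma normal_expR_mean (a : R) : mean N (fun x => expR (a * x)) = expR (a ^+ 2 * s ^+ 2 / 2).
Proof. by rewrite /mean /Rintegral normal_expR_integral. Qed.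

Lemma normal_tilt_integrable (g : R -> R) (a : R) : bounded_measurable g ->
  N.-integrable setT (EFin \o (fun x => g x * expR (a * x))).
Proof.
move=> [mg [B hB]].
apply: (@le_integrable _ _ _ N setT measurableT _ (EFin \o (fun x : R => B * expR (a * x)))) => //.
- by apply/measurable_EFinP; exact: (measurable_funM mg (mexp a)).
- move=> x _ /=; rewrite lee_fin !normrM ler_wpM2r//.
  by apply: le_trans (hB x) (ler_norm _).
- have := integrableZl measurableT B (normal_expR_integrable a).
  by apply: eq_integrable => // x _ /=; rewrite EFinM.
Qed.

Lemma normal_tilt_mean (g : R -> R) (a : R) : bounded_measurable g ->
  mean N (fun x => g x * expR (a * x)) =
  expR (a ^+ 2 * s ^+ 2 / 2) * mean N (fun x => g (x + a * s ^+ 2)).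
Proof.
move=> bg; have [mg [B hB]] := bg.
have bgs := bounded_measurable_shift (a * s ^+ 2) bg.
have bB := bounded_measurable_cst B : bounded_measurable (fun _ : R => B).
have bgB := bounded_measurableD bg bB.
have gB0 x : 0 <= g x + B by have := hB x; rewrite ler_norml; lra.
have h := @normal_tilt R s a (fun x => g x + B) s0 bgB.1 gB0.
have h' : mean N (fun x => (g x + B) * expR (a * x)) =
   expR (a ^+ 2 * s ^+ 2 / 2) * mean N (fun x => g (x + a * s ^+ 2) + B).
  rewrite /mean /Rintegral h fineM//.
  apply: integrable_fin_num => //.
  exact: (bounded_measurable_integrable N (bounded_measurableD bgs bB)).
move: h'; rewrite meanD; last 2 first.
- exact: bounded_measurable_integrable.
- exact: bounded_measurable_integrable.
rewrite mean_cst.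
have -> : (fun x => (g x + B) * expR (a * x)) =
  (fun x => g x * expR (a * x) + B * expR (a * x)).
  by apply/funext => x; rewrite mulrDl.
rewrite meanD ?meanZ ?normal_expR_mean; last 3 first.
- exact: normal_expR_integrable.
- exact: normal_tilt_integrable.
- exact: (normal_tilt_integrable a bB).
by rewrite mulrDr => /eqP; rewrite (mulrC B) => /eqP /addIr.
Qed.

End exponential_tilting.
(** Dominates [y^2 / 4] everywhere and has an explicit mean at [y = h x] under a normal law, of
    order [h^2]. *)
Definition cosh_defect {R : realType} (y : R) := expR y + expR (- y) - 2.

Lemma cosh_defect_ge0 {R : realType} (y : R) : 0 <= cosh_defect y.
Proof. by apply: le_trans (sqr_le_cosh y); rewrite divr_ge0// sqr_ge0. Qed.

(** A first-order expansion of the cosine in [expR y - 1] instead of [y]: the product of a sine with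
    an exponential is what tilting integrates. *)
Lemma cos_tilt_error {R : realType} (x y : R) :
  `|cos (x + y) - cos x + sin x * (expR y - 1)| <= 11 * cosh_defect y.
Proof.
have k := sqr_le_cosh y; have k0 := cosh_defect_ge0 y.
rewrite -/(cosh_defect y) in k.
have h1 : `|cos y - 1| <= 2 * cosh_defect y by have := cos_sub1_le y; lra.
have h2 : `|expR y - 1 - y| <= cosh_defect y.
  rewrite ger0_norm; last by have := expR_ge1Dx y; lra.
  by rewrite /cosh_defect; have := expR_ge1Dx (- y); lra.
have h3 : `|sin y - y| <= 8 * cosh_defect y.
  have [y1|y1] := leP `|y| 1.
    apply: le_trans (sin_sub_le y) _; rewrite exprS real_normK ?num_real//.
    by have := ler_wpM2r (sqr_ge0 y) y1; lra.
  have y2 : `|y| <= y ^+ 2.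
    by rewrite -[leRHS]real_normK ?num_real// expr2 ler_peMl// ltW.
  by apply: le_trans (ler_normB _ _) _; have := norm_sin_le y; lra.
have -> : cos (x + y) - cos x + sin x * (expR y - 1) =
    cos x * (cos y - 1) + sin x * ((expR y - 1 - y) - (sin y - y)).
  by rewrite cosD; ring.
apply: le_trans (ler_normD _ _) _; rewrite !normrM.
have a1 : `|cos x| * `|cos y - 1| <= 1 * (2 * cosh_defect y).
  by apply: ler_pM => //; exact: cos_max.
have a2 : `|sin x| * `|expR y - 1 - y - (sin y - y)| <= 1 * (9 * cosh_defect y).
  apply: ler_pM => //; first exact: sin_max.
  by apply: le_trans (ler_normB _ _) _; lra.
lra.
Qed.

Lemma expR_sub1_le {R : realType} (q : R) : 0 <= q <= 2^-1 -> expR q - 1 <= 2 * q.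
Proof.
move=> /andP[q0 q1]; have h1 : 0 < 1 - q by lra.
have : expR q <= (1 - q)^-1.
  rewrite -[expR q]invrK -expRN lef_pV2 ?posrE ?expR_gt0//.
  exact: expR_ge1Dx (- q).
have : (1 - q)^-1 <= 1 + 2 * q by rewrite -div1r ler_pdivrMr//; nra.
lra.
Qed.

Section normal_characteristic_function.
Context {R : realType}.
Variable s : R.
Hypothesis s0 : s != 0.
Local Notation N := (normal_prob 0 s).

Lemma cosh_defect_integrable (h : R) :
  N.-integrable setT (EFin \o (fun x => cosh_defect (h * x))).
Proof.
have i1 := normal_expR_integrable s0 h.
have i2 := normal_expR_integrable s0 (- h).
have i3 : N.-integrable setT (EFin \o (fun _ : R => 2)).
  exact: bounded_measurable_integrable (bounded_measurable_cst 2).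
have := integrableB measurableT (integrableD measurableT i1 i2) i3.
by apply: eq_integrable => // x _ /=; rewrite /cosh_defect mulNr.
Qed.

Lemma cosh_defect_mean (h : R) :
  mean N (fun x => cosh_defect (h * x)) = 2 * (expR (h ^+ 2 * s ^+ 2 / 2) - 1).
Proof.
have i1 := normal_expR_integrable s0 h.
have i2 := normal_expR_integrable s0 (- h).
have i3 : N.-integrable setT (EFin \o (fun _ : R => 2)).
  exact: bounded_measurable_integrable (bounded_measurable_cst 2).
have i12 : N.-integrable setT (EFin \o (fun x => expR (h * x) + expR (- h * x))).
  exact: (integrableD measurableT i1 i2).
rewrite /cosh_defect; under eq_fun do rewrite -mulNr.
rewrite (meanB i12 i3) (meanD i1 i2) mean_cst !normal_expR_mean// sqrrN.
ring.
Qed.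

Definition normal_char (t al : R) : R := mean N (fun x => cos (t * x + al)).

Let mlin (t al : R) : measurable_fun setT (fun x : R => t * x + al).
Proof. by apply: measurable_funD => //; exact: measurable_funM. Qed.

Let bcos (t al : R) : bounded_measurable (fun x : R => cos (t * x + al)).
Proof. exact: bounded_measurable_cos (mlin t al). Qed.

Let sinE (t al : R) : (fun x : R => sin (t * x + al)) =
  (fun x : R => cos (t * x + (al - pi / 2))).
Proof. by apply/funext => x; rewrite addrA cosBpihalf. Qed.

Let bsin (t al : R) : bounded_measurable (fun x : R => sin (t * x + al)).
Proof. by rewrite sinE; exact: bcos. Qed.

(** The increment of the cosine is [- sin (t x + al) (expR (h x) - 1)] up to [cosh_defect]; tilting
    shifts the sine by [th = t h s^2], whose first-order effect is [th] times the cosine. Hence the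
    derivative in [t] is [- t s^2] times the function, with a quadratic remainder. *)
Lemma normal_char_step t al h : h ^+ 2 * s ^+ 2 <= 1 -> `|h| * s ^+ 2 <= 1 ->
  `|normal_char (t + h) al - normal_char t al - h * (- t * s ^+ 2 * normal_char t al)| <=
  (24 * s ^+ 2 + t ^+ 2 * s ^+ 4 + t ^+ 2 * s ^+ 4 * `|t|) * h ^+ 2.
Proof.
move=> hs hs'; pose S := mean N (fun x => sin (t * x + al)).
set C := normal_char t al; pose th := t * h * s ^+ 2.
set q := h ^+ 2 * s ^+ 2 / 2.
have q0 : 0 <= q by rewrite divr_ge0// mulr_ge0// sqr_ge0.
have S1 : `|S| <= 1.
  apply: mean_bounded => [|x]; last exact: sin_max.
  exact: (bounded_measurable_integrable N (bsin t al)).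
have C1 : `|C| <= 1.
  apply: mean_bounded => [|x]; last exact: cos_max.
  exact: (bounded_measurable_integrable N (bcos t al)).
have ic := bounded_measurable_integrable N (bcos t al).
have ich := bounded_measurable_integrable N (bcos (t + h) al).
have is' := bounded_measurable_integrable N (bsin t al).
have ise := normal_tilt_integrable s0 h (bsin t al).
have tilt : mean N (fun x => sin (t * x + al) * expR (h * x)) =
    expR q * (S * cos th + C * sin th).
  rewrite normal_tilt_mean//; congr (_ * _).
  have -> : (fun x => sin (t * (x + h * s ^+ 2) + al)) =
     (fun x : R => cos th * sin (t * x + al) + sin th * cos (t * x + al)).
    apply/funext => x; rewrite (_ : _ + al = (t * x + al) + th); last by rewrite /th; ring.
    by rewrite sinD; ring.
  have iA := bounded_measurable_integrable N
    (bounded_measurableM (bounded_measurable_cst (cos th)) (bsin t al)).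
  have iB := bounded_measurable_integrable N
    (bounded_measurableM (bounded_measurable_cst (sin th)) (bcos t al)).
  by rewrite (meanD iA iB) (meanZ _ is') (meanZ _ ic) (mulrC S) (mulrC C).
pose D x := cos ((t + h) * x + al) - cos (t * x + al) +
   (sin (t * x + al) * expR (h * x) - sin (t * x + al)).
have i1 : N.-integrable setT (EFin \o (fun x => cos ((t + h) * x + al) - cos (t * x + al))).
  exact: (integrableB measurableT ich ic).
have i2 : N.-integrable setT (EFin \o (fun x => sin (t * x + al) * expR (h * x) - sin (t * x + al))).
  exact: (integrableB measurableT ise is').
have iD : N.-integrable setT (EFin \o D) by exact: (integrableD measurableT i1 i2).
have iK : N.-integrable setT (EFin \o (fun x => 11 * cosh_defect (h * x))).
  by have := integrableZl measurableT 11 (cosh_defect_integrable h);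
    apply: eq_integrable.
have mD : mean N D = normal_char (t + h) al - C + (expR q * (S * cos th + C * sin th) - S).
  by rewrite (meanD i1 i2) (meanB ich ic) (meanB ise is') tilt.
have bD : `|mean N D| <= 22 * (expR q - 1).
  apply: le_trans (ler_norm_mean iD) _.
  have -> : 22 * (expR q - 1) = mean N (fun x => 11 * cosh_defect (h * x)).
    by rewrite meanZ ?cosh_defect_mean//; [rewrite -/q; ring|exact: cosh_defect_integrable].
  apply: ler_mean => //; first exact: (@integrable_norm _ _ _ N setT D).
  move=> x; rewrite /D; have := cos_tilt_error (t * x + al) (h * x).
  rewrite (_ : t * x + al + h * x = (t + h) * x + al); last by ring.
  by rewrite mulrBr mulr1.
have q1 : expR q - 1 <= h ^+ 2 * s ^+ 2.
  have := @expR_sub1_le _ q; rewrite q0/= => /(_ _)-/(_ _)/wrap[].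
    by rewrite /q; lra.
  by rewrite /q; lra.
have eq0 : 0 <= expR q - 1 by rewrite subr_ge0 -expR0 ler_expR.
have e1 : `|(expR q - 1) * (S * cos th + C * sin th)| <= (expR q - 1) * 2.
  rewrite normrM (ger0_norm eq0) ler_wpM2l//; apply: le_trans (ler_normD _ _) _.
  have : `|S * cos th| <= 1 * 1 by rewrite normrM; apply: ler_pM => //; exact: cos_max.
  have : `|C * sin th| <= 1 * 1 by rewrite normrM; apply: ler_pM => //; exact: sin_max.
  lra.
have th2 : th ^+ 2 = t ^+ 2 * s ^+ 4 * h ^+ 2 by rewrite /th; ring.
have e2 : `|S * (cos th - 1)| <= th ^+ 2.
  rewrite normrM -[leRHS]mul1r; apply: ler_pM => //.
  by apply: le_trans (cos_sub1_le _) _; have := sqr_ge0 th; lra.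
have tht : `|th| <= `|t|.
  rewrite /th -mulrA normrM ler_piMr// normrM.
  by rewrite (ger0_norm (sqr_ge0 s)).
have e3 : `|C * (sin th - th)| <= t ^+ 2 * s ^+ 4 * h ^+ 2 * `|t|.
  rewrite normrM -[leRHS]mul1r; apply: ler_pM => //.
  apply: le_trans (sin_sub_le _) _.
  rewrite -th2 exprSr real_normK ?num_real// ler_wpM2l//; exact: sqr_ge0.
have -> : normal_char (t + h) al - C - h * (- t * s ^+ 2 * C) =
    mean N D - (expR q - 1) * (S * cos th + C * sin th) - S * (cos th - 1)
    - C * (sin th - th) by rewrite mD /th; ring.
apply: le_trans (ler_normB _ _) _; apply: le_trans (lerD (ler_normB _ _) e3) _.
have e12 := lerD (le_trans (ler_normB _ _) (lerD bD e1)) e2.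
apply: le_trans (lerD e12 (lexx _)) _; rewrite th2.
have -> : (24 * s ^+ 2 + t ^+ 2 * s ^+ 4 + t ^+ 2 * s ^+ 4 * `|t|) * h ^+ 2 =
  24 * (h ^+ 2 * s ^+ 2) + t ^+ 2 * s ^+ 4 * h ^+ 2 + t ^+ 2 * s ^+ 4 * h ^+ 2 * `|t|.
  by ring.
rewrite lerD2r lerD2r.
have -> : 22 * (expR q - 1) + (expR q - 1) * 2 = 24 * (expR q - 1) by ring.
by rewrite ler_wpM2l.
Qed.

(** The function solves [C' = - t s^2 C], so its product with [expR (s^2 t^2 / 2)] is constant,
    equal to its value [cos al] at 0. *)
Lemma normal_charE t al : normal_char t al = expR (- (t ^+ 2 * s ^+ 2 / 2)) * cos al.
Proof.
have dC u : is_derive u (1 : R) (fun t => normal_char t al)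
    (- u * s ^+ 2 * normal_char u al).
  have s2 : 0 < s ^+ 2 by rewrite exprn_even_gt0.
  have d1 : 0 < 1 + s ^+ 2 by rewrite ltr_pwDl// ltW.
  have h0 : 0 < (1 + s ^+ 2)^-1 by rewrite invr_gt0.
  apply: (is_derive_quadratic h0) => h hh; apply: normal_char_step.
    rewrite -[h ^+ 2]real_normK ?num_real//.
    have : `|h| * (1 + s ^+ 2) <= 1 by rewrite -ler_pdivlMr// div1r.
    have := normr_ge0 h; have : `|h| <= 1.
      by apply: le_trans hh _; rewrite invf_le1// lerDl ltW.
    move: `|h| => y y1 y0; nra.
  have : `|h| * (1 + s ^+ 2) <= 1 by rewrite -ler_pdivlMr// div1r.
  by have := normr_ge0 h; lra.
pose F u := normal_char u al * expR (s ^+ 2 / 2 * u ^+ 2).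
have dF u : is_derive u (1 : R) F 0.
  have dE : is_derive u (1 : R) (fun u => expR (s ^+ 2 / 2 * u ^+ 2))
     (s ^+ 2 * u * expR (s ^+ 2 / 2 * u ^+ 2)).
    rewrite (_ : (fun u => _) = expR \o (fun u : R => s ^+ 2 / 2 * u ^+ 2))//.
    by apply: is_derive_eq; rewrite /GRing.scale/=; field.
  by rewrite /F; apply: is_derive_eq; rewrite /GRing.scale/=; ring.
have := @is_derive_0_is_cst R F t 0 dF.
rewrite /F /normal_char expr0n/= mulr0 expR0 mulr1.
have -> : (fun x : R => cos (0 * x + al)) = (fun=> cos al).
  by apply/funext => x; rewrite mul0r add0r.
rewrite mean_cst => <-; rewrite expRN mulrCA (_ : s ^+ 2 / 2 * t ^+ 2 = t ^+ 2 * s ^+ 2 / 2).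
  by rewrite mulVf ?mulr1// gt_eqF// expR_gt0.
by field.
Qed.

End normal_characteristic_function.

Lemma cvg_dist_bound {R : realType} {I : Type} (F : set_system I) {FF : Filter F}
    (f g : I -> R) (l : R) :
  (\forall i \near F, `|f i - l| <= g i) -> g i @[i --> F] --> (0 : R) ->
  f i @[i --> F] --> l.
Proof.
move=> fg g0.
have h1 : l - g i @[i --> F] --> l by rewrite -[X in _ --> X]subr0; apply: cvgB => //; exact: cvg_cst.
have h2 : l + g i @[i --> F] --> l by rewrite -[X in _ --> X]addr0; apply: cvgD => //; exact: cvg_cst.
apply: squeeze_cvgr h1 h2; apply: filterS fg => i; rewrite ler_norml => /andP[a1 a2].
by apply/andP; split; lra.
Qed.

Lemma cvg_harmonic_dist {R : realType} (f : nat -> R) (l c : R) :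
  (forall n, `|f n - l| <= c * n.+1%:R^-1) -> f n @[n --> \oo] --> l.
Proof.
move=> hf; apply: (@cvg_dist_bound _ _ _ _ _ (fun n => c * n.+1%:R^-1)).
  by near=> n.
by rewrite -(mulr0 c); apply: cvgMl_tmp; exact: cvg_harmonic.
Unshelve. all: by end_near.
Qed.

(** * Centered Gaussian variables and their moments *)

Section centered_gaussian.
Context {d : measure_display} {T : measurableType d} {R : realType}.
Variable P : probability T R.
Implicit Types (X Y : T -> R) (v : R).

(** Defined by the characteristic function, so that degenerate linear combinations are the case
    [v = 0] and need no special treatment. *)
Definition centered_gaussian X v := [/\ measurable_fun setT X, 0 <= v &
  forall t al, mean P (fun w => cos (t * X w + al)) =
    expR (- (t ^+ 2 * v / 2)) * cos al].

Let h (n : nat) : R := n.+1%:R^-1.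

Let h_gt0 n : 0 < h n. Proof. by rewrite invr_gt0. Qed.

Let h_le1 n : h n <= 1. Proof. by rewrite invf_le1// ler1n. Qed.

Let h2_le n : h n ^+ 2 <= h n.
Proof. by rewrite expr2 ger_pMl. Qed.

(** A bounded function of [X] that is at most [X^2], converges to it, and has a mean known from the
    characteristic function: moments are derived from the latter alone. *)
Let sq n X w : R := 2 * (1 - cos (h n * X w)) / h n ^+ 2.

Let sq_cvg X w : sq n X w @[n --> \oo] --> X w ^+ 2.
Proof.
apply: (@cvg_harmonic_dist _ _ _ (2 * X w ^+ 4)) => n.
have hn := h_gt0 n; have := cos_taylor2_le (h n * X w); set y := h n * X w => H.
have -> : sq n X w - X w ^+ 2 = - (2 * (cos y - 1 + y ^+ 2 / 2)) / h n ^+ 2.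
  by rewrite /sq -/y /y; field; rewrite gt_eqF.
rewrite normrM normrN normrM (ger0_norm (ler0n _ 2)) normfV (ger0_norm (sqr_ge0 (h n))).
rewrite ler_pdivrMr ?exprn_gt0// -/(h n).
apply: le_trans (ler_wpM2l (ler0n _ 2) H) _.
have -> : 2 * y ^+ 4 = 2 * X w ^+ 4 * h n ^+ 2 * h n ^+ 2 by rewrite /y; ring.
rewrite ler_pM2r ?exprn_gt0//; apply: ler_wpM2l (h2_le n).
by rewrite mulr_ge0// exprn_even_ge0.
Qed.

Lemma gaussian_cos_bounded X v t al : centered_gaussian X v ->
  bounded_measurable (fun w => cos (t * X w + al)).
Proof.
move=> [mX _ _]; apply: bounded_measurable_cos; apply: measurable_funD => //.
by apply: measurable_funM.
Qed.

Let sq_bounded n X v : centered_gaussian X v -> bounded_measurable (sq n X).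
Proof.
move=> gX; have := gaussian_cos_bounded (h n) 0 gX.
have -> : sq n X = (fun w => - (2 / h n ^+ 2) * cos (h n * X w + 0) + 2 / h n ^+ 2).
  apply/funext => w; rewrite /sq addr0; ring.
move=> bc; apply: bounded_measurableD; last exact: bounded_measurable_cst.
by apply: bounded_measurableM => //; exact: bounded_measurable_cst.
Qed.

Let mean_sq n X v : centered_gaussian X v ->
  mean P (sq n X) = 2 * (1 - expR (- (h n ^+ 2 * v / 2))) / h n ^+ 2.
Proof.
move=> gX; have [mX v0 hX] := gX.
have -> : sq n X = (fun w => 2 / h n ^+ 2 * (1 - cos (h n * X w + 0))).
  apply/funext => w; rewrite /sq addr0; ring.
have ic := bounded_measurable_integrable P (gaussian_cos_bounded (h n) 0 gX).
have i1 := bounded_measurable_integrable P (bounded_measurable_cst (1 : R)).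
rewrite meanZ; last exact: (integrableB measurableT i1 ic).
by rewrite (meanB i1 ic) mean_cst hX cos0; ring.
Qed.

Let mean_sq_cvg X v : centered_gaussian X v -> mean P (sq n X) @[n --> \oo] --> v.
Proof.
move=> gX; have [mX v0 hX] := gX.
apply: (@cvg_harmonic_dist _ _ _ (v ^+ 2)) => n; rewrite (mean_sq n gX).
have hn := h_gt0 n; set q := h n ^+ 2 * v / 2.
have q0 : 0 <= q by rewrite divr_ge0// mulr_ge0// sqr_ge0.
have e1 := expR_ge1Dx (- q).
have e2 : expR (- q) <= 1 - q + q ^+ 2.
  rewrite expRN -div1r ler_pdivrMr ?expR_gt0//.
  have a1 := expR_ge1Dx q; have : 0 <= 1 - q + q ^+ 2.
    by have := sqr_ge0 (q - 2^-1); nra.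
  move=> a2; apply: le_trans (ler_wpM2l a2 a1).
  have q3 : 0 <= q ^+ 3 by exact: exprn_ge0.
  by have -> : (1 - q + q ^+ 2) * (1 + q) = 1 + q ^+ 3; [ring|lra].
have -> : 2 * (1 - expR (- q)) / h n ^+ 2 - v = - (2 * (expR (- q) - 1 + q) / h n ^+ 2).
  by rewrite /q; field; rewrite gt_eqF.
rewrite normrN normrM normrM (ger0_norm (ler0n _ 2)) normfV (ger0_norm (sqr_ge0 (h n))).
rewrite ler_pdivrMr ?exprn_gt0// ger0_norm -/(h n); last by lra.
apply: le_trans (_ : 2 * q ^+ 2 <= _); first by rewrite ler_wpM2l//; lra.
rewrite (_ : 2 * q ^+ 2 = v ^+ 2 * (h n ^+ 2 / 2) * h n ^+ 2); last by rewrite /q; field.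
rewrite ler_pM2r ?exprn_gt0//; apply: ler_wpM2l; first exact: sqr_ge0.
by have := h2_le n; have := sqr_ge0 (h n); lra.
Qed.

Let mX2 X : measurable_fun setT X -> measurable_fun setT (fun w => X w ^+ 2).
Proof. by move=> mX; exact: measurable_funX. Qed.

Lemma integral_mean X : P.-integrable setT (EFin \o X) ->
  (\int[P]_w (X w)%:E)%E = (mean P X)%:E.
Proof. by move=> iX; rewrite /mean /Rintegral fineK// integrable_fin_num. Qed.

Let sqE n X v : centered_gaussian X v ->
  (\int[P]_w (sq n X w)%:E)%E = (mean P (sq n X))%:E.
Proof.
move=> gX; apply: integral_mean; apply: bounded_measurable_integrable.
exact: sq_bounded gX.
Qed.

Let mean_sq_cvg_ereal X v : centered_gaussian X v ->
  (\int[P]_w (sq n X w)%:E)%E @[n --> \oo] --> v%:E.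
Proof.
move=> gX; under eq_fun do rewrite (sqE _ gX).
by apply: cvg_EFin; [exact: nearW|exact: mean_sq_cvg gX].
Qed.

(** Fatou's lemma along [sq n], whose means converge to [v]. *)
Lemma gaussian_square_integrable X v : centered_gaussian X v ->
  P.-integrable setT (EFin \o (fun w => X w ^+ 2)).
Proof.
move=> gX; have [mX v0 _] := gX.
apply/integrableP; split; first exact/measurable_EFinP/mX2.
under eq_integral do rewrite /= (ger0_norm (sqr_ge0 _)).
apply: (@le_lt_trans _ _ v%:E); last exact: ltry.
have mf n : measurable_fun setT (EFin \o sq n X).
  by apply/measurable_EFinP; have [] := sq_bounded n gX.
have := @fatou _ T R P setT measurableT (fun n => EFin \o sq n X) mf.
move=> /(_ _)/wrap[].
  move=> n x _; rewrite lee_fin /sq divr_ge0 ?sqr_ge0// mulr_ge0// subr_ge0 cos_le1.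
rewrite (cvg_limn_einf_sup (mean_sq_cvg_ereal gX)).1.
have lE w : limn_einf (fun n => (EFin \o sq n X) w) = (X w ^+ 2)%:E.
  apply: (cvg_limn_einf_sup _).1; apply: cvg_EFin; first exact: nearW.
  exact: sq_cvg.
by under eq_integral do rewrite lE.
Qed.

Lemma gaussian_integrable X v : centered_gaussian X v ->
  P.-integrable setT (EFin \o X).
Proof.
move=> gX; have [mX v0 _] := gX.
have i1 := bounded_measurable_integrable P (bounded_measurable_cst (1 : R)).
have i2 := integrableD measurableT i1 (gaussian_square_integrable gX).
apply: (le_integrable measurableT _ _ i2); first exact/measurable_EFinP.
move=> w _ /=; rewrite lee_fin; apply: le_trans (ler_norm _).
rewrite ler_norml; apply/andP; split.
- by have := sqr_ge0 (X w + 1); have := sqr_ge0 (X w); nra.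
- by have := sqr_ge0 (X w - 1); have := sqr_ge0 (X w); nra.
Qed.

(** Now that [X^2] is integrable it dominates every [sq n], and the limits may be exchanged. *)
Lemma gaussian_mean_sq X v : centered_gaussian X v -> mean P (fun w => X w ^+ 2) = v.
Proof.
move=> gX; have [mX v0 _] := gX.
have i2 := gaussian_square_integrable gX.
have mf n : measurable_fun setT (EFin \o sq n X).
  by apply/measurable_EFinP; have [] := sq_bounded n gX.
have c1 : (\int[P]_w (sq n X w)%:E)%E @[n --> \oo] --> (\int[P]_w (X w ^+ 2)%:E)%E.
  apply: (dominated_cvg measurableT mf _ _ i2) => //.
    by move=> w _; apply: cvg_EFin; [exact: nearW|exact: sq_cvg].
  move=> n w _ /=; rewrite lee_fin /sq normrM normfV (ger0_norm (sqr_ge0 _)).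
  rewrite ler_pdivrMr ?exprn_gt0// normrM distrC (ger0_norm (ler0n _ 2)).
  have := cos_sub1_le (h n * X w); rewrite exprMn; lra.
have : (\int[P]_w (X w ^+ 2)%:E)%E = v%:E.
  by apply: (cvg_unique (@ereal_hausdorff R) c1); exact: mean_sq_cvg_ereal gX.
by rewrite integral_mean// => -[].
Qed.

(** [sin (h X) / h] converges to [X] under the bound [|X|]; a sine is a cosine of phase [pi / 2], so
    its mean has the factor [cos (pi / 2) = 0]. *)
Lemma gaussian_mean X v : centered_gaussian X v -> mean P X = 0.
Proof.
move=> gX; have [mX v0 hX] := gX; have iX := gaussian_integrable gX.
pose f n w : R := - cos (h n * X w + pi / 2) / h n.
have fE n w : f n w = sin (h n * X w) / h n by rewrite /f cosDpihalf opprK.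
have bf n : bounded_measurable (f n).
  have -> : f n = (fun w => (- (h n)^-1) * cos (h n * X w + pi / 2)).
    by apply/funext => w; rewrite /f mulrC mulrN mulNr.
  apply: bounded_measurableM; first exact: bounded_measurable_cst.
  exact: gaussian_cos_bounded gX.
have mf n : measurable_fun setT (EFin \o f n).
  by apply/measurable_EFinP; have [] := bf n.
have c1 : (\int[P]_w (f n w)%:E)%E @[n --> \oo] --> (\int[P]_w (X w)%:E)%E.
  have iN := integrable_norm iX.
  apply: (dominated_cvg measurableT mf _ _ iN) => //.
    move=> w _; apply: cvg_EFin; first exact: nearW.
    apply: (@cvg_harmonic_dist _ _ _ (`|X w| ^+ 3)) => n /=; rewrite fE.
    have hn := h_gt0 n; have := sin_sub_le (h n * X w).
    have -> : sin (h n * X w) / h n - X w = (sin (h n * X w) - h n * X w) / h n.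
      by field; rewrite gt_eqF.
    move=> H; rewrite normrM normfV (gtr0_norm hn) ler_pdivrMr// -/(h n).
    apply: le_trans H _; rewrite normrM exprMn (gtr0_norm hn).
    rewrite [leLHS]mulrC -[leRHS]mulrA; apply: ler_wpM2l; first exact: exprn_ge0.
    by rewrite exprSr ler_pM2r// h2_le.
  move=> n w _ /=; rewrite lee_fin fE normrM normfV (gtr0_norm (h_gt0 n)).
  rewrite ler_pdivrMr//; apply: le_trans (norm_sin_le _) _.
  by rewrite normrM (gtr0_norm (h_gt0 n)) mulrC.
have c2 : (\int[P]_w (f n w)%:E)%E @[n --> \oo] --> 0%:E.
  have f0 n : (\int[P]_w (f n w)%:E)%E = 0%:E.
    rewrite integral_mean; last exact: bounded_measurable_integrable (bf n).
    have -> : f n = (fun w => (- (h n)^-1) * cos (h n * X w + pi / 2)).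
      by apply/funext => w; rewrite /f mulrC mulrN mulNr.
    rewrite meanZ ?hX ?cos_pihalf ?mulr0//.
    exact: bounded_measurable_integrable (gaussian_cos_bounded _ _ gX).
  by under eq_fun do rewrite f0; exact: cvg_cst.
have : (\int[P]_w (X w)%:E)%E = 0%:E.
  by apply: (cvg_unique (@ereal_hausdorff R) c1); exact: c2.
by rewrite integral_mean// => -[].
Qed.

End centered_gaussian.

Lemma centered_gaussian_law {d : measure_display} {T : measurableType d}
    {R : realType} (P : probability T R) (X : {RV P >-> R}) v :
  centered_gaussian P X v ->
  forall A, measurable A -> P (X @^-1` A) = gaussian_law 0 (Num.sqrt v) A.
Proof.
move=> [_ v0 hX] A mA; rewrite /gaussian_law sqrtr_eq0.
case: ifPn => [v0'|]; last rewrite -ltNge => vgt.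
  have ve : v = 0 by apply/eqP; rewrite eq_le v0'.
  have /(_ _ A mA) -> := @char_fun_law_eq _ _ T T R P P X (cst 0).
    rewrite preimage_cst/= /dirac indicE; case: ifPn => a0; first by rewrite probability_setT.
    by rewrite measure0.
  move=> t al; rewrite hX ve (_ : (fun w => _) = cst (cos al)).
    by rewrite mean_cst mulr0 mul0r oppr0 expR0 mul1r.
  by apply/funext => w /=; rewrite mulr0 add0r.
have s0 : Num.sqrt v != 0 by rewrite gt_eqF// sqrtr_gt0.
have mid : @measurable_fun _ _ (measurableTypeR R) R setT (fun x => x) by [].
have /(_ _ A mA) -> // := @char_fun_law_eq _ _ T (measurableTypeR R) R P
  (normal_prob 0 (Num.sqrt v)) X (@mfun_Sub _ _ (measurableTypeR R) R _ (mem_set mid)).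
move=> t al; rewrite hX.
by have := normal_charE s0 t al; rewrite /normal_char sqr_sqrtr// => ->.
Qed.

(** Independent standard normal variables, added one at a time on a product space; independence is
    recorded only through the joint characteristic function, which is what linear images need. *)
Lemma gaussian_sequence_exists {R : realType} (N : nat) :
  exists (d : measure_display) (T : measurableType d) (P : probability T R)
     (xi : 'I_N -> T -> R), (forall i, measurable_fun setT (xi i)) /\
   forall (c : 'I_N -> R) al,
    mean P (fun w => cos (\sum_i c i * xi i w + al)) =
    expR (- ((\sum_i c i ^+ 2) / 2)) * cos al.
Proof.
elim: N => [|N [d [T [P [xi [mxi hxi]]]]]].
  exists _, (measurableTypeR R), (normal_prob 0 1), (fun _ _ => 0); split=> // c al.
  under eq_fun do rewrite big_ord0 add0r.
  by rewrite mean_cst big_ord0 mul0r oppr0 expR0 mul1r.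
pose P' : probability _ R := (normal_prob (0 : R) 1 \x P)%E.
pose xi' (i : 'I_N.+1) (w : measurableTypeR R * T) : R :=
  if unlift ord0 i is Some j then xi j w.2 else w.1.
have mxi' i : measurable_fun setT (xi' i).
  rewrite /xi'; case: unliftP => [j _|_].
    by apply: (measurableT_comp (mxi j)); exact: measurable_snd.
  exact: measurable_fst.
exists _, _, P', xi'; split => // c al.
have xiE x w : \sum_i c i * xi' i (x, w) =
    c ord0 * x + \sum_(j < N) c (lift ord0 j) * xi j w.
  rewrite big_ord_recl /xi' unlift_none; congr (_ + _).
  by apply: eq_bigr => j _; rewrite liftK.
(* Adding 1 makes the integrand nonnegative, as Tonelli's theorem requires. *)
pose f (w : measurableTypeR R * T) : R := 1 + cos (\sum_i c i * xi' i w + al).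
have bc : bounded_measurable (fun w => cos (\sum_i c i * xi' i w + al)).
  by apply: bounded_measurable_cos; exact: (@measurable_linear _ _ R _ (fun w i => xi' i w)).
have bf : bounded_measurable f.
  by apply: bounded_measurableD bc; exact: bounded_measurable_cst.
have f0 w : (0 <= (f w)%:E)%E by rewrite lee_fin /f; have := cos_geN1 (\sum_i c i * xi' i w + al); lra.
have := @fubini_tonelli1 _ _ (measurableTypeR R) T R (normal_prob (0 : R) 1) P (EFin \o f).
move=> /(_ _ f0)/wrap[]; first by apply/measurable_EFinP; have [] := bf.
set s2 := \sum_(j < N) c (lift ord0 j) ^+ 2.
have FE x : fubini_F P (EFin \o f) x = (1 + expR (- (s2 / 2)) * cos (c ord0 * x + al))%:E.
  have bx : bounded_measurable (fun w => cos (\sum_(j < N) c (lift ord0 j) * xi j w + (c ord0 * x + al))).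
    by apply: bounded_measurable_cos; exact: (@measurable_linear _ _ R _ (fun w i => xi i w)).
  have b1 := bounded_measurable_cst (1 : R).
  rewrite /fubini_F.
  have -> : (fun w => (EFin \o f) (x, w)) = (fun w => (1 + cos (\sum_(j < N) c (lift ord0 j) * xi j w + (c ord0 * x + al)))%:E).
    by apply/funext => w; rewrite /f /= xiE addrCA addrA.
  rewrite integral_mean; last exact: (bounded_measurable_integrable P (bounded_measurableD (b1 _ _) bx)).
  rewrite meanD ?mean_cst ?hxi//; first exact: bounded_measurable_integrable (b1 _ _).
  exact: bounded_measurable_integrable bx.
have -> : (\int[normal_prob 0 1]_x fubini_F P (EFin \o f) x =
    \int[normal_prob 0 1]_x (1 + expR (- (s2 / 2)) * cos (c ord0 * x + al))%:E)%E.
  by apply: eq_integral => x _; exact: FE.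
have b1 := bounded_measurable_cst (1 : R).
rewrite (integral_mean (bounded_measurable_integrable P' bf)).
have bn : bounded_measurable (fun x : measurableTypeR R => cos (c ord0 * x + al)).
  apply: bounded_measurable_cos; apply: measurable_funD => //; exact: measurable_funM.
have bn' : bounded_measurable (fun x : measurableTypeR R => expR (- (s2 / 2)) * cos (c ord0 * x + al)).
  by apply: bounded_measurableM => //; exact: bounded_measurable_cst.
rewrite integral_mean; last first.
  exact: (bounded_measurable_integrable (normal_prob 0 1) (bounded_measurableD (b1 _ _) bn')).
move=> [].
rewrite /f meanD; last 2 first.
  exact: bounded_measurable_integrable (b1 _ _).
  exact: bounded_measurable_integrable bc.
rewrite meanD; last 2 first.
  exact: bounded_measurable_integrable (b1 _ _).
  exact: bounded_measurable_integrable bn'.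
rewrite !mean_cst => /addrI ->; rewrite meanZ; last exact: bounded_measurable_integrable bn.
have := @normal_charE R 1 (oner_neq0 _) (c ord0) al; rewrite /normal_char => ->.
rewrite big_ord_recl mulrA -expRD expr1n mulr1; congr (expR _ * _).
by rewrite mulrDl opprD addrC.
Qed.

(** The covariance is prescribed through a factor [L], so that its positivity is built in and no
    matrix square root is extracted. In the application [I] is the set of transitions. *)
Lemma gaussian_family_exists {R : realType} (I J : finType) (L : J -> I -> R) :
  exists (d : measure_display) (T : measurableType d) (P : probability T R)
     (G : J -> {RV P >-> R}),
   forall t : J -> R, centered_gaussian P (fun w => \sum_j t j * G j w)
     (\sum_i (\sum_j t j * L j i) ^+ 2).
Proof.
have [d [T [P [xi [mxi hxi]]]]] := @gaussian_sequence_exists R #|I|.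
pose g j w := \sum_i L j i * xi (enum_rank i) w.
have mg j : measurable_fun setT (g j).
  by apply: measurable_sum => i; exact: measurable_funM.
exists d, T, P, (fun j => mfun_Sub (mem_set (mg j))) => t.
split.
- by apply: measurable_sum => j; exact: measurable_funM.
- by apply: sumr_ge0 => i _; exact: sqr_ge0.
- move=> u al /=; pose c (k : 'I_#|I|) := u * \sum_j t j * L j (enum_val k).
  have -> : (fun w => cos (u * (\sum_j t j * g j w) + al)) =
      (fun w => cos (\sum_k c k * xi k w + al)).
    apply/funext => w; congr (cos (_ + _)).
    transitivity (\sum_i (u * (\sum_j t j * L j i)) * xi (enum_rank i) w).
      rewrite mulr_sumr; under eq_bigr do rewrite /g !mulr_sumr.
      rewrite exchange_big/=; apply: eq_bigr => i _.
      by rewrite mulr_sumr mulr_suml; apply: eq_bigr => j _; rewrite !mulrA.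
    rewrite (reindex (@enum_val I xpredT)) /=; last first.
      by apply: onW_bij; exact: enum_val_bij.
    by apply: eq_bigr => k _; rewrite /c enum_valK.
  rewrite hxi; congr (expR (- _) * _); rewrite -[_ ^+ 2 * _ / 2]mulrA mulrA.
  congr (_ / 2); rewrite mulr_sumr (reindex (@enum_val I xpredT)) /=; last first.
    by apply: onW_bij; exact: enum_val_bij.
  by apply: eq_bigr => k _; rewrite /c exprMn.
Qed.

Lemma cvg_sum {R : realType} {T : Type} (F : set_system T) {FF : Filter F}
    (I : Type) (s : seq I) (f : I -> T -> R) (l : I -> R) :
  (forall i, f i x @[x --> F] --> l i) ->
  \sum_(i <- s) f i x @[x --> F] --> \sum_(i <- s) l i.
Proof.
move=> h; elim: s => [|i s IH].
  by under eq_fun do rewrite big_nil; rewrite big_nil; exact: cvg_cst.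
by under eq_fun do rewrite big_cons; rewrite big_cons; exact: cvgD.
Qed.

(** * Convergence in distribution *)

Section capped_distance.
Context {R : realType} {J : finType}.
Implicit Types (x y : R) (z : J -> R).

(** Its expectation metrizes convergence in probability, and is defined without any moment
    condition. *)
Definition cap x := Num.min 1 `|x|.

Lemma cap_ge0 x : 0 <= cap x. Proof. by rewrite le_min ler01 normr_ge0. Qed.

Lemma cap_le x : cap x <= `|x|. Proof. by rewrite ge_min lexx orbT. Qed.

Lemma cap0 : cap 0 = 0. Proof. by rewrite /cap normr0 min_r. Qed.

Lemma cap1 x : 1 <= `|x| -> cap x = 1. Proof. by move=> h; rewrite /cap min_l. Qed.

Lemma sum_cap_ge1 z j : 1 <= `|z j| -> 1 <= \sum_j cap (z j).
Proof.
move=> h; rewrite (bigD1 j)//= cap1// lerDl; apply: sumr_ge0 => i _; exact: cap_ge0.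
Qed.

(** A cosine of a linear form is both bounded and Lipschitz: the bound is used when some coordinate
    moves by 1 or more, the Lipschitz constant otherwise. *)
Lemma trigpoly_cap (p : (J -> R) -> R) : trigpoly p ->
  exists2 C, 0 <= C & forall z z', `|p z - p z'| <= C * \sum_j cap (z j - z' j).
Proof.
elim=> {p} [t al|c g h _ [C C0 hC] _ [D D0 hD]].
  have S0 : 0 <= \sum_j `|t j| by apply: sumr_ge0.
  exists (2 + \sum_j `|t j|); first by rewrite addr_ge0.
  move=> z z'; have c0 : 0 <= \sum_j cap (z j - z' j).
    by apply: sumr_ge0 => j _; exact: cap_ge0.
  have [[j hj]|small] := pselect (exists j, 1 <= `|z j - z' j|).
    apply: le_trans (_ : 2 <= _).
      apply: le_trans (ler_normB _ _) _.
      have := @cos_max R (\sum_i t i * z i + al).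
      by have := @cos_max R (\sum_i t i * z' i + al); lra.
    have := @sum_cap_ge1 (fun j => z j - z' j) j hj; nra.
  have cE j : cap (z j - z' j) = `|z j - z' j|.
    rewrite /cap min_r// leNgt; apply/negP => /ltW hj; apply: small.
    by exists j.
  apply: le_trans (cos_lipschitz _ _) _.
  rewrite opprD addrACA subrr addr0 -sumrB mulrDl.
  apply: le_trans (ler_norm_sum _ _ _) _.
  apply: (@le_trans _ _ ((\sum_j `|t j|) * \sum_j cap (z j - z' j))); last by lra.
  rewrite mulr_suml; apply: ler_sum => j _.
  rewrite -mulrBr normrM -cE ler_wpM2l// (bigD1 j)//= lerDl.
  by apply: sumr_ge0 => i _; exact: cap_ge0.
exists (`|c| * C + D); first by rewrite addr_ge0// mulr_ge0.
move=> z z'.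
have -> : c * g z + h z - (c * g z' + h z') = c * (g z - g z') + (h z - h z').
  by ring.
apply: le_trans (ler_normD _ _) _; rewrite normrM mulrDl -mulrA.
by apply: lerD (hD z z'); apply: ler_wpM2l.
Qed.

(** If [z] leaves the cube of radius [L + 1], then either [z'] has a coordinate of size at least
    [L], or [z] and [z'] differ by at least 1 in some coordinate; one of the two penalties is then
    at least 1. *)
Lemma approx_cap (f p : (J -> R) -> R) (B L e : R) : 0 < L -> 0 <= e ->
  (forall z, `|f z| <= B) -> (forall z, `|p z| <= B) ->
  (forall z, (forall j, `|z j| <= L + 1) -> `|f z - p z| <= e) ->
  forall z z', `|f z - p z| <=
    e + 2 * B * (L ^- 2 * (\sum_j z' j ^+ 2) + \sum_j cap (z j - z' j)).
Proof.
move=> L0 e0 hf hp happ z z'.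
have c0 : 0 <= \sum_j cap (z j - z' j).
  by apply: sumr_ge0 => j _; exact: cap_ge0.
have s0 : 0 <= L ^- 2 * (\sum_j z' j ^+ 2).
  rewrite mulr_ge0 ?invr_ge0 ?exprn_ge0 ?(ltW L0)//.
  by apply: sumr_ge0 => j _; exact: sqr_ge0.
have B0 : 0 <= B by apply: le_trans (hf z).
have B2 : `|f z - p z| <= 2 * B.
  by apply: le_trans (ler_normB _ _) _; have := hf z; have := hp z; lra.
have [small|] := pselect (forall j, `|z j| <= L + 1).
  by apply: le_trans (happ z small) _; rewrite lerDl mulr_ge0 ?mulr_ge0 ?addr_ge0.
move=> /existsNP[j /negP]; rewrite -ltNge => big.
suff : 1 <= L ^- 2 * (\sum_j z' j ^+ 2) + \sum_j cap (z j - z' j).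
  move: s0 c0 B0 B2 e0; move: (`|f z - p z|) (L ^- 2 * _) (\sum_j cap _) => u s c.
  by move=> *; nra.
have [h|h] := leP 1 `|z j - z' j|.
  by have := @sum_cap_ge1 (fun j => z j - z' j) j h; lra.
have hz : L <= `|z' j|.
  by have := ler_normD (z j - z' j) (z' j); rewrite subrK; lra.
have : 1 <= L ^- 2 * z' j ^+ 2.
  rewrite mulrC ler_pdivlMr ?exprn_gt0// mul1r -(real_normK (num_real (z' j))).
  by rewrite lerXn2r ?nnegrE ?normr_ge0// ltW.
have : L ^- 2 * z' j ^+ 2 <= L ^- 2 * (\sum_j z' j ^+ 2).
  rewrite ler_wpM2l ?invr_ge0 ?exprn_ge0 ?(ltW L0)// (bigD1 j)//= lerDl.
  by apply: sumr_ge0 => i _; exact: sqr_ge0.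
lra.
Qed.

End capped_distance.

Lemma mean_sum {d : measure_display} {T : measurableType d} {R : realType}
    (P : probability T R) (I : Type) (s : seq I) (f : I -> T -> R) :
  (forall i, P.-integrable setT (EFin \o f i)) ->
  P.-integrable setT (EFin \o (fun w => \sum_(i <- s) f i w)) /\
  mean P (fun w => \sum_(i <- s) f i w) = \sum_(i <- s) mean P (f i).
Proof.
move=> h; elim: s => [|i s [IH1 IH2]].
  have -> : (fun w => \sum_(i <- [::]) f i w) = (fun=> 0).
    by apply/funext => w; rewrite big_nil.
  rewrite mean_cst big_nil; split=> //.
  exact: bounded_measurable_integrable (bounded_measurable_cst 0).
have -> : (fun w => \sum_(j <- i :: s) f j w) = (fun w => f i w + \sum_(j <- s) f j w).
  by apply/funext => w; rewrite big_cons.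
rewrite meanD// big_cons IH2; split=> //.
exact: (integrableD measurableT (h i) IH1).
Qed.

Section convergence_criterion.
Context {R : realType} {J : finType}.
Context {d : measure_display} {T : measurableType d} (P : probability T R).
Variable G : T -> J -> R.
Hypothesis mG : forall j, measurable_fun setT (fun w => G w j).
Hypothesis G2 : forall j, P.-integrable setT (EFin \o (fun w => G w j ^+ 2)).
Variables (Omega : nat -> finType) (pr : forall n, Omega n -> R).
Hypothesis pr_ge0 : forall n w, 0 <= @pr n w.
Hypothesis pr_sum1 : forall n, \sum_w @pr n w = 1.
Variables z z' : forall n, Omega n -> J -> R.
Variable C : R.
Hypothesis z'_sq : \forall n \near \oo, forall j, Ex (@pr n) (fun w => @z' n w j ^+ 2) <= C.
Hypothesis z_z' : forall j,
  Ex (@pr n) (fun w => cap (@z n w j - @z' n w j)) @[n --> \oo] --> (0 : R).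
Hypothesis z'_cos : forall (t : J -> R) al,
  Ex (@pr n) (fun w => cos (\sum_j t j * @z' n w j + al)) @[n --> \oo] -->
  mean P (fun w => cos (\sum_j t j * G w j + al)).

Lemma cvg_Ex_trigpoly p : trigpoly p ->
  Ex (@pr n) (fun w => p (@z' n w)) @[n --> \oo] --> mean P (fun w => p (G w)).
Proof.
elim=> {p} [t al|c g h hg IHg hh IHh]; first exact: z'_cos.
under eq_fun do rewrite ExD ExZ.
have bg := bounded_measurable_integrable P (trigpoly_bounded_measurable mG hg).
have bh := bounded_measurable_integrable P (trigpoly_bounded_measurable mG hh).
rewrite meanD//; last by have := integrableZl measurableT c bg; apply: eq_integrable.
by rewrite meanZ//; apply: cvgD => //; exact: cvgMl_tmp.
Qed.

Let sum_cap_cvg : \sum_j Ex (@pr n) (fun w => cap (@z n w j - @z' n w j)) @[n --> \oo] --> (0 : R).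
Proof.
have := @cvg_sum R nat \oo _ J (index_enum J)
  (fun j n => Ex (@pr n) (fun w => cap (@z n w j - @z' n w j))) (fun=> 0) z_z'.
by move=> /(_ _); rewrite [X in _ --> X]big1//; apply.
Qed.

(** Tightness is taken from the second moments of the approximation [z']; about [z] only the capped
    distance to [z'] is known. On a large cube [f] is a trigonometric polynomial up to a small
    error, and for those the convergence holds by linearity. *)
Lemma cvg_Ex_continuous (f : {ptws J -> R} -> R) (B : R) :
  continuous f -> (forall v, `|f v| <= B) ->
  Ex (@pr n) (fun w => f (@z n w)) @[n --> \oo] --> mean P (fun w => f (G w)).
Proof.
move=> cf hB; apply/cvgrPdist_le => e e0.
have B0 : 0 <= B by exact: le_trans (hB (fun=> 0)).
have C0 : 0 <= `|C| by [].
pose M := \sum_j mean P (fun w => G w j ^+ 2) + #|J|%:R * `|C|.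
have mean0 j : 0 <= mean P (fun w => G w j ^+ 2).
  have h0 : P.-integrable setT (EFin \o (fun _ : T => 0 : R)).
    exact: bounded_measurable_integrable (bounded_measurable_cst 0).
  by rewrite -[leLHS](mean_cst P); apply: ler_mean => // w; exact: sqr_ge0.
have M0 : 0 <= M.
  by rewrite addr_ge0 ?mulr_ge0//; apply: sumr_ge0.
(* The square of the truncation level, such that the Chebyshev term [2 B M / L2] is at most [e / 8];
   the [+ 1] keeps it positive when [B] or [M] is 0. *)
pose L2 := 2 * B * M * (8 / e) + 1.
have L20 : 0 < L2 by rewrite ltr_wpDl// !mulr_ge0// invr_ge0 ltW.
pose L := Num.sqrt L2; have L0 : 0 < L by rewrite sqrtr_gt0.
have LE : L ^- 2 = L2^-1 by rewrite sqr_sqrtr// ltW.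
have hL : 2 * B * (L ^- 2 * M) <= e / 8.
  rewrite LE mulrCA mulrC ler_pdivrMr//.
  have -> : e / 8 * L2 = 2 * B * M + e / 8 by rewrite /L2; field; rewrite gt_eqF.
  by rewrite lerDl divr_ge0// ltW.
have e8 : 0 < e / 8 by rewrite divr_gt0.
have [p [tp pB happ]] := trigpoly_approx cf hB (ltr_wpDl ler01 L0 : 0 < 1 + L) e8.
rewrite addrC in happ.
have [D D0 hD] := trigpoly_cap tp.
have bnd := approx_cap L0 (ltW e8) hB pB happ.
have c1 : D * (\sum_j Ex (@pr n) (fun w => cap (@z n w j - @z' n w j))) @[n --> \oo] --> (0 : R).
  by rewrite -[X in _ --> X](mulr0 D); exact: cvgMl_tmp.
have c2 : 2 * B * (\sum_j Ex (@pr n) (fun w => cap (@z n w j - @z' n w j))) @[n --> \oo] --> (0 : R).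
  by rewrite -[X in _ --> X](mulr0 (2 * B)); exact: cvgMl_tmp.
move/cvgrPdist_le : c1 => /(_ _ e8) c1.
move/cvgrPdist_le : c2 => /(_ _ e8) c2.
have := cvg_Ex_trigpoly tp; move/cvgrPdist_le => /(_ _ e8) c3.
have fG : bounded_measurable (fun w => f (G w)) by exact: (continuous_bounded_measurable mG cf hB).
have pG := trigpoly_bounded_measurable mG tp.
have ifG := bounded_measurable_integrable P fG.
have ipG := bounded_measurable_integrable P pG.
have limit_bound : `|mean P (fun w => f (G w)) - mean P (fun w => p (G w))| <= e / 4.
  rewrite -meanB//; have iB := integrableB measurableT ifG ipG.
  apply: le_trans (ler_norm_mean iB) _.
  pose g w := e / 8 + 2 * B * L ^- 2 * (\sum_j G w j ^+ 2).
  have [iS mS] := mean_sum (index_enum J) G2.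
  have i1 := bounded_measurable_integrable P (bounded_measurable_cst (e / 8)).
  have i2 : P.-integrable setT (EFin \o (fun w => 2 * B * L ^- 2 * (\sum_j G w j ^+ 2))).
    by have := integrableZl measurableT (2 * B * L ^- 2) iS; apply: eq_integrable.
  have ig : P.-integrable setT (EFin \o g) by exact: (integrableD measurableT i1 i2).
  apply: (@le_trans _ _ (mean P g)).
    apply: ler_mean => //; first exact: (@integrable_norm _ _ _ P setT (fun w => f (G w) - p (G w))).
    move=> w; apply: le_trans (bnd (G w) (G w)) _.
    rewrite [X in _ * (_ + X)]big1 ?addr0 /g ?mulrA// => j _.
    by rewrite subrr cap0.
  rewrite meanD// mean_cst meanZ// -mulrA.
  rewrite mS.
  have : 2 * B * (L ^- 2 * \sum_j mean P (fun w => G w j ^+ 2)) <= 2 * B * (L ^- 2 * M).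
    apply: ler_wpM2l; first exact: mulr_ge0.
    by apply: ler_wpM2l; [rewrite LE invr_ge0 ltW|rewrite lerDl mulr_ge0].
  lra.
near=> n.
have Ez : Ex (@pr n) (fun w => \sum_j @z' n w j ^+ 2) <= M.
  rewrite Ex_sum; apply: (@le_trans _ _ (\sum_(j : J) `|C|)).
    apply: ler_sum => j _; apply: le_trans (ler_norm C).
    by move: j; near: n.
  by rewrite sumr_const -[_ *+ _]mulr_natl lerDr; apply: sumr_ge0.
have b1 : `|Ex (@pr n) (fun w => f (@z n w)) - Ex (@pr n) (fun w => p (@z n w))| <= e / 8 + e / 8 + e / 8.
  rewrite -ExB; apply: le_trans (ler_norm_Ex (@pr_ge0 n) _) _.
  apply: le_trans (ler_Ex (@pr_ge0 n) (fun w => bnd (@z n w) (@z' n w))) _.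
  rewrite ExD ExZ ExD (ExZ _ (L ^- 2)) (Ex_cst (@pr_sum1 n)) (Ex_sum _ _ (fun j w => cap (@z n w j - @z' n w j))).
  have : 2 * B * (L ^- 2 * Ex (@pr n) (fun w => \sum_j @z' n w j ^+ 2)) <= 2 * B * (L ^- 2 * M).
    apply: ler_wpM2l; first exact: mulr_ge0.
    by apply: ler_wpM2l => //; rewrite LE invr_ge0 ltW.
  have : 2 * B * (\sum_j Ex (@pr n) (fun w => cap (@z n w j - @z' n w j))) <= e / 8.
    have : `|0 - 2 * B * (\sum_j Ex (@pr n) (fun w => cap (@z n w j - @z' n w j)))| <= e / 8 by near: n.
    by rewrite sub0r normrN; apply: le_trans (ler_norm _).
  lra.
have b2 : `|Ex (@pr n) (fun w => p (@z n w)) - Ex (@pr n) (fun w => p (@z' n w))| <= e / 8.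
  rewrite -ExB; apply: le_trans (ler_norm_Ex (@pr_ge0 n) _) _.
  apply: le_trans (ler_Ex (@pr_ge0 n) (fun w => hD (@z n w) (@z' n w))) _.
  rewrite ExZ (Ex_sum _ _ (fun j w => cap (@z n w j - @z' n w j))).
  have : `|0 - D * (\sum_j Ex (@pr n) (fun w => cap (@z n w j - @z' n w j)))| <= e / 8 by near: n.
  by rewrite sub0r normrN; apply: le_trans (ler_norm _).
have b3 : `|mean P (fun w => p (G w)) - Ex (@pr n) (fun w => p (@z' n w))| <= e / 8 by near: n.
move: limit_bound b1 b2 b3.
move: (mean P (fun w => f (G w))) (mean P (fun w => p (G w))) (Ex _ _) (Ex _ _) (Ex _ _).
move=> mf mp r q s; rewrite !ler_norml => /andP[? ?] /andP[? ?] /andP[? ?] /andP[? ?].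
by apply/andP; split; lra.
Unshelve. all: by end_near.
Qed.

End convergence_criterion.

Section gaussian_limits.
Context {R : realType} {J K : finType} (L : J -> K -> R).
Context {d : measure_display} {T : measurableType d} (P : probability T R).
Variables (Omega : nat -> finType) (pr : forall n, Omega n -> R).
Hypothesis pr_ge0 : forall n w, 0 <= @pr n w.
Hypothesis pr_sum1 : forall n, \sum_w @pr n w = 1.
Variable path : forall n, T -> Omega n.
Hypothesis path_law : forall n (F : Omega n -> R),
  'E_P[fun w => F (path n w)]%E = (Ex (@pr n) F)%:E.
Variables z z' : forall n, Omega n -> J -> R.
Variable C : R.
Hypothesis z'_sq : \forall n \near \oo, forall j, Ex (@pr n) (fun w => @z' n w j ^+ 2) <= C.
Hypothesis z_z' : forall j,
  Ex (@pr n) (fun w => cap (@z n w j - @z' n w j)) @[n --> \oo] --> (0 : R).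
Hypothesis z'_cos : forall (t : J -> R) al,
  Ex (@pr n) (fun w => cos (\sum_j t j * @z' n w j + al)) @[n --> \oo] -->
  expR (- ((\sum_k (\sum_j t j * L j k) ^+ 2) / 2)) * cos al.

Lemma gaussian_limit (Z : nat -> T -> J -> R) (S : J -> J -> R) :
  (forall i j, S i j = \sum_k L i k * L j k) ->
  (forall n w, (1 <= n)%N -> Z n w = @z n (path n w)) ->
  asymptotically_gaussian P Z S.
Proof.
move=> SE ZE.
have [d' [T' [P' [G gG]]]] := @gaussian_family_exists R K J L.
have gi i : centered_gaussian P' (G i) (\sum_k L i k ^+ 2).
  have := gG (fun j => (i == j)%:R).
  have -> : (fun w => \sum_j (i == j)%:R * G j w) = G i.
    by apply/funext => w; rewrite sum_delta.
  by under eq_bigr do rewrite sum_delta.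
have gij i j (s : R) : centered_gaussian P' (fun w => G i w + s * G j w)
    (\sum_k (L i k + s * L j k) ^+ 2).
  have := gG (fun l => (i == l)%:R + s * (j == l)%:R).
  have eS (f : J -> R) : \sum_l ((i == l)%:R + s * (j == l)%:R) * f l = f i + s * f j.
    under eq_bigr do rewrite mulrDl -mulrA.
    by rewrite big_split/= -mulr_sumr !sum_delta.
  have -> : (fun w => \sum_l ((i == l)%:R + s * (j == l)%:R) * G l w) =
     (fun w => G i w + s * G j w) by apply/funext => w; exact: eS.
  by under eq_bigr do rewrite eS.
have mG i : measurable_fun setT (G i) by [].
exists d', T', P', G; split.
- move=> t; exists 0, (Num.sqrt (\sum_k (\sum_j t j * L j k) ^+ 2)) => A mA.
  have [mt _ _] := gG t.
  by have := @centered_gaussian_law _ _ _ P' (mfun_Sub (mem_set mt)) _ (gG t) A mA.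
- move=> i; rewrite expectation_mean; last exact: gaussian_integrable (gi i).
  by rewrite (gaussian_mean (gi i)).
- move=> i j; rewrite unlock !(expectation_mean (gaussian_integrable (gi _))) !(gaussian_mean (gi _)) /=.
  (* Polarization: the covariance is a quarter of the difference of the variances of [G i + G j] and
     [G i - G j], both known. *)
  have i1 := gaussian_square_integrable (gij i j 1).
  have i2 := gaussian_square_integrable (gij i j (-1)).
  have i3 := integrableZl measurableT (4^-1) (integrableB measurableT i1 i2).
  have pE : ((G i \- cst 0) * (G j \- cst 0))%R =
    (fun w => 4^-1 * ((G i w + 1 * G j w) ^+ 2 - (G i w + -1 * G j w) ^+ 2)).
    apply/funext => w; transitivity ((G i w - 0) * (G j w - 0)); first by [].
    by rewrite !subr0; field.
  rewrite pE expectation_mean; last by apply: eq_integrable i3.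
  congr (_%:E); rewrite meanZ; last by apply: eq_integrable (integrableB measurableT i1 i2).
  rewrite (meanB i1 i2) !(gaussian_mean_sq (gij _ _ _)) SE.
  rewrite -sumrB mulr_sumr; by apply: eq_bigr => k _; field.
- move=> f cf [B hB].
  have := @cvg_Ex_continuous R J _ _ P' (fun w j => G j w) mG
    (fun j => gaussian_square_integrable (gi j)) Omega pr pr_ge0 pr_sum1 z z' C z'_sq z_z' _ f B cf hB.
  move=> /(_ _)/wrap[].
    move=> t al; have [_ _ ht] := gG t.
    have -> : mean P' (fun w => cos (\sum_j t j * G j w + al)) =
      expR (- ((\sum_k (\sum_j t j * L j k) ^+ 2) / 2)) * cos al.
      have := ht 1 al; rewrite expr1n mul1r => <-.
      by congr (mean P' _); apply/funext => w; rewrite mul1r.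
    exact: z'_cos.
  move=> H; rewrite expectation_mean; last first.
    exact/bounded_measurable_integrable/(continuous_bounded_measurable _ cf hB).
  have HE : (Ex (@pr n) (fun w => f (@z n w)))%:E @[n --> \oo] -->
      (mean P' (fun w => f (fun i => G i w)))%:E.
    by apply: cvg_EFin H; exact: nearW.
  apply: cvg_trans HE; apply: near_eq_cvg; near=> n.
  have n1 : (1 <= n)%N by near: n; exact: nbhs_infty_ge.
  rewrite -(path_law (fun w => f (@z n w))); congr expectation; apply/funext => w.
  by rewrite ZE.
Unshelve. all: by end_near.
Qed.

End gaussian_limits.

Definition path_of {E : finType} {T : Type} (N : nat) (Y : int -> T -> E) (w : T) :
  {ffun 'I_N.+1 -> E} := [ffun i : 'I_N.+1 => Y (i : nat)%:Z w].

(** [inord] allows a plain [nat] as time, meaningful for [k <= N]. *)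
Definition coordinate {E : finType} (N k : nat) (s : {ffun 'I_N.+1 -> E}) : E :=
  s (inord k).

Definition path_prob {R : realType} {E : finType} {d : measure_display}
    {T : measurableType d} (P : probability T R) (N : nat) (Y : int -> T -> E)
    (s : {ffun 'I_N.+1 -> E}) : R := fine (P [set w | path_of N Y w = s]).

Lemma coordinate_path {E : finType} {T : Type} (N k : nat) (Y : int -> T -> E) w :
  (k <= N)%N -> coordinate k (path_of N Y w) = Y k%:Z w.
Proof. by move=> kN; rewrite /coordinate ffunE inordK. Qed.

(** * Rows of the array *)

Section path_space.
Context {R : realType} {E : finType} {d : measure_display} {T : measurableType d}.
Variables (P : probability T R) (N : nat) (Y : int -> T -> E).
Hypothesis mY : forall k : int, k <= N%:Z -> forall x, measurable [set w | Y k w = x].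
Local Notation pth := (path_of N Y).
Local Notation pr := (@path_prob R E d T P N Y).

Lemma measurable_path s : measurable [set w | pth w = s].
Proof.
have -> : [set w | pth w = s] =
    \bigcap_(i in [set: 'I_N.+1]) [set w | Y (i : nat)%:Z w = s i].
  apply/seteqP; split=> w /=; first by move=> <- i _ /=; rewrite ffunE.
  by move=> h; apply/ffunP => i; rewrite ffunE; exact: h.
apply: fin_bigcap_measurable; first exact: finite_finset.
by move=> i _; apply: mY; rewrite lez_nat -ltnS.
Qed.

Lemma path_prob_ge0 s : 0 <= pr s.
Proof. by rewrite /path_prob fine_ge0. Qed.

Lemma path_indicator (F : {ffun 'I_N.+1 -> E} -> R) w :
  F (pth w) = \sum_s F s * \1_[set w | pth w = s] w.
Proof.
rewrite -[LHS](sum_delta F); apply: eq_bigr => s _; rewrite mulrC; congr (_ * _).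
rewrite indicE; congr (_%:R); congr (nat_of_bool _); apply/eqP/idP => [h|].
  by rewrite inE.
by rewrite inE.
Qed.

Let iI s : P.-integrable setT (EFin \o (\1_[set w | pth w = s] : T -> R)).
Proof.
apply: bounded_measurable_integrable; split.
  by apply: measurable_indic; exact: measurable_path.
by exists 1 => w; rewrite indicE ger0_norm ?ler0n// lern1 leq_b1.
Qed.

Lemma path_expectation (F : {ffun 'I_N.+1 -> E} -> R) :
  'E_P[fun w => F (pth w)]%E = (Ex pr F)%:E.
Proof.
have -> : (fun w => F (pth w)) = (fun w => \sum_s F s * \1_[set w | pth w = s] w).
  by apply/funext => w; exact: path_indicator.
have iF s : P.-integrable setT (EFin \o (fun w => F s * \1_[set w | pth w = s] w)).
  by have := integrableZl measurableT (F s) (iI s); apply: eq_integrable.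
have [i1 i2] := mean_sum (index_enum _) iF.
rewrite expectation_mean// i2; congr (_%:E); apply: eq_bigr => s _.
by rewrite (meanZ _ (iI s)) (mean_indic _ (measurable_path s)) [LHS]mulrC.
Qed.

Lemma path_prob_sum1 : \sum_s pr s = 1.
Proof.
have := path_expectation (fun=> 1); rewrite expectation_cst => -[].
by rewrite /Ex; under [X in _ = X -> _]eq_bigr do rewrite mulr1.
Qed.

Lemma path_event (B : pred {ffun 'I_N.+1 -> E}) :
  P [set w | B (pth w)] = (Ex pr (fun s => (B s)%:R))%:E.
Proof.
have mB : measurable [set w | B (pth w)].
  have -> : [set w | B (pth w)] = \bigcup_(s in [set s | B s]) [set w | pth w = s].
    apply/seteqP; split=> w /=; first by move=> h; exists (pth w).
    by move=> [s /= Bs ->].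
  apply: fin_bigcup_measurable; first exact: finite_finset.
  by move=> s _; exact: measurable_path.
rewrite -path_expectation -expectation_indic//; congr expectation.
apply/funext => w; rewrite indicE; congr (_%:R); congr (nat_of_bool _).
by apply/idP/idP; rewrite inE.
Qed.

Variable Q : R -> E -> E -> R.
Hypothesis row : row_markov_chain P Q N Y.

Let agree k (s s' : {ffun 'I_N.+1 -> E}) :=
  [forall i : 'I_N.+1, (i <= k)%N ==> (s i == s' i)].

Let agree_markov k (s : {ffun 'I_N.+1 -> E}) y : (k < N)%N ->
  Ex pr (fun s' => (agree k s' s)%:R * (coordinate k.+1 s' == y)%:R) =
  Ex pr (fun s' => (agree k s' s)%:R) * triangular_transition Q N k.+1 (coordinate k s) y.
Proof.
move=> kN; have [_ hrow] := row.
(* The hypothesis lists the past backwards from time [k]; with [m = k] it reaches exactly time 0. *)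
have := hrow k.+1%:Z _ k (fun j => coordinate (k - j) s) y.
rewrite lez_nat => /(_ kN).
set past := [set w | _].
have pastE : past = [set w | agree k (pth w) s].
  apply/seteqP; split=> w /= h.
    apply/forallP => i; apply/implyP => ik; rewrite ffunE.
    have := h (k - i)%N (leq_subr _ _); rewrite /coordinate subKn// inord_val => <-.
    by apply/eqP; congr (Y _ w); lia.
  move=> j jk; have kj : (k - j < N.+1)%N by lia.
  have /forallP/(_ (Ordinal kj))/implyP/(_ (leq_subr _ _))/eqP := h.
  rewrite ffunE /= => e; rewrite /coordinate.
  have -> : inord (k - j) = Ordinal kj :> 'I_N.+1 by apply: val_inj; rewrite /= inordK.
  by rewrite -e; congr (Y _ w); lia.
cbv zeta.
have -> : [set w | Y k.+1%:Z w = y] `&` past =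
    [set w | (agree k (pth w) s) && (coordinate k.+1 (pth w) == y)].
  apply/seteqP; split=> w /=.
    by move=> [h1]; rewrite pastE/= => ->; rewrite coordinate_path// h1 eqxx.
  by move=> /andP[h1]; rewrite coordinate_path// => /eqP h2; rewrite pastE.
rewrite pastE (path_event (fun s' => agree k s' s)).
rewrite (path_event (fun s' => agree k s' s && (coordinate k.+1 s' == y))) -EFinM.
move=> [] e.
transitivity (Ex pr (fun s' => (agree k s' s && (coordinate k.+1 s' == y))%:R)).
  by apply: eq_Ex => s'; rewrite -natrM mulnb.
by rewrite e subn0 /triangular_transition (minn_idPl kN) -pmulrn.
Qed.

(** A canonical representative of the paths that agree with [s] up to time [k]. *)
Let trunc (e0 : E) k (s : {ffun 'I_N.+1 -> E}) : {ffun 'I_N.+1 -> E} :=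
  [ffun i : 'I_N.+1 => if (i <= k)%N then s i else e0].

(** An adapted [Z] is a combination of indicators of pasts, indexed by the truncated paths; on each
    of them the Markov property is the one assumed of the row. *)
Lemma path_markov :
  markov_property pr (@coordinate E N) (triangular_transition Q N) N.
Proof.
move=> k kN Z aZ y.
have Zc e0 s : Z (trunc e0 k s) = Z s.
  apply: aZ => j jk; rewrite /coordinate ffunE inordK ?jk//.
  by apply: leq_trans (leqW kN); rewrite ltnS.
have [e0] : exists e0 : E, True.
  by have [w _] : [set: T] !=set0; [apply/set0P/negP => /eqP T0;
    have := @probability_setT _ T R P; rewrite T0 measure0 => -[] /eqP;
    rewrite eq_sym oner_eq0|exists (Y 0 w)].
move=> _; have trE s s' : (trunc e0 k s' == s)%:R = (trunc e0 k s == s)%:R * (agree k s' s)%:R :> R.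
  rewrite -natrM mulnb; congr (_%:R); congr (nat_of_bool _).
  apply/eqP/andP => [<-|[/eqP h1 /forallP h2]].
    split; first by apply/eqP/ffunP => i; rewrite !ffunE; case: (i <= k)%N.
    by apply/forallP => i; apply/implyP => ik; rewrite !ffunE ik.
  rewrite -h1; apply/ffunP => i; rewrite !ffunE; case: ifP => // ik.
  by have /implyP/(_ ik)/eqP := h2 i.
have ZE s' : Z s' = \sum_s (Z s * (trunc e0 k s == s)%:R) * (agree k s' s)%:R.
  rewrite -(Zc e0 s') -[LHS](sum_delta Z); apply: eq_bigr => s _.
  by rewrite (trE s s') [LHS]mulrC [LHS]mulrA.
have aE s s' : (agree k s' s)%:R * triangular_transition Q N k.+1 (coordinate k s') y =
   (agree k s' s)%:R * triangular_transition Q N k.+1 (coordinate k s) y :> R.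
  have [h|_] := boolP (agree k s' s); last by rewrite !mul0r.
  have /forallP/(_ (inord k))/implyP := h.
  rewrite inordK; last by rewrite ltnS ltnW.
  by move=> /(_ (leqnn _))/eqP; rewrite /coordinate => ->.
under eq_Ex do rewrite ZE mulr_suml.
rewrite Ex_sum; under [RHS]eq_Ex do rewrite ZE mulr_suml.
rewrite Ex_sum; apply: eq_bigr => s _.
under eq_Ex do rewrite -mulrA.
rewrite ExZ agree_markov//; under [RHS]eq_Ex do rewrite -mulrA aE.
by rewrite ExZ ExMr.
Qed.

End path_space.

(** Shifting time by [k - 1] turns the times [k - 1] and [k] into 0 and 1, so that the results on
    finite paths apply to negative times too. *)
Lemma law_past {R : realType} {E : finType} {d : measure_display}
    {T : measurableType d} (P : probability T R) (N : nat) (Y : int -> T -> E)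
    (Q : R -> E -> E -> R) (k : int) x :
  row_markov_chain P Q N Y -> k <= 0 -> Q (k%:~R / N%:R) = Q 0 ->
  fine (P [set w | Y k w = x]) =
  \sum_y fine (P [set w | Y (k - 1) w = y]) * Q 0 y x.
Proof.
move=> [mY hrow] k0 Qk; have kN : k <= N%:Z by apply: le_trans k0 _.
pose Y1 (j : int) := Y (k - 1 + j).
have mY1 (j : int) : j <= Posz 1 -> forall z, measurable [set w | Y1 j w = z].
  by move=> j1 z; apply: mY; apply: le_trans kN; rewrite -lerBrDl opprB addrC subrK.
have c0 w : coordinate 0 (path_of 1 Y1 w) = Y (k - 1) w by rewrite coordinate_path// /Y1 addr0.
have c1 w : coordinate 1 (path_of 1 Y1 w) = Y k w by rewrite coordinate_path// /Y1 subrK.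
have -> : [set w | Y k w = x] = [set w | coordinate 1 (path_of 1 Y1 w) == x].
  by apply/seteqP; split=> w /=; rewrite c1 => /eqP.
rewrite (@path_event R E d T P 1 Y1 mY1 (fun s => coordinate 1 s == x)) /=.
transitivity (Ex (@path_prob R E d T P 1 Y1) (fun s => \sum_y
    ((coordinate 0 s == y) && (coordinate 1 s == x))%:R)).
  apply: eq_Ex => s; rewrite -[LHS](@sum_delta R E (fun=> (coordinate 1 s == x)%:R) (coordinate 0 s)).
  by apply: eq_bigr => y _; rewrite -natrM mulnb.
rewrite Ex_sum; apply: eq_bigr => y _; apply: EFin_inj.
rewrite -(@path_event R E d T P 1 Y1 mY1 (fun s => (coordinate 0 s == y) && (coordinate 1 s == x))).
have := hrow k kN 0%N (fun=> y) x; cbv zeta; rewrite Qk.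
have -> : [set w | forall j, (j <= 0)%N -> Y (k - 1 - j%:Z) w = y] = [set w | Y (k - 1) w = y].
  apply/seteqP; split=> w /=; first by move=> /(_ 0%N isT); rewrite subr0.
  by move=> h j; rewrite leqn0 => /eqP ->; rewrite subr0.
have -> : [set w | Y k w = x] `&` [set w | Y (k - 1) w = y] =
    [set w | (coordinate 0 (path_of 1 Y1 w) == y) && (coordinate 1 (path_of 1 Y1 w) == x)].
  apply/seteqP; split=> w /=; rewrite c0 c1; first by move=> [-> ->]; rewrite !eqxx.
  by move=> /andP[/eqP -> /eqP ->].
move=> ->; rewrite EFinM fineK//; apply: fin_num_measure.
by apply: mY; apply: le_trans kN; rewrite lerBlDr lerDl.
Qed.

Lemma le_of_geometric {R : realType} (a c q r : R) : 0 < r < 1 ->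
  (forall k : nat, a <= c * r ^+ k + q) -> a <= q.
Proof.
move=> /andP[r0 r1] h.
have c1 : c * r ^+ k + q @[k --> \oo] --> q.
  rewrite -[X in _ --> X]add0r; apply: cvgD; last exact: cvg_cst.
  rewrite -[X in _ --> X](mulr0 c); apply: cvgMl_tmp; apply: cvg_expr.
  by rewrite ger0_norm ?ltW.
by apply: (@ler_cvg_to _ _ _ _ _ _ _ _ (cvg_cst a) c1); exact: nearW.
Qed.

(** * Perturbed recursions, invariant probabilities and the Poisson equation *)

Section perturbed_chains.
Context {R : realType} {E : finType}.
Variables (A : nat -> E -> E -> R) (c0 r : R).
Hypothesis trA : forall k, transition_matrix (A k).
Hypothesis c0_ge1 : 1 <= c0.
Hypothesis r01 : 0 < r < 1.
Hypothesis contraction : forall k j (v : E -> R), \sum_x v x = 0 ->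
  l1norm (rowmul v (chainmx A k j)) <= c0 * r ^+ j * l1norm v.

Lemma l1normD (v v' : E -> R) : l1norm (fun x => v x + v' x) <= l1norm v + l1norm v'.
Proof. by rewrite -big_split; apply: ler_sum => x _; exact: ler_normD. Qed.

Lemma rowmulD (v v' : E -> R) M y :
  rowmul (fun x => v x + v' x) M y = rowmul v M y + rowmul v' M y.
Proof. by rewrite -big_split; apply: eq_bigr => x _; rewrite mulrDl. Qed.

(** Each error has mass 0, hence is forgotten geometrically by the later transitions; the
    contributions sum to [eta / (1 - r)]. *)
Lemma l1norm_perturbed (N : nat) (D e : nat -> E -> R) (eta : R) : 0 <= eta ->
  (forall k, (k < N)%N -> forall y, D k.+1 y = rowmul (D k) (A k.+1) y + e k y) ->
  (forall k, (k < N)%N -> \sum_x e k x = 0) ->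
  (forall k, (k < N)%N -> l1norm (e k) <= eta) ->
  \sum_x D 0%N x = 0 ->
  forall k, (k <= N)%N -> l1norm (D k) <= c0 * (r ^+ k * l1norm (D 0%N) + eta / (1 - r)).
Proof.
case/andP: (r01) => r0 r1; have q0 : 0 < 1 - r by rewrite subr_gt0.
have c00 : 0 <= c0 by apply: le_trans c0_ge1.
move=> eta0 De e0 eeta D0 k kN.
(* The induction bounds [D k] transported [j] steps further: a bound on [D k] alone would pick up a
   factor [c0] at every step. *)
suff H j : l1norm (rowmul (D k) (chainmx A k j)) <=
    c0 * (r ^+ (k + j) * l1norm (D 0%N) + eta * r ^+ j / (1 - r)).
  have := H 0%N; rewrite addn0 expr0 mulr1; apply: le_trans.
  rewrite le_eqVlt; apply/orP; left; apply/eqP; apply: eq_bigr => x _.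
  by rewrite /rowmul/= sum_deltar.
elim: k kN j => [N0 j|k IH kN j].
  apply: le_trans (contraction 0 j D0) _; rewrite -mulrA ler_wpM2l// add0n lerDl.
  by rewrite divr_ge0 ?mulr_ge0 ?exprn_ge0 ?(ltW r0) ?(ltW q0).
have -> : rowmul (D k.+1) (chainmx A k.+1 j) =
    (fun y => rowmul (D k) (chainmx A k j.+1) y + rowmul (e k) (chainmx A k.+1 j) y).
  apply/funext => y; have := rowmul_chainmxD A k 1 j (D k); rewrite add1n addn1 => ->.
  rewrite -rowmulD.
  apply: eq_bigr => x _; rewrite De//; congr ((_ + _) * _).
  by apply: eq_bigr => z _; rewrite /= sum_deltar.
apply: le_trans (l1normD _ _) _.
apply: le_trans (lerD (IH (ltnW kN) j.+1) (contraction k.+1 j (e0 k kN))) _.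
have h : c0 * r ^+ j * l1norm (e k) <= c0 * r ^+ j * eta.
  by apply: ler_wpM2l (eeta k kN); rewrite mulr_ge0 ?exprn_ge0 ?(ltW r0).
rewrite addSnnS; apply: le_trans (lerD (lexx _) h) _.
by rewrite le_eqVlt; apply/orP; left; apply/eqP; rewrite exprS; field; rewrite gt_eqF.
Qed.

End perturbed_chains.

Section invariant_probabilities.
Context {R : realType} {E : finType}.
Variables (M : E -> E -> R) (p : E -> R) (c0 r : R).
Hypothesis trM : transition_matrix M.
Hypothesis pM : invariant_probability M p.
Hypothesis c0_ge1 : 1 <= c0.
Hypothesis r01 : 0 < r < 1.
Hypothesis contraction : forall k j (v : E -> R), \sum_x v x = 0 ->
  l1norm (rowmul v (chainmx (fun=> M) k j)) <= c0 * r ^+ j * l1norm v.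

Lemma invariant_tpow j : rowmul p (tpow M j) = p.
Proof.
have [_ _ pE] := pM; rewrite (tpowE M 0); elim: j => [|j IH].
  by apply/funext => y; rewrite /rowmul/= sum_deltar.
rewrite -(addn1 j) rowmul_chainmxD IH; apply/funext => y.
rewrite -[RHS]pE; apply: eq_bigr => x _; rewrite /=.
by rewrite sum_deltar.
Qed.

Lemma invariant_ge m delta y : (forall x, delta <= tpow M m x y) -> delta <= p y.
Proof.
move=> h; have [p0 p1 _] := pM.
rewrite -(invariant_tpow m) -[leLHS]mul1r -p1 mulr_suml.
by apply: ler_sum => x _; apply: ler_wpM2l.
Qed.

(** The constant sequence [p' - p] satisfies a perturbed recursion with error [p' - p' M]; its
    initial term is forgotten as the number of steps grows. *)
Lemma l1norm_sub_invariant (p' : E -> R) eta : \sum_x p' x = 1 ->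
  l1norm (fun y => p' y - rowmul p' M y) <= eta ->
  l1norm (fun y => p' y - p y) <= c0 * (eta / (1 - r)).
Proof.
move=> p'1 heta; have [p0 p1 pE] := pM; case/andP: (r01) => r0 r1.
have eta0 : 0 <= eta by apply: le_trans heta; exact: l1norm_ge0.
apply: (@le_of_geometric _ _ (c0 * l1norm (fun y => p' y - p y)) _ r) => // k.
pose D (_ : nat) y := p' y - p y; pose e (_ : nat) y := p' y - rowmul p' M y.
have := @l1norm_perturbed R E (fun=> M) c0 r c0_ge1 r01 contraction k D e eta eta0.
move=> /(_ _ _ _ _ k (leqnn k)) H.
rewrite -mulrA [_ * r ^+ k]mulrC -mulrDr; apply: H => //.
- move=> j _ y; rewrite /D /e; have -> : rowmul (D j) M y = rowmul p' M y - p y.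
    by rewrite /rowmul -[X in _ - X]pE -sumrB; apply: eq_bigr => x _; rewrite mulrBl.
  by ring.
- by move=> j _; rewrite sumrB (rowmul_sum _ trM) subrr.
- by rewrite sumrB p'1 p1 subrr.
Qed.

Lemma avg_tpow_ergodic (f : E -> R) B j x : (forall y, `|f y| <= B) ->
  `|avg (tpow M j) f x - \sum_y p y * f y| <= 2 * c0 * B * r ^+ j.
Proof.
move=> hB; have [p0 p1 pE] := pM; case/andP: (r01) => r0 r1.
have B0 : 0 <= B by apply: le_trans (hB x).
pose v z : R := (x == z)%:R - p z.
have v1 : \sum_z (x == z)%:R = 1 :> R.
  by rewrite -[RHS](sum_delta (fun=> 1) x); apply: eq_bigr => z _; rewrite mulr1.
have v0 : \sum_z v z = 0 by rewrite sumrB p1 v1 subrr.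
have -> : avg (tpow M j) f x - \sum_y p y * f y = \sum_y rowmul v (tpow M j) y * f y.
  rewrite -sumrB; apply: eq_bigr => y _; rewrite -mulrBl; congr (_ * _).
  rewrite /rowmul /v; under eq_bigr do rewrite mulrBl.
  rewrite sumrB sum_delta; congr (_ - _).
  by have /(congr1 (fun q => q y)) := invariant_tpow j.
apply: (@le_trans _ _ (B * l1norm (rowmul v (tpow M j)))).
  rewrite mulr_sumr; apply: le_trans (ler_norm_sum _ _ _) _.
  by apply: ler_sum => y _; rewrite normrM mulrC ler_wpM2r.
have l2 : l1norm v <= 2.
  apply: (@le_trans _ _ (\sum_z ((x == z)%:R + p z))); last first.
    by rewrite big_split/= v1 p1.
  by apply: ler_sum => z _; apply: le_trans (ler_normB _ _) _; rewrite !ger0_norm.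
rewrite (tpowE M 0) (_ : 2 * c0 * B * r ^+ j = B * (c0 * r ^+ j * 2)); last by ring.
apply: ler_wpM2l => //; apply: le_trans (contraction 0 j v0) _.
apply: ler_wpM2l l2; rewrite mulr_ge0 ?exprn_ge0 ?(ltW r0)//.
by apply: le_trans c0_ge1.
Qed.

Lemma avg_tpowS (f : E -> R) j x : avg (tpow M j.+1) f x = avg M (avg (tpow M j) f) x.
Proof.
rewrite /avg /=; under eq_bigr do rewrite mulr_suml.
rewrite exchange_big/=; apply: eq_bigr => z _.
by rewrite mulr_sumr; apply: eq_bigr => y _; rewrite mulrA.
Qed.

(** The solution is the series of the centered iterates of [f], geometrically convergent by
    [avg_tpow_ergodic]. The series is part of the conclusion because the limiting covariance is
    stated as a series. *)
Lemma poisson_solution (f : E -> R) : exists h : E -> R,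
  (forall x, h x - avg M h x = f x - \sum_y p y * f y) /\
  forall x, \sum_(j < n) (avg (tpow M j) f x - \sum_y p y * f y) @[n --> \oo] --> h x.
Proof.
case/andP: (r01) => r0 r1; have c00 : 0 <= c0 by apply: le_trans c0_ge1.
pose B := \sum_y `|f y|.
have hB y : `|f y| <= B by rewrite /B (bigD1 y)//= lerDl sumr_ge0.
have B0 : 0 <= B by apply: sumr_ge0.
pose pf := \sum_y p y * f y.
pose u x j := avg (tpow M j) f x - pf.
have uB x j : `|u x j| <= 2 * c0 * B * r ^+ j by exact: avg_tpow_ergodic.
have cu x : cvgn (series (u x)).
  apply: normed_cvg; apply: (@series_le_cvg _ _ (geometric (2 * c0 * B) r)).
  - by move=> n; exact: normr_ge0.
  - by move=> n; rewrite /geometric/= !mulr_ge0 ?exprn_ge0 ?(ltW r0).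
  - by move=> n; exact: uB.
  - by apply: is_cvg_geometric_series; rewrite ger0_norm ?ltW.
have su x n : series (u x) n = \sum_(j < n) u x j by rewrite /series/= big_mkord.
pose h x := limn (series (u x)); exists h.
have hcv x : \sum_(j < n) u x j @[n --> \oo] --> h x.
  by under eq_fun do rewrite -su; exact: cu.
split=> // x.
have c1 : \sum_(j < n) u x j - avg M (fun y => \sum_(j < n) u y j) x @[n --> \oo] -->
    h x - avg M h x.
  by apply: cvgB; [exact: hcv|apply: cvg_sum => y; exact: cvgMl_tmp].
have e1 n : \sum_(j < n) u x j - avg M (fun y => \sum_(j < n) u y j) x =
    f x - pf - u x n.
  have [_ M1] := trM.
  have -> : avg M (fun y => \sum_(j < n) u y j) x = \sum_(j < n) u x j.+1.
    rewrite /avg; under eq_bigr do rewrite mulr_sumr.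
    rewrite exchange_big/=; apply: eq_bigr => j _.
    rewrite /u avg_tpowS /avg; under eq_bigr do rewrite mulrBr.
    by rewrite sumrB -mulr_suml M1 mul1r.
  have e0 : u x 0%N = f x - pf by rewrite /u /avg /= sum_delta.
  rewrite -e0; elim: n => [|n IH]; first by rewrite !big_ord0 subrr subrr.
  rewrite !big_ord_recr/= opprD addrACA IH; ring.
have c2 : f x - pf - u x n @[n --> \oo] --> f x - pf.
  apply: (@cvg_dist_bound _ _ _ _ _ (fun n => 2 * c0 * B * r ^+ n)).
    by apply: nearW => n; rewrite addrC addKr normrN.
  rewrite -[X in _ --> X](mulr0 (2 * c0 * B)); apply: cvgMl_tmp; apply: cvg_expr.
  by rewrite ger0_norm ?ltW.
rewrite (_ : (fun n => f x - pf - u x n) =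
  (fun n => \sum_(j < n) u x j - avg M (fun y => \sum_(j < n) u y j) x)) in c2.
  by apply: (cvg_unique _ c1 c2); exact: norm_hausdorff.
by apply/funext => n; rewrite e1.
Qed.

End invariant_probabilities.

(** * Kernel sums *)

Section lattice_points.
Context {R : realType}.

(** The induction carries a second bound, by [N - x]: when [N] falls in the window it gives
    [N - x + 1 <= l + 1]. *)
Lemma natr_count_le (x l : R) N : 0 <= l ->
  \sum_(i < N) ((x <= i%:R) && (i%:R <= x + l))%R%:R <= l + 1 :> R.
Proof.
move=> l0.
suff [] : \sum_(i < N) ((x <= i%:R) && (i%:R <= x + l))%R%:R <= l + 1 :> R /\
  \sum_(i < N) ((x <= i%:R) && (i%:R <= x + l))%R%:R <= Num.max 0 (N%:R - x) by [].
elim: N => [|N [IH1 IH2]].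
  by rewrite big_ord0 le_max lexx; split=> //; rewrite addr_ge0.
rewrite big_ord_recr/= -natr1; move: IH1 IH2; set S := \sum_(_ < _) _ => IH1 IH2.
have [/andP[h1 h2]|_] := boolP ((x <= N%:R) && (N%:R <= x + l)).
  move: IH2; rewrite max_r ?subr_ge0// => IH2.
  by rewrite mulr1n le_max; split; [lra|apply/orP; right; lra].
rewrite mulr0n addr0; split=> //; apply: le_trans IH2 _.
by rewrite ge_max !le_max lexx/=; apply/orP; right; lra.
Qed.

Lemma natr_count_ge (x l : R) N : 0 <= x -> x + l <= N%:R ->
  l - 1 <= \sum_(i < N) ((x <= i%:R) && (i%:R <= x + l))%R%:R :> R.
Proof.
move=> x0 xl.
suff h : Num.min N%:R (x + l) - x - 1 <= \sum_(i < N) ((x <= i%:R) && (i%:R <= x + l))%R%:R :> R.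
  by apply: le_trans h; rewrite min_r//; lra.
clear xl; elim: N => [|N IH].
  rewrite big_ord0 subr_le0 lerBlDr; apply: (@le_trans _ _ 0); last lra.
  by rewrite ge_min lexx.
rewrite big_ord_recr/= -natr1; move: IH; set S := \sum_(_ < _) _ => IH.
have S0 : 0 <= S by apply: sumr_ge0.
have [/andP[h1 h2]|] := boolP ((x <= N%:R) && (N%:R <= x + l)).
  move: IH; rewrite min_l// => IH; rewrite mulr1n -lerBlDr.
  apply: le_trans IH; have : Num.min (N%:R + 1) (x + l) <= N%:R + 1 by rewrite ge_min lexx.
  lra.
rewrite mulr0n addr0 negb_and -!ltNge => /orP[h|h].
  have : Num.min (N%:R + 1) (x + l) <= N%:R + 1 by rewrite ge_min lexx.
  lra.
by apply: le_trans IH; rewrite !min_r//; lra.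
Qed.

End lattice_points.

Lemma lipschitz_const {R : realType} (K : R -> R) : lipschitz K ->
  exists2 L : R, 0 <= L & forall x y, `|K x - K y| <= L * `|x - y|.
Proof.
move=> [M [Mr hM]]; exists (`|M| + 1); first by rewrite addr_ge0.
move=> x y; have /hM h : M < `|M| + 1 by rewrite ltr_pwDr// ler_norm.
exact: (h (x, y)).
Qed.

Section riemann_sums.
Context {R : realType}.
Variables (g : R -> R) (L : R).
Hypothesis L0 : 0 <= L.
Hypothesis g_lip : forall x y, `|g x - g y| <= L * `|x - y|.
Hypothesis g_supp : forall z, 1 < `|z| -> g z = 0.

Lemma lipschitz_continuous : continuous g.
Proof.
move=> x; apply: (@cvg_dist_bound _ _ _ _ _ (fun y => L * `|y - x|)).
  by apply: nearW => y; exact: g_lip.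
rewrite -[X in _ --> X](mulr0 L); apply: cvgMl_tmp.
rewrite -[X in _ --> X](@normr0 R R); apply: cvg_norm.
rewrite -[X in _ --> X](subrr (x : R)).
by apply: cvgB; [exact: cvg_id|exact: cvg_cst].
Qed.

Local Notation mu := (@lebesgue_measure R).

Let g_restrict (D : set R) : (forall z, ~ D z -> g z = 0) -> g \_ D = g.
Proof.
move=> h; apply/funext => z; rewrite patchE; case: ifPn => // zD.
by rewrite h//; move=> /mem_set; apply/negP.
Qed.

Lemma supported_integrable : mu.-integrable setT (EFin \o g).
Proof.
have h : mu.-integrable `[-1, 1] (EFin \o g).
  apply: continuous_compact_integrable; first exact: segment_compact.
  by apply: continuous_subspaceT; exact: lipschitz_continuous.
move: h; rewrite integrable_mkcond// => h.
apply: eq_integrable h => // z _; rewrite restrict_EFin /= g_restrict//.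
move=> {}z /=; rewrite in_itv/= => /negP hz; apply: g_supp.
by rewrite ltNge ler_norml.
Qed.

Lemma Rintegral_supported (D : set R) : measurable D -> (forall z, ~ D z -> g z = 0) ->
  \int[mu]_(z in D) g z = \int[mu]_z g z.
Proof.
move=> mD h; rewrite Rintegral_mkcond; congr (Rintegral _ _ _).
exact: g_restrict.
Qed.

(** Constant on both sides of the support, so that its increments over any mesh covering [-1, 1]
    telescope to the full integral. *)
Lemma supported_primitive : exists F : R -> R,
  [/\ forall x, is_derive x (1 : R) F (g x), forall x, x < -1 -> F x = 0 &
    forall x, 1 <= x -> F x = \int[mu]_z g z].
Proof.
pose F x := \int[mu]_(t in [set` Interval -oo%O (BRight x)]) g t; exists F; split.
- move=> x; have ix : mu.-integrable [set` Interval -oo%O (BRight (x + 1))] (EFin \o g).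
    by apply: (integrableS measurableT) supported_integrable => //; exact: measurable_itv.
  have xx : x < x + 1 by rewrite ltrDl.
  have [d1 d2] := continuous_FTC1 xx ix (ltNyr _) (@lipschitz_continuous x).
  apply: DeriveDef; first exact: d1.
  by rewrite -derive1E; exact: d2.
- move=> x x1; rewrite /F Rintegral_mkcond (_ : g \_ _ = cst 0) ?Rintegral_cst ?mul0r//.
  apply/funext => z; rewrite patchE; case: ifPn => //; rewrite inE/= in_itv/= => zx.
  by apply: g_supp; rewrite -normrN; apply: lt_le_trans (ler_norm _); lra.
- move=> x x1; rewrite /F Rintegral_supported//.
  move=> z /=; rewrite in_itv/= => /negP; rewrite -ltNge => xz.
  by apply: g_supp; apply: lt_le_trans (ler_norm _); apply: le_lt_trans xz.
Qed.

Section mesh.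
Variables (n : nat) (b u : R).
Hypothesis n0 : (0 < n)%N.
Hypothesis b0 : 0 < b.
Let N0 : 0 < n%:R :> R. Proof. by rewrite ltr0n. Qed.
Let h : R := (n%:R * b)^-1.
Let h0 : 0 < h. Proof. by rewrite invr_gt0 mulr_gt0. Qed.
Let z (i : nat) : R := (u - i%:R / n%:R) / b.

Let zS i : z i.+1 = z i - h.
Proof.
by rewrite /z /h -(natr1 i); field; rewrite !gt_eqF.
Qed.

(** Only cells meeting the support contribute to the sums below. The margin [h], the mesh of the
    points [z i], accounts for cells with one end outside. *)
Let count_near : \sum_(i < n) (`|z i| <= 1 + h)%R%:R <= n%:R * b * (2 + 2 * h) + 1.
Proof.
pose x := n%:R * (u - b * (1 + h)).
have l0 : 0 <= n%:R * b * (2 + 2 * h).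
  by rewrite mulr_ge0 ?mulr_ge0 ?ltW// addr_gt0// mulr_gt0.
apply: le_trans (natr_count_le x n l0); apply: ler_sum => i _.
rewrite ler_nat; case: (leP `|z i| (1 + h)) => //=; rewrite ler_norml => /andP[h1 h2].
have e1 : u - i%:R / n%:R <= (1 + h) * b by rewrite -ler_pdivrMr.
have e2 : - (1 + h) * b <= u - i%:R / n%:R by rewrite -ler_pdivlMr.
have e3 : i%:R = n%:R * (i%:R / n%:R) :> R by rewrite mulrCA divff ?mulr1// gt_eqF.
rewrite lt0b; apply/andP; split; rewrite e3.
  by rewrite /x ler_pM2l//; lra.
rewrite (_ : x + _ = n%:R * (u + b * (1 + h))); last by rewrite /x; ring.
by rewrite ler_pM2l//; lra.
Qed.

Let far_zero i t : 1 + h < `|z i| -> `|t| <= h -> g (z i - t) = 0.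
Proof.
move=> hz ht; apply: g_supp; have := ler_normD (z i - t) t.
by rewrite subrK; lra.
Qed.

(** About [2 n b] cells contribute, each at most [L h] with [h = 1 / (n b)]: the variation stays
    bounded, and the weights of the martingale vary little after scaling. *)
Lemma total_variation_mesh :
  \sum_(i < n) `|g (z i.+1) - g (z i)| <= L * (2 + 2 * h) + L * h.
Proof.
apply: (@le_trans _ _ (\sum_(i < n) (L * h) * (`|z i| <= 1 + h)%R%:R)).
  apply: ler_sum => i _; case: (leP `|z i| (1 + h)) => hz.
    by rewrite mulr1; apply: le_trans (g_lip _ _) _; rewrite zS addrAC subrr sub0r normrN gtr0_norm.
  have := far_zero hz (_ : `|h| <= h); rewrite -zS gtr0_norm// => -> //.
  have := far_zero hz (_ : `|0| <= h); rewrite normr0 subr0 (ltW h0) => -> //.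
  by rewrite subrr normr0 mulr0.
rewrite -mulr_sumr; have Lh : 0 <= L * h by rewrite mulr_ge0// ltW.
apply: le_trans (ler_wpM2l Lh count_near) _.
by rewrite le_eqVlt; apply/orP; left; apply/eqP; rewrite /h; field; rewrite !gt_eqF.
Qed.

(** The two conditions say that the mesh covers [-1, 1]. Then the integral is a telescoping sum of
    increments of the primitive, compared with the Riemann sum cell by cell. *)
Lemma riemann_sum_error : b <= u -> b < 1 - u ->
  `|h * (\sum_(i < n) g (z i)) - \int[mu]_x g x| <= h * (L * (2 + 2 * h) + L * h).
Proof.
move=> bu bu1; have [F [dF F0 F1]] := supported_primitive.
have z0 : 1 <= z 0 by rewrite /z mul0r subr0 ler_pdivlMr ?mul1r.
have zn : z n < -1 by rewrite /z divff ?gt_eqF// ltr_pdivrMr//; lra.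
have -> : \int[mu]_x g x = \sum_(i < n) (F (z i) - F (z i.+1)).
  rewrite -(F1 _ z0); transitivity (F (z 0) - F (z n)); first by rewrite (F0 _ zn) subr0.
  elim: n => [|k IH]; first by rewrite big_ord0 subrr.
  by rewrite big_ord_recr/= -IH; ring.
rewrite mulr_sumr -sumrB; apply: le_trans (ler_norm_sum _ _ _) _.
apply: (@le_trans _ _ (\sum_(i < n) (L * h * h) * (`|z i| <= 1 + h)%R%:R)).
  apply: ler_sum => i _; rewrite zS; set y := z i.
  pose f t := t * g y - (F y - F (y - t)).
  pose f' t := g y - g (y - t).
  have df t : is_derive t (1 : R) f (f' t).
    have dd : is_derive t (1 : R) (F \o (fun s => y - s)) (- g (y - t)).
      apply: is_derive_eq; by rewrite /GRing.scale/=; ring.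
    rewrite /f /f'; apply: is_derive_eq; rewrite /GRing.scale/=; ring.
  have f0 : f 0 = 0 by rewrite /f mul0r subr0 subrr subr0.
  have := @mvt_bound R f f' (L * h * (`|y| <= 1 + h)%R%:R) h f0 df.
  move=> H; apply: le_trans (H _) _; last by rewrite (gtr0_norm h0) mulrAC.
  move=> t; rewrite (gtr0_norm h0) => th; rewrite /f'.
  case: (leP `|y| (1 + h)) => hy.
    rewrite mulr1; apply: le_trans (g_lip _ _) _; rewrite opprB addrC subrK.
    by apply: ler_wpM2l.
  rewrite (far_zero hy th); have := far_zero hy (_ : `|0| <= h).
  by rewrite normr0 subr0 (ltW h0) => -> //; rewrite subrr normr0 mulr0.
rewrite -mulr_sumr; have Lh : 0 <= L * h * h by rewrite !mulr_ge0// ltW.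
apply: le_trans (ler_wpM2l Lh count_near) _.
by rewrite le_eqVlt; apply/orP; left; apply/eqP; rewrite /h; field; rewrite !gt_eqF.
Qed.

End mesh.
End riemann_sums.

Section bandwidth.
Context {R : realType}.
Variables (b : nat -> R) (eps : R).
Hypothesis b01 : forall n, (1 <= n)%N -> 0 < b n < 1.
Hypothesis eps_gt0 : 0 < eps.
Hypothesis nb_cvg : n%:R * b n `^ (1 + eps) @[n --> \oo] --> +oo.

Lemma bandwidth_large (M : R) : \forall n \near \oo, M <= n%:R * b n.
Proof.
have /cvgryPge/(_ M) := nb_cvg; apply: filter_app; near=> n => H.
have n1 : (1 <= n)%N by near: n; exact: nbhs_infty_ge.
have /andP[b0 b1] := b01 n1; apply: le_trans H _; apply: ler_wpM2l => //.
by apply: ge1r_powR; rewrite ?b0 ?lerDl ltW.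
Unshelve. all: by end_near.
Qed.

Lemma inv_bandwidth_cvg0 : (n%:R * b n)^-1 @[n --> \oo] --> (0 : R).
Proof.
apply/cvgrPdist_le => e e0; have := bandwidth_large e^-1; apply: filter_app.
near=> n => H; rewrite sub0r normrN ger0_norm.
  by rewrite -[leRHS]invrK lef_pV2// posrE ?invr_gt0//; apply: lt_le_trans H; rewrite invr_gt0.
by rewrite invr_ge0; apply: le_trans H; rewrite invr_ge0 ltW.
Unshelve. all: by end_near.
Qed.

(** From [n b^(1+eps) >= 1], taking logarithms, [eps ln n <= (1 + eps) ln (nb)]; with
    [ln y <= 2 sqrt y] this gives [ln n <= D sqrt (nb)]. *)
Lemma log_bandwidth_cvg0 : Num.sqrt (ln n%:R) / Num.sqrt (n%:R * b n) @[n --> \oo] --> (0 : R).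
Proof.
apply/cvgrPdist_le => e e0; pose D := 2 * (1 + eps) / eps.
have eps1 : 0 < 1 + eps by rewrite addr_gt0.
have D0 : 0 < D by rewrite divr_gt0// mulr_gt0.
have /cvgryPge/(_ 1) H1 := nb_cvg.
have H2 := bandwidth_large ((D / e ^+ 2) ^+ 2 + 1); near=> n.
have n1 : (1 <= n)%N by near: n; exact: nbhs_infty_ge.
have /andP[b0 b1] := b01 n1; have n0 : 0 < n%:R :> R by rewrite ltr0n.
have h1 : 1 <= n%:R * b n `^ (1 + eps) by near: n.
have h2 : (D / e ^+ 2) ^+ 2 + 1 <= n%:R * b n by near: n.
set y := n%:R * b n in h2 *; have y0 : 0 < y by rewrite mulr_gt0.
have ln0 : 0 <= ln (n%:R : R) by rewrite ln_ge0// ler1n.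
have lny : eps * ln n%:R <= (1 + eps) * ln y.
  have : 0 <= ln (n%:R * b n `^ (1 + eps)) by rewrite ln_ge0.
  rewrite /y !lnM ?posrE ?powR_gt0// ln_powR; lra.
have sy : ln y <= 2 * Num.sqrt y.
  rewrite -{1}(sqr_sqrtr (ltW y0)) lnXn ?sqrtr_gt0// -[leLHS]mulr_natl ler_wpM2l//.
  by rewrite ltW// ln_sublinear// sqrtr_gt0.
have sD : ln n%:R <= D * Num.sqrt y.
  rewrite -(ler_pM2l eps_gt0); apply: le_trans lny _.
  rewrite (_ : eps * _ = (1 + eps) * (2 * Num.sqrt y)); last by rewrite /D; field; rewrite gt_eqF.
  by apply: ler_wpM2l => //; exact: ltW.
rewrite sub0r normrN ger0_norm ?divr_ge0 ?sqrtr_ge0//.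
rewrite ler_pdivrMr ?sqrtr_gt0//.
rewrite -(@ler_pXn2r _ 2) ?nnegrE ?mulr_ge0 ?sqrtr_ge0 ?(ltW e0)//.
rewrite exprMn !sqr_sqrtr ?(ltW y0)//.
apply: le_trans sD _; have e2 : 0 < e ^+ 2 by rewrite exprn_gt0.
have De : D <= e ^+ 2 * Num.sqrt y.
  rewrite mulrC -ler_pdivrMr// -[leLHS]ger0_norm; last by apply: divr_ge0; exact: ltW.
  rewrite -sqrtr_sqr ler_sqrt ?(ltW y0)//; lra.
apply: le_trans (ler_wpM2r (sqrtr_ge0 y) De) _.
by rewrite -[leLHS]mulrA -(expr2 (Num.sqrt y)) sqr_sqrtr// ltW.
Unshelve. all: by end_near.
Qed.

End bandwidth.

(** * Kernel weights and their normalization *)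

Section kernel_weights.
Context {R : realType}.
Variables (K : R -> R) (L : R).
Hypothesis K_ge0 : forall z, 0 <= K z.
Hypothesis L0 : 0 <= L.
Hypothesis K_lip : forall x y, `|K x - K y| <= L * `|x - y|.
Hypothesis K_supp : forall z, 1 < `|z| -> K z = 0.

Lemma kernel_bound z : K z <= 3 * L.
Proof.
have [z1|z1] := leP `|z| 1; last by rewrite K_supp// mulr_ge0.
have K2 : K 2 = 0 by apply: K_supp; rewrite ger0_norm//; lra.
have := K_lip z 2; rewrite K2 subr0 (ger0_norm (K_ge0 z)).
move=> /le_trans; apply; rewrite mulrC ler_wpM2r//.
by move: z1; rewrite !ler_norml => /andP[? ?]; apply/andP; split; lra.
Qed.

Lemma kernel_sq_lip x y : `|K x ^+ 2 - K y ^+ 2| <= 6 * L ^+ 2 * `|x - y|.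
Proof.
rewrite subr_sqr normrM.
have h : `|K x + K y| <= 6 * L.
  by rewrite ger0_norm ?addr_ge0//; have := kernel_bound x; have := kernel_bound y; lra.
apply: le_trans (ler_pM (normr_ge0 _) (normr_ge0 _) (K_lip x y) h) _.
by rewrite le_eqVlt; apply/orP; left; apply/eqP; ring.
Qed.

(** Extended by 0 so that sums run over ['I_n]; the zeros at 0 and [n] also remove the boundary
    terms of the summation by parts. *)
Definition weight (b : R) (n : nat) (u : R) (i : nat) : R :=
  if (0 < i < n)%N then kernel_weight K b n u i else 0.

Lemma sum_weight b n u (F : nat -> R) :
  \sum_(1 <= i < n) kernel_weight K b n u i * F i = \sum_(i < n) weight b n u i * F i.
Proof.
case: n => [|n]; first by rewrite big_ord0 big_geq.
rewrite -(big_mkord xpredT (fun i => weight b n.+1 u i * F i)) big_ltn// {1}/weight mul0r add0r.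
by rewrite !big_nat; apply: eq_bigr => i hi; rewrite /weight hi.
Qed.

Section fixed_row.
Variables (b : R) (n : nat) (u : R).
Hypothesis b0 : 0 < b.
Hypothesis n0 : (0 < n)%N.
Let nb0 : 0 < n%:R * b. Proof. by rewrite mulr_gt0// ltr0n. Qed.

Lemma kernel_term_ge0 i : 0 <= kernel_term K b n u i.
Proof. by rewrite mulr_ge0// invr_ge0 ltW. Qed.

Lemma weight_ge0 i : 0 <= weight b n u i.
Proof.
rewrite /weight; case: ifP => // _; rewrite divr_ge0 ?kernel_term_ge0//.
by apply: sumr_ge0 => j _; exact: kernel_term_ge0.
Qed.

Lemma weight_sum1 : kernel_mass K b n u != 0 -> \sum_(i < n) weight b n u i = 1.
Proof.
move=> m0; transitivity (\sum_(i < n) weight b n u i * 1).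
  by apply: eq_bigr => i _; rewrite mulr1.
rewrite -(sum_weight _ _ _ (fun=> 1)); under eq_bigr do rewrite mulr1.
by rewrite -mulr_suml divff.
Qed.

Lemma weight_near i : weight b n u i != 0 -> (i < n)%N /\ `|u - i%:R / n%:R| <= b.
Proof.
rewrite /weight; case: ifP; last by rewrite eqxx.
move=> /andP[_ ->] H; split=> //; rewrite leNgt; apply/negP => h; move/eqP: H; apply.
rewrite /kernel_weight /kernel_term K_supp ?mulr0 ?mul0r// normrM normfV.
by rewrite (gtr0_norm b0) ltr_pdivlMr ?mul1r.
Qed.

Lemma weight_le c i : 0 < c -> c <= kernel_mass K b n u ->
  weight b n u i <= 3 * L / (c * (n%:R * b)).
Proof.
move=> c0 cm; have h0 : 0 <= 3 * L / (c * (n%:R * b)).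
  by rewrite divr_ge0 ?mulr_ge0 ?(ltW c0) ?(ltW nb0)// ltW.
rewrite /weight; case: ifP => // _.
rewrite ler_pdivrMr ?(lt_le_trans c0)//.
apply: (@le_trans _ _ (3 * L / (c * (n%:R * b)) * c)); last by rewrite ler_wpM2l.
rewrite (_ : _ * c = (n%:R * b)^-1 * (3 * L)); last by field; rewrite !gt_eqF// ltr0n.
by rewrite ler_wpM2l ?kernel_bound// invr_ge0 ltW.
Qed.

Lemma sum_weight_sq c : 0 < c -> c <= kernel_mass K b n u ->
  \sum_(i < n) weight b n u i ^+ 2 <= 3 * L / (c * (n%:R * b)).
Proof.
move=> c0 cm; have m0 : kernel_mass K b n u != 0 by rewrite gt_eqF// (lt_le_trans c0).
apply: (@le_trans _ _ (3 * L / (c * (n%:R * b)) * \sum_(i < n) weight b n u i)); last first.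
  by rewrite weight_sum1// mulr1.
rewrite mulr_sumr; apply: ler_sum => i _.
by rewrite expr2 ler_wpM2r ?weight_ge0// weight_le.
Qed.

(** The indices with [(u - i/n) / b] within [rho] of [z] number at least [2 n b rho - 1 >= n b rho],
    each contributing at least [k / (n b)]. The last two conditions place them between 1 and [n]; at
    [n], the excluded index, the strict range of the count takes over. *)
Lemma kernel_mass_ge (z rho k : R) : 0 <= k -> 1 <= n%:R * b * rho ->
  (forall z', `|z' - z| <= rho -> k <= K z') ->
  1 <= n%:R * (u - b * (z + rho)) -> u - b * (z - rho) <= 1 ->
  k * rho <= kernel_mass K b n u.
Proof.
move=> k0 nbr hk x1 x2; have n0' : 0 < n%:R :> R by rewrite ltr0n.
pose x := n%:R * (u - b * (z + rho)); pose l := 2 * (n%:R * b * rho).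
have xl : x + l <= n%:R.
  rewrite (_ : x + l = n%:R * (u - b * (z - rho))); last by rewrite /x /l; ring.
  by rewrite -[leRHS]mulr1 ler_pM2l.
have := natr_count_ge (le_trans ler01 x1 : 0 <= x) xl.
pose F (i : nat) : R := ((x <= i%:R) && (i%:R <= x + l))%:R.
have F0 : F 0%N = 0 by rewrite /F [x <= 0]leNgt (lt_le_trans ltr01 x1).
have -> : \sum_(i < n) F i = \sum_(1 <= i < n) F i.
  by rewrite -(big_mkord xpredT F) big_ltn// F0 add0r.
move=> cnt.
apply: (@le_trans _ _ (\sum_(1 <= i < n) (n%:R * b)^-1 * k * F i)).
  rewrite -mulr_sumr; apply: (@le_trans _ _ ((n%:R * b)^-1 * k * (l - 1))).
    rewrite (_ : k * rho = (n%:R * b)^-1 * k * (n%:R * b * rho)); last first.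
      by field; rewrite !gt_eqF.
    apply: ler_wpM2l; last by rewrite /l; lra.
    by rewrite mulr_ge0// invr_ge0 ltW.
  by apply: ler_wpM2l cnt; rewrite mulr_ge0// invr_ge0 ltW.
apply: ler_sum => i _; rewrite /F; case: andP => [[h1 h2]|_]; last first.
  by rewrite mulr0 kernel_term_ge0.
rewrite mulr1 ler_wpM2l ?invr_ge0 ?(ltW nb0)//; apply: hk.
have e3 : i%:R = n%:R * (i%:R / n%:R) :> R by rewrite mulrCA divff ?mulr1// gt_eqF.
move: h1 h2; rewrite (_ : x + l = n%:R * (u - b * (z - rho))); last by rewrite /x /l; ring.
rewrite /x e3 !ler_pM2l// => h1 h2.
rewrite -e3 (_ : _ - z = (u - i%:R / n%:R - b * z) / b); last by field; rewrite !gt_eqF.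
rewrite normrM normfV (gtr0_norm b0) ler_pdivrMr//.
by rewrite ler_norml; apply/andP; split; lra.
Qed.

End fixed_row.

(** Crude but sufficient: each kernel term is Lipschitz with constant [L n] because [1 / b <= n],
    and the normalization doubles the total. The polynomial growth is beaten by the fineness of the
    grid used later. *)
Lemma weight_dist b n u v c : 0 < b -> (0 < n)%N -> 1 <= n%:R * b -> 0 < c ->
  c <= kernel_mass K b n u -> c <= kernel_mass K b n v ->
  \sum_(i < n) `|weight b n u i - weight b n v i| <=
  2 * L * n%:R ^+ 2 / c * `|u - v|.
Proof.
move=> b0 n0 nb1 c0 cu cv.
have N0 : 0 < n%:R :> R by rewrite ltr0n.
have nb0 : 0 < n%:R * b by rewrite mulr_gt0.
have mu0 := lt_le_trans c0 cu; have mv0 := lt_le_trans c0 cv.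
have t i : `|kernel_term K b n u i - kernel_term K b n v i| <= L * n%:R * `|u - v|.
  rewrite /kernel_term -mulrBr normrM.
  have h : `|K ((u - i%:R / n%:R) / b) - K ((v - i%:R / n%:R) / b)| <= L * (`|u - v| / b).
    apply: le_trans (K_lip _ _) _; apply: ler_wpM2l => //.
    by rewrite -mulrBl normrM normfV (gtr0_norm b0) opprB addrA subrK.
  have h1 : `|(n%:R * b)^-1| <= 1 by rewrite gtr0_norm ?invr_gt0// invf_le1.
  apply: le_trans (ler_pM (normr_ge0 _) (normr_ge0 _) h1 h) _.
  rewrite mul1r -!mulrA; apply: ler_wpM2l => //; rewrite mulrC ler_wpM2r//.
  by rewrite -div1r ler_pdivrMr.
have n01 : \sum_(1 <= i < n) (L * n%:R * `|u - v|) <= L * n%:R ^+ 2 * `|u - v|.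
  rewrite sumr_const_nat -[_ *+ _]mulr_natl [leRHS](_ : _ = n%:R * (L * n%:R * `|u - v|)); last by ring.
  by rewrite ler_wpM2r ?mulr_ge0// ler_nat leq_subr.
have dm : `|kernel_mass K b n u - kernel_mass K b n v| <= L * n%:R ^+ 2 * `|u - v|.
  rewrite -sumrB; apply: le_trans (ler_norm_sum _ _ _) _.
  by apply: le_trans n01; apply: ler_sum => i _; exact: t.
have -> : \sum_(i < n) `|weight b n u i - weight b n v i| =
    \sum_(1 <= i < n) `|kernel_weight K b n u i - kernel_weight K b n v i|.
  rewrite -(big_mkord xpredT (fun i => `|weight b n u i - weight b n v i|)) big_ltn//.
  rewrite {1 2}/weight subrr normr0 add0r !big_nat; apply: eq_bigr => i hi.
  by rewrite /weight hi.
apply: (@le_trans _ _ (\sum_(1 <= i < n) (L * n%:R * `|u - v| / c +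
   kernel_term K b n v i / kernel_mass K b n v * (L * n%:R ^+ 2 * `|u - v| / c)))).
  apply: ler_sum => i _; rewrite /kernel_weight.
  set p := kernel_term K b n u i; set q := kernel_term K b n v i.
  set mu := kernel_mass K b n u in cu dm mu0 *; set mv := kernel_mass K b n v in cv dm mv0 *.
  have -> : p / mu - q / mv = (p - q) / mu - q / mv * ((mu - mv) / mu).
    by field; rewrite !gt_eqF.
  apply: le_trans (ler_normB _ _) _.
  rewrite (normrM (p - q)) (normrM (q / mv)) (normrM q) (normrM (mu - mv)).
  rewrite !normfV (gtr0_norm mu0) (gtr0_norm mv0).
  have q0 : 0 <= q by exact: kernel_term_ge0.
  have im : mu^-1 <= c^-1 by rewrite lef_pV2// posrE.
  have imu : 0 <= mu^-1 by rewrite invr_ge0 ltW.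
  apply: lerD; first by apply: ler_pM => //; exact: t.
  rewrite (ger0_norm q0); apply: ler_wpM2l; first by rewrite divr_ge0// ltW.
  by apply: ler_pM.
have s2 (D : R) : \sum_(1 <= i < n) kernel_term K b n v i / kernel_mass K b n v * D = D.
  by rewrite -!mulr_suml divff ?mul1r// gt_eqF.
have s1 (D : R) : \sum_(1 <= i < n) D / c = (\sum_(1 <= i < n) D) / c by rewrite mulr_suml.
rewrite big_split/= s2 s1 [leRHS](_ : _ = L * n%:R ^+ 2 * `|u - v| / c + L * n%:R ^+ 2 * `|u - v| / c); last by ring.
by rewrite lerD2r ler_wpM2r// invr_ge0 ltW.
Qed.

Section mass_lower_bound.
Variable b : nat -> R.
Hypothesis b01 : forall n, (1 <= n)%N -> 0 < b n < 1.
Hypothesis b_cvg0 : b n @[n --> \oo] --> (0 : R).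
Hypothesis nb_large : forall M, \forall n \near \oo, M <= n%:R * b n.
Hypothesis mass_neq0 : \forall n \near \oo,
  forall u, u \in `[0, 1] -> kernel_mass K (b n) n u != 0.

(** [K] may vanish near 0 or be asymmetric. A nonzero mass at both endpoints, for a single [n],
    provides [z1 < 0 < z2] where [K] is positive; by continuity [K] is bounded below around both.
    For [u] in the left half of [0, 1] the indices near [u - b z1], to the right of [u], are
    available; in the right half those near [u - b z2]. *)
Lemma kernel_mass_lower_bound : exists2 c : R, 0 < c &
  \forall n \near \oo, forall u, u \in `[0, 1] -> c <= kernel_mass K (b n) n u.
Proof.
have [n0 [n01 hn0]] : exists n, (1 <= n)%N /\
    forall u, u \in `[0, 1] -> kernel_mass K (b n) n u != 0.
  have : \forall n \near \oo, (1 <= n)%N /\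
      forall u, u \in `[0, 1] -> kernel_mass K (b n) n u != 0.
    by apply: filterI => //; exact: nbhs_infty_ge.
  by move=> [N _ hN]; exists N; exact: hN (leqnn N).
have /andP[b0 _] := b01 n01.
have ex u : u \in `[0, 1] -> exists2 i, (0 < i < n0)%N & 0 < K ((u - i%:R / n0%:R) / b n0).
  move=> /hn0; rewrite /kernel_mass big_nat => /eqP m0.
  apply: contrapT => hno; apply: m0; apply: big1 => i hi.
  rewrite /kernel_term; have [->|Ki] := eqVneq (K ((u - i%:R / n0%:R) / b n0)) 0; first exact: mulr0.
  by exfalso; apply: hno; exists i => //; rewrite lt_neqAle eq_sym Ki K_ge0.
have N0 : 0 < n0%:R :> R by rewrite ltr0n.
have [z1 z10 Kz1] : exists2 z1, z1 < 0 & 0 < K z1.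
  have [|i /andP[i0 _] Ki] := ex 0; first by rewrite in_itv/= lexx ler01.
  exists ((0 - i%:R / n0%:R) / b n0) => //.
  by rewrite sub0r mulNr oppr_lt0 !divr_gt0// ltr0n.
have [z2 z20 Kz2] : exists2 z2, 0 < z2 & 0 < K z2.
  have [|i /andP[_ i0] Ki] := ex 1; first by rewrite in_itv/= lexx ler01.
  exists ((1 - i%:R / n0%:R) / b n0) => //.
  by rewrite divr_gt0// subr_gt0 ltr_pdivrMr// mul1r ltr_nat.
have L1 : 0 < L + 1 by rewrite ltr_wpDl.
(* The first bound keeps the window on one side of [u]; the second one keeps [K] above half its
   value at [z]. *)
pose rho z := Num.min (`|z| / 2) (K z / (2 * (L + 1))).
have rho_gt0 z : z != 0 -> 0 < K z -> 0 < rho z.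
  move=> z0 Kz; rewrite lt_min !divr_gt0 ?normr_gt0//; exact: mulr_gt0.
have Kge z : 0 < K z -> forall z', `|z' - z| <= rho z -> K z / 2 <= K z'.
  move=> Kz z'; rewrite le_min => /andP[_ h].
  have h1 : L * `|z' - z| <= K z / 2.
    apply: le_trans (_ : (L + 1) * (K z / (2 * (L + 1))) <= _).
      by apply: ler_pM => //; rewrite lerDl.
    by rewrite le_eqVlt; apply/orP; left; apply/eqP; field; rewrite gt_eqF.
  have := K_lip z' z; rewrite ler_norml => /andP[h2 _]; lra.
have rle z : rho z <= `|z| / 2 by rewrite ge_min lexx.
have z1' : z1 != 0 by rewrite lt_eqF.
have z2' : z2 != 0 by rewrite gt_eqF.
have r1 := rho_gt0 _ z1' Kz1; have r2 := rho_gt0 _ z2' Kz2.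
have k1 : 0 < K z1 / 2 * rho z1 by rewrite mulr_gt0// divr_gt0.
have k2 : 0 < K z2 / 2 * rho z2 by rewrite mulr_gt0// divr_gt0.
exists (Num.min (K z1 / 2 * rho z1) (K z2 / 2 * rho z2)); first by rewrite lt_min k1.
have H1 := nb_large (rho z1)^-1; have H2 := nb_large (rho z2)^-1.
have H3 := nb_large (`|z1| / 2)^-1.
(* With such a bandwidth the window extends at most [3/16] from [u], hence stays in [0, 1] for [u]
   in the half concerned. *)
have M0 : 0 < (8 * (1 + `|z1| + `|z2|))^-1.
  by rewrite invr_gt0 mulr_gt0//; have := normr_ge0 z1; have := normr_ge0 z2; lra.
have H4 : \forall n \near \oo, b n < (8 * (1 + `|z1| + `|z2|))^-1.
  by apply: cvgr_lt b_cvg0 _ M0.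
near=> n => u; rewrite in_itv/= => /andP[u0 u1].
have n1 : (1 <= n)%N by near: n; exact: nbhs_infty_ge.
have n8 : (8 <= n)%N by near: n; exact: nbhs_infty_ge.
have n8' : 8 <= n%:R :> R by rewrite (ler_nat R 8 n).
have /andP[bn0 _] := b01 n1; have Np : 0 < n%:R :> R by rewrite ltr0n.
have h1 : (rho z1)^-1 <= n%:R * b n by near: n.
have h2 : (rho z2)^-1 <= n%:R * b n by near: n.
have h3 : (`|z1| / 2)^-1 <= n%:R * b n by near: n.
have h4 : b n < (8 * (1 + `|z1| + `|z2|))^-1 by near: n.
have h4' : b n * (1 + `|z1| + `|z2|) <= 8^-1.
  have t0 : 0 < 8 * (1 + `|z1| + `|z2|) by rewrite -invr_gt0.
  have := ltW h4; rewrite -div1r ler_pdivlMr//; lra.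
have bz1 : 0 <= b n * `|z1| by rewrite mulr_ge0// ltW.
have bz2 : 0 <= b n * `|z2| by rewrite mulr_ge0// ltW.
have [ru1 ru2] := (rle z1, rle z2).
have [uh|uh] := leP u 2^-1.
  apply: (@le_trans _ _ (K z1 / 2 * rho z1)); first by rewrite ge_min lexx.
  have az : `|z1| = - z1 by rewrite ltr0_norm.
  have br := ler_wpM2l (ltW bn0) ru1.
  apply: kernel_mass_ge => //.
  - by rewrite divr_ge0// ltW.
  - by rewrite -(ler_pdivrMr _ _ r1) div1r.
  - exact: Kge.
  - apply: (@le_trans _ _ (n%:R * b n * (`|z1| / 2))).
      by rewrite -ler_pdivrMr ?div1r// divr_gt0// normr_gt0.
    by rewrite -mulrA ler_pM2l//; rewrite az in br *; lra.
  - by rewrite az in bz1 br h4'; lra.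
apply: (@le_trans _ _ (K z2 / 2 * rho z2)); first by rewrite ge_min lexx orbT.
have az : `|z2| = z2 by rewrite gtr0_norm.
have br := ler_wpM2l (ltW bn0) ru2.
apply: kernel_mass_ge => //.
- by rewrite divr_ge0// ltW.
- by rewrite -(ler_pdivrMr _ _ r2) div1r.
- exact: Kge.
- have hq : 4^-1 <= u - b n * (z2 + rho z2) by rewrite az in bz2 br h4'; lra.
  by have := ler_wpM2l (ltW Np) hq; lra.
- by rewrite az in bz2 br h4'; lra.
Unshelve. all: by end_near.
Qed.

End mass_lower_bound.

End kernel_weights.

Section interior_points.
Context {R : realType}.
Variables (K : R -> R) (L : R).
Hypothesis K_ge0 : forall z, 0 <= K z.
Hypothesis L0 : 0 <= L.
Hypothesis K_lip : forall x y, `|K x - K y| <= L * `|x - y|.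
Hypothesis K_supp : forall z, 1 < `|z| -> K z = 0.
Hypothesis K_int : \int[lebesgue_measure]_z K z = 1.
Variable b : nat -> R.
Hypothesis b01 : forall n, (1 <= n)%N -> 0 < b n < 1.
Hypothesis b_cvg0 : b n @[n --> \oo] --> (0 : R).
Hypothesis nb_large : forall M, \forall n \near \oo, M <= n%:R * b n.
Hypothesis inv_nb_cvg0 : (n%:R * b n)^-1 @[n --> \oo] --> (0 : R).
Variable u : R.
Hypothesis u01 : 0 < u < 1.

Lemma near_bandwidth_interior : \forall n \near \oo,
  [/\ (0 < n)%N, 0 < b n, b n < u, b n < 1 - u & 1 <= n%:R * b n].
Proof.
case/andP: u01 => u0 u1; have u1' : 0 < 1 - u by rewrite subr_gt0.
have h1 : \forall n \near \oo, b n < u by apply: cvgr_lt b_cvg0 _ u0.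
have h2 : \forall n \near \oo, b n < 1 - u by apply: cvgr_lt b_cvg0 _ u1'.
have h3 := nb_large 1; near=> n.
have n1 : (1 <= n)%N by near: n; exact: nbhs_infty_ge.
by split; [|have /andP[] := b01 n1|near: n|near: n|near: n].
Unshelve. all: by end_near.
Qed.

Let h n : R := (n%:R * b n)^-1.
Let z n i : R := (u - i%:R / n%:R) / b n.

Let sum_mesh (g : R -> R) n : b n < u -> 0 < b n -> (0 < n)%N ->
  (forall z, 1 < `|z| -> g z = 0) ->
  \sum_(i < n) g (z n i) = \sum_(1 <= i < n) g (z n i).
Proof.
move=> bu b0 n0 g0; rewrite -(big_mkord xpredT (fun i => g (z n i))) big_ltn// g0 ?add0r//.
by apply: lt_le_trans (ler_norm _); rewrite /z mul0r subr0 ltr_pdivlMr// mul1r.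
Qed.

Let mesh_cvg (g : R -> R) L' : 0 <= L' ->
  (forall x y, `|g x - g y| <= L' * `|x - y|) -> (forall z, 1 < `|z| -> g z = 0) ->
  h n * (\sum_(1 <= i < n) g (z n i)) @[n --> \oo] --> \int[lebesgue_measure]_x g x.
Proof.
move=> L'0 glip gsupp; have nI := near_bandwidth_interior.
apply: (@cvg_dist_bound _ _ _ _ _ (fun n => h n * (5 * L'))).
  apply: filterS nI => n [n0 b0 bu bu1 nb1].
  have h1 : h n <= 1 by rewrite /h invf_le1// (lt_le_trans ltr01).
  have h0 : 0 <= h n by rewrite /h invr_ge0 (le_trans ler01).
  rewrite -sum_mesh//; apply: le_trans (riemann_sum_error L'0 glip gsupp n0 b0 (ltW bu) bu1) _.
  rewrite -/(h n); apply: ler_wpM2l => //.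
  have := ler_wpM2l L'0 h1; rewrite mulr1 mulrDr [L' * (2 * _)]mulrCA; lra.
by rewrite -[X in _ --> X](mul0r (5 * L')); exact: cvgMr_tmp.
Qed.

Lemma interior_mass_cvg : kernel_mass K (b n) n u @[n --> \oo] --> (1 : R).
Proof.
rewrite -K_int; apply: cvg_trans (mesh_cvg L0 K_lip K_supp).
by apply: near_eq_cvg; apply: nearW => n; rewrite mulr_sumr.
Qed.

Lemma interior_mass_ge : \forall n \near \oo, 2^-1 <= kernel_mass K (b n) n u.
Proof.
apply: cvgr_ge interior_mass_cvg _ _; rewrite invf_lt1//; lra.
Qed.

(** The coefficients of the limiting martingale: small one by one, of small total variation, with
    sums of squares converging to the integral of [K^2]. *)
Let a n i : R := Num.sqrt (n%:R * b n) * weight K (b n) n u i.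

Lemma interior_sq_cvg : \sum_(i < n) a n i ^+ 2 @[n --> \oo] --> kernel_sq K.
Proof.
have K2supp w : 1 < `|w| -> K w ^+ 2 = 0 by move=> /K_supp ->; rewrite expr0n.
have L2 : 0 <= 6 * L ^+ 2 by rewrite mulr_ge0// sqr_ge0.
have c1 := mesh_cvg L2 (kernel_sq_lip K_ge0 L0 K_lip K_supp) K2supp.
have c2 : (kernel_mass K (b n) n u ^+ 2)^-1 @[n --> \oo] --> (1 : R).
  rewrite -[X in _ --> X]invr1; apply: cvgV; first exact: oner_neq0.
  rewrite -[X in _ --> X](mulr1 1); under eq_fun do rewrite expr2.
  by apply: cvgM; exact: interior_mass_cvg.
have c3 : h n * (\sum_(1 <= i < n) K (z n i) ^+ 2) * (kernel_mass K (b n) n u ^+ 2)^-1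
    @[n --> \oo] --> kernel_sq K.
  by rewrite -[X in _ --> X]mulr1; exact: cvgM c1 c2.
apply: cvg_trans c3; apply: near_eq_cvg.
apply: filterS near_bandwidth_interior => n [n0 b0 bu bu1 nb1].
have nb0 : 0 < n%:R * b n by rewrite (lt_le_trans ltr01).
transitivity (\sum_(i < n) weight K (b n) n u i * (n%:R * b n * weight K (b n) n u i)); last first.
  by apply: eq_bigr => i _; rewrite /a exprMn sqr_sqrtr ?(ltW nb0)// mulrCA expr2.
rewrite -(@sum_weight _ K (b n) n u (fun i => n%:R * b n * weight K (b n) n u i)).
rewrite mulr_sumr mulr_suml !big_nat; apply: eq_bigr => i hi.
rewrite /weight hi /kernel_weight /kernel_term -/(h n) -/(z n i) /= -[n%:R * b n]invrK -/(h n).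
set m := kernel_mass K (b n) n u.
have h0 : h n != 0 by rewrite gt_eqF// invr_gt0.
have [->|m0] := eqVneq m 0; first by rewrite expr0n/= !invr0; ring.
have alg (x k y : R) : x != 0 -> y != 0 ->
    x * k ^+ 2 / y ^+ 2 = x * k / y * (x^-1 * (x * k / y)).
  by move=> x0 y0; field; rewrite y0 x0.
exact: alg.
Qed.

(** The constants come from [K <= 3 L], from a mass at least 1/2, and from a variation of [K] along
    the mesh of at most [5 L] once [h n <= 1]. *)
Lemma interior_bounds : \forall n \near \oo,
  [/\ forall i, 0 <= a n i <= 6 * L * Num.sqrt (h n),
      a n 0%N = 0, a n n = 0 &
      \sum_(i < n) `|a n i.+1 - a n i| <= 10 * L * Num.sqrt (h n)].
Proof.
have m2 := interior_mass_ge.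
apply: filterS2 near_bandwidth_interior m2 => n [n0 b0 bu bu1 nb1] mass2.
have nb0 : 0 < n%:R * b n by rewrite (lt_le_trans ltr01).
have h0 : 0 < h n by rewrite invr_gt0.
have h1 : h n <= 1 by rewrite /h invf_le1.
have sh : Num.sqrt (n%:R * b n) * h n = Num.sqrt (h n).
  have s0 : Num.sqrt (n%:R * b n) != 0 by rewrite gt_eqF// sqrtr_gt0.
  rewrite /h sqrtrV ?(ltW nb0)// -{2}(sqr_sqrtr (ltW nb0)) expr2 invfM mulrA divff// mul1r//.
have a0 : a n 0 = 0 by rewrite /a /weight mulr0.
have an : a n n = 0 by rewrite /a /weight ltnn andbF mulr0.
have i20 : 0 < 2^-1 :> R by rewrite invr_gt0.
split=> //.
- move=> i; apply/andP; split; first by rewrite mulr_ge0 ?sqrtr_ge0 ?weight_ge0.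
  rewrite -sh; have := weight_le K_ge0 L0 K_lip K_supp b0 n0 i i20 mass2.
  rewrite invfM invrK -/(h n) => /(ler_wpM2l (sqrtr_ge0 (n%:R * b n))).
  by rewrite -/(a n i) (_ : Num.sqrt _ * (_ * _) = 6 * L * (Num.sqrt (n%:R * b n) * h n)); last ring.
- set m := kernel_mass K (b n) n u in mass2.
  have m0 : 0 < m by apply: lt_le_trans mass2.
  have aE i : (i <= n)%N -> a n i = Num.sqrt (h n) / m * K (z n i).
    move=> iln; rewrite /a /weight; case: ifPn => [hi|].
      by rewrite /kernel_weight /kernel_term -/m -/(h n) -/(z n i) -sh; ring.
    rewrite negb_and -leqNgt leqn0 -leqNgt => /orP[/eqP ->|ni].
      rewrite K_supp ?mulr0//; apply: lt_le_trans (ler_norm _).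
      by rewrite /z mul0r subr0 ltr_pdivlMr// mul1r.
    have -> : i = n by apply/eqP; rewrite eqn_leq iln.
    rewrite K_supp ?mulr0// -normrN; apply: lt_le_trans (ler_norm _).
    by rewrite /z divff ?pnatr_eq0 -?lt0n// -mulNr opprB ltr_pdivlMr// mul1r.
  apply: (@le_trans _ _ (\sum_(i < n) Num.sqrt (h n) / m * `|K (z n i.+1) - K (z n i)|)).
    apply: ler_sum => i _; rewrite !aE ?(ltnW (ltn_ord i))// -mulrBr normrM.
    by rewrite ger0_norm// divr_ge0 ?sqrtr_ge0// ltW.
  have tv := total_variation_mesh L0 K_lip K_supp u n0 b0.
  have mi : m^-1 <= 2 by rewrite -[leRHS]invrK lef_pV2// posrE.
  have m1 : Num.sqrt (h n) / m <= Num.sqrt (h n) * 2 by rewrite ler_wpM2l ?sqrtr_ge0.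
  rewrite -mulr_sumr; apply: le_trans (ler_wpM2r _ m1) _; first by apply: sumr_ge0.
  apply: le_trans (ler_wpM2l _ tv) _; first by rewrite mulr_ge0 ?sqrtr_ge0.
  rewrite -/(h n) (_ : 10 * L * _ = Num.sqrt (h n) * 2 * (5 * L)); last by ring.
  rewrite ler_wpM2l ?mulr_ge0 ?sqrtr_ge0//.
  have := ler_wpM2l L0 h1; rewrite mulr1 mulrDr [L * (2 * _)]mulrCA; lra.
Qed.

End interior_points.

(** * The triangular array *)

Section triangular_array.
Context {R : realType} {E : finType}.
Variable kappa : R.
Hypothesis kappa01 : 0 < kappa < 1.
Variable Q : R -> E -> E -> R.
Hypothesis Q_transition : forall u, u \in `[0, 1] -> transition_matrix (Q u).
Hypothesis Q_irreducible : forall u, u \in `[0, 1] -> irreducible (Q u).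
Hypothesis Q_aperiodic : forall u, u \in `[0, 1] -> aperiodic (Q u).
Hypothesis Q_holder : forall x y, holder01 kappa (fun u => Q u x y).
Hypothesis Q_neg : forall u, u < 0 -> Q u = Q 0.
Variable pi : R -> E -> R.
Hypothesis pi_inv : forall u, u \in `[0, 1] -> invariant_probability (Q u) (pi u).
Context {d : measure_display} {T : measurableType d}.
Variables (P : probability T R) (X : nat -> int -> T -> E).
Hypothesis X_markov : forall n, (1 <= n)%N -> row_markov_chain P Q n (X n).

(* The hypotheses say nothing about row 0, which is replaced with row 1. *)
Definition row (n : nat) := X (maxn n 1).

Definition row_prob (n : nat) : {ffun 'I_n.+1 -> E} -> R := path_prob P (row n).

Lemma rowE n : (1 <= n)%N -> row n = X n.
Proof. by move=> n1; rewrite /row (maxn_idPl n1). Qed.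

Lemma row_measurable n (k : int) : k <= n%:Z -> forall x, measurable [set w | row n k w = x].
Proof.
move=> kn x; have n1 : (1 <= maxn n 1)%N by rewrite leq_max orbT.
have [mX _] := X_markov n1; apply: mX; apply: le_trans kn _.
by rewrite lez_nat leq_max leqnn.
Qed.

Lemma row_prob_ge0 n s : 0 <= @row_prob n s.
Proof. exact: path_prob_ge0. Qed.

Lemma row_prob_sum1 n : \sum_s @row_prob n s = 1.
Proof. exact: (path_prob_sum1 P (@row_measurable n)). Qed.

Lemma row_expectation n (F : {ffun 'I_n.+1 -> E} -> R) :
  'E_P[fun w => F (path_of n (row n) w)]%E = (Ex (@row_prob n) F)%:E.
Proof. exact: (path_expectation P (@row_measurable n)). Qed.

Lemma row_markov n : (1 <= n)%N ->
  markov_property (@row_prob n) (@coordinate E n) (triangular_transition Q n) n.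
Proof.
move=> n1; apply: (path_markov (@row_measurable n)).
by rewrite rowE//; exact: X_markov.
Qed.

(** At times [k <= 0] the transition is always [Q 0], and the row has no beginning: for every [k],
    its law at time 0 is the law at time [-k] moved by [k] steps of [Q 0], so its distance to [pi 0]
    is at most [2 c0 r^k]. *)
Lemma initial_law (c0 r : R) n : (1 <= n)%N -> 1 <= c0 -> 0 < r < 1 ->
  (forall k j (v : E -> R), \sum_x v x = 0 ->
    l1norm (rowmul v (chainmx (fun=> Q 0) k j)) <= c0 * r ^+ j * l1norm v) ->
  law (@row_prob n) (@coordinate E n) 0 = pi 0.
Proof.
move=> n1 c01 r01 contr; have i0 : (0 : R) \in `[0, 1] by rewrite in_itv/= lexx ler01.
have [p0 p1 pE] := pi_inv i0.
pose nu (k : int) x : R := fine (P [set w | row n k w = x]).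
have nuS (k : int) x : k <= 0 -> nu k x = rowmul (nu (k - 1)) (Q 0) x.
  move=> k0; have H : row_markov_chain P Q n (row n) by rewrite rowE//; exact: X_markov.
  apply: (law_past x H k0); have [->|k0'] := eqVneq k 0; first by rewrite mul0r.
  by rewrite Q_neg// pmulr_llt0 ?invr_gt0 ?ltr0n// ltrz0 lt_neqAle k0' k0.
have nu_prob (k : int) : k <= 0 -> (forall x, 0 <= nu k x) /\ \sum_x nu k x = 1.
  move=> k0; split; first by move=> x; rewrite /nu fine_ge0.
  pose Y0 (j : int) := row n (k + j).
  have mY0 (j : int) : j <= Posz 0 -> forall z, measurable [set w | Y0 j w = z].
    by move=> j0 z; apply: row_measurable; lia.
  have nuE x : nu k x = Ex (@path_prob R E d T P 0 Y0) (fun s => (coordinate 0 s == x)%:R).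
    rewrite /nu; have -> : [set w | row n k w = x] = [set w | coordinate 0 (path_of 0 Y0 w) == x].
      apply/seteqP; split=> w /=; rewrite coordinate_path// /Y0 addr0.
        by move/eqP.
      by move/eqP.
    by rewrite (@path_event R E d T P 0 Y0 mY0 (fun s => coordinate 0 s == x)).
  under eq_bigr do rewrite nuE; rewrite -Ex_sum.
  rewrite -[RHS](Ex_cst (path_prob_sum1 P mY0) 1); apply: eq_Ex => s.
  by rewrite -[RHS](sum_delta (fun=> 1) (coordinate 0 s)); apply: eq_bigr => x _; rewrite mulr1.
have lawE x : law (@row_prob n) (@coordinate E n) 0 x = nu 0 x.
  rewrite /law /nu; have -> : [set w | row n 0 w = x] =
      [set w | coordinate 0 (path_of n (row n) w) == x].
    apply/seteqP; split=> w /=; rewrite coordinate_path//; by move/eqP.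
  by rewrite (@path_event R E d T P n (row n) (@row_measurable n) (fun s => coordinate 0 s == x)).
have dist0 : l1norm (fun x => nu 0 x - pi 0 x) <= 0.
  apply: (@le_of_geometric _ _ (c0 * 2) 0 r) => // k.
  pose D (j : nat) x := nu (j%:Z - k%:Z) x - pi 0 x.
  have := @l1norm_perturbed R E (fun=> Q 0) c0 r c01 r01 contr k D (fun _ _ => 0) 0 (lexx 0).
  move=> /(_ _ _ _ _ k (leqnn k)) H.
  have Dk : D k = (fun x => nu 0 x - pi 0 x) by rewrite /D subrr.
  rewrite Dk in H; apply: le_trans (H _ _ _ _) _.
  - move=> j jk y; rewrite addr0 /D nuS; last by lia.
    have -> : j.+1%:Z - k%:Z - 1 = j%:Z - k%:Z by lia.
    by rewrite /rowmul -[X in _ - X]pE -sumrB; apply: eq_bigr => x _; rewrite mulrBl.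
  - by move=> j _; rewrite big1.
  - by move=> j _; rewrite /l1norm big1// => x _; rewrite normr0.
  - by rewrite sumrB p1; have [|_ ->] := @nu_prob (0%:Z - k%:Z); [lia|rewrite subrr].
  - rewrite mul0r !addr0 -mulrA; case/andP: r01 => r0 r1.
    apply: ler_wpM2l; first exact: le_trans c01.
    rewrite mulrC; apply: ler_wpM2r; first by rewrite exprn_ge0// ltW.
    have [|n0' n1'] := @nu_prob (0%:Z - k%:Z); first by lia.
    apply: (@le_trans _ _ (\sum_x (nu (0%:Z - k%:Z) x + pi 0 x))).
      by apply: ler_sum => x _; apply: le_trans (ler_normB _ _) _; rewrite !ger0_norm.
    by rewrite big_split/= n1' p1.
apply/funext => x; rewrite lawE; apply/eqP; rewrite -subr_eq0 -normr_le0.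
by apply: le_trans dist0; exact: (@ler_l1norm R E (fun x => nu 0 x - pi 0 x) x).
Qed.

Lemma chain_constants : exists c0 r delta C : R,
  [/\ [/\ 1 <= c0, 0 < r < 1, 0 < delta & 0 < C],
    forall u, u \in `[0, 1] -> forall k j (v : E -> R), \sum_x v x = 0 ->
      l1norm (rowmul v (chainmx (fun=> Q u) k j)) <= c0 * r ^+ j * l1norm v,
    (forall u, u \in `[0, 1] -> forall y, delta <= pi u y),
    (forall u v, u \in `[0, 1] -> v \in `[0, 1] ->
       (forall x, \sum_y `|Q u x y - Q v x y| <= C * `|u - v| `^ kappa) /\
       l1norm (fun x => pi u x - pi v x) <= C * `|u - v| `^ kappa) &
    \forall n \near \oo,
      (forall k j (v : E -> R), \sum_x v x = 0 ->
        l1norm (rowmul v (chainmx (triangular_transition Q n) k j)) <=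
        c0 * r ^+ j * l1norm v) /\
      (forall i, (i <= n)%N ->
        l1norm (fun x => law (@row_prob n) (@coordinate E n) i x - pi (i%:R / n%:R) x) <=
        C * n%:R^-1 `^ kappa)].
Proof.
have [m [delta [m0 d01 mixQ mixA]]] := uniform_mixing kappa01 Q_transition Q_irreducible Q_aperiodic Q_holder.
have [C1 C10 hC1] := holder_uniform Q_holder.
pose c0 := mix_cst m delta; pose r := mix_rate m delta.
have c01 : 1 <= c0 by exact: mix_cst_ge1.
have r01 : 0 < r < 1 by exact: mix_rate_bounds.
have r1 : 0 < 1 - r by case/andP: r01 => ? ?; rewrite subr_gt0.
have contrQ u : u \in `[0, 1] -> forall k j (v : E -> R), \sum_x v x = 0 ->
      l1norm (rowmul v (chainmx (fun=> Q u) k j)) <= c0 * r ^+ j * l1norm v.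
  move=> hu k j v v0; apply: l1norm_chainmx => // [_|k' x y]; first exact: Q_transition.
  by rewrite -(tpowE (Q u) k' m); exact: mixQ.
pose C2 := c0 * (C1 / (1 - r)).
have C20 : 0 < C2 by rewrite mulr_gt0 ?divr_gt0// (lt_le_trans ltr01).
have piC u v : u \in `[0, 1] -> v \in `[0, 1] ->
    l1norm (fun x => pi u x - pi v x) <= C2 * `|u - v| `^ kappa.
  move=> hu hv; have [pu0 pu1 puE] := pi_inv hu.
  have -> : C2 * `|u - v| `^ kappa = c0 * (C1 * `|u - v| `^ kappa / (1 - r)).
    by rewrite /C2; ring.
  apply: (l1norm_sub_invariant (Q_transition hv) (pi_inv hv) c01 r01 (contrQ v hv)) => //.
  apply: (@le_trans _ _ (\sum_y \sum_x pi u x * `|Q u x y - Q v x y|)).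
    apply: ler_sum => y _; rewrite -{1}puE -sumrB; apply: le_trans (ler_norm_sum _ _ _) _.
    by apply: ler_sum => x _; rewrite -mulrBr normrM ger0_norm.
  rewrite exchange_big/= -[leRHS]mul1r -pu1 mulr_suml; apply: ler_sum => x _.
  by rewrite -mulr_sumr; apply: ler_wpM2l => //; exact: hC1.
pose C3 := c0 * (C2 / (1 - r)).
have C30 : 0 < C3 by rewrite mulr_gt0 ?divr_gt0// (lt_le_trans ltr01).
exists c0, r, delta, (C1 + C2 + C3); split=> //.
- by split=> //; [case/andP: d01|rewrite !addr_gt0].
- by move=> u hu y; apply: (invariant_ge (m := m) (pi_inv hu)) => x; exact: mixQ.
- move=> u v hu hv; have p0 := powR_ge0 `|u - v| kappa; split=> [x|].
    by apply: le_trans (hC1 u v hu hv x) _; apply: ler_wpM2r => //; lra.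
  by apply: le_trans (piC u v hu hv) _; apply: ler_wpM2r => //; lra.
- near=> n; have mixn : forall k x y, delta <= chainmx (triangular_transition Q n) k m x y by near: n.
  have n1 : (1 <= n)%N by near: n; exact: nbhs_infty_ge.
  have N0 : 0 < n%:R :> R by rewrite ltr0n.
  have trA := triangular_transitionP Q_transition n.
  have contrA k j (v : E -> R) : \sum_x v x = 0 ->
      l1norm (rowmul v (chainmx (triangular_transition Q n) k j)) <= c0 * r ^+ j * l1norm v.
    by move=> v0; apply: l1norm_chainmx.
  split=> // i iln.
  have i0 : (0 : R) \in `[0, 1] by rewrite in_itv/= lexx ler01.
  have kn k : (k <= n)%N -> k%:R / n%:R \in `[0 : R, 1].
    move=> kn; rewrite in_itv/= divr_ge0 ?ler0n//= ler_pdivrMr// mul1r ler_nat//.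
  pose lw := law (@row_prob n) (@coordinate E n).
  pose D k x := lw k x - pi (k%:R / n%:R) x.
  (* Since [pi ((k+1)/n)] is invariant for the transition into time [k + 1], the discrepancy [D]
     obeys the perturbed recursion with error [p' k] moved by that transition, of order
     [n^-kappa]. *)
  pose p' k x := pi (k%:R / n%:R) x - pi (k.+1%:R / n%:R) x.
  pose e k := rowmul (p' k) (triangular_transition Q n k.+1).
  pose eta := C2 * n%:R^-1 `^ kappa.
  have eta0 : 0 <= eta by rewrite mulr_ge0 ?powR_ge0// ltW.
  have D0 : D 0%N = (fun=> 0).
    by apply/funext => x; rewrite /D /lw (initial_law n1 c01 r01 (contrQ _ i0)) mul0r subrr.
  have p'0 k : (k < n)%N -> \sum_x p' k x = 0.
    move=> kn'; rewrite sumrB; have [_ -> _] := pi_inv (kn _ (ltnW kn')).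
    by have [_ -> _] := pi_inv (kn _ kn'); rewrite subrr.
  have := @l1norm_perturbed R E (triangular_transition Q n) c0 r c01 r01 contrA n D e eta eta0.
  move=> /(_ _ _ _ _ i iln) H; apply: le_trans (H _ _ _ _) _.
  + move=> k kn' y; rewrite /D /lw (lawS (row_markov n1) kn').
    have [_ _ pE] := pi_inv (kn _ kn').
    rewrite /e /rowmul -big_split/= -[X in _ - X]pE -sumrB; apply: eq_bigr => x _.
    by rewrite /triangular_transition (minn_idPl kn') /p'; ring.
  + by move=> k kn'; rewrite (rowmul_sum _ (trA _)) p'0.
  + move=> k kn'; apply: le_trans (l1norm_rowmul _ (trA _)) _.
    apply: le_trans (piC _ _ (kn _ (ltnW kn')) (kn _ kn')) _.
    have -> : `|k%:R / n%:R - k.+1%:R / n%:R| = n%:R^-1 :> R.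
      by rewrite -mulrBl -natr1 opprD addrA subrr sub0r mulN1r normrN ger0_norm// invr_ge0.
    by [].
  + by rewrite D0 big1.
  + have l0 : l1norm (D 0%N) = 0 by rewrite D0 /l1norm big1// => x _; rewrite normr0.
    rewrite l0 mulr0 add0r.
    have -> : c0 * (eta / (1 - r)) = C3 * n%:R^-1 `^ kappa by rewrite /C3 /eta; ring.
    by apply: ler_wpM2r; [exact: powR_ge0|lra].
Unshelve. all: by end_near.
Qed.

End triangular_array.

Lemma finite_bound2 {R : realType} {E : finType} (g : E -> E -> R) :
  exists B, forall x y, `|g x y| <= B.
Proof.
exists (\sum_x \sum_y `|g x y|) => x y.
rewrite (bigD1 x)//= (bigD1 y)//= -addrA lerDl addr_ge0 ?sumr_ge0// => z _.
by apply: sumr_ge0.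
Qed.

(** * Limit theorems for the estimators *)

Section triangular_clt.
Context {R : realType} {E : finType}.
Variables (Omega : nat -> finType) (pr : forall n, Omega n -> R).
Variables (Y : forall n, nat -> Omega n -> E) (A : nat -> nat -> E -> E -> R).
Hypothesis pr_ge0 : forall n w, 0 <= @pr n w.
Hypothesis pr_sum1 : forall n, \sum_w @pr n w = 1.
Hypothesis trA : forall n k, transition_matrix (A n k).
Hypothesis markov : forall n, (1 <= n)%N -> markov_property (@pr n) (@Y n) (A n) n.
Variables (c0 r : R).
Hypothesis c0_ge1 : 1 <= c0.
Hypothesis r01 : 0 < r < 1.
Hypothesis contraction : \forall n \near \oo, forall k j (v : E -> R), \sum_x v x = 0 ->
  l1norm (rowmul v (chainmx (A n) k j)) <= c0 * r ^+ j * l1norm v.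
Variables (M : E -> E -> R) (p : E -> R).
Hypothesis trM : transition_matrix M.
Hypothesis pM : invariant_probability M p.
Hypothesis contractionM : forall k j (v : E -> R), \sum_x v x = 0 ->
  l1norm (rowmul v (chainmx (fun=> M) k j)) <= c0 * r ^+ j * l1norm v.
Variables (a : nat -> nat -> R) (eps tau eta : nat -> R) (kappa2 : R).
Hypothesis a_bound : \forall n \near \oo, forall k, 0 <= a n k <= eps n.
Hypothesis eps_cvg : eps n @[n --> \oo] --> (0 : R).
Hypothesis a_tv : \forall n \near \oo, \sum_(i < n) `|a n i.+1 - a n i| <= tau n.
Hypothesis tau_cvg : tau n @[n --> \oo] --> (0 : R).
Hypothesis a_sq : \sum_(i < n) a n i ^+ 2 @[n --> \oo] --> kappa2.
Hypothesis a_close : \forall n \near \oo, forall k, a n k != 0 ->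
  (k < n)%N /\ forall x, \sum_y `|A n k.+1 x y - M x y| <= eta n.
Hypothesis eta_ge0 : \forall n \near \oo, 0 <= eta n.
Hypothesis eta_cvg : eta n @[n --> \oo] --> (0 : R).
Variable x0 : E.

Lemma near_positive_row : \forall n \near \oo, (1 <= n)%N.
Proof. exact: nbhs_infty_ge. Qed.

Lemma kappa2_ge0 : 0 <= kappa2.
Proof.
by apply: cvgr_to_ge a_sq _; apply: nearW => n; apply: sumr_ge0 => i _; exact: sqr_ge0.
Qed.

Lemma a_sq_bounded : \forall n \near \oo, \sum_(i < n) a n i ^+ 2 <= kappa2 + 1.
Proof. by apply: cvgr_le a_sq _ _; rewrite ltrDl. Qed.

Lemma cvg0_le (f g : nat -> R) : (\forall n \near \oo, 0 <= f n <= g n) ->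
  g n @[n --> \oo] --> (0 : R) -> f n @[n --> \oo] --> (0 : R).
Proof.
move=> fg; apply: cvg_dist_bound; apply: filterS fg => n /andP[f0 ?].
by rewrite subr0 ger0_norm.
Qed.

(** Cauchy-Schwarz in the form [F G <= th F^2 + G^2 / th], with [th] fixed by the target
    precision. *)
Lemma cvg_Ex_mul (F G : forall n, Omega n -> R) (C : R) :
  (forall n w, 0 <= @F n w) -> (forall n w, 0 <= @G n w) ->
  (\forall n \near \oo, Ex (@pr n) (fun w => @F n w ^+ 2) <= C) ->
  Ex (@pr n) (fun w => @G n w ^+ 2) @[n --> \oo] --> (0 : R) ->
  Ex (@pr n) (fun w => @F n w * @G n w) @[n --> \oo] --> (0 : R).
Proof.
move=> F0 G0 FC Gcv; apply/cvgrPdist_le => e e0.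
have C0 : 0 < `|C| + 1 by rewrite ltr_wpDl.
pose th := e / (2 * (`|C| + 1)); have th0 : 0 < th by rewrite divr_gt0// mulr_gt0.
have the : 0 < th * e / 2 by rewrite divr_gt0// mulr_gt0.
have G2 : \forall n \near \oo, Ex (@pr n) (fun w => @G n w ^+ 2) <= th * e / 2.
  by apply: cvgr_le Gcv _ the.
apply: filterS2 FC G2 => n HF HG; rewrite sub0r normrN ger0_norm; last first.
  by apply: Ex_ge0 => // w; exact: mulr_ge0.
apply: (@le_trans _ _ (Ex (@pr n) (fun w => th * @F n w ^+ 2 + th^-1 * @G n w ^+ 2))).
  apply: ler_Ex => // w; rewrite -(ler_pM2l th0) mulrDr mulrA.
  rewrite (mulrA th th^-1) divff ?gt_eqF// mul1r.
  move: (F0 n w) (G0 n w) (@F n w) (@G n w) => _ _ f g.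
  rewrite (_ : th * (th * f ^+ 2) = (th * f) ^+ 2); last by ring.
  move: (th * f) => s; have := sqr_ge0 (s - g); have := sqr_ge0 s; have := sqr_ge0 g.
  by nra.
rewrite ExD !ExZ (_ : e = e / 2 + e / 2); last by field.
apply: lerD.
  apply: le_trans (ler_wpM2l (ltW th0) HF) _.
  apply: le_trans (ler_wpM2l (ltW th0) (_ : C <= `|C| + 1)) _.
    by apply: le_trans (ler_norm C) _; rewrite lerDl.
  by rewrite le_eqVlt; apply/orP; left; apply/eqP; rewrite /th; field; rewrite gt_eqF.
apply: le_trans (ler_wpM2l _ HG) _; first by rewrite invr_ge0 ltW.
by rewrite -mulrA mulKf// gt_eqF.
Qed.

Lemma cvg_Ex_abs (G : forall n, Omega n -> R) :
  Ex (@pr n) (fun w => @G n w ^+ 2) @[n --> \oo] --> (0 : R) ->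
  Ex (@pr n) (fun w => `|@G n w|) @[n --> \oo] --> (0 : R).
Proof.
move=> h; have := @cvg_Ex_mul (fun _ _ => 1) (fun n w => `|@G n w|) 1.
move=> /(_ (fun _ _ => ler01) (fun _ _ => normr_ge0 _)) H.
have h1 : \forall n \near \oo, Ex (@pr n) (fun=> 1 ^+ 2) <= 1.
  by apply: nearW => n; rewrite expr1n Ex_cst.
have h2 : Ex (@pr n) (fun w => `|@G n w| ^+ 2) @[n --> \oo] --> (0 : R).
  apply: cvg_trans h; apply: near_eq_cvg; apply: nearW => n.
  by apply: eq_Ex => w; rewrite real_normK ?num_real.
apply: cvg_trans (H h1 h2); apply: near_eq_cvg; apply: nearW => n.
by apply: eq_Ex => w; rewrite mul1r.
Qed.

Lemma functional0E n (f : nat -> E -> E -> R) (w : Omega n) :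
  functional (@Y n) f n 0 w = \sum_(i < n) f i (Y i w) (Y i.+1 w).
Proof. by []. Qed.

Lemma functional_variance n (f : nat -> E -> E -> R) (phi : nat -> R) (Phi : R) :
  (1 <= n)%N -> (forall k j (v : E -> R), \sum_x v x = 0 ->
     l1norm (rowmul v (chainmx (A n) k j)) <= c0 * r ^+ j * l1norm v) ->
  (forall k x y, `|f k x y| <= phi k) -> \sum_(i < n) phi i ^+ 2 <= Phi -> 0 <= Phi ->
  Ex (@pr n) (fun w => (functional (@Y n) f n 0 w - Ex (@pr n) (functional (@Y n) f n 0)) ^+ 2)
  <= 8 * expR 1 * mgf_cst c0 r * Phi.
Proof.
move=> n1 contr hf hPhi Phi0.
(* [variance_functional] requires a positive [Phi]; it is applied to [Phi + r^k], and [k] goes to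
   infinity. *)
apply: (@le_of_geometric _ _ (8 * expR 1 * mgf_cst c0 r) _ r) => // k.
have rk : 0 < r ^+ k by rewrite exprn_gt0//; case/andP: r01.
have H := @variance_functional R E (Omega n) (@pr n) (@Y n) (A n) n (@pr_ge0 n)
  (@pr_sum1 n) (trA n) (markov n1) c0 r c0_ge1 r01 contr f phi (Phi + r ^+ k) hf.
apply: le_trans (H _ _) _; first by apply: le_trans hPhi _; rewrite lerDl ltW.
  by rewrite ltr_wpDl.
by rewrite mulrDr addrC.
Qed.

Lemma mean_martingale n (g : E -> E -> R) : (1 <= n)%N ->
  Ex (@pr n) (martingale (@Y n) (A n) g (a n) n) = 0.
Proof.
move=> n1; rewrite /martingale Ex_sum big1// => i _.
have ad : adapted (@Y n) i (fun=> a n i) by [].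
rewrite (markov_step (markov n1) (increment g (A n i.+1)) (ltn_ord i) ad).
have e0 x : avg (A n i.+1) (increment g (A n i.+1) x) x = 0.
  by rewrite /increment avgB avg_cst ?subrr.
by under eq_Ex do rewrite e0 mulr0; rewrite Ex_cst.
Qed.

Lemma row_increment_bound n k (g : E -> E -> R) B x y : (forall x y, `|g x y| <= B) ->
  `|increment g (A n k) x y| <= 2 * B.
Proof.
move=> hB; apply: le_trans (ler_normB _ _) _.
by have := avg_bound x (trA n k) (hB x); have := hB x y; lra.
Qed.

Lemma martingale_sq (g : E -> E -> R) : exists C, \forall n \near \oo,
  Ex (@pr n) (fun w => martingale (@Y n) (A n) g (a n) n w ^+ 2) <= C.
Proof.
have [B hB] := finite_bound2 g.
exists (8 * expR 1 * mgf_cst c0 r * (4 * B ^+ 2 * (kappa2 + 1))).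
have aB := a_bound; have aS := a_sq_bounded; near=> n.
have n1 : (1 <= n)%N by near: n; exact: near_positive_row.
have contr : forall k j (v : E -> R), \sum_x v x = 0 ->
  l1norm (rowmul v (chainmx (A n) k j)) <= c0 * r ^+ j * l1norm v by near: n.
have aS' : \sum_(i < n) a n i ^+ 2 <= kappa2 + 1 by near: n.
pose f k x y := a n k * increment g (A n k.+1) x y.
have := @functional_variance n f (fun k => `|a n k| * (2 * B))
  (4 * B ^+ 2 * (kappa2 + 1)) n1 contr.
rewrite (_ : Ex _ (functional (@Y n) f n 0) = 0); last exact: (mean_martingale g n1).
move=> H; rewrite (_ : Ex _ _ = Ex (@pr n) (fun w => (functional (@Y n) f n 0 w - 0) ^+ 2)); last first.
  by apply: eq_Ex => w; rewrite subr0.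
apply: H.
- by move=> k x y; rewrite /f normrM ler_wpM2l//; exact: row_increment_bound.
- apply: (@le_trans _ _ (4 * B ^+ 2 * \sum_(i < n) a n i ^+ 2)).
    rewrite mulr_sumr; apply: ler_sum => i _.
    rewrite exprMn real_normK ?num_real//.
    by rewrite le_eqVlt; apply/orP; left; apply/eqP; ring.
  by apply: ler_wpM2l => //; rewrite mulr_ge0// sqr_ge0.
- apply: mulr_ge0; first by apply: mulr_ge0 => //; exact: sqr_ge0.
  by apply: addr_ge0 => //; exact: kappa2_ge0.
Unshelve. all: by end_near.
Qed.

Lemma increment_sum {J : finType} (t : J -> R) (G : J -> E -> E -> R) N x y :
  increment (fun x y => \sum_j t j * G j x y) N x y =
  \sum_j t j * increment (G j) N x y.
Proof.
rewrite /increment; under [RHS]eq_bigr do rewrite mulrBr.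
rewrite sumrB; congr (_ - _); rewrite /avg; under eq_bigr do rewrite mulr_sumr.
rewrite exchange_big/=; apply: eq_bigr => j _; rewrite mulr_sumr.
by apply: eq_bigr => z _; rewrite mulrCA.
Qed.

(** A linear combination of the martingales is the martingale of [g = sum of t j G j], so the scalar
    bound suffices (Cramer-Wold). The limiting variance [Vb kappa2] is written as a sum of squares
    over transitions, which exhibits the factor of the covariance needed to build the Gaussian
    limit. *)
Lemma clt_triangular {J : finType} (G : J -> E -> E -> R) (t : J -> R) (al : R) :
  Ex (@pr n) (fun w => cos (\sum_j t j * martingale (@Y n) (A n) (G j) (a n) n w + al))
    @[n --> \oo] -->
  expR (- ((\sum_(k : E * E) (\sum_j t j *
    (Num.sqrt (kappa2 * (p k.1 * M k.1 k.2)) * increment (G j) M k.1 k.2)) ^+ 2) / 2)) * cos al.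
Proof.
pose g x y := \sum_j t j * G j x y.
have [B hB] := finite_bound2 g.
pose V := cond_var g M; pose Vb := \sum_y p y * V y.
have [p0 p1 pE] := pM; have [M0 M1] := trM; have k20 := kappa2_ge0.
have V0 x : 0 <= V x by apply: sumr_ge0 => y _; rewrite mulr_ge0// sqr_ge0.
have Vb0 : 0 <= Vb by apply: sumr_ge0 => y _; rewrite mulr_ge0.
have [wf [hwf _]] := poisson_solution trM pM c0_ge1 r01 contractionM V.
pose W := \sum_x `|wf x|.
have hW x : `|wf x| <= W by rewrite /W (bigD1 x)//= lerDl sumr_ge0.
have VbE : Vb * kappa2 = \sum_(k : E * E) (\sum_j t j *
    (Num.sqrt (kappa2 * (p k.1 * M k.1 k.2)) * increment (G j) M k.1 k.2)) ^+ 2.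
  rewrite -(pair_bigA _ (fun x y => (\sum_j t j *
    (Num.sqrt (kappa2 * (p x * M x y)) * increment (G j) M x y)) ^+ 2)) /=.
  rewrite /Vb mulr_suml; apply: eq_bigr => x _.
  rewrite /V /cond_var /avg mulr_sumr mulr_suml; apply: eq_bigr => y _.
  rewrite increment_sum; under [X in _ = X ^+ 2]eq_bigr do rewrite mulrCA.
  by rewrite -mulr_sumr exprMn sqr_sqrtr ?mulr_ge0//; ring.
rewrite -VbE; pose S n := \sum_(i < n) a n i ^+ 2.
pose X n := Ex (@pr n) (fun w => cos (martingale (@Y n) (A n) g (a n) n w + al)).
have XE n : Ex (@pr n) (fun w => cos (\sum_j t j * martingale (@Y n) (A n) (G j) (a n) n w + al)) = X n.
  apply: eq_Ex => w; congr (cos (_ + _)); rewrite /martingale.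
  under eq_bigr do rewrite mulr_sumr; rewrite exchange_big/=.
  apply: eq_bigr => i _; rewrite /g increment_sum mulr_sumr.
  by apply: eq_bigr => j _; rewrite mulrCA.
under eq_fun do rewrite XE.
have cE : expR (2^-1 * Vb * S n) * X n @[n --> \oo] --> cos al.
  pose s := kappa2 + 1.
  pose bd n := expR (2^-1 * Vb * s) * (s * (clt_cst B W Vb * eps n + clt_cst' B W * eta n)
    + W * eps n * tau n + W * eps n).
  have bd0 : bd n @[n --> \oo] --> (0 : R).
    rewrite [X in _ --> X](_ : _ = expR (2^-1 * Vb * s) *
      (s * (clt_cst B W Vb * 0 + clt_cst' B W * 0) + W * 0 * 0 + W * 0)); last by ring.
    apply: cvgMl_tmp; apply: cvgD; last exact: cvgMl_tmp.
    apply: cvgD; last by apply: cvgM => //; exact: cvgMl_tmp.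
    by apply: cvgMl_tmp; apply: cvgD; exact: cvgMl_tmp.
  apply: cvg_dist_bound bd0.
  have aB := a_bound; have aS := a_sq_bounded; have aT := a_tv; have aC := a_close.
  have e0 := eta_ge0; have e1 : \forall n \near \oo, eps n <= 1.
    by apply: cvgr_le eps_cvg _ ltr01.
  near=> n; have n1 : (1 <= n)%N by near: n; exact: near_positive_row.
  have hb : forall k, 0 <= a n k <= eps n by near: n.
  have hc : forall k, a n k != 0 ->
    (k < n)%N /\ forall x, \sum_y `|A n k.+1 x y - M x y| <= eta n by near: n.
  have := @clt_bound R E (Omega n) (@pr n) (@Y n) (A n) n (@pr_ge0 n) (@pr_sum1 n)
    (trA n) (markov n1) M g (a n) wf B W Vb (eps n) (eta n) al trM hB hW Vb0 hwf.
  apply => //.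
  - apply/andP; split; last by near: n.
    by have /andP[h1 h2] := hb 0%N; apply: le_trans h2.
  - by move=> k; have /andP[h1 h2] := hb k; rewrite ger0_norm.
  - by near: n.
  - by move=> k /hc[].
  - by near: n.
  - by near: n.
(* The compensator is deterministic and converges, so it can be divided out of the previous
   limit. *)
have cS : expR (- (2^-1 * Vb * S n)) @[n --> \oo] --> expR (- (2^-1 * Vb * kappa2)).
  apply: continuous_cvg; first exact: continuous_expR.
  by apply: cvgN; exact: cvgMl_tmp.
have c3 : expR (- (2^-1 * Vb * S n)) * (expR (2^-1 * Vb * S n) * X n) @[n --> \oo] -->
    expR (- (Vb * kappa2 / 2)) * cos al.
  by rewrite (_ : Vb * kappa2 / 2 = 2^-1 * Vb * kappa2); [apply: cvgM|ring].
apply: cvg_trans c3; apply: near_eq_cvg; apply: nearW => n /=.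
by rewrite mulrA -expRD addNr expR0 mul1r.
Unshelve. all: by end_near.
Qed.

Lemma functional_var_cvg0 (f : nat -> nat -> E -> E -> R) (q : nat -> R) :
  (\forall n \near \oo, forall k x y, `|f n k x y| <= `|a n k| * q n) ->
  q n @[n --> \oo] --> (0 : R) ->
  Ex (@pr n) (fun w => (functional (@Y n) (f n) n 0 w -
    Ex (@pr n) (functional (@Y n) (f n) n 0)) ^+ 2) @[n --> \oo] --> (0 : R).
Proof.
move=> fq qcv; pose D := 8 * expR 1 * mgf_cst c0 r * (kappa2 + 1).
have k1 : 0 <= kappa2 + 1 by rewrite addr_ge0// kappa2_ge0.
apply: (@cvg0_le _ (fun n => D * q n ^+ 2)); last first.
  rewrite -[X in _ --> X](mulr0 D); apply: cvgMl_tmp.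
  rewrite -[X in _ --> X](mulr0 0); under eq_fun do rewrite expr2.
  exact: cvgM.
have aS := a_sq_bounded; near=> n.
have n1 : (1 <= n)%N by near: n; exact: near_positive_row.
have contr : forall k j (v : E -> R), \sum_x v x = 0 ->
  l1norm (rowmul v (chainmx (A n) k j)) <= c0 * r ^+ j * l1norm v by near: n.
have aS' : \sum_(i < n) a n i ^+ 2 <= kappa2 + 1 by near: n.
have fqn : forall k x y, `|f n k x y| <= `|a n k| * q n by near: n.
apply/andP; split; first by apply: Ex_ge0 => // w; exact: sqr_ge0.
have := @functional_variance n (f n) (fun k => `|a n k| * q n)
  ((kappa2 + 1) * q n ^+ 2) n1 contr fqn.
rewrite mulrA; apply; last by apply: mulr_ge0 => //; exact: sqr_ge0.
apply: (@le_trans _ _ ((\sum_(i < n) a n i ^+ 2) * q n ^+ 2)).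
  rewrite mulr_suml; apply: ler_sum => i _.
  by rewrite exprMn real_normK ?num_real.
by apply: ler_wpM2r => //; exact: sqr_ge0.
Unshelve. all: by end_near.
Qed.

Hypothesis a_ends : \forall n \near \oo, a n 0%N = 0 /\ a n n = 0.

(** Writing [F] as a constant plus [h - M h] splits the sum into a constant, a summation by parts
    bounded by the variation of [a], the martingale, and a term [T] due to the gap between [A] and
    [M]. The mean of [T] need not be small, but its variance is, which is why the sum must be
    centered at its own expectation. *)
Lemma poisson_approx (F h : E -> R) :
  (forall x, h x - avg M h x = F x - \sum_y p y * F y) ->
  Ex (@pr n) (fun w => cap ((\sum_(i < n) a n i * F (Y i w) -
      Ex (@pr n) (fun w => \sum_(i < n) a n i * F (Y i w))) -
    martingale (@Y n) (A n) (fun _ y => h y) (a n) n w)) @[n --> \oo] --> (0 : R).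
Proof.
move=> hF; have [H hH] := finite_bound2 (fun (_ : E) y => h y).
have H0 : 0 <= H by apply: le_trans (hH x0 x0).
pose f n k (x _ : E) := a n k * (avg (A n k.+1) h x - avg M h x).
pose T n (w : Omega n) := functional (@Y n) (f n) n 0 w.
have fq : \forall n \near \oo, forall k x y, `|f n k x y| <= `|a n k| * (H * eta n).
  have aC := a_close; apply: filterS aC => n hc k x y; rewrite /f normrM.
  have [->|ak] := eqVneq (a n k) 0; first by rewrite normr0 !mul0r.
  apply: ler_wpM2l => //; have [_ hx] := hc k ak.
  apply: le_trans (avg_dist (A n k.+1) M x (hH x)) _.
  by apply: ler_wpM2l.
have qcv : H * eta n @[n --> \oo] --> (0 : R).
  by rewrite -[X in _ --> X](mulr0 H); exact: cvgMl_tmp.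
have cT := cvg_Ex_abs (functional_var_cvg0 fq qcv).
apply: (@cvg0_le _ (fun n => 2 * (H * tau n) + Ex (@pr n) (fun w => `|T n w - Ex (@pr n) (T n)|))); last first.
  rewrite -[X in _ --> X]addr0; apply: cvgD; last exact: cT.
  rewrite [X in _ --> X](_ : _ = 2 * (H * 0)); last by rewrite !mulr0.
  by apply: cvgMl_tmp; exact: cvgMl_tmp.
have aT := a_tv; have aE := a_ends; near=> n.
have n1 : (1 <= n)%N by near: n; exact: near_positive_row.
have [a0 an] : a n 0%N = 0 /\ a n n = 0 by near: n.
have tv : \sum_(i < n) `|a n i.+1 - a n i| <= tau n by near: n.
apply/andP; split; first by apply: Ex_ge0 => // w; exact: cap_ge0.
pose m := \sum_y p y * F y.
pose g (_ y : E) := h y.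
pose mart (w : Omega n) := martingale (@Y n) (A n) g (a n) n w.
pose Ab (w : Omega n) := \sum_(i < n) a n i * (h (Y i w) - h (Y i.+1 w)).
have SE w : \sum_(i < n) a n i * F (Y i w) = m * (\sum_(i < n) a n i) + Ab w + mart w + T n w.
  rewrite /Ab /mart /martingale /T functional0E mulr_sumr -!big_split/=.
  apply: eq_bigr => i _; rewrite /f /increment /g.
  have := hF (Y i w); rewrite -/m => e.
  have -> : F (Y i w) = m + (h (Y i w) - avg M h (Y i w)) by rewrite e; ring.
  rewrite /avg; ring.
have AbE w : `|Ab w| <= H * tau n.
  have -> : Ab w = \sum_(i < n) (a n i.+1 - a n i) * h (Y i.+1 w).
    have : \sum_(0 <= i < n) (a n i.+1 * h (Y i.+1 w) - a n i * h (Y i w)) = 0.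
      by rewrite (telescope_sumr (fun i => a n i * h (Y i w))) ?a0 ?an ?mul0r ?subrr.
    rewrite big_mkord => tel; apply/esym/eqP; rewrite -subr_eq0 /Ab -sumrB; apply/eqP.
    by rewrite -[RHS]tel; apply: eq_bigr => i _; ring.
  apply: le_trans (ler_norm_sum _ _ _) _; apply: le_trans (ler_wpM2l H0 tv).
  by rewrite mulr_sumr; apply: ler_sum => i _; rewrite normrM mulrC; apply: ler_wpM2r => //; exact: (hH x0).
have ES : Ex (@pr n) (fun w => \sum_(i < n) a n i * F (Y i w)) =
    m * (\sum_(i < n) a n i) + Ex (@pr n) Ab + Ex (@pr n) (T n).
  under eq_Ex do rewrite SE; rewrite ExD ExD ExD Ex_cst// (mean_martingale g n1).
  by rewrite addr0.
apply: (@le_trans _ _ (Ex (@pr n) (fun w => 2 * (H * tau n) + `|T n w - Ex (@pr n) (T n)|))); last first.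
  by rewrite ExD Ex_cst.
apply: ler_Ex => // w; apply: le_trans (cap_le _) _.
rewrite SE ES -/(mart w) (_ : _ - mart w = (Ab w - Ex (@pr n) Ab) + (T n w - Ex (@pr n) (T n))); last by ring.
apply: le_trans (ler_normD _ _) _; rewrite lerD2r.
apply: le_trans (ler_normB _ _) _.
have : `|Ex (@pr n) Ab| <= H * tau n.
  apply: le_trans (ler_norm_Ex _ _) _ => //.
  by rewrite -[leRHS](Ex_cst (@pr_sum1 n)); exact: ler_Ex.
by have := AbE w; lra.
Unshelve. all: by end_near.
Qed.

Section ratio.
Variables (sigma : nat -> R) (c e : E).
Hypothesis sigma_gt0 : \forall n \near \oo, 0 < sigma n.
Hypothesis sigma_cvg : sigma n @[n --> \oo] --> (0 : R).
Hypothesis pc_gt0 : 0 < p c.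

Let occ n (w : Omega n) : R := \sum_(i < n) sigma n * a n i * (Y i w == c)%:R.
Let pair_occ n (w : Omega n) : R :=
  \sum_(i < n) sigma n * a n i * ((Y i w == c) && (Y i.+1 w == e))%:R.
Hypothesis bias : Ex (@pr n) (@occ n) @[n --> \oo] --> p c.

Let rho n := Ex (@pr n) (@pair_occ n) / Ex (@pr n) (@occ n).

Lemma mean_occ_sq : Ex (@pr n) (fun w => (@occ n w - p c) ^+ 2) @[n --> \oo] --> (0 : R).
Proof.
pose f n k (x _ : E) := sigma n * a n k * (x == c)%:R.
have fq : \forall n \near \oo, forall k x y, `|f n k x y| <= `|a n k| * sigma n.
  have s0 := sigma_gt0; apply: filterS s0 => n s0 k x y.
  rewrite /f !normrM (gtr0_norm s0) mulrC mulrA -[leRHS]mul1r -mulrA (mulrC (sigma n)).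
  by apply: ler_wpM2r; [rewrite mulr_ge0// ltW|case: eqP; rewrite ?normr1 ?normr0].
have v0 := functional_var_cvg0 fq sigma_cvg.
have b0 : (Ex (@pr n) (@occ n) - p c) ^+ 2 @[n --> \oo] --> (0 : R).
  have b1 : Ex (@pr n) (@occ n) - p c @[n --> \oo] --> (0 : R).
    by rewrite -[X in _ --> X](subrr (p c)); apply: cvgB => //; exact: cvg_cst.
  rewrite -[X in _ --> X](mulr0 0); under eq_fun do rewrite expr2.
  exact: cvgM.
apply: (@cvg0_le _ (fun n => Ex (@pr n) (fun w => (functional (@Y n) (f n) n 0 w -
    Ex (@pr n) (functional (@Y n) (f n) n 0)) ^+ 2) + (Ex (@pr n) (@occ n) - p c) ^+ 2)); last first.
  by rewrite -[X in _ --> X]addr0; exact: cvgD.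
apply: nearW => n; apply/andP; split; first by apply: Ex_ge0 => // w; exact: sqr_ge0.
rewrite le_eqVlt; apply/orP; left; apply/eqP.
change (functional (@Y n) (f n) n 0) with (@occ n); set m := Ex _ (@occ n).
have -> : Ex (@pr n) (fun w => (@occ n w - p c) ^+ 2) =
  Ex (@pr n) (fun w => (@occ n w - m) ^+ 2 + 2 * (m - p c) * (@occ n w - m) + (m - p c) ^+ 2).
  by apply: eq_Ex => w; ring.
by rewrite ExD ExD ExZ ExB !Ex_cst// -/m subrr mulr0 addr0.
Qed.

Let mean_pair n i : (i < n)%N ->
  Ex (@pr n) (fun w => ((Y i w == c) && (Y i.+1 w == e))%:R) =
  law (@pr n) (@Y n) i c * A n i.+1 c e.
Proof.
move=> ilt; have n1 : (1 <= n)%N by apply: leq_ltn_trans ilt.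
have ad : adapted (@Y n) i (fun w => (Y i w == c)%:R : R).
  by move=> w w' hw; rewrite hw.
under eq_Ex do rewrite -mulnb natrM.
rewrite (markov n1 ilt ad) /law -ExMr; apply: eq_Ex => w.
by case: eqP => [->|_]; rewrite ?mul0r.
Qed.

Let mean_occE n : Ex (@pr n) (@occ n) = \sum_(i < n) sigma n * a n i * law (@pr n) (@Y n) i c.
Proof. by rewrite /occ Ex_sum; apply: eq_bigr => i _; rewrite ExZ. Qed.

Let mean_pair_occE n : Ex (@pr n) (@pair_occ n) =
  \sum_(i < n) sigma n * a n i * (law (@pr n) (@Y n) i c * A n i.+1 c e).
Proof. by rewrite /pair_occ Ex_sum; apply: eq_bigr => i _; rewrite ExZ mean_pair. Qed.

(** [rho n] is an average, with nonnegative weights, of the entries [A n i.+1 c e], each within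
    [eta n] of [M c e] where the weight is not 0. *)
Lemma ratio_bias : \forall n \near \oo, 0 < Ex (@pr n) (@occ n) /\ `|rho n - M c e| <= eta n.
Proof.
have m0 : \forall n \near \oo, 0 < Ex (@pr n) (@occ n) by apply: cvgr_gt bias _ pc_gt0.
have s0 := sigma_gt0; have aC := a_close; have aB := a_bound; near=> n.
have m0' : 0 < Ex (@pr n) (@occ n) by near: n.
have s0' : 0 < sigma n by near: n.
have hb : forall k, 0 <= a n k <= eps n by near: n.
have hc : forall k, a n k != 0 ->
    (k < n)%N /\ forall x, \sum_y `|A n k.+1 x y - M x y| <= eta n by near: n.
split=> //.
have -> : rho n - M c e = (Ex (@pr n) (@pair_occ n) - M c e * Ex (@pr n) (@occ n)) / Ex (@pr n) (@occ n).
  by rewrite /rho mulrBl mulfK ?gt_eqF.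
rewrite normrM normfV (gtr0_norm m0') ler_pdivrMr// mean_occE mean_pair_occE !mulr_sumr -sumrB.
apply: le_trans (ler_norm_sum _ _ _) _; apply: ler_sum => i _.
have l0 := law_ge0 (@Y n) (@pr_ge0 n) i c; have /andP[ai _] := hb i.
have [->|aik] := eqVneq (a n i) 0; first by rewrite !(mulr0, mul0r) subrr normr0.
have [_ /(_ c) hci] := hc i aik.
have t0 : 0 <= sigma n * a n i * law (@pr n) (@Y n) i c by rewrite !mulr_ge0// ltW.
rewrite (_ : _ - _ = sigma n * a n i * law (@pr n) (@Y n) i c * (A n i.+1 c e - M c e)); last by ring.
rewrite normrM ger0_norm// [leLHS]mulrC; apply: ler_wpM2r => //; apply: le_trans hci.
by rewrite (bigD1 e)//= lerDl sumr_ge0.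
Unshelve. all: by end_near.
Qed.

(** The scaled [pair_occ - rho occ] is [p c] times the martingale plus a functional [B] of small
    variance. Dividing by [occ] is harmless when [occ >= p c / 2]; otherwise the cap 1 is at most
    [(2 / p c)^2 (occ - p c)^2], whose mean tends to 0. A vanishing denominator belongs to this
    second case. *)
Lemma ratio_approx :
  Ex (@pr n) (fun w => cap ((sigma n)^-1 * (@pair_occ n w / @occ n w - rho n) -
    martingale (@Y n) (A n) (fun x y => (x == c)%:R * (y == e)%:R / p c) (a n) n w))
  @[n --> \oo] --> (0 : R).
Proof.
pose g x y : R := (x == c)%:R * (y == e)%:R / p c.
pose mart n (w : Omega n) := martingale (@Y n) (A n) g (a n) n w.
pose f n k (x _ : E) := a n k * (x == c)%:R * (A n k.+1 c e - rho n).
pose B n (w : Omega n) := functional (@Y n) (f n) n 0 w.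
have rb := ratio_bias.
have fq : \forall n \near \oo, forall k x y, `|f n k x y| <= `|a n k| * (2 * eta n).
  have aC := a_close; apply: filterS2 aC rb => n hc [_ hr] k x y; rewrite /f -mulrA normrM.
  have [->|ak] := eqVneq (a n k) 0; first by rewrite normr0 !mul0r.
  apply: ler_wpM2l => //; have [_ /(_ c) hck] := hc k ak.
  have h1 : `|A n k.+1 c e - M c e| <= eta n.
    by apply: le_trans hck; rewrite (bigD1 e)//= lerDl sumr_ge0.
  have h2 : `|A n k.+1 c e - rho n| <= 2 * eta n.
    rewrite (_ : _ - rho n = (A n k.+1 c e - M c e) - (rho n - M c e)); last by ring.
    by apply: le_trans (ler_normB _ _) _; lra.
  case: eqP => _; rewrite ?mul1r// mul0r normr0.
  by apply: le_trans h2.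
have qcv : 2 * eta n @[n --> \oo] --> (0 : R).
  by rewrite -[X in _ --> X](mulr0 2); exact: cvgMl_tmp.
have cB := cvg_Ex_abs (functional_var_cvg0 fq qcv).
have [C hC] := martingale_sq g.
have osq := mean_occ_sq.
have cM : Ex (@pr n) (fun w => `|mart n w| * `|@occ n w - p c|) @[n --> \oo] --> (0 : R).
  apply: (@cvg_Ex_mul (fun n w => `|mart n w|) (fun n w => `|@occ n w - p c|) C) => //.
    apply: filterS hC => n; apply: le_trans; rewrite le_eqVlt; apply/orP; left; apply/eqP.
    by apply: eq_Ex => w; rewrite real_normK ?num_real.
  apply: cvg_trans osq; apply: near_eq_cvg; apply: nearW => n.
  by apply: eq_Ex => w; rewrite real_normK ?num_real.
pose k2 := 2 / p c; have k20 : 0 < k2 by rewrite divr_gt0.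
apply: (@cvg0_le _ (fun n => k2 * Ex (@pr n) (fun w => `|B n w - Ex (@pr n) (B n)|) +
   k2 * Ex (@pr n) (fun w => `|mart n w| * `|@occ n w - p c|) +
   k2 ^+ 2 * Ex (@pr n) (fun w => (@occ n w - p c) ^+ 2))); last first.
  rewrite [X in _ --> X](_ : _ = k2 * 0 + k2 * 0 + k2 ^+ 2 * 0); last by ring.
  by apply: cvgD; [apply: cvgD|]; apply: cvgMl_tmp.
have s0 := sigma_gt0; near=> n.
have n1 : (1 <= n)%N by near: n; exact: near_positive_row.
have s0' : 0 < sigma n by near: n.
have [m0 _] : 0 < Ex (@pr n) (@occ n) /\ `|rho n - M c e| <= eta n by near: n.
apply/andP; split; first by apply: Ex_ge0 => // w; exact: cap_ge0.
rewrite -!ExZ -!ExD; apply: ler_Ex => // w.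
(* Holds because [rho n] is the exact ratio of the two expectations; the remainder is thus centered,
   and its variance suffices. *)
have EB : Ex (@pr n) (B n) = 0.
  rewrite /B /functional Ex_sum.
  transitivity (\sum_(i < n) (sigma n)^-1 * (sigma n * a n i * (law (@pr n) (@Y n) i c * A n i.+1 c e) -
     rho n * (sigma n * a n i * law (@pr n) (@Y n) i c))).
    apply: eq_bigr => i _; rewrite /f add0n; under eq_Ex do rewrite mulrAC.
    by rewrite ExZ -/(law (@pr n) (@Y n) i c); field; rewrite gt_eqF.
  rewrite -mulr_sumr sumrB -mulr_sumr -mean_occE -mean_pair_occE /rho divfK ?gt_eqF//.
  by rewrite subrr mulr0.
rewrite EB subr0.
have decomp : (sigma n)^-1 * (@pair_occ n w - rho n * @occ n w) = p c * mart n w + B n w.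
  rewrite /pair_occ /occ /mart /martingale /B functional0E !mulr_sumr -sumrB mulr_sumr -big_split/=.
  apply: eq_bigr => i _; rewrite /f /increment /g.
  have -> : avg (A n i.+1) (fun y => (Y i w == c)%:R * (y == e)%:R / p c) (Y i w) =
     (Y i w == c)%:R * A n i.+1 c e / p c.
    rewrite /avg; transitivity (\sum_y ((Y i w == c)%:R / p c * A n i.+1 (Y i w) y) * (y == e)%:R).
      by apply: eq_bigr => y _; ring.
    by rewrite sum_deltar; case: eqP => [->|_]; [ring|rewrite !mul0r].
  rewrite -mulnb natrM; field; by rewrite !gt_eqF.
set o := @occ n w in decomp *.
set mw := mart n w in decomp *; rewrite -/(mart n w) -/mw.
set Bw := B n w in decomp *.
have t1 : 0 <= k2 * `|Bw| by apply: mulr_ge0 => //; exact: ltW.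
have t2 : 0 <= k2 * (`|mw| * `|o - p c|) by apply: mulr_ge0; [exact: ltW|exact: mulr_ge0].
have t3 : 0 <= k2 ^+ 2 * (o - p c) ^+ 2 by apply: mulr_ge0; exact: sqr_ge0.
have [big|small] := leP (p c / 2) o.
  have o0 : 0 < o by apply: lt_le_trans big; rewrite divr_gt0.
  have io : o^-1 <= k2.
    by rewrite /k2 -[leRHS]invrK invfM invrK mulrC lef_pV2// posrE divr_gt0.
  have -> : (sigma n)^-1 * (@pair_occ n w / o - rho n) - mw = o^-1 * (Bw - mw * (o - p c)).
    have -> : (sigma n)^-1 * (@pair_occ n w / o - rho n) =
       o^-1 * ((sigma n)^-1 * (@pair_occ n w - rho n * o)).
      by field; rewrite !gt_eqF.
    by rewrite decomp; field; rewrite gt_eqF.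
  apply: le_trans (cap_le _) _; rewrite normrM gtr0_norm ?invr_gt0//.
  apply: (@le_trans _ _ (k2 * (`|Bw| + `|mw| * `|o - p c|))).
    apply: ler_pM => //; first by rewrite invr_ge0 ltW.
    by apply: le_trans (ler_normB _ _) _; rewrite normrM.
  by rewrite mulrDr lerDl.
apply: (@le_trans _ _ 1); first by rewrite ge_min lexx.
apply: (@le_trans _ _ (k2 ^+ 2 * (o - p c) ^+ 2)); last by rewrite lerDr addr_ge0.
rewrite -exprMn -(real_normK (num_real (k2 * _))) -[leLHS](expr1n _ 2).
rewrite lerXn2r ?nnegrE// normrM gtr0_norm// distrC.
have : p c / 2 <= `|p c - o| by apply: le_trans (ler_norm _); lra.
move=> /(ler_wpM2l (ltW k20)); apply: le_trans.
by rewrite le_eqVlt; apply/orP; left; apply/eqP; rewrite /k2; field; rewrite gt_eqF.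
Unshelve. all: by end_near.
Qed.

End ratio.
End triangular_clt.

(** * The limiting covariances as covariances of martingale increments *)

Section limiting_covariance.
Context {R : realType} {E : finType}.
Variables (K : R -> R) (M : E -> E -> R) (p : E -> R).
Hypothesis trM : transition_matrix M.
Hypothesis pM : invariant_probability M p.
Hypothesis kernel_sq_ge0 : 0 <= kernel_sq K.

Let inc_scale (k : E * E) : R := Num.sqrt (kernel_sq K * (p k.1 * M k.1 k.2)).

Let scale_sq x y s t : inc_scale (x, y) * s * (inc_scale (x, y) * t) =
  kernel_sq K * (p x * (M x y * (s * t))).
Proof.
have [p0 _ _] := pM; have [M0 _] := trM.
rewrite mulrACA -expr2 sqr_sqrtr ?mulr_ge0//=; ring.
Qed.

Lemma invariant_avg (f : E -> R) : \sum_x p x * avg M f x = \sum_x p x * f x.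
Proof.
have [_ _ pE] := pM; rewrite /avg; under eq_bigr do rewrite mulr_sumr.
rewrite exchange_big/=; apply: eq_bigr => y _.
by rewrite -pE mulr_suml; apply: eq_bigr => x _; rewrite mulrA.
Qed.

Lemma increment_covariance (f g : E -> R) :
  \sum_(k : E * E) inc_scale k * increment (fun _ y => f y) M k.1 k.2 *
     (inc_scale k * increment (fun _ y => g y) M k.1 k.2) =
  kernel_sq K * (\sum_x p x * (f x * g x) - \sum_x p x * (avg M f x * avg M g x)).
Proof.
have [M0 M1] := trM.
rewrite -(pair_bigA _ (fun x y => inc_scale (x, y) * increment (fun _ y => f y) M x y *
     (inc_scale (x, y) * increment (fun _ y => g y) M x y))) /=.
rewrite -(invariant_avg (fun x => f x * g x)) -sumrB mulr_sumr; apply: eq_bigr => x _.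
under eq_bigr do rewrite scale_sq.
rewrite -mulr_sumr -mulr_sumr -mulrBr; congr (_ * (_ * _)).
rewrite /increment -/(avg M f x) -/(avg M g x).
set af := avg M f x; set ag := avg M g x.
transitivity (\sum_y (M x y * (f y * g y) - ag * (M x y * f y) - af * (M x y * g y) + M x y * (af * ag))).
  by apply: eq_bigr => y _; ring.
rewrite big_split/= !sumrB -!mulr_sumr -mulr_suml M1.
by rewrite -/(avg M f x) -/(avg M g x) -/(avg M (fun y => f y * g y) x) -/af -/ag; ring.
Qed.

(** The sum of [Gamma k x l] over [k >= 0] is [p x] times the Poisson solution [h l x]. The
    right-hand side is reduced to the same quantities by substituting [M h = h - 1 + p]; the cross
    terms vanish by the normalization that [h] has mean 0 under [p], which comes from its form as a
    series. *)
Lemma Sigma1E (h : E -> E -> R) :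
  (forall i x, h i x - avg M (h i) x = (x == i)%:R - \sum_y p y * (y == i)%:R) ->
  (forall i x, \sum_(j < n) (avg (tpow M j) (fun y => (y == i)%:R) x -
      \sum_y p y * (y == i)%:R) @[n --> \oo] --> h i x) ->
  forall i j, Sigma1 K M p i j =
  \sum_(k : E * E) inc_scale k * increment (fun _ y => h i y) M k.1 k.2 *
     (inc_scale k * increment (fun _ y => h j y) M k.1 k.2).
Proof.
move=> hP hL i j; have [p0 p1 pE] := pM.
have pd (l : E) : \sum_y p y * (y == l)%:R = p l by rewrite sum_deltar.
have hL' l x : \sum_(k < n) (tpow M k x l - p l) @[n --> \oo] --> h l x.
  have := hL l x; apply: cvg_trans; apply: near_eq_cvg; apply: nearW => n.
  by apply: eq_bigr => k _; rewrite pd /avg sum_deltar.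
have GL x l : \sum_(1 <= k < n) Gamma M p k x l @[n --> \oo] --> p x * h l x - Gamma M p 0 x l.
  have c1 : p x * (\sum_(k < n) (tpow M k x l - p l)) - Gamma M p 0 x l @[n --> \oo] -->
     p x * h l x - Gamma M p 0 x l.
    by apply: cvgB; [exact: cvgMl_tmp|exact: cvg_cst].
  apply: cvg_trans c1; apply: near_eq_cvg; near=> n.
  have n1 : (0 < n)%N by near: n; exact: nbhs_infty_ge.
  have -> : p x * (\sum_(k < n) (tpow M k x l - p l)) = \sum_(k < n) Gamma M p k x l.
    by rewrite mulr_sumr; apply: eq_bigr => k _; rewrite mulrBr.
  by rewrite -(big_mkord xpredT (fun k => Gamma M p k x l)) (big_ltn n1) addrC addKr.
have hp0 l : \sum_x p x * h l x = 0.
  have c1 : \sum_x p x * (\sum_(k < n) (tpow M k x l - p l)) @[n --> \oo] --> \sum_x p x * h l x.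
    by apply: cvg_sum => x; exact: cvgMl_tmp.
  have e1 n : \sum_x p x * (\sum_(k < n) (tpow M k x l - p l)) = 0.
    under eq_bigr do rewrite mulr_sumr; rewrite exchange_big/= big1// => k _.
    under eq_bigr do rewrite mulrBr; rewrite sumrB -mulr_suml p1 mul1r.
    by have /(congr1 (fun q => q l)) := invariant_tpow pM k; rewrite /rowmul => ->; rewrite subrr.
  have c2 : \sum_x p x * (\sum_(k < n) (tpow M k x l - p l)) @[n --> \oo] --> (0 : R).
    apply: (@cvg_dist_bound _ _ _ _ _ (fun=> 0)); last exact: cvg_cst.
    by apply: nearW => n; rewrite e1 subrr normr0.
  by apply: (cvg_unique _ c1 c2); exact: norm_hausdorff.
have SG : limn (fun n => \sum_(1 <= k < n) (Gamma M p k i j + Gamma M p k j i)) =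
    p i * h j i - Gamma M p 0 i j + (p j * h i j - Gamma M p 0 j i).
  apply: cvg_lim; first exact: norm_hausdorff.
  by under eq_fun do rewrite big_split/=; exact: cvgD.
rewrite /Sigma1 [X in _ + X](_ : _ = p i * h j i - Gamma M p 0 i j + (p j * h i j - Gamma M p 0 j i)) //.
rewrite increment_covariance; congr (_ * _).
have aE l x : avg M (h l) x = h l x - (x == l)%:R + p l.
  by have := hP l x; rewrite pd => e; rewrite -[LHS]opprK -[- avg _ _ _](addKr (h l x)) e; ring.
transitivity (p i * h j i + p j * h i j - Gamma M p 0 j i); first by ring.
rewrite -sumrB.
transitivity (\sum_x (p x * h i x * (x == j)%:R - p j * (p x * h i x) +
    (p x * h j x * (x == i)%:R - p i * (p x * h j x)) -
    (p x * (x == i)%:R * (x == j)%:R - p j * (p x * (x == i)%:R) - p i * (p x * (x == j)%:R)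
       + p x * (p i * p j)))); last first.
  by apply: eq_bigr => x _; rewrite !aE; ring.
rewrite sumrB big_split/= !sumrB -!mulr_sumr !hp0 !mulr0 !subr0 !sum_deltar.
rewrite [X in _ = _ - X]big_split/= !sumrB -!mulr_sumr -mulr_suml p1 !sum_deltar /Gamma /=.
rewrite (_ : p j * (j == i)%:R = (j == i)%:R * p j); last exact: mulrC.
ring.
Unshelve. all: by end_near.
Qed.

(** Increments attached to different departure states have disjoint supports; for a common one, the
    conditional covariance is that of a multinomial draw from the row of [M]. *)
Lemma Sigma2E : (forall x, 0 < p x) -> forall i j, Sigma2 K M p i j =
  \sum_(k : E * E)
    inc_scale k * increment (fun x y => (x == i.1)%:R * (y == i.2)%:R / p i.1) M k.1 k.2 *
   (inc_scale k * increment (fun x y => (x == j.1)%:R * (y == j.2)%:R / p j.1) M k.1 k.2).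
Proof.
move=> p0 [c e] [c' e'] /=; have [M0 M1] := trM.
have incE (a b x y : E) : increment (fun x y => (x == a)%:R * (y == b)%:R / p a) M x y =
    (x == a)%:R * ((y == b)%:R - M x b) / p a.
  rewrite /increment; have -> : avg M (fun y => (x == a)%:R * (y == b)%:R / p a) x =
      (x == a)%:R * M x b / p a.
    rewrite /avg; transitivity (\sum_y ((x == a)%:R / p a * M x y) * (y == b)%:R).
      by apply: eq_bigr => z _; ring.
    by rewrite sum_deltar; ring.
  ring.
rewrite -(pair_bigA _ (fun x y => inc_scale (x, y) * increment _ M x y *
     (inc_scale (x, y) * increment _ M x y))) /=.
transitivity (\sum_x kernel_sq K * (p x * ((x == c')%:R / (p c * p c') *
    (M x e' * (e' == e)%:R - M x e * M x e'))) * (x == c)%:R).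
  rewrite sum_deltar /Sigma2 /=; have [<-|cc'] := eqVneq c c'; last by rewrite !(mul0r, mulr0).
  rewrite (eq_sym e'); have [<-|ee'] := eqVneq e e'; first by rewrite !mulr1n; field; rewrite gt_eqF.
  by rewrite mulr0n mulr1n; field; rewrite gt_eqF.
apply: eq_bigr => x _; under eq_bigr do rewrite !incE scale_sq.
rewrite -mulr_sumr -mulr_sumr -mulrA; congr (_ * _); rewrite -mulrA; congr (_ * _).
transitivity (\sum_y ((x == c)%:R * (x == c')%:R / (p c * p c')) *
   (M x y * (y == e)%:R * (y == e')%:R - M x e' * (M x y * (y == e)%:R) -
    M x e * (M x y * (y == e')%:R) + M x y * (M x e * M x e'))); last first.
  by apply: eq_bigr => y _; field; rewrite !gt_eqF.
by rewrite -mulr_sumr big_split/= !sumrB -!mulr_sumr -mulr_suml M1 !sum_deltar; ring.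
Qed.

End limiting_covariance.

(** * The estimators as functions of the path *)

Section kernel_estimators.
Context {R : realType} {E : finType}.
Variable kappa : R.
Hypothesis kappa01 : 0 < kappa < 1.
Variable Q : R -> E -> E -> R.
Hypothesis Q_transition : forall u, u \in `[0, 1] -> transition_matrix (Q u).
Hypothesis Q_irreducible : forall u, u \in `[0, 1] -> irreducible (Q u).
Hypothesis Q_aperiodic : forall u, u \in `[0, 1] -> aperiodic (Q u).
Hypothesis Q_holder : forall x y, holder01 kappa (fun u => Q u x y).
Hypothesis Q_neg : forall u, u < 0 -> Q u = Q 0.
Variable pi : R -> E -> R.
Hypothesis pi_inv : forall u, u \in `[0, 1] -> invariant_probability (Q u) (pi u).
Context {d : measure_display} {T : measurableType d}.
Variables (P : probability T R) (X : nat -> int -> T -> E).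
Hypothesis X_markov : forall n, (1 <= n)%N -> row_markov_chain P Q n (X n).
Variables (K : R -> R) (L : R).
Hypothesis K_ge0 : forall z, 0 <= K z.
Hypothesis L0 : 0 <= L.
Hypothesis K_lip : forall x y, `|K x - K y| <= L * `|x - y|.
Hypothesis K_supp : forall z, 1 < `|z| -> K z = 0.
Variable b : nat -> R.
Hypothesis b01 : forall n, (1 <= n)%N -> 0 < b n < 1.
Hypothesis b_cvg0 : b n @[n --> \oo] --> (0 : R).
Hypothesis nb_large : forall M, \forall n \near \oo, M <= n%:R * b n.

Local Notation pr n := (@row_prob R E d T P X n).
Local Notation Y n := (@coordinate E n).
Local Notation A n := (triangular_transition Q n).

Definition occupation n u (x : E) (s : {ffun 'I_n.+1 -> E}) : R :=
  \sum_(i < n) weight K (b n) n u i * (coordinate i s == x)%:R.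

Definition pair_occupation n u (x y : E) (s : {ffun 'I_n.+1 -> E}) : R :=
  \sum_(i < n) weight K (b n) n u i * ((coordinate i s == x) && (coordinate i.+1 s == y))%:R.

Lemma pi_hatE n u x w : (1 <= n)%N ->
  pi_hat K (b n) n (X n) u x w = occupation u x (path_of n (row X n) w).
Proof.
move=> n1; rewrite /pi_hat (sum_weight K (b n) n u (fun i => (X n i%:Z w == x)%:R)).
by apply: eq_bigr => i _; rewrite coordinate_path ?rowE// ltnW.
Qed.

Lemma pi2_hatE n u x y w : (1 <= n)%N ->
  pi2_hat K (b n) n (X n) u x y w = pair_occupation u x y (path_of n (row X n) w).
Proof.
move=> n1; rewrite /pi2_hat
  (sum_weight K (b n) n u (fun i => ((X n i%:Z w == x) && (X n i.+1%:Z w == y))%:R)).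
by apply: eq_bigr => i _; rewrite !coordinate_path ?rowE// ltnW.
Qed.

Lemma mean_pi_hatE n u x : (1 <= n)%N ->
  mean_pi_hat P K (b n) n (X n) u x = Ex (pr n) (@occupation n u x).
Proof.
move=> n1; rewrite /mean_pi_hat (_ : pi_hat _ _ _ _ _ _ =
    (fun w => @occupation n u x (path_of n (row X n) w))).
  by rewrite (row_expectation X_markov).
by apply/funext => w; exact: pi_hatE.
Qed.

Lemma mean_ratioE n u x y : (1 <= n)%N ->
  mean_ratio P K (b n) n (X n) u x y =
  Ex (pr n) (@pair_occupation n u x y) / Ex (pr n) (@occupation n u x).
Proof.
move=> n1; rewrite /mean_ratio mean_pi_hatE// /mean_pi2_hat.
rewrite (_ : pi2_hat _ _ _ _ _ _ _ =
    (fun w => @pair_occupation n u x y (path_of n (row X n) w))).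
  by rewrite (row_expectation X_markov).
by apply/funext => w; exact: pi2_hatE.
Qed.

Lemma state_inhabited : exists x0 : E, True.
Proof.
have /set0P[w _] : [set: T] != set0.
  apply/eqP => T0; have := @probability_setT _ T R P.
  by rewrite T0 measure0 => -[] /eqP; rewrite eq_sym oner_eq0.
by exists (X 1 0 w).
Qed.

(** The weights sum to 1 and charge times within [b] of [u] only: there the law is within
    [C n^-kappa] of [pi (i/n)], itself within [C b^kappa] of [pi u], and [1/n <= b]. *)
Lemma occupation_bias C n u x : (1 <= n)%N -> 0 < C -> u \in `[0, 1] ->
  0 < b n -> 1 <= n%:R * b n -> kernel_mass K (b n) n u != 0 ->
  (forall u v, u \in `[0, 1] -> v \in `[0, 1] ->
     l1norm (fun x => pi u x - pi v x) <= C * `|u - v| `^ kappa) ->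
  (forall i, (i <= n)%N ->
     l1norm (fun x => law (pr n) (Y n) i x - pi (i%:R / n%:R) x) <= C * n%:R^-1 `^ kappa) ->
  `|Ex (pr n) (@occupation n u x) - pi u x| <= 2 * C * b n `^ kappa.
Proof.
move=> n1 C0 hu b0 nb1 m0 hpi hlaw; have N0 : 0 < n%:R :> R by rewrite ltr0n.
case/andP: kappa01 => k0 k1.
have mono s t : 0 <= s -> s <= t -> s `^ kappa <= t `^ kappa.
  by move=> s0 st; apply: ge0_ler_powR; rewrite ?nnegrE ?(ltW k0)// (le_trans s0).
have inv_le : n%:R^-1 <= b n by rewrite -div1r ler_pdivrMr// mulrC.
have wsum := weight_sum1 m0.
have -> : Ex (pr n) (@occupation n u x) - pi u x =
    \sum_(i < n) weight K (b n) n u i * (law (pr n) (Y n) i x - pi u x).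
  rewrite /occupation Ex_sum; under eq_bigr do rewrite ExZ.
  under [RHS]eq_bigr do rewrite mulrBr.
  by rewrite sumrB -mulr_suml wsum mul1r.
have -> : 2 * C * b n `^ kappa = \sum_(i < n) weight K (b n) n u i * (2 * C * b n `^ kappa).
  by rewrite -mulr_suml wsum mul1r.
apply: le_trans (ler_norm_sum _ _ _) _.
apply: ler_sum => i _; have w0 := weight_ge0 K_ge0 u b0 n1 i.
rewrite normrM (ger0_norm w0).
have [->|wi] := eqVneq (weight K (b n) n u i) 0; first by rewrite !mul0r.
have [iltn iu] := weight_near K_supp b0 wi.
have hi : i%:R / n%:R \in `[0 : R, 1].
  by rewrite in_itv/= divr_ge0 ?ler0n//= ler_pdivrMr// mul1r ler_nat ltnW.
apply: ler_wpM2l => //.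
rewrite (_ : _ - pi u x = (law (pr n) (Y n) i x - pi (i%:R / n%:R) x) + (pi (i%:R / n%:R) x - pi u x)); last by ring.
apply: le_trans (ler_normD _ _) _.
have h1 := le_trans (ler_l1norm (fun x => law (pr n) (Y n) i x - pi (i%:R / n%:R) x) x) (hlaw i (ltnW iltn)).
have h2 := le_trans (ler_l1norm (fun x => pi (i%:R / n%:R) x - pi u x) x) (hpi _ _ hi hu).
have e1 : n%:R^-1 `^ kappa <= b n `^ kappa by apply: mono => //; rewrite invr_ge0 ltW.
have e2 : `|i%:R / n%:R - u| `^ kappa <= b n `^ kappa by apply: mono => //; rewrite distrC.
have := ler_wpM2l (ltW C0) e1; have := ler_wpM2l (ltW C0) e2; lra.
Qed.

(** The factor 2 comes from the transition being that of time [i + 1]: the distance to [u] is at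
    most [b + 1/n <= 2 b]. *)
Lemma transition_near C n u i : (1 <= n)%N -> 0 < C -> u \in `[0, 1] ->
  0 < b n -> 1 <= n%:R * b n ->
  (forall u v, u \in `[0, 1] -> v \in `[0, 1] ->
     forall x, \sum_y `|Q u x y - Q v x y| <= C * `|u - v| `^ kappa) ->
  weight K (b n) n u i != 0 ->
  (i < n)%N /\ forall x, \sum_y `|A n i.+1 x y - Q u x y| <= C * (2 * b n) `^ kappa.
Proof.
move=> n1 C0 hu b0 nb1 hQ wi; have N0 : 0 < n%:R :> R by rewrite ltr0n.
case/andP: kappa01 => k0 k1.
have inv_le : n%:R^-1 <= b n by rewrite -div1r ler_pdivrMr// mulrC.
have [iltn iu] := weight_near K_supp b0 wi; split=> // x.
have hm : (minn i.+1 n)%:R / n%:R \in `[0 : R, 1] by exact: min_div_itv01.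
apply: le_trans (hQ _ _ hm hu x) _; apply: ler_wpM2l; first exact: ltW.
rewrite (minn_idPl iltn); apply: ge0_ler_powR; rewrite ?nnegrE ?(ltW k0)//.
  by rewrite mulr_ge0// ltW.
rewrite (_ : _ - u = - (u - i%:R / n%:R) + n%:R^-1); last by rewrite -natr1; field; rewrite gt_eqF.
apply: le_trans (ler_normD _ _) _; have ni : 0 <= n%:R^-1 :> R by rewrite invr_ge0 ltW.
by rewrite normrN (ger0_norm ni); lra.
Qed.

Hypothesis K_int : \int[lebesgue_measure]_z K z = 1.
Hypothesis inv_nb_cvg0 : (n%:R * b n)^-1 @[n --> \oo] --> (0 : R).

Lemma holder_rate_cvg0 C : 0 < C -> C * (2 * b n) `^ kappa @[n --> \oo] --> (0 : R).
Proof.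
move=> C0; apply/cvgrPdist_le => e e0.
have [eta eta0 heta] := powR_small kappa01 C0 e0.
have b2 : 2 * b n @[n --> \oo] --> (0 : R).
  by rewrite -[X in _ --> X](mulr0 2); exact: cvgMl_tmp.
have h1 : \forall n \near \oo, 2 * b n < eta by apply: cvgr_lt b2 _ eta0.
near=> n; have n1 : (1 <= n)%N by near: n; exact: nbhs_infty_ge.
have /andP[b0 _] := b01 n1; rewrite sub0r normrN ger0_norm; last first.
  by rewrite mulr_ge0 ?powR_ge0// ltW.
apply: ltW; apply: heta; first by rewrite mulr_ge0// ltW.
by near: n.
Unshelve. all: by end_near.
Qed.

Lemma sqrt_inv_cvg0 D : D * Num.sqrt (n%:R * b n)^-1 @[n --> \oo] --> (0 : R).
Proof.
rewrite -[X in _ --> X](mulr0 D); apply: cvgMl_tmp; rewrite -(@sqrtr0 R).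
by apply: (continuous_cvg _ (@sqrt_continuous R 0)) inv_nb_cvg0.
Qed.

Section chain_parameters.
Variables (c0 r delta C : R).
Hypotheses (c01 : 1 <= c0) (r01 : 0 < r < 1) (delta0 : 0 < delta) (C0 : 0 < C).
Hypothesis contrQ : forall u, u \in `[0, 1] -> forall k j (v : E -> R), \sum_x v x = 0 ->
  l1norm (rowmul v (chainmx (fun=> Q u) k j)) <= c0 * r ^+ j * l1norm v.
Hypothesis pi_ge : forall u, u \in `[0, 1] -> forall y, delta <= pi u y.
Hypothesis hC : forall u v, u \in `[0, 1] -> v \in `[0, 1] ->
  (forall x, \sum_y `|Q u x y - Q v x y| <= C * `|u - v| `^ kappa) /\
  l1norm (fun x => pi u x - pi v x) <= C * `|u - v| `^ kappa.
Hypothesis near_row : \forall n \near \oo,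
  (forall k j (v : E -> R), \sum_x v x = 0 ->
    l1norm (rowmul v (chainmx (triangular_transition Q n) k j)) <= c0 * r ^+ j * l1norm v) /\
  (forall i, (i <= n)%N ->
    l1norm (fun x => law (pr n) (Y n) i x - pi (i%:R / n%:R) x) <= C * n%:R^-1 `^ kappa).

Section uniform_estimates.
Hypothesis log_cvg0 : Num.sqrt (ln n%:R) / Num.sqrt (n%:R * b n) @[n --> \oo] --> (0 : R).
Variable cm : R.
Hypothesis cm_gt0 : 0 < cm.
Hypothesis mass_ge : \forall n \near \oo, forall u, u \in `[0, 1] -> cm <= kernel_mass K (b n) n u.

Let rate n : R := Num.sqrt (ln n%:R) / Num.sqrt (n%:R * b n).

Lemma sup01_le (f : R -> R) B : (forall u, u \in `[0, 1] -> `|f u| <= B) ->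
  (`|sup01 f| <= B%:E)%E.
Proof.
move=> hB; have h0 : (0 <= sup01 f)%E.
  apply: (@le_trans _ _ (`|f 0|%:E)%E); first by rewrite lee_fin.
  by apply: ereal_sup_ubound; exists 0 => //; rewrite /= in_itv/= lexx ler01.
rewrite gee0_abs//; apply: ge_ereal_sup => _ [u hu <-]; rewrite lee_fin.
exact: hB.
Qed.

Let near_basic : \forall n \near \oo, [/\ (1 <= n)%N, 0 < b n & 1 <= n%:R * b n].
Proof.
have h := nb_large 1; near=> n; have n1 : (1 <= n)%N by near: n; exact: nbhs_infty_ge.
by have /andP[b0 _] := b01 n1; split=> //; near: n.
Unshelve. all: by end_near.
Qed.

Lemma uniform_occupation_bias x : \forall n \near \oo, forall u, u \in `[0, 1] ->
  `|Ex (pr n) (@occupation n u x) - pi u x| <= 2 * C * b n `^ kappa.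
Proof.
apply: filterS3 near_basic near_row mass_ge => n [n1 b0 nb1] [_ hlaw] hm u hu.
have m0 : kernel_mass K (b n) n u != 0 by rewrite gt_eqF// (lt_le_trans cm_gt0)// hm.
exact: (@occupation_bias C n u x n1 C0 hu b0 nb1 m0 (fun v v' hv hv' => (hC hv hv').2) hlaw).
Qed.

Lemma uniform_occupation_ge x : \forall n \near \oo, forall u, u \in `[0, 1] ->
  delta / 2 <= Ex (pr n) (@occupation n u x).
Proof.
have d4 : 0 < delta / 4 by rewrite divr_gt0.
have hr : \forall n \near \oo, C * (2 * b n) `^ kappa < delta / 4.
  by apply: cvgr_lt (holder_rate_cvg0 C0) _ d4.
apply: filterS3 near_basic (uniform_occupation_bias x) hr => n [n1 b0 nb1] hb hrn u hu.
have := hb u hu; have := pi_ge hu x.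
have : b n `^ kappa <= (2 * b n) `^ kappa.
  case/andP: kappa01 => k0 _; apply: ge0_ler_powR; rewrite ?nnegrE ?(ltW k0) ?(ltW b0)//.
    by rewrite mulr_ge0// ltW.
  lra.
move=> /(ler_wpM2l (ltW C0)) h1 h2; rewrite ler_norml => /andP[h3 _]; lra.
Qed.

Let mean_pairE n i x y : (i < n)%N ->
  Ex (pr n) (fun s => ((coordinate i s == x) && (coordinate i.+1 s == y))%:R) =
  law (pr n) (Y n) i x * A n i.+1 x y.
Proof.
move=> ilt; have n1 : (1 <= n)%N by apply: leq_ltn_trans ilt.
have ad : adapted (Y n) i (fun s => (coordinate i s == x)%:R : R).
  by move=> s s' hs; rewrite hs.
under eq_Ex do rewrite -mulnb natrM.
rewrite (row_markov X_markov n1 ilt ad) /law -ExMr; apply: eq_Ex => s.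
by case: eqP => [->|_]; rewrite ?mul0r.
Qed.

(** The ratio of expectations is an average of entries [A n i.+1 x y] with nonnegative weights, so
    the denominator needs to be positive only; and [2^kappa <= 2]. *)
Lemma uniform_ratio_bias x y : \forall n \near \oo, forall u, u \in `[0, 1] ->
  `|Ex (pr n) (@pair_occupation n u x y) / Ex (pr n) (@occupation n u x) - Q u x y| <=
  2 * C * b n `^ kappa.
Proof.
apply: filterS2 near_basic (uniform_occupation_ge x) => n [n1 b0 nb1] hge u hu.
have m0 : 0 < Ex (pr n) (@occupation n u x) by apply: lt_le_trans (hge u hu); rewrite divr_gt0.
apply: (@le_trans _ _ (C * (2 * b n) `^ kappa)); last first.
  rewrite powRM ?(ltW b0)// mulrCA -mulrA ler_wpM2r ?mulr_ge0 ?powR_ge0 ?(ltW C0)//.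
  by apply: ler1_powR; [rewrite ler1n|case/andP: kappa01 => _ /ltW].
set m1 := Ex (pr n) (@occupation n u x) in m0 *; set m2 := Ex _ (@pair_occupation n u x y).
have -> : m2 / m1 - Q u x y = (m2 - Q u x y * m1) / m1 by rewrite mulrBl mulfK ?gt_eqF.
rewrite normrM normfV (gtr0_norm m0) ler_pdivrMr//.
have m1E : m1 = \sum_(i < n) weight K (b n) n u i * law (pr n) (Y n) i x.
  by rewrite /m1 /occupation Ex_sum; apply: eq_bigr => i _; rewrite ExZ.
have m2E : m2 = \sum_(i < n) weight K (b n) n u i * (law (pr n) (Y n) i x * A n i.+1 x y).
  by rewrite /m2 /pair_occupation Ex_sum; apply: eq_bigr => i _; rewrite ExZ mean_pairE.
rewrite m1E m2E !mulr_sumr -sumrB; apply: le_trans (ler_norm_sum _ _ _) _.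
apply: ler_sum => i _; have w0 := weight_ge0 K_ge0 u b0 n1 i.
have l0 := law_ge0 (Y n) (row_prob_ge0 P X (n := n)) i x.
have [->|wi] := eqVneq (weight K (b n) n u i) 0; first by rewrite !(mulr0, mul0r) subrr normr0.
have [_ /(_ x) hx] := transition_near n1 C0 hu b0 nb1 (fun v v' hv hv' => (hC hv hv').1) wi.
rewrite (_ : _ - _ = weight K (b n) n u i * law (pr n) (Y n) i x * (A n i.+1 x y - Q u x y)); last by ring.
have t0 : 0 <= weight K (b n) n u i * law (pr n) (Y n) i x by rewrite mulr_ge0.
rewrite normrM ger0_norm// [leLHS]mulrC; apply: ler_wpM2r => //; apply: le_trans hx.
by rewrite (bigD1 y)//= lerDl sumr_ge0.
Qed.

Definition weighted_sum n u (phi : E -> E -> R) (s : {ffun 'I_n.+1 -> E}) : R :=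
  \sum_(i < n) weight K (b n) n u i * phi (coordinate i s) (coordinate i.+1 s).

(** The squared weights sum to at most [3 L / (cm n b)]; with [l = sqrt(ln n) sqrt(nb)] both terms
    of the Chernoff exponent become multiples of [ln n], hence a power of [n]. *)
Lemma weighted_sum_tail n u phi B0 : (1 <= n)%N -> 0 < b n -> 0 <= ln (n%:R : R) ->
  cm <= kernel_mass K (b n) n u -> (forall x y, `|phi x y| <= 1) ->
  (forall k j (v : E -> R), \sum_x v x = 0 ->
    l1norm (rowmul v (chainmx (A n) k j)) <= c0 * r ^+ j * l1norm v) ->
  Ex (pr n) (fun s => (B0 * rate n <
    `|@weighted_sum n u phi s - Ex (pr n) (@weighted_sum n u phi)|)%R%:R) <=
  2 * expR (- (B0 - mgf_cst c0 r * (3 * L / cm)) * ln n%:R).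
Proof.
move=> n1 b0 ln0 hm hphi contr; have N0 : 0 < n%:R :> R by rewrite ltr0n.
have nb0 : 0 < n%:R * b n by rewrite mulr_gt0.
pose l : R := Num.sqrt (ln n%:R) * Num.sqrt (n%:R * b n).
have l0 : 0 <= l by rewrite mulr_ge0 ?sqrtr_ge0.
pose f k x y := weight K (b n) n u k * phi x y.
have fb k x y : `|f k x y| <= weight K (b n) n u k.
  rewrite normrM ger0_norm ?(weight_ge0 K_ge0)// -[leRHS]mulr1.
  by apply: ler_wpM2l => //; exact: (weight_ge0 K_ge0).
have := @tail_functional R E _ (pr n) (Y n) (A n) n (row_prob_ge0 P X (n := n))
  (row_prob_sum1 X_markov n) (triangular_transitionP Q_transition n)
  (row_markov X_markov n1) c0 r c01 r01 contr f _ _ fb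
  (sum_weight_sq K_ge0 L0 K_lip K_supp b0 n1 cm_gt0 hm) l (B0 * rate n) l0.
move=> /le_trans; apply; rewrite ler_pM2l// ler_expR.
have s0 : Num.sqrt (n%:R * b n) != 0 by rewrite gt_eqF// sqrtr_gt0.
have e1 : l * (B0 * rate n) = B0 * ln n%:R.
  rewrite /l /rate -{3}(sqr_sqrtr ln0); field; exact: s0.
have e2 : l ^+ 2 * (3 * L / (cm * (n%:R * b n))) = 3 * L / cm * ln n%:R.
  by rewrite /l exprMn !sqr_sqrtr ?(ltW nb0)//; field; rewrite !gt_eqF.
by rewrite e1 e2 le_eqVlt; apply/orP; left; apply/eqP; ring.
Qed.

Lemma weighted_sum_dist n u v phi s : (1 <= n)%N -> 0 < b n -> 1 <= n%:R * b n ->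
  cm <= kernel_mass K (b n) n u -> cm <= kernel_mass K (b n) n v ->
  (forall x y, `|phi x y| <= 1) ->
  `|@weighted_sum n u phi s - @weighted_sum n v phi s| <= 2 * L * n%:R ^+ 2 / cm * `|u - v|.
Proof.
move=> n1 b0 nb1 hu hv hphi.
apply: le_trans (weight_dist K_ge0 L0 K_lip b0 n1 nb1 cm_gt0 hu hv).
rewrite -sumrB; apply: le_trans (ler_norm_sum _ _ _) _; apply: ler_sum => i _.
by rewrite -mulrBl normrM ler_piMr.
Qed.

(* Discretize [0, 1] with mesh n^-3: a union bound over the grid, and the
   Lipschitz bound on the weights between grid points. *)
Lemma uniform_deviation : exists2 B : R, 0 < B & \forall n \near \oo,
  forall phi : E -> E -> R, (forall x y, `|phi x y| <= 1) ->
  exists2 bad : pred {ffun 'I_n.+1 -> E},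
    Ex (pr n) (fun s => (bad s)%:R) <= 4 * n%:R^-1 &
    forall s, ~~ bad s -> forall u, u \in `[0, 1] ->
     `|@weighted_sum n u phi s - Ex (pr n) (@weighted_sum n u phi)| <= B * rate n.
Proof.
pose D := mgf_cst c0 r * (3 * L / cm).
have M0 : 0 < mgf_cst c0 r by apply: mgf_cst_gt0.
have D0 : 0 <= D.
  by apply: mulr_ge0; [exact: ltW|rewrite divr_ge0 ?mulr_ge0 ?(ltW cm_gt0)].
(* With this choice each grid point fails with probability at most [2 n^-5], so the [n^3 + 1] points
   together with probability at most [4 / n]. Between grid points the deviation moves by a multiple
   of [n^2 n^-3 = 1/n], which is below [rate n]. *)
pose B0 := D + 5; have B00 : 0 < B0 by rewrite ltr_wpDl.
exists (B0 + 4 * L / cm); first by rewrite ltr_pwDl// divr_ge0 ?mulr_ge0// ltW.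
have ln1 : \forall n \near \oo, 1 <= ln (n%:R : R).
  near=> n; rewrite -[leLHS]expRK ler_ln ?posrE ?expR_gt0//; last first.
    by rewrite ltr0n; near: n; exact: nbhs_infty_gt.
  by near: n; exact: nbhs_infty_ger.
apply: filterS2 (filterI near_basic ln1) (filterI near_row mass_ge).
move=> n [[n1 b0 nb1] ln1n] [[contr _] hm] phi hphi.
have N0 : 0 < n%:R :> R by rewrite ltr0n.
have ln0 : 0 <= ln (n%:R : R) by apply: le_trans ln1n.
pose N := (n ^ 3)%N; have Nn : N%:R = n%:R ^+ 3 :> R by rewrite natrX.
have Np : 0 < N%:R :> R by rewrite Nn exprn_gt0.
pose dev u s := @weighted_sum n u phi s - Ex (pr n) (@weighted_sum n u phi).
pose g (k : 'I_N.+1) : R := (k : nat)%:R / N%:R.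
have g01 k : g k \in `[0, 1].
  by rewrite in_itv/= divr_ge0 ?ler0n//= ler_pdivrMr// mul1r ler_nat -ltnS.
exists (fun s => [exists k : 'I_N.+1, B0 * rate n < `|dev (g k) s|]).
  apply: (@le_trans _ _ (\sum_(k < N.+1) Ex (pr n) (fun s => (B0 * rate n < `|dev (g k) s|)%R%:R))).
    rewrite -Ex_sum; apply: ler_Ex => [s|s]; first exact: row_prob_ge0.
    case: existsP => [[k hk]|_]; last by apply: sumr_ge0.
    by rewrite (bigD1 k)//= hk lerDl sumr_ge0.
  apply: (@le_trans _ _ (\sum_(k < N.+1) (2 * n%:R ^- 5))).
    apply: ler_sum => k _.
    apply: le_trans (weighted_sum_tail B0 n1 b0 ln0 (hm _ (g01 k)) hphi contr) _.
    rewrite ler_pM2l// -/D (_ : B0 - D = 5%:R); last by rewrite /B0; ring.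
    rewrite mulNr expRN lef_pV2 ?posrE ?expR_gt0 ?exprn_gt0//.
    by rewrite mulrC -powR_mulrn ?(ltW N0)// /powR gt_eqF// mulrC.
  rewrite sumr_const card_ord -[_ *+ _]mulr_natl -natr1 Nn.
  have n1R : 1 <= n%:R :> R by rewrite ler1n.
  have p5 : 0 < n%:R ^+ 5 :> R by rewrite exprn_gt0.
  rewrite mulrA ler_pdivrMr// (_ : 4 * n%:R^-1 * n%:R ^+ 5 = 4 * n%:R ^+ 4); last by field; rewrite gt_eqF.
  have h3 : n%:R ^+ 3 <= n%:R ^+ 4 :> R by rewrite ler_weXn2l.
  have h0 : 1 <= n%:R ^+ 4 :> R by rewrite exprn_ege1.
  lra.
move=> s /existsPn good u hu.
have [k hk] : exists k : 'I_N.+1, `|u - g k| <= N%:R^-1.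
  move: hu; rewrite in_itv/= => /andP[u0 u1].
  have uN : 0 <= u * N%:R by rewrite mulr_ge0// ltW.
  have /andP[t1 t2] := truncn_itv uN.
  have tN : (Num.truncn (u * N%:R) < N.+1)%N.
    by rewrite ltnS -(ler_nat R); apply: le_trans t1 _; rewrite ger_pMl.
  exists (Ordinal tN); rewrite /g /=; move: t1 t2; set t := (Num.truncn _)%:R => t1 t2.
  have -> : u - t / N%:R = (u * N%:R - t) / N%:R by field; rewrite gt_eqF.
  rewrite normrM normfV (gtr0_norm Np) ler_pdivrMr// mulVf ?gt_eqF// ger0_norm ?subr_ge0//.
  by rewrite lerBlDr addrC natr1 ltW.
have h1 : `|dev (g k) s| <= B0 * rate n by rewrite leNgt; exact: good.
have lip t := @weighted_sum_dist n u (g k) phi t n1 b0 nb1 (hm _ hu) (hm _ (g01 k)) hphi.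
have step : 2 * L * n%:R ^+ 2 / cm * `|u - g k| <= 2 * L / cm * n%:R^-1.
  apply: le_trans (ler_wpM2l _ hk) _.
    by rewrite divr_ge0 ?(ltW cm_gt0)// mulr_ge0 ?mulr_ge0// sqr_ge0.
  by rewrite Nn le_eqVlt; apply/orP; left; apply/eqP; field; rewrite !gt_eqF.
have lipE : `|Ex (pr n) (@weighted_sum n u phi) - Ex (pr n) (@weighted_sum n (g k) phi)| <=
    2 * L / cm * n%:R^-1.
  rewrite -ExB; apply: le_trans (ler_norm_Ex _ _) _; first exact: row_prob_ge0.
  rewrite -[leRHS](Ex_cst (row_prob_sum1 X_markov n)); apply: ler_Ex => [t|t].
    exact: row_prob_ge0.
  exact: le_trans (lip t) step.
have lips := le_trans (lip s) step.
have rate_ge : n%:R^-1 <= rate n.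
  have nb0 : 0 < n%:R * b n by apply: lt_le_trans nb1.
  rewrite ler_pdivlMr ?sqrtr_gt0//; apply: (@le_trans _ _ 1); last first.
    by rewrite -[leLHS]sqrtr1 ler_sqrt.
  rewrite mulrC ler_pdivrMr// mul1r -[leRHS]ger0_norm ?(ltW N0)// -sqrtr_sqr ler_sqrt ?sqr_ge0//.
  rewrite expr2 ler_wpM2l ?(ltW N0)//; have /andP[_ b1] := b01 n1.
  by apply: le_trans (ltW b1) _; rewrite ler1n.
have K1 : 0 <= 4 * L / cm by rewrite divr_ge0 ?mulr_ge0// ltW.
have := ler_wpM2l K1 rate_ge.
have := ler_normD (dev (g k) s) ((@weighted_sum n u phi s - @weighted_sum n (g k) phi s) -
  (Ex (pr n) (@weighted_sum n u phi) - Ex (pr n) (@weighted_sum n (g k) phi))).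
have := ler_normB (@weighted_sum n u phi s - @weighted_sum n (g k) phi s)
  (Ex (pr n) (@weighted_sum n u phi) - Ex (pr n) (@weighted_sum n (g k) phi)).
rewrite (_ : dev (g k) s + _ = @weighted_sum n u phi s - Ex (pr n) (@weighted_sum n u phi)); last first.
  by rewrite /dev; ring.
rewrite mulrDl; lra.
Unshelve. all: by end_near.
Qed.

(** The process depends on the path only, so that even a supremum over all [u] defines a finite
    union of path events; measurability is automatic. *)
Lemma is_bigO_prob_path (Z : nat -> T -> \bar R)
    (Zs : forall n, {ffun 'I_n.+1 -> E} -> \bar R) (rt : nat -> R) (B D : R) :
  0 < B -> (forall n w, (1 <= n)%N -> Z n w = @Zs n (path_of n (row X n) w)) ->
  (\forall n \near \oo, exists2 bad : pred {ffun 'I_n.+1 -> E},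
    Ex (pr n) (fun s => (bad s)%:R) <= D * n%:R^-1 &
    forall s, ~~ bad s -> (`|@Zs n s| <= (B * rt n)%:E)%E) ->
  is_bigO_prob P Z rt.
Proof.
move=> B0 ZE hbad eta eta0; exists B => //.
have hD : \forall n \near \oo, D / eta <= n%:R by exact: nbhs_infty_ger.
near=> n; have n1 : (1 <= n)%N by near: n; exact: nbhs_infty_ge.
have N0 : 0 < n%:R :> R by rewrite ltr0n.
have [bad h1 h2] : exists2 bad : pred {ffun 'I_n.+1 -> E},
    Ex (pr n) (fun s => (bad s)%:R) <= D * n%:R^-1 &
    forall s, ~~ bad s -> (`|@Zs n s| <= (B * rt n)%:E)%E by near: n.
have -> : [set w | ((B * rt n)%:E < `|Z n w|)%E] =
    [set w | ((B * rt n)%:E < `|@Zs n (path_of n (row X n) w)|)%E].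
  by apply/seteqP; split=> w /=; rewrite ZE.
rewrite (path_event P (row_measurable X_markov (n := n)) (fun s => ((B * rt n)%:E < `|@Zs n s|)%E)).
rewrite lee_fin; apply: (@le_trans _ _ (D * n%:R^-1)); last first.
  by rewrite ler_pdivrMr// mulrC -ler_pdivrMr//; near: n.
apply: le_trans h1; apply: ler_Ex => [s|s]; first exact: row_prob_ge0.
case: (boolP (bad s)) => [_|/h2]; first by rewrite ler_nat leq_b1.
by rewrite leNgt => /negbTE ->.
Unshelve. all: by end_near.
Qed.

Lemma uniform_consistency (x y : E) :
    [/\ is_bigO
          (fun n => sup01 (fun u => mean_pi_hat P K (b n) n (X n) u x - pi u x))
          (fun n => b n `^ kappa),
        is_bigO
          (fun n => sup01 (fun u =>
             mean_ratio P K (b n) n (X n) u x y - Q u x y))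
          (fun n => b n `^ kappa),
        is_bigO_prob P
          (fun n w => sup01 (fun u =>
             pi_hat K (b n) n (X n) u x w - mean_pi_hat P K (b n) n (X n) u x))
          (fun n => Num.sqrt (ln n%:R) / Num.sqrt (n%:R * b n))
      & is_bigO_prob P
          (fun n w => sup01 (fun u =>
             Q_hat K (b n) n (X n) u x y w
               - mean_ratio P K (b n) n (X n) u x y))
          (fun n => Num.sqrt (ln n%:R) / Num.sqrt (n%:R * b n))].
Proof.
pose phi1 (x' _ : E) : R := (x' == x)%:R.
pose phi2 (x' y' : E) : R := ((x' == x) && (y' == y))%:R.
have phi1b x' y' : `|phi1 x' y'| <= 1 by rewrite ger0_norm// lern1 leq_b1.
have phi2b x' y' : `|phi2 x' y'| <= 1 by rewrite ger0_norm// lern1 leq_b1.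
have [B B0 hdev] := uniform_deviation.
split.
- exists (2 * C); apply: filterS2 near_basic (uniform_occupation_bias x) => n [n1 _ _] h.
  by apply: sup01_le => u hu; rewrite mean_pi_hatE//; exact: h.
- exists (2 * C); apply: filterS2 near_basic (uniform_ratio_bias x y) => n [n1 _ _] h.
  by apply: sup01_le => u hu; rewrite mean_ratioE//; exact: h.
- apply: (@is_bigO_prob_path _ (fun n s => sup01 (fun u =>
    @occupation n u x s - Ex (pr n) (@occupation n u x))) _ B 4 B0).
    by move=> n w n1; congr sup01; apply/funext => u; rewrite pi_hatE// mean_pi_hatE.
  apply: filterS hdev => n /(_ phi1 phi1b)[bad h1 h2]; exists bad => // s /h2 hs.
  exact: sup01_le.
- have B'0 : 0 < 8 * B / delta by rewrite divr_gt0// mulr_gt0.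
  apply: (@is_bigO_prob_path _ (fun n s => sup01 (fun u =>
    @pair_occupation n u x y s / @occupation n u x s -
    Ex (pr n) (@pair_occupation n u x y) / Ex (pr n) (@occupation n u x))) _ (8 * B / delta) 8 B'0).
    by move=> n w n1; congr sup01; apply/funext => u; rewrite /Q_hat pi_hatE// pi2_hatE// mean_ratioE.
  have dB : 0 < delta / (4 * B) by rewrite divr_gt0// mulr_gt0.
  have hr : \forall n \near \oo, rate n < delta / (4 * B) by apply: cvgr_lt log_cvg0 _ dB.
  apply: filterS3 hdev hr (filterI near_basic (uniform_occupation_ge x)).
  move=> n hd hrn [[n1 b0 nb1] hge].
  have [bad1 p1 d1] := hd phi1 phi1b; have [bad2 p2 d2] := hd phi2 phi2b.
  exists (fun s => bad1 s || bad2 s).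
    apply: (@le_trans _ _ (Ex (pr n) (fun s => (bad1 s)%:R + (bad2 s)%:R))).
      apply: ler_Ex => [s|s]; first exact: row_prob_ge0.
      by case: (bad1 s); case: (bad2 s); rewrite /= ?addr0 ?add0r ?lerDl.
    by rewrite ExD; lra.
  move=> s; rewrite negb_or => /andP[g1 g2]; apply: sup01_le => u hu.
  have e1 := d1 s g1 u hu; have e2 := d2 s g2 u hu; have m1ge := hge u hu.
  change (weighted_sum u phi1 s) with (@occupation n u x s) in e1.
  change (weighted_sum (n := n) u phi1) with (@occupation n u x) in e1.
  change (weighted_sum u phi2 s) with (@pair_occupation n u x y s) in e2.
  change (weighted_sum (n := n) u phi2) with (@pair_occupation n u x y) in e2.
  have m2le : 0 <= Ex (pr n) (@pair_occupation n u x y) <= Ex (pr n) (@occupation n u x).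
    have w0 i := weight_ge0 K_ge0 u b0 n1 i; have p0 := row_prob_ge0 P X (n := n).
    apply/andP; split; first by apply: Ex_ge0 => // t; apply: sumr_ge0 => i _; rewrite mulr_ge0.
    apply: ler_Ex => // t; apply: ler_sum => i _; apply: ler_wpM2l => //.
    by rewrite ler_nat; case: (coordinate i t == x) => //=; exact: leq_b1.
  move: m1ge m2le e1 e2; set m1 := Ex _ (@occupation n u x); set m2 := Ex _ (@pair_occupation n u x y).
  set o := occupation u x s; set q := pair_occupation u x y s => m1ge /andP[m20 m21] e1 e2.
  have m10 : 0 < m1 by apply: lt_le_trans m1ge; rewrite divr_gt0.
  have Br : B * rate n < delta / 4.
    have -> : delta / 4 = B * (delta / (4 * B)) by field; rewrite gt_eqF.
    by rewrite ltr_pM2l.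
  have o4 : delta / 4 <= o by move: e1; rewrite ler_norml => /andP[e1 _]; lra.
  have o0 : 0 < o by apply: lt_le_trans o4; rewrite divr_gt0.
  (* Here [m2 / m1] lies in [0, 1] and [o >= delta / 4] off the bad event, which yields the constant
     [8 B / delta]. *)
  have -> : q / o - m2 / m1 = ((q - m2) - m2 / m1 * (o - m1)) / o by field; rewrite !gt_eqF.
  rewrite normrM normfV (gtr0_norm o0) ler_pdivrMr//.
  have ratio1 : `|m2 / m1| <= 1 by rewrite ger0_norm ?divr_ge0 ?(ltW m10)// ler_pdivrMr// mul1r.
  have h1 : `|m2 / m1 * (o - m1)| <= 1 * (B * rate n) by rewrite normrM; exact: ler_pM.
  apply: le_trans (ler_normB _ _) _.
  have Br0 : 0 <= B * rate n by apply: le_trans e1.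
  apply: (@le_trans _ _ (2 * (B * rate n))); first by lra.
  apply: (@le_trans _ _ (8 * B / delta * rate n * (delta / 4))).
    by rewrite le_eqVlt; apply/orP; left; apply/eqP; field; rewrite gt_eqF.
  apply: ler_wpM2l => //; rewrite (_ : _ * rate n = 8 / delta * (B * rate n)); last by ring.
  by rewrite mulr_ge0// divr_ge0// ltW.
Qed.

End uniform_estimates.

Section interior.
Variable u : R.
Hypothesis u01 : 0 < u < 1.

Let hu : u \in `[0, 1].
Proof. by case/andP: u01 => u0 u1; rewrite in_itv/= !ltW. Qed.

Let a n i : R := Num.sqrt (n%:R * b n) * weight K (b n) n u i.
Let sigma n : R := Num.sqrt (n%:R * b n)^-1.
Let eta n : R := C * (2 * b n) `^ kappa.

Let sigma_weight n i : (1 <= n)%N -> sigma n * a n i = weight K (b n) n u i.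
Proof.
move=> n1; have /andP[b0 _] := b01 n1; rewrite /sigma /a mulrA.
have nb0 : 0 < n%:R * b n by rewrite mulr_gt0// ltr0n.
by rewrite sqrtrV ?(ltW nb0)// mulVf ?mul1r// gt_eqF// sqrtr_gt0.
Qed.

Let near_b := near_bandwidth_interior b01 b_cvg0 nb_large u01.
Let bnds := interior_bounds K_ge0 L0 K_lip K_supp K_int b01 b_cvg0 nb_large inv_nb_cvg0 u01.
Let a_sq : \sum_(i < n) a n i ^+ 2 @[n --> \oo] --> kernel_sq K :=
  interior_sq_cvg K_ge0 L0 K_lip K_supp K_int b01 b_cvg0 nb_large inv_nb_cvg0 u01.

Let kernel_sq_nonneg : 0 <= kernel_sq K.
Proof.
apply: (cvgr_to_ge a_sq); apply: nearW => n; apply: sumr_ge0 => i _; exact: sqr_ge0.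
Qed.

Let trM : transition_matrix (Q u). Proof. exact: Q_transition. Qed.
Let pM : invariant_probability (Q u) (pi u). Proof. exact: pi_inv. Qed.

Let contr : \forall n \near \oo, forall k j (v : E -> R), \sum_x v x = 0 ->
    l1norm (rowmul v (chainmx (triangular_transition Q n) k j)) <= c0 * r ^+ j * l1norm v.
Proof. by apply: filterS near_row => n []. Qed.

Let a_bound : \forall n \near \oo, forall k, 0 <= a n k <= 6 * L * sigma n.
Proof. by apply: filterS bnds => n []. Qed.

Let a_tv : \forall n \near \oo, \sum_(i < n) `|a n i.+1 - a n i| <= 10 * L * sigma n.
Proof. by apply: filterS bnds => n []. Qed.

Let a_ends : \forall n \near \oo, a n 0%N = 0 /\ a n n = 0.
Proof. by apply: filterS bnds => n []. Qed.

Let eta0 : \forall n \near \oo, 0 <= eta n.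
Proof. by apply: nearW => n; rewrite mulr_ge0 ?powR_ge0// ltW. Qed.

Let a_close : \forall n \near \oo, forall k, a n k != 0 ->
  (k < n)%N /\ forall x, \sum_y `|A n k.+1 x y - Q u x y| <= eta n.
Proof.
apply: filterS near_b => n [n1 b0 _ _ nb1] k; rewrite mulf_eq0 negb_or => /andP[_ wk].
by apply: transition_near => // v v' hv hv' x; have [] := hC hv hv'.
Qed.

Let trA n := triangular_transitionP Q_transition n.
Let mk := row_markov X_markov.

(** Reduces both central limit theorems to two checks: closeness to martingales for the capped
    distance, and an expression of the covariance as a Gram matrix of scaled increments. *)
Lemma martingale_limit {J : finType} (G : J -> E -> E -> R)
    (z : forall n, {ffun 'I_n.+1 -> E} -> J -> R) (Z : nat -> T -> J -> R) (S : J -> J -> R) :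
  (forall j, Ex (pr n) (fun s => cap (@z n s j - martingale (Y n) (A n) (G j) (a n) n s))
     @[n --> \oo] --> (0 : R)) ->
  (forall i j, S i j = \sum_(k : E * E)
     Num.sqrt (kernel_sq K * (pi u k.1 * Q u k.1 k.2)) * increment (G i) (Q u) k.1 k.2 *
     (Num.sqrt (kernel_sq K * (pi u k.1 * Q u k.1 k.2)) * increment (G j) (Q u) k.1 k.2)) ->
  (forall n w, (1 <= n)%N -> Z n w = @z n (path_of n (row X n) w)) ->
  asymptotically_gaussian P Z S.
Proof.
move=> zG SE ZE; have [x0 _] := state_inhabited.
pose z' n (s : {ffun 'I_n.+1 -> E}) (j : J) : R := martingale (Y n) (A n) (G j) (a n) n s.
have sq j : exists D, \forall n \near \oo, Ex (pr n) (fun w => @z' n w j ^+ 2) <= D.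
  exact: (@martingale_sq R E _ (fun n => pr n) (fun n => Y n) (fun n => A n)
    (row_prob_ge0 P X) (row_prob_sum1 X_markov) trA mk c0 r c01 r01 contr a _ _ a_bound a_sq (G j)).
pose D j := projT1 (cid (sq j)).
have z'_sq : \forall n \near \oo, forall j, Ex (pr n) (fun w => @z' n w j ^+ 2) <= \sum_j `|D j|.
  have : \forall n \near \oo, forall j, Ex (pr n) (fun w => @z' n w j ^+ 2) <= D j.
    by apply: (@near_all_finType _ \oo _ J) => j; exact: projT2 (cid (sq j)).
  apply: filterS => n hn j; apply: le_trans (hn j) _; apply: le_trans (ler_norm _) _.
  by rewrite (bigD1 j)//= lerDl sumr_ge0.
apply: (@gaussian_limit R J (E * E)%type
  (fun j k => Num.sqrt (kernel_sq K * (pi u k.1 * Q u k.1 k.2)) * increment (G j) (Q u) k.1 k.2)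
  d T P _ (fun n => pr n) (row_prob_ge0 P X) (row_prob_sum1 X_markov)
  (fun n => path_of n (row X n)) (row_expectation X_markov) z z' _ z'_sq) => // t al.
exact: (@clt_triangular R E _ (fun n => pr n) (fun n => Y n) (fun n => A n)
   (row_prob_ge0 P X) (row_prob_sum1 X_markov) trA mk c0 r c01 r01 (Q u) (pi u) trM pM
   (contrQ hu) a _ _ eta (kernel_sq K) a_bound (sqrt_inv_cvg0 (6 * L)) a_tv
   (sqrt_inv_cvg0 (10 * L)) a_sq a_close eta0 (holder_rate_cvg0 C0) x0 J G t al).
Qed.

Lemma occupation_clt : asymptotically_gaussian P
      (fun n w (x : E) => Num.sqrt (n%:R * b n) *
         (pi_hat K (b n) n (X n) u x w - mean_pi_hat P K (b n) n (X n) u x))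
      (Sigma1 K (Q u) (pi u)).
Proof.
have [x0 _] := state_inhabited.
have poiss i := poisson_solution trM pM c01 r01 (contrQ hu) (fun y => (y == i)%:R).
pose h i := projT1 (cid (poiss i)).
have hP i := (projT2 (cid (poiss i))).1; have hL i := (projT2 (cid (poiss i))).2.
apply: (@martingale_limit E (fun j _ y => h j y) (fun n s x =>
  \sum_(i < n) a n i * (coordinate i s == x)%:R -
  Ex (pr n) (fun s => \sum_(i < n) a n i * (coordinate i s == x)%:R))).
- move=> j; exact: (@poisson_approx R E _ (fun n => pr n) (fun n => Y n) (fun n => A n)
   (row_prob_ge0 P X) (row_prob_sum1 X_markov) trA mk c0 r c01 r01 contr (Q u) (pi u) a _ eta
   (kernel_sq K) a_tv (sqrt_inv_cvg0 (10 * L)) a_sq a_close (holder_rate_cvg0 C0)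
   x0 a_ends (fun y => (y == j)%:R) (h j) (hP j)).
- by move=> i j; exact: (Sigma1E trM pM kernel_sq_nonneg hP hL).
- move=> n w n1; apply/funext => x; rewrite pi_hatE// mean_pi_hatE// mulrBr.
  have e s : Num.sqrt (n%:R * b n) * @occupation n u x s = \sum_(i < n) a n i * (coordinate i s == x)%:R.
    by rewrite mulr_sumr; apply: eq_bigr => i _; rewrite mulrA.
  by rewrite e -ExZ; under eq_Ex do rewrite e.
Qed.

Lemma ratio_clt : asymptotically_gaussian P
      (fun n w (a : E * E) => Num.sqrt (n%:R * b n) *
         (Q_hat K (b n) n (X n) u a.1 a.2 w
            - mean_ratio P K (b n) n (X n) u a.1 a.2))
      (Sigma2 K (Q u) (pi u)).
Proof.
have pi0 x : 0 < pi u x by apply: lt_le_trans (pi_ge hu x).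
have sigma0 : \forall n \near \oo, 0 < sigma n.
  apply: filterS near_b => n [n1 b0 _ _ nb1].
  by rewrite sqrtr_gt0 invr_gt0; apply: lt_le_trans nb1.
have sigma_cvg : sigma n @[n --> \oo] --> (0 : R).
  have := sqrt_inv_cvg0 1; apply: cvg_trans; apply: near_eq_cvg; apply: nearW => n.
  by rewrite mul1r.
pose occ c n (s : {ffun 'I_n.+1 -> E}) : R := \sum_(i < n) sigma n * a n i * (coordinate i s == c)%:R.
pose pocc c e n (s : {ffun 'I_n.+1 -> E}) : R :=
  \sum_(i < n) sigma n * a n i * ((coordinate i s == c) && (coordinate i.+1 s == e))%:R.
have occE c n s : (1 <= n)%N -> @occ c n s = occupation u c s.
  by move=> n1; apply: eq_bigr => i _; rewrite sigma_weight.
have poccE c e n s : (1 <= n)%N -> @pocc c e n s = pair_occupation u c e s.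
  by move=> n1; apply: eq_bigr => i _; rewrite sigma_weight.
have bias c : Ex (pr n) (@occ c n) @[n --> \oo] --> pi u c.
  apply: (@cvg_dist_bound _ _ _ _ _ (fun n => 2 * (C * (2 * b n) `^ kappa))); last first.
    by rewrite -[X in _ --> X](mulr0 2); apply: cvgMl_tmp; exact: holder_rate_cvg0.
  have mass := @interior_mass_ge R K L L0 K_lip K_supp K_int b b01 b_cvg0 nb_large inv_nb_cvg0 u u01.
  apply: filterS3 near_b near_row mass => n [n1 b0 _ _ nb1] [_ hlaw] m2.
  under eq_Ex do rewrite occE//.
  have m0 : kernel_mass K (b n) n u != 0 by rewrite gt_eqF// (lt_le_trans _ m2)// invr_gt0.
  have := @occupation_bias C n u c n1 C0 hu b0 nb1 m0 (fun v v' hv hv' => (hC hv hv').2) hlaw.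
  move=> /le_trans; apply; rewrite -mulrA ler_pM2l// ler_pM2l//.
  case/andP: kappa01 => k0 _; apply: ge0_ler_powR; rewrite ?nnegrE ?(ltW k0) ?(ltW b0)//.
    by rewrite mulr_ge0// ltW.
  lra.
apply: (@martingale_limit (E * E)%type
  (fun j x y => (x == j.1)%:R * (y == j.2)%:R / pi u j.1) (fun n s j =>
  (sigma n)^-1 * (@pocc j.1 j.2 n s / @occ j.1 n s -
     Ex (pr n) (@pocc j.1 j.2 n) / Ex (pr n) (@occ j.1 n)))).
- move=> [c e]; exact: (@ratio_approx R E _ (fun n => pr n) (fun n => Y n) (fun n => A n)
   (row_prob_ge0 P X) (row_prob_sum1 X_markov) trA mk c0 r c01 r01 contr (Q u) (pi u) a _ eta
   (kernel_sq K) a_bound a_sq a_close (holder_rate_cvg0 C0) sigma c e sigma0 sigma_cvg (pi0 c) (bias c)).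
- by move=> i j; exact: (Sigma2E trM pM kernel_sq_nonneg pi0).
- move=> n w n1; apply/funext => -[c e] /=; rewrite /Q_hat pi_hatE// pi2_hatE// mean_ratioE//.
  rewrite /sigma sqrtrV; last by rewrite mulr_ge0//; have /andP[/ltW] := b01 n1.
  rewrite invrK occE// poccE//; congr (_ * (_ - _ / _)); apply: eq_Ex => s.
    by rewrite poccE.
  by rewrite occE.
Qed.

End interior.
End chain_parameters.
End kernel_estimators.

(** For [u] inside the interval the kernel window eventually lies in [0, 1], so that the mass tends
    to 1 and the sums of squares to [kernel_sq K]; at an endpoint part of the window is cut off, and
    the limiting variance differs in general. For the uniform bounds, a one-sided [K] would make the
    mass vanish at an endpoint, whence the assumption on it. *)
Theorem theorem2 (R : realType) (E : finType)
    (* the transition matrices *)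
    (kappa : R) (kappa01 : 0 < kappa < 1)
    (Q : R -> E -> E -> R)
    (Q_transition : forall u, u \in `[0, 1] -> transition_matrix (Q u))
    (Q_irreducible : forall u, u \in `[0, 1] -> irreducible (Q u))
    (Q_aperiodic : forall u, u \in `[0, 1] -> aperiodic (Q u))
    (Q_holder : forall x y, holder01 kappa (fun u => Q u x y))
    (Q_neg : forall u, u < 0 -> Q u = Q 0)
    (pi : R -> E -> R)
    (pi_inv : forall u, u \in `[0, 1] -> invariant_probability (Q u) (pi u))
    (* the triangular array *)
    (d : measure_display) (T : measurableType d) (P : probability T R)
    (X : nat -> int -> T -> E)
    (X_markov : forall n, (1 <= n)%N -> row_markov_chain P Q n (X n))
    (* the kernel *)
    (K : R -> R)
    (K_ge0 : forall z, 0 <= K z)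
    (K_lipschitz : lipschitz K)
    (K_support : forall z, z \notin `[-1, 1] -> K z = 0)
    (K_int : \int[lebesgue_measure]_z K z = 1)
    (* the bandwidth *)
    (b : nat -> R)
    (b01 : forall n, (1 <= n)%N -> 0 < b n < 1)
    (b_cvg0 : b n @[n --> \oo] --> (0 : R))
    (eps : R) (eps_gt0 : 0 < eps)
    (nb_cvg : n%:R * b n `^ (1 + eps) @[n --> \oo] --> +oo) :
  [/\
    (* 1: the weights e_i(u) being well defined on [0, 1] for n large *)
    (\forall n \near \oo,
        forall u, u \in `[0, 1] -> kernel_mass K (b n) n u != 0) ->
    forall x y : E,
    [/\ is_bigO
          (fun n => sup01 (fun u => mean_pi_hat P K (b n) n (X n) u x - pi u x))
          (fun n => b n `^ kappa),
        is_bigO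
          (fun n => sup01 (fun u =>
             mean_ratio P K (b n) n (X n) u x y - Q u x y))
          (fun n => b n `^ kappa),
        is_bigO_prob P
          (fun n w => sup01 (fun u =>
             pi_hat K (b n) n (X n) u x w - mean_pi_hat P K (b n) n (X n) u x))
          (fun n => Num.sqrt (ln n%:R) / Num.sqrt (n%:R * b n))
      & is_bigO_prob P
          (fun n w => sup01 (fun u =>
             Q_hat K (b n) n (X n) u x y w
               - mean_ratio P K (b n) n (X n) u x y))
          (fun n => Num.sqrt (ln n%:R) / Num.sqrt (n%:R * b n))],
    (* 2 *)
    forall u, u \in `]0, 1[ ->
    asymptotically_gaussian P
      (fun n w (x : E) => Num.sqrt (n%:R * b n) *
         (pi_hat K (b n) n (X n) u x w - mean_pi_hat P K (b n) n (X n) u x))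
      (Sigma1 K (Q u) (pi u))
    & (* 3 *)
    forall u, u \in `]0, 1[ ->
    asymptotically_gaussian P
      (fun n w (a : E * E) => Num.sqrt (n%:R * b n) *
         (Q_hat K (b n) n (X n) u a.1 a.2 w
            - mean_ratio P K (b n) n (X n) u a.1 a.2))
      (Sigma2 K (Q u) (pi u))].
Proof.
have [L L0 K_lip] := lipschitz_const K_lipschitz.
have K_supp z : 1 < `|z| -> K z = 0.
  by move=> hz; apply: K_support; rewrite in_itv/= -ler_norml -ltNge.
have nb_large := bandwidth_large b01 eps_gt0 nb_cvg.
have inv_nb := inv_bandwidth_cvg0 b01 eps_gt0 nb_cvg.
have log_nb := log_bandwidth_cvg0 b01 eps_gt0 nb_cvg.
have [c0 [r [delta [C [[c01 r01 delta0 C0] contrQ pi_ge hC near_row]]]]] :=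
  chain_constants kappa01 Q_transition Q_irreducible Q_aperiodic Q_holder Q_neg pi_inv X_markov.
split.
- move=> mass x y.
  have [cm cm0 hm] := kernel_mass_lower_bound K_ge0 L0 K_lip b01 b_cvg0 nb_large mass.
  exact: (uniform_consistency kappa01 Q_transition X_markov K_ge0 L0 K_lip K_supp
    b01 b_cvg0 nb_large c01 r01 delta0 C0 pi_ge hC near_row log_nb cm0 hm x y).
- move=> u; rewrite in_itv/= => u01.
  exact: (occupation_clt kappa01 Q_transition pi_inv X_markov K_ge0 L0 K_lip K_supp
    b01 b_cvg0 nb_large K_int inv_nb c01 r01 C0 contrQ hC near_row u01).
- move=> u; rewrite in_itv/= => u01.
  exact: (ratio_clt kappa01 Q_transition pi_inv X_markov K_ge0 L0 K_lip K_supp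
    b01 b_cvg0 nb_large K_int inv_nb c01 r01 delta0 C0 contrQ pi_ge hC near_row u01).
Qed.
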